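(* Let $\alpha,\beta,\gamma\in\mathbb{R}$ with $\alpha,\gamma\neq 0$, and let $s\ge -1$. Then the Cauchy problem, for real-valued $u$, $$\partial_t u+\alpha\,\partial_x^5u+\beta\,\partial_x^3u+\gamma\,\partial_x(u^2)=0,\quad (t,x)\in[0,T]\times\mathbb{T},\qquad u(0,x)=u_0(x),\quad x\in\mathbb{T},$$ is globally well-posed in $\dot H^s(\mathbb{T})$.
   Context: $\mathbb{T}=\mathbb{R}/2\pi\mathbb{Z}$ and $\dot{\mathbb{Z}}=\mathbb{Z}\setminus\{0\}$. $\dot H^s(\mathbb{T})$ is the space of mean-zero periodic distributions $\varphi$ (zero Fourier mode equal to $0$) with finite norm $\|\varphi\|_{\dot H^s(\mathbb{T})}=\|\langle k\rangle^s\widehat\varphi(k)\|_{\ell^2_k(\dot{\mathbb{Z}})}$, where $\langle k\rangle=(1+|k|^2)^{1/2}$. Initial data and solutions are real valued. Globally well-posed in $\dot H^s(\mathbb{T})$ means that the problem is well-posed on arbitrarily long time intervals: for every $T>0$ there is a Banach space $X_T^s$ of functions on $[0,T]\times\mathbb{T}$, continuously embedded in $C([0,T];\dot H^s(\mathbb{T}))$, such that for every real-valued $u_0\in\dot H^s(\mathbb{T})$ there is a unique $u\in X_T^s$ solving $$u(t)=U(t)u_0-\gamma\int_0^tU(t-t')\,\partial_x\big(u(t')^2\big)\,dt',\qquad 0\le t\le T,$$ with $U(t)=\exp(-t(\alpha\partial_x^5+\beta\partial_x^3))$, and the data-to-solution map $u_0\mapsto u$ is continuous from $\dot H^s(\mathbb{T})$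 to $X_T^s$. For negative $s$, the integral term is understood through the continuous extension to $X_T^s$ of the bilinear Duhamel operator $(u,v)\mapsto\int_0^tU(t-t')\partial_x(u(t')v(t'))\,dt'$ defined on smooth functions. *)

(* Defs.v *)
From HB Require Import structures.
From mathcomp Require Import all_boot all_order all_algebra.
From mathcomp Require Import ring complex.
From mathcomp Require Import all_classical all_reals all_analysis.

Set Implicit Arguments.
Unset Strict Implicit.
Unset Printing Implicit Defensive.

Import Order.TTheory GRing.Theory Num.Theory.
Import numFieldNormedType.Exports.

Local Open Scope classical_set_scope.
Local Open Scope ring_scope.

(* Functions on T = R/2piZ are 2pi-periodic functions on R. *)

Definition smooth1 (R : realType) (f : R -> R) : Prop :=
  forall (n : nat) (x : R), derivable (derive1n n f) x 1.

Record testfun (R : realType) : Type := TestFun {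
  tf_fun :> R -> R;
  tf_periodic : periodic tf_fun (pi *+ 2);
  tf_smooth : smooth1 tf_fun }.

Lemma is_derive_trig (R : realType) (a b c x : R) :
  is_derive x 1 (fun x => a * cos (c * x) + b * sin (c * x))
    (b * c * cos (c * x) + - a * c * sin (c * x)).
Proof.
have dc : is_derive x 1 (fun y : R => c * y) c.
  by have := is_deriveZ c (is_derive_id x (1 : R)); rewrite /GRing.scale/= mulr1.
have d1 : is_derive x 1 (fun y : R => cos (c * y)) (- sin (c * x) * c).
  exact: (@is_derive1_comp _ cos (fun y => c * y)).
have d2 : is_derive x 1 (fun y : R => sin (c * y)) (cos (c * x) * c).
  exact: (@is_derive1_comp _ sin (fun y => c * y)).
have d := is_deriveD (is_deriveZ a d1) (is_deriveZ b d2).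
apply: (@is_derive_eq _ _ _ _ _ _ _ _ d).
by rewrite /GRing.scale/=; ring.
Qed.

Lemma derive1n_trig (R : realType) (a b c : R) (n : nat) :
  exists a' b' : R,
    derive1n n (fun x => a * cos (c * x) + b * sin (c * x)) =
    (fun x => a' * cos (c * x) + b' * sin (c * x)).
Proof.
elim: n => [|n [a' [b' IH]]]; first by exists a, b.
exists (b' * c), (- a' * c); rewrite derive1nS IH.
apply/funext => x; rewrite derive1E.
exact: (@derive_val _ _ _ _ _ _ _ (is_derive_trig a' b' c x)).
Qed.

Lemma smooth1_trig (R : realType) (a b c : R) :
  smooth1 (fun x => a * cos (c * x) + b * sin (c * x)).
Proof.
move=> n x; have [a' [b' ->]] := derive1n_trig a b c n.
exact: (@ex_derive _ _ _ _ _ _ _ (is_derive_trig a' b' c x)).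
Qed.

Lemma smooth1_cos (R : realType) (k : int) :
  smooth1 (fun x : R => cos (k%:~R * x)).
Proof.
have := @smooth1_trig R 1 0 k%:~R; congr smooth1.
by apply/funext => x; rewrite mul1r mul0r addr0.
Qed.

Lemma smooth1_sin (R : realType) (k : int) :
  smooth1 (fun x : R => sin (k%:~R * x)).
Proof.
have := @smooth1_trig R 0 1 k%:~R; congr smooth1.
by apply/funext => x; rewrite mul1r mul0r add0r.
Qed.

Lemma periodic_int (R : realType) (f : R -> R) (k : int) :
  periodic f (pi *+ 2) -> periodic (fun x : R => f (k%:~R * x)) (pi *+ 2).
Proof.
move=> pf x; rewrite mulrDr; case: k => n.
  by rewrite [n%:~R * (pi *+ 2)]mulr_natl periodicn.
rewrite NegzE mulrNz [X in _ + X]mulNr [_%:~R * (pi *+ 2)]mulr_natl.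
by rewrite -[in LHS](periodicn pf n.+1) subrK.
Qed.

Definition cos_tf (R : realType) (k : int) : testfun R :=
  TestFun (periodic_int k (@cosD2pi R)) (@smooth1_cos R k).

Definition sin_tf (R : realType) (k : int) : testfun R :=
  TestFun (periodic_int k (@sinD2pi R)) (@smooth1_sin R k).

(* Real-valued periodic distributions: real-linear functionals on the real
   test functions, bounded by finitely many of the seminorms sup |f^(j)|. *)
Definition is_distribution (R : realType) (phi : testfun R -> R) : Prop :=
  (forall (a : R) (f g h : testfun R),
     (forall x, h x = a * f x + g x) -> phi h = a * phi f + phi g) /\
  (exists (N : nat) (C : R), forall (f : testfun R) (M : R),
     (forall (j : nat) (x : R), (j <= N)%N -> `| derive1n j f x | <= M) ->
     `| phi f | <= C * M).

Definition distribution_of (R : realType) (g : R -> R) : testfun R -> R :=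
  fun f => \int[lebesgue_measure]_(x in `[0, pi *+ 2]) (g x * f x).

(* (2 pi)^-1 <phi, e^{-ikx}> *)
Definition fourier (R : realType) (phi : testfun R -> R) (k : int) : R[i] :=
  ((phi (cos_tf R k) / (pi *+ 2)) +i* (- phi (sin_tf R k) / (pi *+ 2)))%C.

Definition japanese_bracket (R : realType) (k : int) : R :=
  Num.sqrt (1 + `| k%:~R : R | ^+ 2).

(* The value is +oo when the sum diverges. *)
Definition Hdot_norm (R : realType) (s : R) (phi : testfun R -> R) : \bar R :=
  ((\esum_(k in [set k : int | k != 0%R])
      ((japanese_bracket R k `^ s * Normc.normc (fourier phi k)) ^+ 2)%:E)
   `^ 2^-1)%E.

Definition Hdot (R : realType) (s : R) : set (testfun R -> R) :=
  [set phi | [/\ is_distribution phi, fourier phi 0 = 0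
               & (Hdot_norm s phi < +oo)%E]].

(* Only the values of w on [0, T] matter. *)
Definition in_C_Hdot (R : realType) (T s : R) (w : R -> testfun R -> R) : Prop :=
  (forall t : R, t \in `[0, T] -> Hdot s (w t)) /\
  (forall t : R, t \in `[0, T] ->
     (fun t' : R => Hdot_norm s (w t' - w t)%R) @ within `[0, T] (nbhs t) --> 0%E).

(* C^oo functions of (t, x), periodic and of mean zero in x; D m n is the
   partial derivative d_t^m d_x^n v.  Smooth functions on [0, T] x T are the
   restrictions of these. *)
Definition smooth_tx (R : realType) (v : R -> R -> R) : Prop :=
  [/\ exists D : nat -> nat -> R -> R -> R,
        [/\ D 0%N 0%N = v,
            forall m n, continuous (fun p : R * R => D m n p.1 p.2),
            forall m n (t x : R), is_derive t (1 : R) (fun t' => D m n t' x) (D m.+1 n t x)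
          & forall m n (t x : R), is_derive x (1 : R) (D m n t) (D m n.+1 t x)],
      forall t, periodic (v t) (pi *+ 2)
    & forall t, fourier (distribution_of (v t)) 0 = 0].

(* The Fourier multiplier of U(t) = exp (- t (alpha d_x^5 + beta d_x^3)):
   alpha (ik)^5 + beta (ik)^3 = i (alpha k^5 - beta k^3). *)
Definition U_mult (R : realType) (alpha beta t : R) (k : int) : R[i] :=
  let theta := - (t * (alpha * k%:~R ^+ 5 - beta * k%:~R ^+ 3)) in
  (cos theta +i* sin theta)%C.

Definition Cintegral (R : realType) (a b : R) (f : R -> R[i]) : R[i] :=
  ((\int[lebesgue_measure]_(t in `[a, b]) complex.Re (f t)) +i*
   (\int[lebesgue_measure]_(t in `[a, b]) complex.Im (f t)))%C.

(* k-th Fourier coefficient of \int_0^t U(t-t') d_x (v(t') w(t')) dt'. *)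
Definition duhamel (R : realType) (alpha beta : R) (v w : R -> R -> R)
    (t : R) (k : int) : R[i] :=
  Cintegral 0 t (fun t' =>
    U_mult alpha beta (t - t') k * ((0 +i* k%:~R)%C *
      fourier (distribution_of (fun x => v t' x * w t' x)) k)).

Definition represents (R : realType) (T : R) (w : R -> testfun R -> R)
    (v : R -> R -> R) : Prop :=
  forall t : R, t \in `[0, T] -> w t = distribution_of (v t).

(* X, seen as a space of functions on [0, T] x T through iota, is a Banach
   space continuously embedded in C([0, T]; Hdot s). *)
Definition embedded (R : realType) (T s : R) (X : completeNormedModType R)
    (iota : {linear X -> (R -> testfun R -> R)}) : Prop :=
  [/\ forall x y : X,
        (forall t : R, t \in `[0, T] -> iota x t = iota y t) -> x = y,
      forall x : X, in_C_Hdot T s (iota x)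
    & exists C : R, forall (x : X) (t : R), t \in `[0, T] ->
        (Hdot_norm s (iota x t) <= (C * `|x|)%:E)%E].

(* Smooth functions belong to X and are dense in it, so that a continuous B
   extending the Duhamel operator of smooth functions is unique. *)
Definition duhamel_extension (R : realType) (alpha beta T : R)
    (X : completeNormedModType R)
    (iota : {linear X -> (R -> testfun R -> R)}) (B : X * X -> X) : Prop :=
  [/\ forall v, smooth_tx v -> exists x : X, represents T (iota x) v,
      dense [set x : X | exists2 v, smooth_tx v & represents T (iota x) v],
      continuous B
    & forall (v w : R -> R -> R) (x y : X), smooth_tx v -> smooth_tx w ->
        represents T (iota x) v -> represents T (iota y) w ->
        forall (t : R) (k : int), t \in `[0, T] ->
          fourier (iota (B (x, y)) t) k = duhamel alpha beta v w t k].

(* u(t) = U(t) u0 - gamma B(u, u)(t), read on Fourier coefficients, which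
   determine a periodic distribution. *)
Definition integral_solution (R : realType) (alpha beta gamma T : R)
    (X : completeNormedModType R)
    (iota : {linear X -> (R -> testfun R -> R)}) (B : X * X -> X)
    (u0 : testfun R -> R) (u : X) : Prop :=
  forall (t : R) (k : int), t \in `[0, T] ->
    fourier (iota u t) k =
      U_mult alpha beta t k * fourier u0 k
      - (gamma%:C)%C * fourier (iota (B (u, u)) t) k.

Definition globally_well_posed (R : realType) (alpha beta gamma s : R) : Prop :=
  forall T : R, 0 < T ->
  exists (X : completeNormedModType R)
         (iota : {linear X -> (R -> testfun R -> R)})
         (B : X * X -> X)
         (S : (testfun R -> R) -> X),
    [/\ embedded T s iota,
        duhamel_extension alpha beta T iota B,
        forall u0, Hdot s u0 ->
          integral_solution alpha beta gamma T iota B u0 (S u0) /\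
          (forall u : X,
             integral_solution alpha beta gamma T iota B u0 u -> u = S u0)
      & forall u0, Hdot s u0 -> forall e : R, 0 < e ->
          exists2 d : R, 0 < d & forall v0, Hdot s v0 ->
            (Hdot_norm s (v0 - u0)%R < d%:E)%E -> `|S v0 - S u0| < e].

(* Main.v *)
(** In the interaction variables [v_k(t) = e^{i t p(k)} u_k(t)], with
    [p(k) = alpha k^5 - beta k^3], the equation reads
    [v_k' = - i gamma k sum_{a + b = k} e^{i t Phi} v_a v_b], and the phase
    [Phi = p(k) - p(a) - p(b)] satisfies [|Phi| >= c l L^4] for large [L], where
    [L] and [l] are the largest and smallest of [|a|, |b|, |k|].  Fields are
    measured by the square sum over [k] of [<k>^s A_k], where [A_k] bounds [v_k]
    and its modulus of continuity relative to
    [om_k(h) = h / delta + [k]^{-1/2} h^{2/5}], [[k] = max(N, |k|)].  Cutting time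
    integrals into periods [2 pi / |Phi|] bounds the Duhamel operator in this
    gauge, uniformly in [N] on windows of length [N^{-5/2}], where Picard
    iteration solves the equation for data that are small in the norm with
    weight [[k]^{-1}].

    Any datum of regularity [s >= -1] is small in that norm once [N] is large,
    and the norm is almost conserved: the interactions of two high frequencies
    with a low output are removed by a normal form (a difference of averages
    over one period), after which the weighted energy of Galerkin approximations
    varies by a third power of its size over the whole of [0, T].  So the windows
    can be glued up to any [T]; a weight [1 + eta <k>^{s+1}] carries the extra
    regularity along.

    The Banach space is the closure of the smooth functions in the gauge.  It is
    stable under the Duhamel operator since fields with finitely many modes that
    are C^1 in time are approximated by trigonometric polynomials in [x] whose
    coefficients are polynomials in [t]. *)

Require Import Defs.
From HB Require Import structures.
From mathcomp Require Import all_boot all_order all_algebra.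
From mathcomp Require Import ring lra zify complex.
From mathcomp Require Import all_classical all_reals all_analysis.

Set Implicit Arguments.
Unset Strict Implicit.
Unset Printing Implicit Defensive.

Import Order.TTheory GRing.Theory Num.Theory.
Import numFieldNormedType.Exports.
Local Open Scope classical_set_scope.
Local Open Scope ring_scope.

(** * Sums over symmetric ranges and square-summable sequences *)

(** The exponents are forced by one count. Below frequency N nothing oscillates: in the weights
    1/[k] the multiplier is at most N^2, and a window of length N^{-5/2} brings it down to N^{-1/2},
    the value at l = L = N of the kernel l^{-2/5} L^{-1/10}. This kernel is just square summable in
    l <= L, uniformly in L, because the sum of l^{-4/5} is of order L^{1/5}. Above N, the
    interpolation min(h, P) <= h^{2/5} P^{3/5} with a period P of order 1 / (l L^4) leads to the
    same kernel. About T N^{5/2} windows are needed, and on each the energy moves by N^{-5/2} times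
    the cube of the gauge. The powers of N cancel, so that smallness can be fixed before N is
    chosen. The normal form cannot divide by the phase and differentiate the fields, of which only a
    modulus of continuity is controlled uniformly. A primitive minus its average over one period
    asks for no more than that modulus. *)

Definition ZM (M : nat) : seq int := locked [seq (i%:Z - M%:Z) | i <- iota 0 (M.*2.+1)].

Lemma mem_ZM M k : (k \in ZM M) = (`|k| <= M)%N.
Proof.
rewrite /ZM -lock; apply/mapP/idP => [[i hi ->]|hk].
  by move: hi; rewrite mem_iota; lia.
exists (absz (k + M%:Z)); last by lia.
rewrite mem_iota; lia.
Qed.

Lemma uniq_ZM M : uniq (ZM M).
Proof. by rewrite /ZM -lock map_inj_uniq ?iota_uniq// => i j; lia. Qed.

Lemma perm_ZM_opp M : perm_eq [seq - k | k <- ZM M] (ZM M).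
Proof.
apply: uniq_perm; rewrite ?(map_inj_uniq oppr_inj) ?uniq_ZM//.
move=> k; rewrite mem_ZM; apply/mapP/idP => [[j hj ->]|hk].
  by move: hj; rewrite mem_ZM; lia.
by exists (- k); rewrite ?opprK// mem_ZM; lia.
Qed.

Lemma sum_ZM_opp (V : nmodType) M (F : int -> V) :
  \sum_(k <- ZM M) F (- k) = \sum_(k <- ZM M) F k.
Proof. by rewrite -[RHS](perm_big _ (perm_ZM_opp M)) [RHS]big_map. Qed.

Section sums.
Variable R : realType.
Implicit Types (M : nat).

Lemma ler_sum_seq (I : eqType) (r : seq I) (F G : I -> R) :
  (forall i, i \in r -> F i <= G i) -> \sum_(i <- r) F i <= \sum_(i <- r) G i.
Proof.
move=> h; rewrite big_seq [leRHS]big_seq; exact: ler_sum.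
Qed.

(** Images that leave [r'] contribute nothing and the others are distinct members of [r'], so
    nonnegativity concludes. With [h] the identity it compares sums over two ranges. *)
Lemma ler_sum_inj (I J : eqType) (r : seq I) (r' : seq J) (h : I -> J) (F : J -> R) :
  uniq r -> uniq r' -> injective h -> (forall j, 0 <= F j) ->
  (forall i, i \in r -> h i \notin r' -> F (h i) = 0) ->
  \sum_(i <- r) F (h i) <= \sum_(j <- r') F j.
Proof.
move=> ur ur' ih F0 Fz.
rewrite -(big_map h xpredT F) (bigID (mem r')) /= [X in _ + X]big_seq_cond.
rewrite [X in _ + X]big1 ?addr0; last first.
  by move=> j /andP[/mapP[i hi ->]]; exact: Fz.
rewrite [leRHS](bigID (mem (map h r))) /= -[leLHS]big_filter -[X in _ <= X + _]big_filter.
have -> : \sum_(i <- [seq x <- map h r | x \in r']) F i =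
          \sum_(i <- [seq x <- r' | x \in map h r]) F i.
  apply: perm_big; apply: uniq_perm; rewrite ?filter_uniq ?map_inj_uniq//.
  by move=> j; rewrite !mem_filter andbC.
by rewrite lerDl sumr_ge0.
Qed.

Lemma ler_sum_ZM M M' (F : int -> R) : (M <= M')%N -> (forall k, 0 <= F k) ->
  \sum_(k <- ZM M) F k <= \sum_(k <- ZM M') F k.
Proof.
move=> MM' F0; apply: (@ler_sum_inj _ _ _ _ id); rewrite ?uniq_ZM//.
by move=> i; rewrite !mem_ZM => h /negP[]; exact: leq_trans h MM'.
Qed.

Lemma cauchy_schwarz (I : Type) (r : seq I) (x y : I -> R) :
  (\sum_(i <- r) x i * y i) ^+ 2 <= (\sum_(i <- r) x i ^+ 2) * (\sum_(i <- r) y i ^+ 2).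
Proof.
set A := \sum_(i <- r) x i ^+ 2; set B := \sum_(i <- r) y i ^+ 2.
set S := \sum_(i <- r) x i * y i.
have A0 : 0 <= A by apply: sumr_ge0 => i _; rewrite sqr_ge0.
have B0 : 0 <= B by apply: sumr_ge0 => i _; rewrite sqr_ge0.
have key t : 0 <= A - t * 2 * S + t ^+ 2 * B.
  have -> : A - t * 2 * S + t ^+ 2 * B = \sum_(i <- r) (x i - t * y i) ^+ 2.
    rewrite /A /S /B !mulr_sumr -sumrN -!big_split /=.
    by apply: eq_bigr => i _; ring.
  by apply: sumr_ge0 => i _; rewrite sqr_ge0.
have [B00|Bn0] := eqVneq B 0.
  have S0 : S = 0.
    apply/eqP; apply: contraT => Sn0.
    (* For B = 0 the quadratic is affine in t; this t would make it negative. *)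
    have := key ((A + 1) / S); rewrite B00 mulr0 addr0.
    have -> : (A + 1) / S * 2 * S = 2 * (A + 1) by field.
    by move=> ?; lra.
  by rewrite S0 B00 mulr0 expr0n.
have Bp : 0 < B by rewrite lt_def Bn0.
have := key (S / B).
have -> : A - S / B * 2 * S + (S / B) ^+ 2 * B = A - S ^+ 2 / B by field.
by rewrite subr_ge0 ler_pdivrMr.
Qed.

Lemma cauchy_schwarz_sqrt (I : Type) (r : seq I) (x y : I -> R) :
  \sum_(i <- r) x i * y i <=
  Num.sqrt (\sum_(i <- r) x i ^+ 2) * Num.sqrt (\sum_(i <- r) y i ^+ 2).
Proof.
have h := cauchy_schwarz r x y.
rewrite -sqrtrM; last by apply: sumr_ge0 => i _; rewrite sqr_ge0.
by apply: le_trans (ler_wsqrtr h); rewrite sqrtr_sqr ler_norm.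
Qed.

(** An l^2 bound through partial sums, so that no series has to converge. *)
Definition ell2 (a : int -> R) (C : R) :=
  forall M, \sum_(k <- ZM M) a k ^+ 2 <= C ^+ 2.

Lemma ell2D a b C D : 0 <= C -> 0 <= D -> ell2 a C -> ell2 b D ->
  ell2 (fun k => a k + b k) (C + D).
Proof.
move=> C0 D0 ha hb M.
have h := cauchy_schwarz_sqrt (ZM M) a b.
have -> : \sum_(k <- ZM M) (a k + b k) ^+ 2 =
  \sum_(k <- ZM M) a k ^+ 2 + 2 * (\sum_(k <- ZM M) a k * b k) + \sum_(k <- ZM M) b k ^+ 2.
  by rewrite mulr_sumr -!big_split /=; apply: eq_bigr => i _; ring.
have ha' : Num.sqrt (\sum_(k <- ZM M) a k ^+ 2) <= C.
  by rewrite -(ger0_norm C0) -sqrtr_sqr ler_sqrt ?sqr_ge0// ha.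
have hb' : Num.sqrt (\sum_(k <- ZM M) b k ^+ 2) <= D.
  by rewrite -(ger0_norm D0) -sqrtr_sqr ler_sqrt ?sqr_ge0// hb.
have hm : \sum_(k <- ZM M) a k * b k <= C * D.
  by apply: (le_trans h); apply: ler_pM; rewrite ?sqrtr_ge0.
have := ha M; have := hb M; nra.
Qed.

Lemma ell2_le a b C D : (forall k, 0 <= a k <= b k) -> 0 <= C <= D -> ell2 b C -> ell2 a D.
Proof.
move=> ab /andP[C0 CD] hb M; apply: (@le_trans _ _ (\sum_(k <- ZM M) b k ^+ 2)).
  apply: ler_sum_seq => k _; have /andP[a0 akb] := ab k.
  by rewrite ler_sqr ?nnegrE// (le_trans a0).
by apply: (le_trans (hb M)); rewrite ler_sqr ?nnegrE// (le_trans C0).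
Qed.

Lemma ell2Z a C c : ell2 a C -> ell2 (fun k => c * a k) (c * C).
Proof.
move=> ha M; under eq_bigr do rewrite exprMn; rewrite -mulr_sumr exprMn.
by apply: ler_wpM2l; rewrite ?sqr_ge0.
Qed.

Lemma ell2_pt a C k : 0 <= C -> ell2 a C -> `|a k| <= C.
Proof.
move=> C0 ha.
have kM : k \in ZM `|k| by rewrite mem_ZM.
have : a k ^+ 2 <= C ^+ 2.
  apply: le_trans (ha `|k|%N); rewrite (bigD1_seq k) ?uniq_ZM//= lerDl.
  by apply: sumr_ge0 => i _; rewrite sqr_ge0.
by rewrite -(real_normK (num_real (a k))) ler_sqr ?nnegrE.
Qed.

Definition ab (k : int) : R := `|k|%N%:R.

(** The kernel |x|^{-2/5} |y|^{-1/10} on 0 < |x| <= |y|. The bilinear and trilinear estimates all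
    reduce to its square summability in [x], uniform in [y] ([sum_sig]). *)
Definition sig (x y : int) : R :=
  if (0 < `|x| <= `|y|)%N then expR (- (2 / 5) * ln (ab x) - 1 / 10 * ln (ab y)) else 0.

(** Three of the six ordered pairs of frequencies. The other three enter through [Kab] and [kk],
    which add the kernel with [a] and [b] exchanged. *)
Definition kap3 (a b c : int) : R := sig a c + sig b a + sig c b.

Lemma sig_ge0 x y : 0 <= sig x y.
Proof. by rewrite /sig; case: ifP => // _; exact: expR_ge0. Qed.

Lemma kap3_ge0 a b c : 0 <= kap3 a b c.
Proof. by rewrite /kap3 !addr_ge0 ?sig_ge0. Qed.

Lemma sum_pow45 (n : nat) :
  \sum_(1 <= i < n.+1) expR (- (4 / 5) * ln (i%:R : R)) <= 5 * expR (1 / 5 * ln (n%:R : R)) :> R.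
Proof.
elim: n => [|n IH].
  by rewrite big_geq// mulr_ge0// expR_ge0.
rewrite big_nat_recr //=.
set u : R := expR (1 / 5 * ln n.+1%:R).
have u5 : u ^+ 5 = n.+1%:R.
  rewrite -expRM_natl mulrA (_ : 5%:R * (1 / 5) = 1 :> R); last by field.
  by rewrite mul1r lnK// posrE.
have u0 : 0 < u by exact: expR_gt0.
have -> : expR (- (4 / 5) * ln n.+1%:R) = (u ^+ 4)^-1.
  by rewrite -expRM_natl -expRN; congr expR; field.
(* The first term is treated apart: the fifth root of 0 would be read as expR (1 / 5 * ln 0), which
   is not 0. *)
case: n => [|n] in IH u u5 u0 *.
  rewrite big_geq ?add0r//; have u1 : u = 1 by rewrite /u ln1 mulr0 expR0.
  by rewrite u1 expr1n invr1 mulr1 ler1n.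
set v : R := expR (1 / 5 * ln n.+1%:R) in IH.
have v5 : v ^+ 5 = n.+1%:R.
  rewrite -expRM_natl mulrA (_ : 5%:R * (1 / 5) = 1 :> R); last by field.
  by rewrite mul1r lnK// posrE.
have v0 : 0 < v by exact: expR_gt0.
have vu : v <= u.
  rewrite /u /v ler_expR ler_pM2l// ler_ln ?posrE// ler_nat; exact: leqnSn.
(* A telescoping form of the integral test: [u] and [v] are fifth roots of consecutive integers, so
   1 = u^5 - v^5 <= 5 u^4 (u - v). *)
suff : (u ^+ 4)^-1 <= 5 * (u - v) by lra.
rewrite -div1r ler_pdivrMr ?exprn_gt0//.
have e1 : u ^+ 5 - v ^+ 5 = 1.
  by rewrite u5 v5 [X in X - _]mulrS addrK.
rewrite -[leLHS]e1 (_ : u ^+ 5 - v ^+ 5 = (u - v) * (u ^+ 4 + u ^+ 3 * v + u ^+ 2 * v ^+ 2 + u * v ^+ 3 + v ^+ 4)); last by ring.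
rewrite (_ : 5 * (u - v) * u ^+ 4 = (u - v) * (5 * u ^+ 4)); last by ring.
apply: ler_wpM2l; first by lra.
have h i j : v ^+ j * u ^+ i <= u ^+ j * u ^+ i.
  have u1 := ltW u0; have v1 := ltW v0.
  by apply: ler_wpM2r; [exact: exprn_ge0|apply: lerXn2r; rewrite ?nnegrE].
have h1 : v * u ^+ 3 <= u ^+ 4 by have := h 3%N 1%N; rewrite -exprD.
have h2 : v ^+ 2 * u ^+ 2 <= u ^+ 4 by have := h 2%N 2%N; rewrite -exprD.
have h3 : v ^+ 3 * u <= u ^+ 4 by have := h 1%N 3%N; rewrite -exprD.
have h4 : v ^+ 4 <= u ^+ 4 by have := h 0%N 4%N; rewrite -exprD expr0 mulr1.
lra.
Qed.

Lemma sum_sig (c : int) (M : nat) : \sum_(a <- ZM M) sig a c ^+ 2 <= 10.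
Proof.
have [->|c0] := eqVneq c 0.
  rewrite big1// => a _; rewrite /sig (_ : (_ && _)%N = false) ?expr0n//; lia.
pose G (i : nat) : R := if (0 < i <= `|c|)%N then expR (- (4/5) * ln i%:R - 1/5 * ln (ab c)) else 0.
have G0 i : 0 <= G i by rewrite /G; case: ifP => // _; exact: expR_ge0.
have sigG a : sig a c ^+ 2 = G `|a|%N.
  rewrite /sig /G; case: ifP => h; last by rewrite expr0n.
  by rewrite -expRM_natl; congr expR; rewrite /ab; field.
have sG : \sum_(1 <= i < `|c|.+1) G i <= 5.
  apply: (@le_trans _ _ (\sum_(1 <= i < `|c|.+1) expR (- (4/5) * ln (i%:R : R)) * expR (- (1/5) * ln (ab c)))).
    rewrite big_nat [leRHS]big_nat; apply: ler_sum => i hi.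
    rewrite /G ifT; last by lia.
    by rewrite -expRD ler_expR; lra.
  rewrite -mulr_suml; apply: (@le_trans _ _ (5 * expR (1 / 5 * ln (ab c)) * expR (- (1/5) * ln (ab c)))).
    by apply: ler_wpM2r; rewrite ?expR_ge0// sum_pow45.
  by rewrite -mulrA -expRD (_ : _ + _ = 0) ?expR0 ?mulr1//; lra.
rewrite (eq_bigr (fun a => G `|a|%N)); last by move=> a _; exact: sigG.
rewrite (bigID (fun a : int => 0 <= a)) /=.
(* Positive and negative frequencies contribute at most 5 each; the sign [e] treats both at once. *)
suff h (e : int) : e = 1 \/ e = -1 -> \sum_(i <- ZM M | (0 < e * i)) G `|i|%N <= 5.
  have -> : 10 = 5 + 5 :> R by lra.
  apply: lerD.
    apply: le_trans (h 1 _); last by left.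
    rewrite (bigID (fun i : int => i == 0)) /= [X in X + _]big1 ?add0r; last first.
      by move=> i /andP[_ /eqP ->]; rewrite /G.
    by rewrite le_eqVlt; apply/orP; left; apply/eqP; apply: eq_bigl => i; lia.
  apply: le_trans (h (-1) _); last by right.
  by rewrite le_eqVlt; apply/orP; left; apply/eqP; apply: eq_bigl => i; lia.
move=> he; apply: le_trans sG; rewrite -big_filter.
have -> : \sum_(i <- [seq x <- ZM M | 0 < e * x]) G `|i|%N =
   \sum_(i <- [seq `|x|%N | x <- ZM M & 0 < e * x]) G i by rewrite big_map.
rewrite -[leRHS]big_filter.
rewrite (_ : [seq i <- index_iota 1 `|c|.+1 | true] = index_iota 1 `|c|.+1); last exact: filter_predT.
apply: (@ler_sum_inj _ _ _ _ id) => //.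
- rewrite map_inj_in_uniq ?filter_uniq ?uniq_ZM//.
  by move=> x y; rewrite !mem_filter => /andP[hx _] /andP[hy _]; case: he => he; subst e; lia.
- exact: iota_uniq.
- move=> i /mapP[x]; rewrite mem_filter => /andP[hx _] ->.
  rewrite mem_index_iota => hn; rewrite /G ifF//; case: he => he; subst e; lia.
Qed.

End sums.

(** * Trilinear sums over triples of zero sum, and the convolution estimate *)

Section tri.
Variable R : realType.

Lemma sum_eq_ZM M (e : int) (F : int -> R) :
  \sum_(b <- ZM M) (if b == e then F b else 0) = if e \in ZM M then F e else 0.
Proof.
case: ifP => he.
  rewrite (bigD1_seq e) ?uniq_ZM//= eqxx big1 ?addr0// => b /negbTE ->//.
rewrite big_seq big1// => b hb; case: eqP => // be; by rewrite -be hb in he.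
Qed.

Lemma sqrt_ell2 (a : int -> R) C M : 0 <= C -> ell2 a C ->
  Num.sqrt (\sum_(k <- ZM M) a k ^+ 2) <= C.
Proof. by move=> C0 h; rewrite -(ger0_norm C0) -sqrtr_sqr ler_wsqrtr. Qed.

(** Cauchy-Schwarz in a for fixed c, where the square sum of the kernel is at most 10 <= 4^2, then
    Cauchy-Schwarz in c. What remains, the sum of (x_a y_b)^2 over a and c, is at most X^2 Y^2. *)
Lemma tri_sig M (x y z : int -> R) (X Y Z : R) :
  (forall k, 0 <= x k) -> (forall k, 0 <= y k) -> (forall k, 0 <= z k) ->
  0 <= X -> 0 <= Y -> 0 <= Z -> ell2 x X -> ell2 y Y -> ell2 z Z ->
  \sum_(c <- ZM M) \sum_(a <- ZM M) \sum_(b <- ZM M)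
    (if a + b + c == 0 then sig R a c * (x a * y b * z c) else 0) <= 4 * (X * Y * Z).
Proof.
move=> x0 y0 z0 X0 Y0 Z0 hx hy hz.
pose y' b := if b \in ZM M then y b else 0.
have y'0 b : 0 <= y' b by rewrite /y'; case: ifP.
pose D c := \sum_(a <- ZM M) (x a * y' (- a - c)) ^+ 2.
have step c : \sum_(a <- ZM M) \sum_(b <- ZM M)
    (if a + b + c == 0 then sig R a c * (x a * y b * z c) else 0) <=
    4 * (z c * Num.sqrt (D c)).
  have -> : \sum_(a <- ZM M) \sum_(b <- ZM M)
    (if a + b + c == 0 then sig R a c * (x a * y b * z c) else 0) =
    z c * \sum_(a <- ZM M) sig R a c * (x a * y' (- a - c)).
    rewrite mulr_sumr; apply: eq_bigr => a _.
    rewrite (eq_bigr (fun b => if b == - a - c then sig R a c * (x a * y b * z c) else 0)).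
      by rewrite sum_eq_ZM /y'; case: ifP => _; ring.
    by move=> b _; congr (if _ then _ else _); apply/eqP/eqP; lia.
  rewrite mulrCA; apply: ler_wpM2l; first exact: z0.
  apply: le_trans (cauchy_schwarz_sqrt _ _ _) _.
  apply: ler_wpM2r; first exact: sqrtr_ge0.
  rewrite -(@ger0_norm _ 4)// -sqrtr_sqr ler_wsqrtr//.
  by apply: le_trans (sum_sig R c M) _; lra.
apply: le_trans (ler_sum_seq (fun c _ => step c)) _.
rewrite -mulr_sumr; apply: ler_wpM2l => //.
apply: le_trans (cauchy_schwarz_sqrt _ _ _) _.
rewrite mulrC; apply: ler_pM; rewrite ?sqrtr_ge0//; last exact: sqrt_ell2.
rewrite -(@ger0_norm _ (X * Y)) ?mulr_ge0// -sqrtr_sqr ler_wsqrtr//.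
rewrite (eq_bigr D); last first.
  by move=> c _; rewrite sqr_sqrtr// sumr_ge0// => a _; rewrite sqr_ge0.
rewrite /D exchange_big /= exprMn.
apply: (@le_trans _ _ (\sum_(a <- ZM M) x a ^+ 2 * Y ^+ 2)).
  apply: ler_sum_seq => a _; under eq_bigr do rewrite exprMn.
  rewrite -mulr_sumr; apply: ler_wpM2l; rewrite ?sqr_ge0//.
  apply: le_trans (hy M).
  apply: (@le_trans _ _ (\sum_(b <- ZM M) y' b ^+ 2)).
    apply: (@ler_sum_inj R _ _ (ZM M) (ZM M) (fun c => - a - c) (fun b => y' b ^+ 2)); rewrite ?uniq_ZM//.
    - by move=> c d; lia.
    - by move=> b; rewrite sqr_ge0.
    - by move=> c _ /negbTE h; rewrite /y' h expr0n.
  by apply: ler_sum_seq => b hb; rewrite /y' hb.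
by rewrite -mulr_suml; apply: ler_wpM2r; rewrite ?sqr_ge0.
Qed.

(** Testing a bilinear form against a third sequence and writing the output frequency as -c makes
    the three frequencies interchangeable. *)
Definition tri (M : nat) (F : int -> int -> int -> R) : R :=
  \sum_(a <- ZM M) \sum_(b <- ZM M) \sum_(c <- ZM M) (if a + b + c == 0 then F a b c else 0).

Lemma triC12 M F : tri M F = tri M (fun a b c => F b a c).
Proof.
rewrite /tri exchange_big /=; apply: eq_bigr => b _; apply: eq_bigr => a _.
by apply: eq_bigr => c _; rewrite (addrC a b).
Qed.

Lemma triC23 M F : tri M F = tri M (fun a b c => F a c b).
Proof.
rewrite /tri; apply: eq_bigr => a _; rewrite exchange_big /=; apply: eq_bigr => b _.
by apply: eq_bigr => c _; rewrite (addrAC a b c).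
Qed.

Lemma tri_rot M F : tri M F = tri M (fun a b c => F b c a).
Proof. by rewrite triC23 triC12. Qed.

Lemma triD M F G : tri M (fun a b c => F a b c + G a b c) = tri M F + tri M G.
Proof.
rewrite /tri -big_split; apply: eq_bigr => a _ /=; rewrite -big_split; apply: eq_bigr => b _ /=.
by rewrite -big_split; apply: eq_bigr => c _ /=; case: ifP => _; rewrite ?addr0.
Qed.

Lemma triZ M k F : tri M (fun a b c => k * F a b c) = k * tri M F.
Proof.
rewrite /tri mulr_sumr; apply: eq_bigr => a _; rewrite mulr_sumr; apply: eq_bigr => b _.
by rewrite mulr_sumr; apply: eq_bigr => c _; case: ifP; rewrite ?mulr0.
Qed.

Lemma ler_tri M F G :
  (forall a b c, a \in ZM M -> b \in ZM M -> c \in ZM M -> a + b + c = 0 -> F a b c <= G a b c) ->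
  tri M F <= tri M G.
Proof.
move=> h; apply: ler_sum_seq => a ha; apply: ler_sum_seq => b hb; apply: ler_sum_seq => c hc.
by case: eqP => // e; exact: h.
Qed.

Lemma eq_tri M F G :
  (forall a b c, a \in ZM M -> b \in ZM M -> c \in ZM M -> a + b + c = 0 -> F a b c = G a b c) ->
  tri M F = tri M G.
Proof.
by move=> h; apply/eqP; rewrite eq_le; apply/andP; split; apply: ler_tri => a b c ? ? ? ?; rewrite h.
Qed.

Lemma tri_norm M F : `|tri M F| <= tri M (fun a b c => `|F a b c|).
Proof.
apply: le_trans (ler_norm_sum _ _ _) _; apply: ler_sum => a _.
apply: le_trans (ler_norm_sum _ _ _) _; apply: ler_sum => b _.
apply: le_trans (ler_norm_sum _ _ _) _; apply: ler_sum => c _.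
by case: ifP; rewrite ?normr0.
Qed.

Lemma tri_kap M (x y z : int -> R) (X Y Z : R) :
  (forall k, 0 <= x k) -> (forall k, 0 <= y k) -> (forall k, 0 <= z k) ->
  0 <= X -> 0 <= Y -> 0 <= Z -> ell2 x X -> ell2 y Y -> ell2 z Z ->
  tri M (fun a b c => kap3 R a b c * (x a * y b * z c)) <= 12 * (X * Y * Z).
Proof.
move=> x0 y0 z0 X0 Y0 Z0 hx hy hz.
have sm u v w U V W : (forall k, 0 <= u k) -> (forall k, 0 <= v k) -> (forall k, 0 <= w k) ->
  0 <= U -> 0 <= V -> 0 <= W -> ell2 u U -> ell2 v V -> ell2 w W ->
  tri M (fun a b c => sig R a c * (u a * v b * w c)) <= 4 * (U * V * W).
  move=> u0 v0 w0 U0 V0 W0 hu hv hw; apply: le_trans (tri_sig M u0 v0 w0 U0 V0 W0 hu hv hw).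
  rewrite /tri le_eqVlt; apply/orP; left; apply/eqP.
  rewrite [RHS]exchange_big /=; apply: eq_bigr => a _.
  by rewrite exchange_big.
have -> : tri M (fun a b c => kap3 R a b c * (x a * y b * z c)) =
   tri M (fun a b c => sig R a c * (x a * y b * z c)) +
   tri M (fun a b c => sig R a c * (y a * z b * x c)) +
   tri M (fun a b c => sig R a c * (z a * x b * y c)).
  rewrite [X in _ = _ + X + _]tri_rot [X in _ = _ + X]tri_rot [X in _ = _ + X]tri_rot -!triD.
  by apply: eq_tri => a b c _ _ _ _; rewrite /kap3; ring.
have := sm _ _ _ _ _ _ x0 y0 z0 X0 Y0 Z0 hx hy hz.
have := sm _ _ _ _ _ _ y0 z0 x0 Y0 Z0 X0 hy hz hx.
have := sm _ _ _ _ _ _ z0 x0 y0 Z0 X0 Y0 hz hx hy.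
rewrite (_ : Y * Z * X = X * Y * Z); last by ring.
rewrite (_ : Z * X * Y = X * Y * Z); last by ring.
lra.
Qed.

(** Duality: the convolution is tested against [b] itself. If Q is a partial square sum of [b],
    [tri_kap] gives Q <= 12 K X Y sqrt Q, hence the bound on sqrt Q. The output k becomes c = -k in
    the trilinear form, whence the kernel at [- k]. *)
Lemma ell2_conv M (b x y : int -> R) (X Y K : R) :
  (forall k, 0 <= x k) -> (forall k, 0 <= y k) -> (forall k, 0 <= b k) ->
  0 <= X -> 0 <= Y -> 0 <= K -> ell2 x X -> ell2 y Y ->
  (forall k, b k <= K * \sum_(i <- ZM M) \sum_(j <- ZM M)
     (if i + j == k then kap3 R i j (- k) * (x i * y j) else 0)) ->
  ell2 b (12 * K * (X * Y)).
Proof.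
move=> x0 y0 b0 X0 Y0 K0 hx hy hb M'.
set Q := \sum_(k <- ZM M') _.
have Q0 : 0 <= Q by apply: sumr_ge0 => k _; rewrite sqr_ge0.
pose N := maxn M M'.
pose b' k := if - k \in ZM M' then b (- k) else 0.
have b'0 k : 0 <= b' k by rewrite /b'; case: ifP.
have hb' : ell2 b' (Num.sqrt Q).
  move=> P; rewrite sqr_sqrtr//.
  apply: (@le_trans _ _ (\sum_(k <- ZM M') b' (- k) ^+ 2)).
    rewrite (eq_bigr (fun k => b' (- (- k)) ^+ 2)); last by move=> k _; rewrite opprK.
    apply: (@ler_sum_inj R _ _ (ZM P) (ZM M') (fun k => - k) (fun k => b' (- k) ^+ 2)); rewrite ?uniq_ZM//.
    - by move=> j; rewrite sqr_ge0.
    - by move=> i _ h; rewrite opprK /b' (negbTE h) expr0n.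
  by rewrite /Q; apply: ler_sum_seq => k hk; rewrite /b' opprK hk.
have T := tri_kap N x0 y0 b'0 X0 Y0 (sqrtr_ge0 _) hx hy hb'.
have QT : Q <= K * (12 * (X * Y * Num.sqrt Q)).
  apply: le_trans (ler_wpM2l K0 T).
  rewrite /Q.
  apply: (@le_trans _ _ (\sum_(k <- ZM M') b k * (K * \sum_(i <- ZM N) \sum_(j <- ZM N)
     (if i + j == k then kap3 R i j (- k) * (x i * y j) else 0)))).
    apply: ler_sum_seq => k _; rewrite expr2; apply: ler_wpM2l => //.
    apply: (le_trans (hb k)); apply: ler_wpM2l => //.
    have pos i j : 0 <= (if i + j == k then kap3 R i j (- k) * (x i * y j) else 0).
      by case: ifP => // _; rewrite mulr_ge0 ?kap3_ge0 ?mulr_ge0.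
    apply: (@le_trans _ _ (\sum_(i <- ZM M) \sum_(j <- ZM N)
     (if i + j == k then kap3 R i j (- k) * (x i * y j) else 0))).
      apply: ler_sum => i _; apply: ler_sum_ZM => //; exact: leq_maxl.
    apply: (@ler_sum_ZM R M N (fun i => \sum_(j <- ZM N)
     (if i + j == k then kap3 R i j (- k) * (x i * y j) else 0))); first exact: leq_maxl.
    by move=> i; apply: sumr_ge0.
  have -> : \sum_(k <- ZM M') b k * (K * \sum_(i <- ZM N) \sum_(j <- ZM N)
     (if i + j == k then kap3 R i j (- k) * (x i * y j) else 0)) =
     K * \sum_(k <- ZM M') \sum_(i <- ZM N) \sum_(j <- ZM N)
     (if i + j == k then kap3 R i j (- k) * (x i * y j * b' (- k)) else 0).
    rewrite mulr_sumr; apply: eq_big_seq => k hk; rewrite mulrCA; congr (_ * _).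
    rewrite mulr_sumr; apply: eq_bigr => i _; rewrite mulr_sumr; apply: eq_bigr => j _.
    by rewrite /b' opprK hk; case: ifP => _; rewrite ?mulr0//; ring.
  apply: ler_wpM2l => //.
  apply: (@le_trans _ _ (\sum_(k <- ZM N) \sum_(i <- ZM N) \sum_(j <- ZM N)
     (if i + j == k then kap3 R i j (- k) * (x i * y j * b' (- k)) else 0))).
    apply: ler_sum_ZM; first exact: leq_maxr.
    move=> k; apply: sumr_ge0 => i _; apply: sumr_ge0 => j _; case: ifP => // _.
    by rewrite !mulr_ge0 ?kap3_ge0.
  rewrite -sum_ZM_opp /tri exchange_big /= le_eqVlt; apply/orP; left; apply/eqP.
  apply: eq_bigr => i _; rewrite exchange_big /=; apply: eq_bigr => j _.
  by apply: eq_bigr => c _; rewrite opprK -subr_eq0 opprK.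
have [Q00|Qp] := eqVneq Q 0; first by rewrite Q00 sqr_ge0.
have sQ : 0 < Num.sqrt Q by rewrite sqrtr_gt0 lt_def Qp.
have QQ : Num.sqrt Q * Num.sqrt Q = Q by rewrite -expr2 sqr_sqrtr.
have le : Num.sqrt Q <= 12 * K * (X * Y).
  rewrite -(ler_pM2r sQ) QQ (le_trans QT)// le_eqVlt; apply/orP; left; apply/eqP; ring.
by rewrite -[leLHS]QQ expr2; apply: ler_pM; rewrite ?sqrtr_ge0.
Qed.

End tri.

(** * Frequency kernels and the resonance bound *)

Section ker.
Variable R : realType.
Implicit Types (N d D P h Ca g C K : R) (a b k : int).

(** [br N k] is the bracket [k], and [om N d k] the modulus om_k with delta = [d]. Powers are
    written as expR of multiples of ln: estimates of products of powers become linear inequalities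
    between exponents, within reach of [lra]. *)
Definition br N k : R := Num.max N (ab R k).
Definition om N d k h : R := h / d + expR (- (1 / 2) * ln (br N k)) * h `^ (2 / 5).

Definition mn3 (a b c : int) : nat := minn `|a| (minn `|b| `|c|).
Definition mx3 (a b c : int) : nat := maxn `|a| (maxn `|b| `|c|).
(** 1 / (l L^4): up to a constant, the upper bound of a period 2 pi / |Phi|. *)
Definition g3 a b c : R := ((mn3 a b c)%:R * (mx3 a b c)%:R ^+ 4)^-1.

Lemma expR_powR (u r : R) : (expR u) `^ r = expR (r * u).
Proof. by rewrite /powR gt_eqF ?expR_gt0// expRK. Qed.

(** Interpolation between the trivial bound h and the oscillatory bound P. It converts a short
    period into the Hoelder exponent 2/5 of the gauge. *)
Lemma minh_le h P : 0 <= h -> 0 <= P -> Num.min h P <= h `^ (2 / 5) * P `^ (3 / 5).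
Proof.
move=> h0 P0; set m := Num.min h P.
have m0 : 0 <= m by rewrite le_min h0.
have e1 : 2 / 5 + 3 / 5 = 1 :> R by lra.
have e : m `^ (2 / 5) * m `^ (3 / 5) = m.
  rewrite -powRD; first by rewrite e1 powRr1.
  by rewrite e1 oner_eq0.
rewrite -[leLHS]e; apply: ler_pM; rewrite ?powR_ge0//.
  by apply: ge0_ler_powR; rewrite ?nnegrE// ?ge_min ?lexx//; lra.
by apply: ge0_ler_powR; rewrite ?nnegrE// ?ge_min ?lexx ?orbT//; lra.
Qed.

Lemma natr_expR (i : nat) : (0 < i)%N -> exists2 x : R, 0 <= x & i%:R = expR x.
Proof.
move=> i0; exists (ln (i%:R : R)); last by rewrite lnK// posrE ltr0n.
by rewrite ln_ge0// ler1n.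
Qed.

Lemma om_ge1 N d k h : 0 <= h -> h / d <= om N d k h.
Proof. by move=> h0; rewrite lerDl mulr_ge0 ?expR_ge0 ?powR_ge0. Qed.

Lemma om_ge2 N d k h : 0 <= h -> 0 < d -> expR (- (1 / 2) * ln (br N k)) * h `^ (2 / 5) <= om N d k h.
Proof. by move=> h0 d0; rewrite lerDr divr_ge0// ltW. Qed.

Lemma om_ge0 N d k h : 0 <= h -> 0 < d -> 0 <= om N d k h.
Proof.
move=> h0 d0; apply: addr_ge0; first by apply: divr_ge0 => //; exact: ltW.
by rewrite mulr_ge0 ?expR_ge0 ?powR_ge0.
Qed.

Lemma br_expR N k : 0 < N -> br N k = expR (ln (br N k)).
Proof. by move=> N0; rewrite lnK// posrE lt_max N0. Qed.

Lemma ab_gt0 k : k != 0 -> 0 < ab R k.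
Proof. by move=> k0; rewrite /ab ltr0n absz_gt0. Qed.

Lemma om_period N d k P Ca g : 0 < d -> 0 < g -> 1 <= Ca -> 0 < P <= Ca * g ->
  om N d k P <= Ca * (g / d + expR (- (1 / 2) * ln (br N k)) * g `^ (2 / 5)).
Proof.
move=> d0 g0 C1 /andP[P0 PC]; have Ca0 : 0 <= Ca by lra.
have g0' := ltW g0; rewrite /om mulrDr; apply: lerD.
  by rewrite mulrA ler_pM2r ?invr_gt0.
rewrite mulrCA; apply: ler_wpM2l; first exact: expR_ge0.
apply: (@le_trans _ _ ((Ca * g) `^ (2 / 5))).
  by apply: ge0_ler_powR; rewrite ?nnegrE ?mulr_ge0// ltW.
rewrite powRM//.
apply: ler_wpM2r; first exact: powR_ge0.
rewrite -[leRHS](@powRr1 _ Ca); last by lra.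
by apply: ler_powR => //; lra.
Qed.

(* The kernel inequality in logarithmic variables: [m] is the quantity
   bounding an oscillating integral, [C] the coefficient. *)
Lemma ker_abs N d D Ca P h g C K q1 q2 k :
  0 < N -> 0 < d -> d <= D * expR (- (5 / 2) * ln N) -> 1 <= D -> 1 <= Ca -> 0 < g ->
  0 < P <= Ca * g -> 0 <= h <= d -> 0 <= C -> 0 <= K ->
  C * g <= K ->
  (forall q, q \in [:: q1; q2] ->
     C * (expR (- (5 / 2) * ln N) * (expR (- (1 / 2) * ln (br N q)) * g `^ (2 / 5))) <= 2 * K) ->
  C * g `^ (3 / 5) <= 2 * (K * expR (- (1 / 2) * ln (br N k))) \/
    C * expR (- (5 / 2) * ln N) <= 2 * K ->
  C * (Num.min h P + h * (om N d q1 P + om N d q2 P)) <= 8 * Ca * D * K * om N d k h.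
Proof.
move=> N0 d0 dD D1 C1 g0 hP /andP[h0 hd] Cp K0 H1 H2 H3.
have [P0 PC] := andP hP.
have Ca0 : 0 <= Ca by lra.
have g0' := ltW g0.
have DK : 0 <= Ca * D * K by rewrite !mulr_ge0//; lra.
have Ok := om_ge0 N k h0 d0.
(* The variation of the amplitude over a period, summed over a time h, is charged to the linear part
   h / d of the modulus by writing h as d * (h / d). *)
have A q : q \in [:: q1; q2] -> C * (h * om N d q P) <= 3 * (Ca * D * K) * om N d k h.
  move=> hq; have hop := om_period N q d0 g0 C1 hP.
  apply: (@le_trans _ _ (C * (Ca * (g + d * (expR (- (1 / 2) * ln (br N q)) * g `^ (2 / 5)))) * (h / d))).
    rewrite -[leRHS]mulrA; apply: ler_wpM2l => //.
    have -> : Ca * (g + d * (expR (- (1 / 2) * ln (br N q)) * g `^ (2 / 5))) * (h / d) =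
       h * (Ca * (g / d + expR (- (1 / 2) * ln (br N q)) * g `^ (2 / 5))).
      by field; rewrite gt_eqF.
    exact: ler_wpM2l.
  apply: ler_pM; rewrite ?om_ge1 ?divr_ge0 ?(ltW d0)//.
    apply: mulr_ge0 => //; apply: mulr_ge0 => //; apply: addr_ge0 => //.
    by rewrite !mulr_ge0 ?expR_ge0 ?powR_ge0// ltW.
  have h2 := H2 _ hq.
  set w := expR (- (1 / 2) * ln (br N q)) * g `^ (2 / 5) in h2 *.
  have w0 : 0 <= w by rewrite mulr_ge0 ?expR_ge0 ?powR_ge0.
  have dw : C * (d * w) <= D * (2 * K).
    apply: (@le_trans _ _ (D * (C * (expR (- (5 / 2) * ln N) * w)))).
      rewrite mulrCA [leRHS]mulrCA; apply: (@le_trans _ _ ((D * expR (- (5 / 2) * ln N)) * (C * w))).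
        by apply: ler_wpM2r => //; rewrite mulr_ge0.
      by rewrite le_eqVlt; apply/orP; left; apply/eqP; ring.
    by apply: ler_wpM2l => //; lra.
  have -> : C * (Ca * (g + d * w)) = Ca * (C * g + C * (d * w)) by ring.
  have -> : 3 * (Ca * D * K) = Ca * (D * K + D * (2 * K)) by ring.
  apply: ler_wpM2l; first lra.
  apply: lerD => //; apply: (le_trans H1); exact: ler_peMl.
(* The first alternative of [H3] charges this term to the h^{2/5} part of the modulus, by
   interpolation; the second charges it to the linear part, as h <= d * om h. *)
have B : C * Num.min h P <= 2 * (Ca * D * K) * om N d k h.
  case: H3 => H3.
    apply: (@le_trans _ _ (C * (h `^ (2 / 5) * (Ca * g `^ (3 / 5))))).
      apply: ler_wpM2l => //; apply: le_trans (minh_le h0 (ltW P0)) _.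
      apply: ler_wpM2l; first exact: powR_ge0.
      apply: (@le_trans _ _ ((Ca * g) `^ (3 / 5))).
        by apply: ge0_ler_powR; rewrite ?nnegrE ?mulr_ge0// ltW.
      rewrite powRM//.
      apply: ler_wpM2r; first exact: powR_ge0.
      rewrite -[leRHS](@powRr1 _ Ca); last by lra.
      by apply: ler_powR => //; lra.
    have -> : C * (h `^ (2 / 5) * (Ca * g `^ (3 / 5))) = Ca * h `^ (2 / 5) * (C * g `^ (3 / 5)) by ring.
    apply: (@le_trans _ _ (Ca * h `^ (2 / 5) * (2 * (K * expR (- (1 / 2) * ln (br N k)))))).
      by apply: ler_wpM2l => //; rewrite mulr_ge0 ?powR_ge0//; lra.
    apply: (@le_trans _ _ (2 * (Ca * D * K) * (expR (- (1 / 2) * ln (br N k)) * h `^ (2 / 5)))).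
      set e := expR (- (1 / 2) * _); set w := h `^ _.
      have -> : Ca * w * (2 * (K * e)) = 1 * (2 * Ca * K * (e * w)) by ring.
      have -> : 2 * (Ca * D * K) * (e * w) = D * (2 * Ca * K * (e * w)) by ring.
      apply: ler_wpM2r => //; rewrite !mulr_ge0 ?expR_ge0 ?powR_ge0//; lra.
    by apply: ler_wpM2l; [rewrite mulr_ge0|exact: om_ge2].
  apply: (@le_trans _ _ (C * (d * om N d k h))).
    apply: ler_wpM2l => //; rewrite ge_min; apply/orP; left.
    rewrite -ler_pdivrMl// mulrC; exact: om_ge1.
  rewrite [leLHS]mulrA; apply: ler_wpM2r => //.
  apply: (@le_trans _ _ (C * (D * expR (- (5 / 2) * ln N)))); first exact: ler_wpM2l.
  rewrite mulrCA; apply: (@le_trans _ _ (D * (2 * K))); first by apply: ler_wpM2l => //; lra.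
  rewrite (_ : 2 * (Ca * D * K) = Ca * (D * (2 * K))); last by ring.
  by apply: ler_peMl => //; rewrite !mulr_ge0//; lra.
rewrite mulrDr mulrDr mulrDr.
have := A q1 (mem_head _ _); have := A q2; rewrite !inE eqxx orbT => /(_ isT).
move: B; set X := C * _; set Y := C * _; set Z := C * _ => ???.
have -> : 8 * Ca * D * K * om N d k h = 2 * (Ca * D * K) * om N d k h +
  (3 * (Ca * D * K) * om N d k h + 3 * (Ca * D * K) * om N d k h) by ring.
by apply: lerD => //; apply: lerD.
Qed.

End ker.

(** * Kernel bounds according to the smallest frequency, and the lower bound of the phase *)

Section ker.
Variable R : realType.
Implicit Types (N d D P h Ca : R) (a b k q : int).

(** The largest frequency is at most the sum of the two others, so the middle one is at least half
    of it. *)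
Lemma mnmx_cases a b k : a + b = k ->
  [\/ [/\ mn3 a b k = `|a|%N, (mx3 a b k <= 2 * `|b|)%N & (mx3 a b k <= 2 * `|k|)%N],
      [/\ mn3 a b k = `|b|%N, (mx3 a b k <= 2 * `|a|)%N & (mx3 a b k <= 2 * `|k|)%N] |
      [/\ mn3 a b k = `|k|%N, (mx3 a b k <= 2 * `|a|)%N & (mx3 a b k <= 2 * `|b|)%N]].
Proof.
move=> e; rewrite /mn3 /mx3.
have [ha|ha] := boolP ((`|a| <= `|b|) && (`|a| <= `|k|))%N; first by constructor 1; split; lia.
have [hb|hb] := boolP ((`|b| <= `|a|) && (`|b| <= `|k|))%N; first by constructor 2; split; lia.
by constructor 3; split; lia.
Qed.

Lemma br_big N q (L : nat) : 1 <= N -> N < L%:R -> (`|q| <= L)%N -> (L <= 2 * `|q|)%N ->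
  L%:R / 2 <= br N q <= L%:R.
Proof.
move=> N1 NL qL Lq; rewrite /br /ab ge_max le_max (ltW NL) ler_nat qL /= andbT.
apply/orP; right; by rewrite ler_pdivrMr// -natrM ler_nat mulnC.
Qed.

Lemma exph_big N q y : 0 < N -> expR y / 2 <= br N q -> expR (- (1 / 2) * ln (br N q)) <= 2 * expR (- (1 / 2) * y).
Proof.
move=> N0 h.
have b0 : 0 < br N q by rewrite lt_max N0.
have e2 : expR (ln 2) = 2 :> R by rewrite lnK// posrE.
rewrite -[X in _ <= X * _]e2 -expRD ler_expR.
have : ln (expR y / 2) <= ln (br N q) by rewrite ler_ln ?posrE ?divr_gt0 ?expR_gt0.
rewrite lnM ?posrE ?expR_gt0 ?invr_gt0// expRK lnV ?posrE//.
have : 0 <= ln (2 : R) by rewrite ln_ge0//; lra.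
lra.
Qed.

Lemma br_small N q x : 0 < N -> ab R q = expR x ->
  exists2 b, br N q = expR b & [/\ ln N <= b, x <= b & b = ln N \/ b = x].
Proof.
move=> N0 e; rewrite /br e.
have eN : N = expR (ln N) by rewrite lnK// posrE.
have [h|h] := leP N (expR x).
  by exists x => //; split => //; [rewrite -ler_expR -eN|right].
exists (ln N); first by rewrite -eN.
by split => //; [rewrite -ler_expR -eN ltW|left].
Qed.

Lemma mx3_le a b k : [/\ (`|a| <= mx3 a b k)%N, (`|b| <= mx3 a b k)%N & (`|k| <= mx3 a b k)%N].
Proof. by rewrite /mx3; split; lia. Qed.

Lemma mn3_le a b k : [/\ (mn3 a b k <= `|a|)%N, (mn3 a b k <= `|b|)%N & (mn3 a b k <= `|k|)%N].
Proof. by rewrite /mn3; split; lia. Qed.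

Lemma mnmx_gt0 a b k : a != 0 -> b != 0 -> k != 0 -> (0 < mn3 a b k)%N /\ (0 < mx3 a b k)%N.
Proof. by rewrite /mn3 /mx3; split; lia. Qed.

Lemma sig_le x y (l L : R) : x != 0 -> (`|x| <= `|y|)%N -> ab R x = expR l -> ab R y <= expR L ->
  expR (- (2 / 5) * l - 1 / 10 * L) <= sig R x y.
Proof.
move=> x0 xy ex ey; rewrite /sig absz_gt0 x0 xy /= ler_expR ex expRK lerD2l lerN2 ler_pM2l//.
have y0 : y != 0 by rewrite -absz_gt0 (leq_trans _ xy)// absz_gt0.
by rewrite -[leRHS]expRK ler_ln ?posrE ?expR_gt0 ?ab_gt0.
Qed.

(** The derivative k with the output weight 1/[k], the input weights 1/[a] and 1/[b] being divided
    out. *)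
Definition Cker N a b k : R := ab R k / br N k * (br N a * br N b).

Lemma Cker_sym N a b k : Cker N a b k = Cker N b a k.
Proof. by rewrite /Cker [br N a * _]mulrC. Qed.

(** The input [a] is low, the other input and the output are high. With l = exp x, L = exp y and [a]
    = exp bb, the multiplier is at most exp (bb + y) and the period at most [Ca] times exp (- (x + 4
    y)), so each requirement of [ker_abs] is linear in x, y, bb and ln N. *)
Lemma ker_HLH N d D P Ca h a b k : a != 0 -> b != 0 -> k != 0 -> a + b = k ->
  1 <= N -> 0 < d -> d <= D * expR (- (5 / 2) * ln N) -> 1 <= D -> 1 <= Ca ->
  0 < P <= Ca * g3 R a b k -> 0 <= h <= d -> N < (mx3 a b k)%:R ->
  mn3 a b k = `|a|%N -> (mx3 a b k <= 2 * `|b|)%N -> (mx3 a b k <= 2 * `|k|)%N ->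
  Cker N a b k * (Num.min h P + h * (om N d a P + om N d b P)) <=
    8 * Ca * D * sig R a (- k) * om N d k h.
Proof.
move=> a0 b0 k0 eab N1 d0 dD D1 C1 hP hh NL el Lb Lk.
have N0 : 0 < N by lra.
have [aL bL kL] := mx3_le a b k.
have [al bl kl] := mn3_le a b k.
have [mn0 mx0] := mnmx_gt0 a0 b0 k0.
have [x x0 ex] : exists2 x : R, 0 <= x & (mn3 a b k)%:R = expR x by exact: natr_expR.
have [y y0 ey] : exists2 y : R, 0 <= y & (mx3 a b k)%:R = expR y by exact: natr_expR.
have exa : ab R a = expR x by rewrite /ab -el.
have [bb ebr [nb xb bc]] := br_small N0 exa.
have /andP[b1 b2] := br_big N1 NL bL Lb.
have /andP[k1 k2] := br_big N1 NL kL Lk.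
have eN : N = expR (ln N) by rewrite lnK// posrE.
have n0 : 0 <= ln N by rewrite ln_ge0.
have ny : ln N < y by rewrite -ltr_expR -eN -ey.
have xy : x <= y by rewrite -ler_expR -ey -exa ler_nat.
have by_ : bb <= y by case: bc => ->//; exact: ltW.
have eg : g3 R a b k = expR (- (x + 4 * y)).
  by rewrite /g3 ex ey -expRM_natl -expRD -expRN.
have sK : expR (- (2 / 5) * x - 1 / 10 * y) <= sig R a (- k).
  by apply: sig_le => //; [rewrite abszN -el|rewrite -ey /ab abszN ler_nat].
have CB : Cker N a b k <= expR (bb + y).
  rewrite /Cker ebr expRD -[leRHS]mul1r; apply: ler_pM; rewrite ?divr_ge0 ?mulr_ge0 ?expR_ge0//.
  - by rewrite le_max ltW.
  - by rewrite le_max ltW.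
  - by rewrite ler_pdivrMr ?mul1r ?le_max ?lexx ?orbT// lt_max N0.
  - by rewrite ler_pM2l ?expR_gt0// -ey.
have C0 : 0 <= Cker N a b k by rewrite /Cker !mulr_ge0 ?invr_ge0 ?le_max ?ltW// ?ab_gt0.
rewrite eg in hP.
have key : Cker N a b k * (Num.min h P + h * (om N d a P + om N d b P)) <=
    8 * Ca * D * expR (- (2 / 5) * x - 1 / 10 * y) * om N d k h.
  apply: (ker_abs N0 d0 dD D1 C1 (expR_gt0 _) hP hh) => //.
  - apply: (@le_trans _ _ (expR (bb + y) * expR (- (x + 4 * y)))); first by rewrite ler_pM2r ?expR_gt0.
    rewrite -expRD ler_expR; lra.
  - move=> q; rewrite !inE => hq; rewrite expR_powR.
    apply: (@le_trans _ _ (expR (bb + y) * (expR (- (5 / 2) * ln N) * (2 * expR (- (1 / 2) * bb) * expR (2 / 5 * - (x + 4 * y)))))).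
      apply: ler_pM => //; rewrite ?mulr_ge0 ?expR_ge0//.
      rewrite ler_pM2l ?expR_gt0// ler_pM2r ?expR_gt0//.
      case/orP: hq => /eqP ->; first by rewrite ebr expRK ler_peMl ?expR_ge0//; lra.
      rewrite ey in b1; apply: le_trans (exph_big N0 b1) _.
      by rewrite ler_pM2l// ler_expR; lra.
    rewrite -!mulrA [_ * (2 * _)]mulrCA [expR (bb + y) * _]mulrCA ler_pM2l// -!expRD ler_expR; lra.
  - rewrite !expR_powR.
    (* Up to this threshold interpolation yields the kernel times [k]^{-1/2}, with equality at the
       threshold. Beyond it bb > x, so [a] = N, and the window length N^{-5/2} alone is enough. *)
    have [h1|h1] := leP bb (8 / 10 * y + 2 / 10 * x); [left|right].
      apply: (@le_trans _ _ (expR (bb + y) * expR (3 / 5 * - (x + 4 * y)))); first by rewrite ler_pM2r ?expR_gt0.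
      apply: (@le_trans _ _ (1 * (expR (- (2 / 5) * x - 1 / 10 * y) * expR (- (1 / 2) * y)))).
        rewrite mul1r -!expRD ler_expR; lra.
      apply: ler_pM; rewrite ?mulr_ge0 ?expR_ge0//; first lra.
      rewrite ler_pM2l ?expR_gt0// ler_expR.
      have : ln (br N k) <= y by rewrite -[y]expRK -ey ler_ln ?posrE ?lt_max ?N0// ey expR_gt0.
      lra.
    apply: (@le_trans _ _ (expR (bb + y) * expR (- (5 / 2) * ln N))); first by rewrite ler_pM2r ?expR_gt0.
    apply: (@le_trans _ _ (1 * expR (- (2 / 5) * x - 1 / 10 * y))).
      rewrite mul1r -expRD ler_expR; case: bc => bc; lra.
    by apply: ler_pM; rewrite ?expR_ge0//; lra.
apply: (le_trans key); apply: ler_wpM2r; first by case/andP: hh => h0 _; exact: om_ge0.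
by rewrite ler_pM2l// !mulr_gt0//; lra.
Qed.

(** Two high inputs and a low output. The factor |k| / [k] = exp (x - bb) compensates the two large
    weights; interpolation always succeeds since x <= bb and x <= y, with no slack when x = bb =
    y. *)
Lemma ker_HHL N d D P Ca h a b k : a != 0 -> b != 0 -> k != 0 -> a + b = k ->
  1 <= N -> 0 < d -> d <= D * expR (- (5 / 2) * ln N) -> 1 <= D -> 1 <= Ca ->
  0 < P <= Ca * g3 R a b k -> 0 <= h <= d -> N < (mx3 a b k)%:R ->
  mn3 a b k = `|k|%N -> (mx3 a b k <= 2 * `|a|)%N -> (mx3 a b k <= 2 * `|b|)%N ->
  Cker N a b k * (Num.min h P + h * (om N d a P + om N d b P)) <=
    8 * Ca * D * sig R (- k) b * om N d k h.
Proof.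
move=> a0 b0 k0 eab N1 d0 dD D1 C1 hP hh NL el La Lb.
have N0 : 0 < N by lra.
have [aL bL kL] := mx3_le a b k.
have [al bl kl] := mn3_le a b k.
have [mn0 mx0] := mnmx_gt0 a0 b0 k0.
have [x x0 ex] : exists2 x : R, 0 <= x & (mn3 a b k)%:R = expR x by exact: natr_expR.
have [y y0 ey] : exists2 y : R, 0 <= y & (mx3 a b k)%:R = expR y by exact: natr_expR.
have exk : ab R k = expR x by rewrite /ab -el.
have [bb ebr [nb xb bc]] := br_small N0 exk.
have /andP[b1 b2] := br_big N1 NL bL Lb.
have /andP[a1 a2] := br_big N1 NL aL La.
have eN : N = expR (ln N) by rewrite lnK// posrE.
have n0 : 0 <= ln N by rewrite ln_ge0.
have ny : ln N < y by rewrite -ltr_expR -eN -ey.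
have xy : x <= y by rewrite -ler_expR -ey -exk ler_nat.
have by_ : bb <= y by case: bc => ->//; exact: ltW.
have eg : g3 R a b k = expR (- (x + 4 * y)).
  by rewrite /g3 ex ey -expRM_natl -expRD -expRN.
have sK : expR (- (2 / 5) * x - 1 / 10 * y) <= sig R (- k) b.
  apply: sig_le => //; [by rewrite oppr_eq0|by rewrite abszN -el|by rewrite /ab abszN|].
  by rewrite -ey /ab ler_nat.
have CB : Cker N a b k <= expR (x - bb + 2 * y).
  rewrite /Cker ebr exk -expRN -expRD [leRHS]expRD ler_pM2l ?expR_gt0//.
  rewrite (_ : 2 * y = y + y); last by lra.
  by rewrite expRD -ey; apply: ler_pM => //; rewrite le_max (ltW N0).
have C0 : 0 <= Cker N a b k by rewrite /Cker !mulr_ge0 ?invr_ge0 ?le_max ?ltW// ?ab_gt0.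
rewrite eg in hP.
have key : Cker N a b k * (Num.min h P + h * (om N d a P + om N d b P)) <=
    8 * Ca * D * expR (- (2 / 5) * x - 1 / 10 * y) * om N d k h.
  apply: (ker_abs N0 d0 dD D1 C1 (expR_gt0 _) hP hh) => //.
  - apply: (@le_trans _ _ (expR (x - bb + 2 * y) * expR (- (x + 4 * y)))); first by rewrite ler_pM2r ?expR_gt0.
    rewrite -expRD ler_expR; lra.
  - move=> q; rewrite !inE => hq; rewrite expR_powR.
    apply: (@le_trans _ _ (expR (x - bb + 2 * y) * (expR (- (5 / 2) * ln N) * (2 * expR (- (1 / 2) * y) * expR (2 / 5 * - (x + 4 * y)))))).
      apply: ler_pM => //; rewrite ?mulr_ge0 ?expR_ge0//.
      rewrite ler_pM2l ?expR_gt0// ler_pM2r ?expR_gt0//.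
      by rewrite ey in a1 b1; case/orP: hq => /eqP ->; apply: exph_big.
    rewrite -!mulrA [_ * (2 * _)]mulrCA [expR (x - bb + 2 * y) * _]mulrCA ler_pM2l// -!expRD ler_expR; lra.
  - rewrite !expR_powR; left.
    apply: (@le_trans _ _ (expR (x - bb + 2 * y) * expR (3 / 5 * - (x + 4 * y)))); first by rewrite ler_pM2r ?expR_gt0.
    apply: (@le_trans _ _ (1 * (expR (- (2 / 5) * x - 1 / 10 * y) * expR (- (1 / 2) * bb)))).
      rewrite mul1r -!expRD ler_expR; lra.
    apply: ler_pM; rewrite ?mulr_ge0 ?expR_ge0//; first lra.
    by rewrite ebr expRK.
apply: (le_trans key); apply: ler_wpM2r; first by case/andP: hh => h0 _; exact: om_ge0.
by rewrite ler_pM2l// !mulr_gt0//; lra.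
Qed.

Lemma g3_sym a b k : [/\ mn3 a b k = mn3 b a k, mx3 a b k = mx3 b a k & g3 R a b k = g3 R b a k].
Proof.
have h1 : mn3 a b k = mn3 b a k by rewrite /mn3 minnCA.
have h2 : mx3 a b k = mx3 b a k by rewrite /mx3 maxnCA.
by rewrite /g3 h1 h2.
Qed.

Lemma ker_high N d D P Ca h a b k : a != 0 -> b != 0 -> k != 0 -> a + b = k ->
  1 <= N -> 0 < d -> d <= D * expR (- (5 / 2) * ln N) -> 1 <= D -> 1 <= Ca ->
  0 < P <= Ca * g3 R a b k -> 0 <= h <= d -> N < (mx3 a b k)%:R ->
  Cker N a b k * (Num.min h P + h * (om N d a P + om N d b P)) <=
    8 * Ca * D * (kap3 R a b (- k) + kap3 R b a (- k)) * om N d k h.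
Proof.
move=> a0 b0 k0 eab N1 d0 dD D1 C1 hP hh NL.
have [h0 _] := andP hh.
have W s : s <= kap3 R a b (- k) + kap3 R b a (- k) -> 0 <= s ->
   8 * Ca * D * s * om N d k h <= 8 * Ca * D * (kap3 R a b (- k) + kap3 R b a (- k)) * om N d k h.
  move=> hs s0; apply: ler_wpM2r; first exact: om_ge0.
  by apply: ler_wpM2l => //; rewrite !mulr_ge0//; lra.
have p1 := sig_ge0 R a (- k); have p2 := sig_ge0 R b a; have p3 := sig_ge0 R (- k) b.
have q1 := sig_ge0 R b (- k); have q2 := sig_ge0 R a b; have q3 := sig_ge0 R (- k) a.
have [[e1 e2 e3]|[e1 e2 e3]|[e1 e2 e3]] := mnmx_cases eab.
- apply: le_trans (ker_HLH a0 b0 k0 eab N1 d0 dD D1 C1 hP hh NL e1 e2 e3) (W _ _ _) => //.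
  by rewrite /kap3; lra.
- have [s1 s2 s3] := g3_sym a b k.
  rewrite s1 s2 in e1 e2 e3; rewrite s3 in hP; rewrite s2 in NL.
  rewrite Cker_sym [om N d a P + _]addrC.
  apply: le_trans (ker_HLH b0 a0 k0 _ N1 d0 dD D1 C1 hP hh NL e1 e2 e3) (W _ _ _) => //; first by rewrite addrC.
  by rewrite /kap3; lra.
- apply: le_trans (ker_HHL a0 b0 k0 eab N1 d0 dD D1 C1 hP hh NL e1 e2 e3) (W _ _ _) => //.
  by rewrite /kap3; lra.
Qed.

(** All brackets equal [N], so the multiplier is at most N^2, and the kernel is at least N^{-1/2}:
    this is what the window length N^{-5/2} is made for. *)
Lemma ker_low N d D h a b k : a != 0 -> b != 0 -> k != 0 -> a + b = k ->
  1 <= N -> 0 < d -> d <= D * expR (- (5 / 2) * ln N) -> 1 <= D ->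
  0 <= h <= d -> (mx3 a b k)%:R <= N ->
  Cker N a b k * h <= D * (kap3 R a b (- k) + kap3 R b a (- k)) * om N d k h.
Proof.
move=> a0 b0 k0 eab N1 d0 dD D1 /andP[h0 hd] LN.
have N0 : 0 < N by lra.
have eN : N = expR (ln N) by rewrite lnK// posrE.
have [aL bL kL] := mx3_le a b k.
have brN q : (`|q| <= mx3 a b k)%N -> br N q = N.
  by move=> h1; apply/max_idPl; apply: le_trans LN; rewrite ler_nat.
have kN q : (`|q| <= mx3 a b k)%N -> ab R q <= N.
  by move=> h1; apply: le_trans LN; rewrite ler_nat.
have [al bl kl] := mn3_le a b k.
have Ok := om_ge1 N d k h0.
have cK : Cker N a b k <= expR (2 * ln N).
  rewrite /Cker !brN// (_ : 2 * ln N = ln N + ln N); last by lra.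
  rewrite expRD -eN mulrA divfK ?gt_eqF//.
  by rewrite ler_pM2r// kN.
have C0 : 0 <= Cker N a b k by rewrite /Cker !mulr_ge0 ?invr_ge0 ?le_max ?ltW// ?ab_gt0.
have kapN : expR (- (1 / 2) * ln N) <= kap3 R a b (- k) + kap3 R b a (- k).
  have p1 := sig_ge0 R a (- k); have p2 := sig_ge0 R b a; have p3 := sig_ge0 R (- k) b.
  have q1 := sig_ge0 R b (- k); have q2 := sig_ge0 R a b; have q3 := sig_ge0 R (- k) a.
  have S u v : u != 0 -> (`|u| <= `|v|)%N -> ab R u <= N -> ab R v <= N -> expR (- (1 / 2) * ln N) <= sig R u v.
    move=> u0 uv uN vN; rewrite /sig absz_gt0 u0 uv /= ler_expR.
    have v0 : v != 0 by rewrite -absz_gt0 (leq_trans _ uv)// absz_gt0.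
    have : ln (ab R u) <= ln N by rewrite ler_ln ?posrE ?ab_gt0.
    have : ln (ab R v) <= ln N by rewrite ler_ln ?posrE ?ab_gt0.
    lra.
  have kN' := kN _ kL; rewrite (_ : ab R k = ab R (- k)) in kN'; last by rewrite /ab abszN.
  have [[e1 e2 e3]|[e1 e2 e3]|[e1 e2 e3]] := mnmx_cases eab.
  - have := S a (- k) a0 _ (kN _ aL) kN'; rewrite abszN -e1 => /(_ kl); rewrite /kap3; lra.
  - have := S b a b0 _ (kN _ bL) (kN _ aL); rewrite -e1 => /(_ al); rewrite /kap3; lra.
  - have := S (- k) b _ _ kN' (kN _ bL); rewrite oppr_eq0 abszN -e1 => /(_ k0 bl); rewrite /kap3; lra.
apply: (@le_trans _ _ (expR (2 * ln N) * (d * (h / d)))).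
  by rewrite [d * _]mulrC divfK ?gt_eqF//; apply: ler_wpM2r.
rewrite mulrA; apply: ler_pM => //; rewrite ?mulr_ge0 ?expR_ge0 ?invr_ge0 ?(ltW d0)//.
apply: (@le_trans _ _ (expR (2 * ln N) * (D * expR (- (5 / 2) * ln N)))).
  by rewrite ler_pM2l ?expR_gt0.
rewrite mulrCA; apply: ler_wpM2l; first lra.
apply: le_trans kapN; rewrite -expRD ler_expR; lra.
Qed.

Definition phase (alpha beta : R) (a b : int) : R :=
  let p (k : int) : R := alpha * k%:~R ^+ 5 - beta * k%:~R ^+ 3 in p (a + b) - p a - p b.

(** Phi = a b k (5 alpha (a^2 + a b + b^2) - 3 beta). The quadratic form is at least 3/4 L^2, and |a
    b k| >= l L^2 / 4 because two of the factors are at least L / 2. The threshold on L lets the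
    alpha term absorb the beta term. *)
Lemma phase_lower alpha beta : alpha != 0 -> exists N0 : R, 1 <= N0 /\
  exists c, [/\ 0 < c & forall a b k, a != 0 -> b != 0 -> k != 0 -> a + b = k ->
    N0 <= (mx3 a b k)%:R -> c / g3 R a b k <= `|phase alpha beta a b| ].
Proof.
move=> a0; have na0 : 0 < `|alpha| by rewrite normr_gt0.
exists (Num.max 1 (2 * `|beta| / `|alpha|)); split; first by rewrite le_max lexx.
exists (`|alpha| / 4); split; first by rewrite divr_gt0.
move=> a b k az bz kz e hN.
have [aL bL kL] := mx3_le a b k.
set L : R := (mx3 a b k)%:R in hN *.
have L1 : 1 <= L by apply: le_trans hN; rewrite le_max lexx.
have L2 : 2 * `|beta| <= L * `|alpha|.
  by rewrite -ler_pdivrMr//; apply: le_trans hN; rewrite le_max lexx orbT.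
have -> : phase alpha beta a b = a%:~R * b%:~R * k%:~R *
   (5 * alpha * (a%:~R ^+ 2 + a%:~R * b%:~R + b%:~R ^+ 2) - 3 * beta).
  by rewrite /phase -e rmorphD /=; ring.
have nab q : `|q%:~R : R| = ab R q by rewrite /ab -intr_norm pmulrn abszE.
set Q := a%:~R ^+ 2 + a%:~R * b%:~R + b%:~R ^+ 2.
have Q34 : 3 / 4 * L ^+ 2 <= Q.
  have sq q : (q%:~R : R) ^+ 2 = (ab R q) ^+ 2 by rewrite -nab real_normK// num_real.
  have [eL|eL|eL] : [\/ L = ab R a, L = ab R b | L = ab R k].
    have : (mx3 a b k = `|a| \/ mx3 a b k = `|b| \/ mx3 a b k = `|k|)%N by rewrite /mx3; lia.
    by case=> [h|[h|h]]; rewrite /L h; [constructor 1|constructor 2|constructor 3].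
  - by rewrite eL -sq /Q; have := sqr_ge0 (a%:~R + 2 * b%:~R : R); lra.
  - by rewrite eL -sq /Q; have := sqr_ge0 (2 * a%:~R + b%:~R : R); lra.
  - by rewrite eL -sq -e rmorphD /= /Q; have := sqr_ge0 (a%:~R - b%:~R : R); lra.
have inner : `|alpha| * L ^+ 2 <= `|5 * alpha * Q - 3 * beta|.
  have h1 : `|5 * alpha * Q| - `|3 * beta| <= `|5 * alpha * Q - 3 * beta| by exact: lerB_dist.
  apply: le_trans h1; rewrite !normrM (@ger0_norm _ 5)// (@ger0_norm _ 3)// (@ger0_norm _ Q); last first.
    by apply: le_trans Q34; rewrite mulr_ge0 ?sqr_ge0//; lra.
  have : `|alpha| * (3 / 4 * L ^+ 2) <= `|alpha| * Q by rewrite ler_pM2l.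
  have : L * `|alpha| <= `|alpha| * L ^+ 2 by rewrite mulrC ler_pM2l// expr2 ler_peMr//; lra.
  have : 0 <= `|alpha| * L ^+ 2 by rewrite mulr_ge0 ?sqr_ge0.
  lra.
have prod : (mn3 a b k)%:R * L ^+ 2 / 4 <= ab R a * ab R b * ab R k.
  rewrite ler_pdivrMr// /L /ab -!natrX -!natrM ler_nat.
  have [[-> e2 e3]|[-> e2 e3]|[-> e2 e3]] := mnmx_cases e.
  - have : (mx3 a b k * mx3 a b k <= (2 * `|b|) * (2 * `|k|))%N by apply: leq_mul.
    by rewrite -mulnn; move: (mx3 a b k * mx3 a b k)%N `|a|%N `|b|%N `|k|%N; clear; nia.
  - have : (mx3 a b k * mx3 a b k <= (2 * `|a|) * (2 * `|k|))%N by apply: leq_mul.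
    by rewrite -mulnn; move: (mx3 a b k * mx3 a b k)%N `|a|%N `|b|%N `|k|%N; clear; nia.
  - have : (mx3 a b k * mx3 a b k <= (2 * `|a|) * (2 * `|b|))%N by apply: leq_mul.
    by rewrite -mulnn; move: (mx3 a b k * mx3 a b k)%N `|a|%N `|b|%N `|k|%N; clear; nia.
rewrite !normrM !nab /g3 invrK -/L.
rewrite (_ : `|alpha| / 4 * ((mn3 a b k)%:R * L ^+ 4) = ((mn3 a b k)%:R * L ^+ 2 / 4) * (`|alpha| * L ^+ 2)); last by ring.
by apply: ler_pM; rewrite ?mulr_ge0 ?sqr_ge0 ?invr_ge0// ?ltW.
Qed.

End ker.

(** * Complex-valued functions of time and oscillatory integrals *)

Section prim.
Variable R : realType.
Implicit Types (f g F G : R -> R).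

Lemma dR_continuous F g : (forall t, is_derive t (1 : R) F (g t)) -> continuous F.
Proof. by move=> h t; apply/differentiable_continuous/derivable1_diffP; apply: ex_derive. Qed.

Lemma mvt_le F g (s t M : R) : s <= t -> (forall r, is_derive r (1 : R) F (g r)) ->
  (forall r, s <= r <= t -> `|g r| <= M) -> `|F t - F s| <= M * (t - s).
Proof.
move=> st dF hM; have [c hc ->] := @MVT_segment R F g s t st (fun x _ => dF x)
  (continuous_subspaceT (dR_continuous dF)).
by rewrite normrM (@ger0_norm _ (t - s)) ?subr_ge0// ler_wpM2r ?subr_ge0// hM// -in_itv.
Qed.

Lemma dR_eq F G g : (forall r, is_derive r (1 : R) F (g r)) ->
  (forall r, is_derive r (1 : R) G (g r)) -> F 0 = G 0 -> F = G.
Proof.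
move=> dF dG e; apply/funext => t.
have dH r : is_derive r (1 : R) (F - G) (0 : R).
  by have := is_deriveB (dF r) (dG r); rewrite subrr.
have h s s' : s <= s' -> (F - G) s' = (F - G) s.
  move=> ss; apply/eqP; rewrite -subr_eq0 -normr_le0.
  have := @mvt_le (F - G) (fun=> 0) s s' 0 ss dH; rewrite mul0r; apply=> r _.
  by rewrite normr0.
have e0 : (F - G) 0 = 0 by rewrite /GRing.add/= /GRing.opp/= e subrr.
have : (F - G) t = 0.
  by case: (leP 0 t) => ht; [rewrite (h _ _ ht)|rewrite -(h _ _ (ltW ht))].
by move=> /eqP; rewrite subr_eq0 => /eqP.
Qed.

(** An integral from a left endpoint a is a primitive only to the right of a. The difference of the
    integrals over [a, t] and [a, 0] does not depend on a, so the endpoint may move with t, as - |t|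
    - 1. *)
Lemma prim_exists g : continuous g ->
  exists F, F 0 = 0 /\ forall t, is_derive t (1 : R) F (g t).
Proof.
move=> cg; set mu := @lebesgue_measure R.
have ig a b : mu.-integrable `[a, b] (EFin \o g).
  apply: continuous_compact_integrable; first exact: segment_compact.
  exact: continuous_subspaceT.
pose Fa a t := \int[mu]_(r in `[a, t]) g r - \int[mu]_(r in `[a, 0]) g r.
have Faa a a' t : a' < a -> a < 0 -> a < t -> Fa a' t = Fa a t.
  move=> a'a a0 at_; rewrite /Fa.
  have E b : a < b -> \int[mu]_(r in `[a', b]) g r - \int[mu]_(r in `[a', a]) g r = \int[mu]_(r in `[a, b]) g r.
    move=> ab; rewrite Rintegral_itvB; [|exact: ig|by rewrite bnd_simp ltW|by rewrite bnd_simp ltW].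
    rewrite Rintegral_itv_obnd_cbnd//.
    by apply: integrableS (ig a b) => //; apply: subset_itvr; rewrite bnd_simp.
  by rewrite -(E t)// -(E 0)//; ring.
pose F t := Fa (- `|t| - 1) t.
exists F; split; first by rewrite /F /Fa subrr.
move=> t; set a := - `|t| - 3.
have a0 : a < 0 by rewrite /a; have := normr_ge0 t; lra.
have at_ : a < t by rewrite /a; have := lerNnormlW (lexx `|t|); lra.
have tt1 : t < t + 1 by lra.
have [d1 d2] := @continuous_FTC1_closed R g a t (t + 1) tt1 (ig _ _) at_ (cg t).
have dFa : is_derive t (1 : R) (Fa a) (g t).
  have h1 : is_derive t (1 : R) (fun x => \int[mu]_(r in `[a, x]) g r) (g t).
    by apply: DeriveDef; [exact: d1|rewrite -d2 derive1E].
  have := @is_deriveB _ _ _ _ (cst (\int[mu]_(r in `[a, 0]) g r)) t (1 : R) _ _ h1 (is_derive_cst _ _ _).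
  by rewrite subr0.
apply: near_eq_is_derive dFa; near=> x; rewrite /F.
have xt : `|x - t| < 1.
  by near: x; apply/nbhs_ballP; exists 1 => //= y; rewrite /ball /= distrC.
have h1 : `|x| <= `|t| + 1.
  by have := ler_normD (x - t) t; rewrite subrK; move/ltW in xt; lra.
have xn := lerNnormlW (lexx `|x|); have x0 := normr_ge0 x.
by apply: Faa; rewrite /a; lra.
Unshelve. all: by end_near. Qed.

(** A chosen primitive vanishing at 0. Time integrals are handled as its increments, through
    derivatives and the mean value inequality. *)
Definition primR g : R -> R :=
  xget (fun=> 0) [set F | F 0 = 0 /\ forall t, is_derive t (1 : R) F (g t)].

Lemma primRP g : continuous g -> primR g 0 = 0 /\ forall t, is_derive t (1 : R) (primR g) (g t).
Proof. by move=> /prim_exists[F hF]; exact: (@xgetPex _ _ [set F | F 0 = 0 /\ _] (ex_intro _ F hF)). Qed.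

End prim.

(** * Derivatives and primitives of complex-valued functions, component by component *)

Section cplx.
Variable R : realType.
Notation C := R[i].
Notation Re := (@complex.Re R).
Notation Im := (@complex.Im R).
Implicit Types (z w : C) (f g F G : R -> C).

Definition nc (z : C) : R := Normc.normc z.

Lemma nc_ge0 z : 0 <= nc z. Proof. by case: z => a b; exact: sqrtr_ge0. Qed.
Lemma nc0 : nc 0 = 0. Proof. exact: Normc.normc0. Qed.
Lemma ncM z w : nc (z * w) = nc z * nc w. Proof. exact: Normc.normcM. Qed.
Lemma ncD z w : nc (z + w) <= nc z + nc w. Proof. exact: le_normcD. Qed.
Lemma ncN z : nc (- z) = nc z. Proof. exact: normcN. Qed.
Lemma ncB z w : nc (z - w) <= nc z + nc w. Proof. by rewrite -(ncN w); exact: ncD. Qed.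
Lemma ncBC z w : nc (z - w) = nc (w - z). Proof. by rewrite -ncN opprB. Qed.
Lemma nc_eq0 z : nc z = 0 -> z = 0. Proof. exact: Normc.eq0_normc. Qed.
Lemma nc_conj z : nc (conjc z) = nc z. Proof. by case: z => a b; rewrite /nc /= sqrrN. Qed.
Lemma nc_real (x : R) : nc (x%:C)%C = `|x|. Proof. by rewrite /nc /= expr0n addr0 sqrtr_sqr. Qed.
Lemma nc_i (x : R) : nc (0 +i* x)%C = `|x|. Proof. by rewrite /nc /= expr0n add0r sqrtr_sqr. Qed.

Lemma Re_le z : `|Re z| <= nc z.
Proof. by case: z => a b; rewrite /nc /= -sqrtr_sqr ler_wsqrtr// lerDl sqr_ge0. Qed.
Lemma Im_le z : `|Im z| <= nc z.
Proof. by case: z => a b; rewrite /nc /= -sqrtr_sqr ler_wsqrtr// lerDr sqr_ge0. Qed.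
Lemma nc_le z : nc z <= `|Re z| + `|Im z|.
Proof.
case: z => a b; rewrite -[leRHS]ger0_norm ?addr_ge0// -sqrtr_sqr ler_wsqrtr//= sqrrD.
by rewrite !real_normK ?num_real// addrAC lerDl mulrn_wge0 ?mulr_ge0.
Qed.

Lemma ReD z w : Re (z + w) = Re z + Re w. Proof. by case: z; case: w. Qed.
Lemma ImD z w : Im (z + w) = Im z + Im w. Proof. by case: z; case: w. Qed.
Lemma ReN z : Re (- z) = - Re z. Proof. by case: z. Qed.
Lemma ImN z : Im (- z) = - Im z. Proof. by case: z. Qed.
Lemma cReM z w : Re (z * w) = Re z * Re w - Im z * Im w. Proof. by case: z; case: w. Qed.
Lemma cImM z w : Im (z * w) = Re z * Im w + Im z * Re w.
Proof. by case: z => a b; case: w => c d. Qed.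
Lemma Re_sum (I : Type) (r : seq I) (P : pred I) (h : I -> C) :
  Re (\sum_(i <- r | P i) h i) = \sum_(i <- r | P i) Re (h i).
Proof. by elim/big_rec2: _ => // i x y _ <-; rewrite ReD. Qed.
Lemma nc_sum (I : Type) (r : seq I) (h : I -> C) :
  nc (\sum_(i <- r) h i) <= \sum_(i <- r) nc (h i).
Proof.
elim/big_rec2: _ => [|i x y _ h1]; first by rewrite nc0.
by apply: le_trans (ncD _ _) _; rewrite lerD2l.
Qed.
Lemma cplx_eq z w : Re z = Re w -> Im z = Im w -> z = w.
Proof. by case: z => a b; case: w => c d /= -> ->. Qed.
Lemma sqr_nc z : nc z ^+ 2 = Re z ^+ 2 + Im z ^+ 2.
Proof. by case: z => a b; rewrite /nc /= sqr_sqrtr// addr_ge0 ?sqr_ge0. Qed.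

Definition dC F f := forall t, is_derive t (1 : R) (Re \o F) (Re (f t)) /\
                               is_derive t (1 : R) (Im \o F) (Im (f t)).
Definition cC f := continuous (Re \o f) /\ continuous (Im \o f).

Lemma dC_cont F f : dC F f -> cC F.
Proof. by move=> h; split; apply: (@dR_continuous R) => t; have [] := h t; eauto. Qed.

(** The factor 2 is the price of estimating real and imaginary parts apart. *)
Lemma dC_mvt F f (s t M : R) : s <= t -> dC F f ->
  (forall r, s <= r <= t -> nc (f r) <= M) -> nc (F t - F s) <= 2 * M * (t - s).
Proof.
move=> st dF hM; apply: le_trans (nc_le _) _; rewrite ReD ImD ReN ImN.
have h1 := @mvt_le R (Re \o F) (Re \o f) s t M st (fun r => (dF r).1)
  (fun r hr => le_trans (Re_le _) (hM r hr)).
have h2 := @mvt_le R (Im \o F) (Im \o f) s t M st (fun r => (dF r).2)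
  (fun r hr => le_trans (Im_le _) (hM r hr)).
by rewrite /= in h1 h2; lra.
Qed.

Lemma dC_eq F G f : dC F f -> dC G f -> F 0 = G 0 -> F = G.
Proof.
move=> dF dG e; apply/funext => t; apply: cplx_eq.
  exact: (congr1 (fun h => h t) (@dR_eq R (Re \o F) (Re \o G) (Re \o f) (fun r => (dF r).1) (fun r => (dG r).1) (congr1 (@complex.Re R) e))).
exact: (congr1 (fun h => h t) (@dR_eq R (Im \o F) (Im \o G) (Im \o f) (fun r => (dF r).2) (fun r => (dG r).2) (congr1 (@complex.Im R) e))).
Qed.

Lemma dCD F G f g : dC F f -> dC G g -> dC (fun t => F t + G t) (fun t => f t + g t).
Proof.
move=> h1 h2 t; have [a1 b1] := h1 t; have [a2 b2] := h2 t; split.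
  have -> : Re \o (fun t => F t + G t) = (Re \o F) + (Re \o G) by apply/funext => r /=; rewrite ReD.
  by rewrite ReD; exact: is_deriveD.
have -> : Im \o (fun t => F t + G t) = (Im \o F) + (Im \o G) by apply/funext => r /=; rewrite ImD.
by rewrite ImD; exact: is_deriveD.
Qed.

Lemma dC_cst z : dC (fun=> z) (fun=> 0).
Proof. by move=> t; split; exact: is_derive_cst. Qed.

Lemma dCM F G f g : dC F f -> dC G g -> dC (fun t => F t * G t) (fun t => f t * G t + F t * g t).
Proof.
move=> h1 h2 t; have [a1 b1] := h1 t; have [a2 b2] := h2 t; split.
  have -> : Re \o (fun t => F t * G t) = (Re \o F) * (Re \o G) - (Im \o F) * (Im \o G).
    by apply/funext => r /=; rewrite cReM.
  have := is_deriveB (is_deriveM a1 a2) (is_deriveM b1 b2).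
  by move=> hh; apply: (@is_derive_eq _ _ _ _ _ _ _ _ hh); rewrite /GRing.scale/= ReD !cReM /=; ring.
have -> : Im \o (fun t => F t * G t) = (Re \o F) * (Im \o G) + (Im \o F) * (Re \o G).
  by apply/funext => r /=; rewrite cImM.
have := is_deriveD (is_deriveM a1 b2) (is_deriveM b1 a2).
by move=> hh; apply: (@is_derive_eq _ _ _ _ _ _ _ _ hh); rewrite /GRing.scale/= ImD !cImM /=; ring.
Qed.

Lemma dCZ z F f : dC F f -> dC (fun t => z * F t) (fun t => z * f t).
Proof.
move=> h; have := dCM (dC_cst z) h => h' t; have := h' t.
by rewrite mul0r add0r.
Qed.

Lemma dC_sum (I : Type) (r : seq I) (F f : I -> R -> C) : (forall i, dC (F i) (f i)) ->
  dC (fun t => \sum_(i <- r) F i t) (fun t => \sum_(i <- r) f i t).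
Proof.
move=> h; elim: r => [|i r IH].
  have -> : (fun t => \sum_(i <- [::]) F i t) = fun=> 0 by apply/funext => t; rewrite big_nil.
  by move=> t; rewrite big_nil; exact: dC_cst.
have -> : (fun t => \sum_(j <- i :: r) F j t) = fun t => F i t + \sum_(j <- r) F j t.
  by apply/funext => t; rewrite big_cons.
by move=> t; rewrite big_cons; exact: (dCD (h i) IH).
Qed.

Definition cprim f : R -> C := fun t => (primR (Re \o f) t +i* primR (Im \o f) t)%C.

Lemma cprimP f : cC f -> cprim f 0 = 0 /\ dC (cprim f) f.
Proof.
move=> [c1 c2]; have [a1 b1] := primRP c1; have [a2 b2] := primRP c2.
by split; [rewrite /cprim a1 a2|move=> t; split].
Qed.

Lemma cprim_uniq F f : cC f -> dC F f -> F 0 = 0 -> cprim f = F.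
Proof. by move=> cf dF F0; have [p0 dp] := cprimP cf; apply: dC_eq dp dF _; rewrite p0. Qed.

Definition ce (x : R) : C := (cos x +i* sin x)%C.

Lemma nc_ce x : nc (ce x) = 1.
Proof. by rewrite /nc /= cos2Dsin2 sqrtr1. Qed.

Lemma ceD x y : ce (x + y) = ce x * ce y.
Proof. by apply: cplx_eq; rewrite ?cReM ?cImM /= ?cosD ?sinD; ring. Qed.

Lemma ce0 : ce 0 = 1. Proof. by rewrite /ce cos0 sin0. Qed.

Lemma ceN x : ce (- x) = conjc (ce x).
Proof. by rewrite /ce cosN sinN. Qed.

Lemma dC_ce (w : R) : dC (fun t => ce (w * t)) (fun t => (0 +i* w)%C * ce (w * t)).
Proof.
move=> t; split.
  have := is_derive_trig 1 0 w t.
  have -> : (fun x => 1 * cos (w * x) + 0 * sin (w * x)) = Re \o (fun t => ce (w * t)).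
    by apply/funext => x /=; rewrite mul1r mul0r addr0.
  by move=> hh; apply: (@is_derive_eq _ _ _ _ _ _ _ _ hh); rewrite cReM /=; ring.
have := is_derive_trig 0 1 w t.
have -> : (fun x => 0 * cos (w * x) + 1 * sin (w * x)) = Im \o (fun t => ce (w * t)).
  by apply/funext => x /=; rewrite mul1r mul0r add0r.
by move=> hh; apply: (@is_derive_eq _ _ _ _ _ _ _ _ hh); rewrite cImM /=; ring.
Qed.

Lemma cC_cst z : cC (fun=> z).
Proof. by split; exact: cst_continuous. Qed.

Lemma cCD f g : cC f -> cC g -> cC (fun t => f t + g t).
Proof.
move=> [a1 b1] [a2 b2]; split => t.
  have -> : Re \o (fun t => f t + g t) = (Re \o f) \+ (Re \o g) by apply/funext => r /=; rewrite ReD.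
  by apply: continuousD; [exact: a1|exact: a2].
have -> : Im \o (fun t => f t + g t) = (Im \o f) \+ (Im \o g) by apply/funext => r /=; rewrite ImD.
by apply: continuousD; [exact: b1|exact: b2].
Qed.

Lemma cCM f g : cC f -> cC g -> cC (fun t => f t * g t).
Proof.
move=> [a1 b1] [a2 b2]; split => t.
  have -> : Re \o (fun t => f t * g t) = fun r => (Re \o f) r * (Re \o g) r - (Im \o f) r * (Im \o g) r.
    by apply/funext => r /=; rewrite cReM.
  by apply: (@cvgB _ R^o); apply: cvgM; [exact: a1|exact: a2|exact: b1|exact: b2].
have -> : Im \o (fun t => f t * g t) = fun r => (Re \o f) r * (Im \o g) r + (Im \o f) r * (Re \o g) r.
  by apply/funext => r /=; rewrite cImM.
by apply: (@cvgD _ R^o); apply: cvgM; [exact: a1|exact: b2|exact: b1|exact: a2].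
Qed.

Lemma cC_sum (I : Type) (r : seq I) (f : I -> R -> C) : (forall i, cC (f i)) ->
  cC (fun t => \sum_(i <- r) f i t).
Proof.
move=> h; elim: r => [|i r IH].
  have -> : (fun t => \sum_(i <- [::]) f i t) = fun=> 0 by apply/funext => t; rewrite big_nil.
  exact: cC_cst.
have -> : (fun t => \sum_(j <- i :: r) f j t) = fun t => f i t + \sum_(j <- r) f j t.
  by apply/funext => t; rewrite big_cons.
exact: cCD.
Qed.

Lemma cC_ce (w : R) : cC (fun t => ce (w * t)).
Proof. exact: dC_cont (dC_ce w). Qed.

End cplx.

(** * Oscillatory integrals cut into periods *)

Section osc.
Variable R : realType.
Notation C := R[i].
Implicit Types (f E : R -> C) (Phi A W s t r : R).

Definition per Phi : R := 2 * pi / `|Phi|.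

Lemma per_gt0 Phi : Phi != 0 -> 0 < per Phi.
Proof. by move=> h; rewrite /per divr_gt0 ?normr_gt0// mulr_gt0// pi_gt0. Qed.

Lemma ce_per Phi r : Phi != 0 -> ce (Phi * (r + per Phi)) = ce (Phi * r).
Proof.
move=> h; rewrite mulrDr ceD.
suff -> : ce (Phi * per Phi) = 1 by rewrite mulr1.
rewrite /per; have [p|n] := leP 0 Phi.
  rewrite ger0_norm// [Phi * _]mulrC divfK ?gt_eqF//; last by rewrite lt_def h.
  by rewrite (_ : 2 * pi = pi *+ 2) ?mulr_natl// /ce cos2pi sin2pi.
rewrite ltr0_norm// (_ : Phi * (2 * pi / - Phi) = - (pi *+ 2)); last first.
  by rewrite -[pi *+ 2]mulr_natl; field.
by rewrite ceN /ce cos2pi sin2pi /= oppr0.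
Qed.

Lemma osc_one Phi W s f E : Phi != 0 -> dC E (fun r => ce (Phi * r) * f r) ->
  (forall r, s <= r <= s + per Phi -> nc (f r - f s) <= W) ->
  nc (E (s + per Phi) - E s) <= 2 * W * per Phi.
Proof.
move=> h dE hW; have P0 := per_gt0 h.
pose z : C := f s / (0 +i* Phi)%C.
have dz := dCZ z (dC_ce Phi).
have dN := dCZ (-1) dz.
have dH := dCD dE dN.
have := @dC_mvt R _ _ s (s + per Phi) W _ dH.
rewrite lerDl ltW// => /(_ isT) key.
have iP : (0 +i* Phi)%C != 0 :> C by rewrite eq_complex /= eqxx.
have e : E (s + per Phi) - E s = E (s + per Phi) + -1 * (z * ce (Phi * (s + per Phi))) - (E s + -1 * (z * ce (Phi * s))).
  by rewrite ce_per//; ring.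
have e2 : s + per Phi - s = per Phi by ring.
rewrite e -[X in _ <= _ * X]e2; apply: key => r hr.
rewrite (_ : _ + _ = ce (Phi * r) * (f r - f s)) ?ncM ?nc_ce ?mul1r ?hW//.
by rewrite /z; field.
Qed.

Lemma osc_periods Phi W s t f E (n : nat) : Phi != 0 -> dC E (fun r => ce (Phi * r) * f r) ->
  (forall r r', s <= r <= t -> s <= r' <= t -> `|r - r'| <= per Phi -> nc (f r - f r') <= W) ->
  s + per Phi *+ n <= t -> nc (E (s + per Phi *+ n) - E s) <= 2 * W * (per Phi *+ n).
Proof.
move=> h dE hW; have P0 := per_gt0 h; elim: n => [|n IH] hn.
  by rewrite mulr0n addr0 subrr nc0 mulr0.
have hn' : s + per Phi *+ n <= t by apply: le_trans hn; rewrite lerD2l mulrS lerDr ltW.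
have n0 : 0 <= per Phi *+ n by rewrite mulrn_wge0 ?ltW.
rewrite mulrSr addrA; rewrite mulrSr addrA in hn.
have -> : E (s + per Phi *+ n + per Phi) - E s =
  (E (s + per Phi *+ n + per Phi) - E (s + per Phi *+ n)) + (E (s + per Phi *+ n) - E s) by ring.
apply: le_trans (ncD _ _) _; rewrite mulrDr addrC; apply: lerD; first exact: IH.
apply: osc_one => // r /andP[r1 r2]; apply: hW.
- by apply/andP; split; lra.
- by apply/andP; split; lra.
- by rewrite ger0_norm; lra.
Qed.

(** As many whole periods as fit, each contributing only the oscillation [W] of the amplitude, then
    a remainder shorter than a period, bounded through the size [A]. *)
Lemma osc Phi A W s t f E : Phi != 0 -> dC E (fun r => ce (Phi * r) * f r) -> s <= t -> 0 <= W ->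
  (forall r, s <= r <= t -> nc (f r) <= A) ->
  (forall r r', s <= r <= t -> s <= r' <= t -> `|r - r'| <= per Phi -> nc (f r - f r') <= W) ->
  nc (E t - E s) <= 2 * A * per Phi + 2 * W * (t - s).
Proof.
move=> h dE st W0 hA hW; have P0 := per_gt0 h.
have x0 : 0 <= (t - s) / per Phi by rewrite divr_ge0 ?subr_ge0// ltW.
have /andP[n1 n2] := truncn_itv x0; set n := Num.truncn _ in n1 n2.
rewrite ler_pdivlMr// in n1; rewrite ltr_pdivrMr// in n2.
rewrite mulr_natl in n1; rewrite mulr_natl mulrSr in n2.
have n0 : 0 <= per Phi *+ n by rewrite mulrn_wge0 ?ltW.
have A0 : 0 <= A by apply: le_trans (hA s _); [exact: nc_ge0|rewrite lexx].
have -> : E t - E s = (E t - E (s + per Phi *+ n)) + (E (s + per Phi *+ n) - E s) by ring.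
apply: le_trans (ncD _ _) _; apply: lerD.
  apply: le_trans (@dC_mvt R _ _ (s + per Phi *+ n) t A _ dE _) _; first lra.
    by move=> r /andP[r1 r2]; rewrite ncM nc_ce mul1r hA//; apply/andP; split; lra.
  by apply: ler_wpM2l; [rewrite mulr_ge0|lra].
apply: le_trans (osc_periods h dE hW _) _; first lra.
by apply: ler_wpM2l; [rewrite mulr_ge0|].
Qed.

Lemma osc_triv Phi A s t f E : dC E (fun r => ce (Phi * r) * f r) -> s <= t ->
  (forall r, s <= r <= t -> nc (f r) <= A) -> nc (E t - E s) <= 2 * A * (t - s).
Proof. by move=> dE st hA; apply: dC_mvt dE _ => // r hr; rewrite ncM nc_ce mul1r hA. Qed.

End osc.

(** * The gauge on time-dependent Fourier coefficients *)

Section gauge.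
Variable R : realType.
Notation C := R[i].
Implicit Types (f g : R -> C) (A c e : R) (o : R -> R).

(** One constant for both the size and the modulus of continuity relative to [o]: a single number
    per frequency then measures a field. *)
Definition Hol A o f := (forall t, nc (f t) <= A) /\
  (forall t s, nc (f t - f s) <= A * o `|t - s|).

Definition gpos o := (forall h, 0 <= h -> 0 <= o h).

Lemma Hol_ge0 A o f : Hol A o f -> 0 <= A.
Proof. by move=> [h _]; apply: le_trans (h 0); exact: nc_ge0. Qed.

Lemma Hol_le A B o f : gpos o -> A <= B -> Hol A o f -> Hol B o f.
Proof.
move=> go AB [h1 h2]; split=> [t|t s]; first exact: le_trans AB.
by apply: (le_trans (h2 t s)); apply: ler_wpM2r => //; exact: go.
Qed.

Lemma HolD A B o f g : Hol A o f -> Hol B o g -> Hol (A + B) o (fun t => f t + g t).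
Proof.
move=> [a1 a2] [b1 b2]; split=> [t|t s].
  by apply: le_trans (ncD _ _) _; exact: lerD.
rewrite mulrDl (_ : f t + g t - (f s + g s) = (f t - f s) + (g t - g s)); last by ring.
by apply: le_trans (ncD _ _) _; exact: lerD.
Qed.

Lemma HolZ A o f (z : C) : Hol A o f -> Hol (nc z * A) o (fun t => z * f t).
Proof.
move=> [a1 a2]; split=> [t|t s]; first by rewrite ncM ler_wpM2l ?nc_ge0.
by rewrite -mulrBr ncM -mulrA ler_wpM2l ?nc_ge0.
Qed.

Lemma Hol_cst o (z : C) : gpos o -> Hol (nc z) o (fun=> z).
Proof.
by move=> go; split=> // t s; rewrite subrr nc0 mulr_ge0 ?nc_ge0// go.
Qed.

Definition nu o f : R := inf [set A | Hol A o f].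

(** The infimum is attained, each of the defining inequalities being closed in the constant. *)
Lemma nu_Hol A o f : gpos o -> Hol A o f -> Hol (nu o f) o f /\ 0 <= nu o f <= A.
Proof.
move=> go h; have hl : has_inf [set A | Hol A o f].
  by split; [exists A|exists 0 => B /Hol_ge0].
split; last first.
  apply/andP; split; first by apply: lb_le_inf; [exists A|move=> B /Hol_ge0].
  by apply: ge_inf => //; case: hl.
split=> [t|t s]; first by apply: lb_le_inf; [exists A|move=> B [h1 _]].
have o0 : 0 <= o `|t - s| by apply: go.
have [oz|on] := eqVneq (o `|t - s|) 0.
  by have [_ h2] := h; have := h2 t s; rewrite oz !mulr0.
have op : 0 < o `|t - s| by rewrite lt_def on.
rewrite -ler_pdivrMr//; apply: lb_le_inf; first by exists A.
by move=> B [_ h2]; rewrite ler_pdivrMr.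
Qed.

Implicit Types (w : int -> R) (O : int -> R -> R) (v u : int -> R -> C).

(** A relation, [v] has gauge at most [c], rather than a norm: it applies to arbitrary fields, and
    infima are postponed to the construction of the Banach space. *)
Definition bd w O v c := 0 <= c /\ exists2 A : int -> R,
  (forall k, 0 <= A k /\ Hol (A k) (O k) (v k)) & ell2 (fun k => w k * A k) c.

Variables (w : int -> R) (O : int -> R -> R).
Hypothesis w0 : forall k, 0 < w k.
Hypothesis O0 : forall k, gpos (O k).

Definition NU v k := nu (O k) (v k).

Lemma bd_nu v c : bd w O v c -> [/\ forall k, 0 <= NU v k,
  forall k, Hol (NU v k) (O k) (v k) & ell2 (fun k => w k * NU v k) c].
Proof.
move=> [c0 [A hA eA]].
have h k : Hol (NU v k) (O k) (v k) /\ 0 <= NU v k <= A k.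
  by have [_ hk] := hA k; exact: nu_Hol.
split=> [k|k|]; [by have [_ /andP[]] := h k|by have [] := h k|].
apply: ell2_le eA; last by rewrite c0 lexx.
by move=> k; have [_ /andP[h1 h2]] := h k; rewrite mulr_ge0 ?(ltW (w0 k))//= ler_pM2l.
Qed.

Lemma bd_le v c e : c <= e -> bd w O v c -> bd w O v e.
Proof.
move=> ce [c0 [A hA eA]]; split; first exact: le_trans ce.
exists A => //; apply: ell2_le eA; last by rewrite c0.
by move=> k; have [h1 _] := hA k; rewrite lexx andbT mulr_ge0// ltW.
Qed.

Lemma bdD u v c e : bd w O u c -> bd w O v e -> bd w O (fun k t => u k t + v k t) (c + e).
Proof.
move=> [c0 [A hA eA]] [e0 [B hB eB]]; split; first exact: addr_ge0.
exists (fun k => A k + B k) => [k|].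
  have [a1 a2] := hA k; have [b1 b2] := hB k; split; [exact: addr_ge0|exact: HolD].
have := ell2D c0 e0 eA eB; apply: ell2_le; last by rewrite addr_ge0// lexx.
move=> k; have [a1 a2] := hA k; have [b1 b2] := hB k.
by rewrite mulrDr lexx andbT addr_ge0// mulr_ge0// ltW.
Qed.

Lemma bdZ v c (z : C) : bd w O v c -> bd w O (fun k t => z * v k t) (nc z * c).
Proof.
move=> [c0 [A hA eA]]; split; first by rewrite mulr_ge0 ?nc_ge0.
exists (fun k => nc z * A k) => [k|].
  by have [a1 a2] := hA k; split; [rewrite mulr_ge0 ?nc_ge0|exact: HolZ].
have := ell2Z (nc z) eA; apply: ell2_le; last by rewrite mulr_ge0 ?nc_ge0//= lexx.
by move=> k; have [a1 a2] := hA k; rewrite mulrCA lexx andbT !mulr_ge0 ?nc_ge0// ltW.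
Qed.

Lemma bd_ext u v c : (forall k t, u k t = v k t) -> bd w O u c -> bd w O v c.
Proof. by move=> h; rewrite (_ : u = v)//; apply/funext => k; apply/funext => t; exact: h. Qed.

Lemma bdB u v c e : bd w O u c -> bd w O v e -> bd w O (fun k t => u k t - v k t) (c + e).
Proof.
move=> h1 /(bdZ (-1)); rewrite ncN [nc 1]Normc.normc1 mul1r => h2.
by apply: bd_ext (bdD h1 h2) => k t; rewrite mulN1r.
Qed.

Lemma bdBC u v c : bd w O (fun k t => u k t - v k t) c -> bd w O (fun k t => v k t - u k t) c.
Proof.
move=> /(bdZ (-1)); rewrite ncN [nc 1]Normc.normc1 mul1r; apply: bd_ext => k t; ring.
Qed.

Lemma bd0 c : 0 <= c -> bd w O (fun _ _ => 0) c.
Proof.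
move=> c0; split=> //; exists (fun=> 0) => [k|M].
  by split=> //; rewrite -nc0; apply: Hol_cst.
by rewrite big1 ?sqr_ge0// => k _; rewrite mulr0 expr0n.
Qed.

Lemma bd_pt v c k t : bd w O v c -> nc (v k t) <= c / w k.
Proof.
move=> [c0 [A hA eA]]; have [a1 [a2 _]] := hA k.
apply: le_trans (a2 t) _; rewrite ler_pdivlMr// mulrC.
by have := ell2_pt k c0 eA; rewrite ger0_norm// mulr_ge0// ltW.
Qed.

Lemma bd_HolM v c k : bd w O v c -> Hol (c / w k) (O k) (v k).
Proof.
move=> [c0 [A hA eA]]; have [a1 a2] := hA k; apply: (Hol_le _ _ a2); first exact: O0.
rewrite ler_pdivlMr// mulrC.
by have := ell2_pt k c0 eA; rewrite ger0_norm// mulr_ge0// ltW.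
Qed.

Definition proj (M : nat) v : int -> R -> C := fun k t => if (`|k| <= M)%N then v k t else 0.

Lemma projE M v k : proj M v k = if (`|k| <= M)%N then v k else fun=> 0.
Proof. by apply/funext => t; rewrite /proj; case: ifP. Qed.

Lemma bd_proj v c M : bd w O v c -> bd w O (proj M v) c.
Proof.
move=> [c0 [A hA eA]]; split=> //; exists A => // k; have [a1 a2] := hA k; split=> //.
rewrite projE; case: ifP => // _; apply: (@Hol_le 0); [exact: O0|exact: a1|].
by rewrite -nc0; exact: Hol_cst.
Qed.

(** The partial square sums come within e^2 of their supremum at some M; the modes beyond M carry no
    more than that. *)
Lemma bd_tail v c e : bd w O v c -> 0 < e -> exists M, forall M', (M <= M')%N ->
  bd w O (fun k t => v k t - proj M' v k t) e.
Proof.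
move=> [c0 [A hA eA]] e0.
pose S M := \sum_(k <- ZM M) (w k * A k) ^+ 2.
have hS : has_sup [set S M | M in [set: nat]].
  by split; [exists (S 0%N); exists 0%N|exists (c ^+ 2) => _ [M _ <-]; exact: eA].
have e2 : 0 < e ^+ 2 by rewrite exprn_gt0.
have [_ [M _ <-] hM] := sup_adherent e2 hS.
exists M => M' MM'; split; first exact: ltW.
exists (fun k => if (`|k| <= M')%N then 0 else A k) => [k|P].
  have [a1 a2] := hA k; rewrite projE; case: ifP => _; last first.
    by split=> //; rewrite (_ : (fun t => v k t - 0) = v k)//; apply/funext => t; rewrite subr0.
  split=> //; rewrite (_ : (fun t => v k t - v k t) = fun=> 0); last by apply/funext => t; rewrite subrr.
  by rewrite -nc0; apply: Hol_cst.
pose Q := maxn P M.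
have hQ : S Q <= sup [set S M | M in [set: nat]] by apply: ub_le_sup; [case: hS|exists Q].
apply: (@le_trans _ _ (S Q - S M)); last by lra.
apply: (@le_trans _ _ (\sum_(k <- ZM Q) (w k * (if (`|k| <= M')%N then 0 else A k)) ^+ 2)).
  by apply: ler_sum_ZM; [exact: leq_maxl|move=> k; rewrite sqr_ge0].
rewrite lerBrDr.
have -> : S M = \sum_(k <- ZM Q) (if (`|k| <= M)%N then (w k * A k) ^+ 2 else 0).
  rewrite -big_mkcond -big_filter; apply: perm_big; apply: uniq_perm; rewrite ?filter_uniq ?uniq_ZM//.
  move=> k; rewrite mem_filter !mem_ZM; apply/idP/andP => [h|[]//]; split=> //.
  by rewrite (leq_trans h)// leq_maxr.
rewrite -big_split; apply: ler_sum => k _ /=.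
case: (leqP `|k| M) => h; first by rewrite (leq_trans h MM') mulr0 expr0n add0r.
by case: ifP => _; rewrite ?addr0// mulr0 expr0n sqr_ge0.
Qed.

Lemma minkowski (I : Type) (r : seq I) (a b : I -> R) :
  Num.sqrt (\sum_(i <- r) (a i + b i) ^+ 2) <=
  Num.sqrt (\sum_(i <- r) a i ^+ 2) + Num.sqrt (\sum_(i <- r) b i ^+ 2).
Proof.
have h := cauchy_schwarz_sqrt r a b.
set X := Num.sqrt (\sum_(i <- r) a i ^+ 2) in h *; set Y := Num.sqrt (\sum_(i <- r) b i ^+ 2) in h *.
have X0 : 0 <= X by rewrite sqrtr_ge0. have Y0 : 0 <= Y by rewrite sqrtr_ge0.
rewrite -[leRHS]ger0_norm ?addr_ge0// -sqrtr_sqr ler_wsqrtr//.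
have -> : \sum_(i <- r) (a i + b i) ^+ 2 =
  \sum_(i <- r) a i ^+ 2 + 2 * (\sum_(i <- r) a i * b i) + \sum_(i <- r) b i ^+ 2.
  by rewrite mulr_sumr -!big_split /=; apply: eq_bigr => i _; ring.
have -> : \sum_(i <- r) a i ^+ 2 = X ^+ 2 by rewrite sqr_sqrtr// sumr_ge0// => i _; rewrite sqr_ge0.
have -> : \sum_(i <- r) b i ^+ 2 = Y ^+ 2 by rewrite sqr_sqrtr// sumr_ge0// => i _; rewrite sqr_ge0.
by nra.
Qed.

Lemma Re_dist (z z' : C) : `|complex.Re z - complex.Re z'| <= nc (z - z').
Proof. by have := Re_le (z - z'); rewrite ReD ReN. Qed.

Lemma Im_dist (z z' : C) : `|complex.Im z - complex.Im z'| <= nc (z - z').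
Proof. by have := Im_le (z - z'); rewrite ImD ImN. Qed.

(* No convergence is needed here: a sequence with oscillation bounds has a
   point within all of them. *)
Lemma real_seq_center (x : nat -> R) (e : nat -> R) :
  (forall n m, (n <= m)%N -> `|x m - x n| <= e n) -> (forall n, 0 <= e n) ->
  exists l, forall n, `|x n - l| <= e n.
Proof.
move=> h e0.
have h2 n m : x n - e n <= x m + e m.
  have [nm|/ltnW mn] := leqP n m.
    by have := h n m nm; rewrite ler_norml => /andP[h1 _]; have := e0 m; lra.
  by have := h m n mn; rewrite ler_norml => /andP[_ h1]; have := e0 n; lra.
exists (sup [set x n - e n | n in [set: nat]]) => n.
have hs : has_sup [set x n - e n | n in [set: nat]].
  by split; [exists (x 0%N - e 0%N); exists 0%N|exists (x 0%N + e 0%N) => _ [m _ <-]].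
have h3 : x n - e n <= sup [set x n - e n | n in [set: nat]].
  by apply: ub_le_sup; [case: hs|exists n].
have h4 : sup [set x n - e n | n in [set: nat]] <= x n + e n.
  by apply: ge_sup; [case: hs|move=> _ [m _ <-]].
by rewrite ler_norml; apply/andP; split; lra.
Qed.

(** The limit is found for each mode and time by [real_seq_center]. On a finite range of modes the
    best constant of u - v n exceeds that of v m - v n by at most [e m] / w k; letting m grow bounds
    every partial square sum. *)
Lemma bd_complete (v : nat -> int -> R -> C) (e : nat -> R) :
  (forall n m, (n <= m)%N -> bd w O (fun k t => v m k t - v n k t) (e n)) ->
  (forall d, 0 < d -> exists n0, forall n, (n0 <= n)%N -> e n <= d) ->
  exists u, forall n, bd w O (fun k t => u k t - v n k t) (e n).
Proof.
move=> h he.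
have e0 n : 0 <= e n by have [] := h n n (leqnn n).
have hp k t : exists z : C, forall n, nc (v n k t - z) <= 2 * (e n / w k).
  have q n m (nm : (n <= m)%N) := @bd_pt _ _ k t (h n m nm).
  have [l1 h1] := @real_seq_center (fun n => complex.Re (v n k t)) (fun n => e n / w k)
    (fun n m nm => le_trans (Re_dist _ _) (q n m nm))
    (fun n => divr_ge0 (e0 n) (ltW (w0 k))).
  have [l2 h2] := @real_seq_center (fun n => complex.Im (v n k t)) (fun n => e n / w k)
    (fun n m nm => le_trans (Im_dist _ _) (q n m nm))
    (fun n => divr_ge0 (e0 n) (ltW (w0 k))).
  exists (l1 +i* l2)%C => n; apply: le_trans (nc_le _) _; rewrite ReD ImD ReN ImN /=.
  by have := h1 n; have := h2 n; lra.
pose u k t := projT1 (cid (hp k t)).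
have hu k t n : nc (v n k t - u k t) <= 2 * (e n / w k) by rewrite /u; case: cid.
have lim0 (x y : R) : (forall n d, 0 < d -> (forall k, e n / w k <= d / w k) -> x <= y + d) -> x <= y.
  move=> hx; apply/ler_addgt0Pr => d d0; have [n0 hn] := he _ d0.
  by apply: (hx n0) => // k; rewrite ler_pM2r ?invr_gt0//; exact: hn.
have holu k n : Hol (e n / w k) (O k) (fun t => u k t - v n k t).
  split=> [t|t s].
    apply/ler_addgt0Pr => d d0.
    have dw : 0 < d * w k / 2 by rewrite !mulr_gt0 ?invr_gt0.
    have [n0 hn] := he _ dw.
    pose m := maxn n0 n.
    have -> : u k t - v n k t = - (v m k t - u k t) + (v m k t - v n k t) by ring.
    apply: le_trans (ncD _ _) _; rewrite ncN addrC; apply: lerD.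
      exact: (@bd_pt _ _ k t (h n m (leq_maxr _ _))).
    apply: le_trans (hu k t m) _.
    have := hn m (leq_maxl _ _); rewrite -(@ler_pM2r _ (w k)^-1) ?invr_gt0//.
    by rewrite (_ : d * w k / 2 / w k = d / 2); [lra|field; rewrite gt_eqF].
  apply/ler_addgt0Pr => d d0.
  have dw : 0 < d * w k / 4 by rewrite !mulr_gt0 ?invr_gt0.
  have [n0 hn] := he _ dw.
  pose m := maxn n0 n.
  have -> : u k t - v n k t - (u k s - v n k s) = - (v m k t - u k t) + (v m k s - u k s) +
     ((v m k t - v n k t) - (v m k s - v n k s)) by ring.
  apply: le_trans (ncD _ _) _; rewrite addrC; apply: lerD.
    by have [_ h2] := bd_HolM k (h n m (leq_maxr _ _)); exact: h2.
  apply: le_trans (ncD _ _) _; rewrite ncN.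
  have := hn m (leq_maxl _ _); rewrite -(@ler_pM2r _ (w k)^-1) ?invr_gt0//.
  rewrite (_ : d * w k / 4 / w k = d / 4); last by field; rewrite gt_eqF.
  by have := hu k t m; have := hu k s m; lra.
exists u => n; split; first exact: e0.
pose N := NU (fun k t => u k t - v n k t).
have hN k : Hol (N k) (O k) (fun t => u k t - v n k t) /\ 0 <= N k <= e n / w k.
  by apply: nu_Hol; [exact: O0|exact: holu].
exists N => [k|M].
  by have [h1 /andP[h2 _]] := hN k.
have N0 : 0 <= \sum_(k <- ZM M) (w k * N k) ^+ 2 by apply: sumr_ge0 => k _; rewrite sqr_ge0.
rewrite -(sqr_sqrtr N0) ler_sqr ?nnegrE ?sqrtr_ge0//.
apply/ler_addgt0Pr => d d0.
(* The error [e m] is paid once for each mode of the range, hence taken below d / s. *)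
pose s : R := (size (ZM M))%:R + 1.
have s0 : 0 < s by rewrite ltr_wpDl.
have [n0 hn] := he (d / s) (divr_gt0 d0 s0).
pose m := maxn n0 n.
pose N1 := NU (fun k t => v m k t - v n k t).
have [p1 p2 p3] := bd_nu (h n m (leq_maxr _ _)).
apply: (@le_trans _ _ (Num.sqrt (\sum_(k <- ZM M) (w k * N1 k + e m) ^+ 2))).
  apply: ler_wsqrtr; apply: ler_sum => k _.
  have [q1 /andP[q2 q3]] := hN k.
  rewrite ler_sqr ?nnegrE ?mulr_ge0 ?addr_ge0 ?mulr_ge0 ?p1 ?(ltW (w0 _))//.
  have : Hol (e m / w k + N1 k) (O k) (fun t => u k t - v n k t).
    have := HolD (holu k m) (p2 k); congr Hol; apply/funext => t; ring.
  move=> /(nu_Hol (O0 k))[_ /andP[_ hh]].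
  apply: (@le_trans _ _ (w k * (e m / w k + N1 k))); first by rewrite ler_pM2l.
  by rewrite mulrDr mulrCA divff ?gt_eqF// mulr1 addrC.
apply: le_trans (minkowski _ _ _) _; apply: lerD.
  exact: sqrt_ell2.
rewrite big_const_seq count_predT iter_addr_0.
have em := hn m (leq_maxl _ _).
apply: (@le_trans _ _ (Num.sqrt ((s * e m) ^+ 2))).
  apply: ler_wsqrtr; rewrite -mulr_natl exprMn; apply: ler_wpM2r; first by rewrite sqr_ge0.
  have : 0 <= (size (ZM M))%:R :> R by []. rewrite /s; nra.
rewrite sqrtr_sqr ger0_norm; last by rewrite mulr_ge0// ltW.
by rewrite mulrC -ler_pdivlMr.
Qed.

End gauge.

(** * The Duhamel operator in interaction variables *)

Section clip.
Variable R : realType.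
Implicit Types (a b t s : R).
(** Stopping the time at both ends extends a field from a window to the whole line without enlarging
    its modulus of continuity. *)
Definition clip a b t : R := Num.max a (Num.min t b).

Lemma clip_in a b t : a <= b -> a <= clip a b t <= b.
Proof. by move=> ab; rewrite /clip le_max lexx ge_max ab ge_min lexx orbT. Qed.

Lemma clip_id a b t : a <= t <= b -> clip a b t = t.
Proof. by move=> /andP[h1 h2]; rewrite /clip (min_idPl h2); apply/max_idPr. Qed.

Lemma min_lip b t s : `|Num.min t b - Num.min s b| <= `|t - s|.
Proof.
have h1 := ler_norm (t - s); have h2 := ler_norm (s - t); rewrite distrC in h2.
by case: (leP t b) => ?; case: (leP s b) => ?; rewrite ler_norml; apply/andP; split; lra.
Qed.

Lemma max_lip a t s : `|Num.max a t - Num.max a s| <= `|t - s|.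
Proof.
have h1 := ler_norm (t - s); have h2 := ler_norm (s - t); rewrite distrC in h2.
by case: (leP a t) => ?; case: (leP a s) => ?; rewrite ler_norml; apply/andP; split; lra.
Qed.

Lemma clip_lip a b t s : `|clip a b t - clip a b s| <= `|t - s|.
Proof. exact: le_trans (max_lip _ _ _) (min_lip _ _ _). Qed.

Lemma clip_clip a b t : a <= b -> clip a b (clip a b t) = clip a b t.
Proof. by move=> ab; apply: clip_id; exact: clip_in. Qed.
End clip.

Section Bop.
Variable R : realType.
Notation C := R[i].
Variables (alpha beta : R).
Implicit Types (v f g : int -> R -> C) (i j k : int) (N d D Ca t s : R).

Definition osmall (o : R -> R) := forall e, 0 < e -> exists2 d, 0 < d & forall h, 0 <= h < d -> o h <= e.

Lemma Hol_cont A (o : R -> R) (f : R -> C) : osmall o -> @Hol R A o f -> cC f.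
Proof.
move=> os h; have A0 := Hol_ge0 h; have [_ h2] := h.
have key (p : C -> R) : (forall z z', `|p z - p z'| <= nc (z - z')) -> continuous (p \o f).
  move=> hp t; apply/cvgrPdist_le => e e0.
  have A1 : 0 < A + 1 by lra.
  have [d d0 hd] := os (e / (A + 1)) (divr_gt0 e0 A1).
  near=> s.
  apply: le_trans (hp _ _) _; apply: le_trans (h2 _ _) _.
  apply: (@le_trans _ _ (A * (e / (A + 1)))).
    apply: ler_wpM2l => //; apply: hd; rewrite normr_ge0 /=.
    near: s; apply/nbhs_ballP; exists d => //.
  by rewrite mulrA ler_pdivrMr//; nra.
by split; apply: key => z z'; [exact: Re_dist|exact: Im_dist].
Unshelve. all: by end_near. Qed.

Lemma om_small N d k : 0 < d -> osmall (om N d k).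
Proof.
move=> d0 e e0.
pose E := expR (- (1 / 2) * ln (br N k)).
have E0 : 0 < E by exact: expR_gt0.
(* The solution of E h^{2/5} = e / 2. *)
pose y := (e / (2 * E)) `^ (5 / 2).
have q0 : 0 < e / (2 * E) by rewrite divr_gt0// mulr_gt0.
have y0 : 0 < y by rewrite powR_gt0.
exists (Num.min (e * d / 2) y); first by rewrite lt_min y0 !mulr_gt0 ?invr_gt0.
move=> h /andP[h0]; rewrite lt_min => /andP[h1 h2].
have -> : e = e / 2 + e / 2 by field.
apply: lerD; first by rewrite ler_pdivrMr// mulrAC ltW.
have : h `^ (2 / 5) <= y `^ (2 / 5) by apply: ge0_ler_powR; rewrite ?nnegrE//; try exact: ltW; lra.
rewrite /y -powRrM (_ : 5 / 2 * (2 / 5) = 1); last by field.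
rewrite powRr1; last exact: ltW.
move=> hh; apply: (@le_trans _ _ (E * (e / (2 * E)))); first by rewrite ler_pM2l.
by rewrite le_eqVlt; apply/orP; left; apply/eqP; field; rewrite gt_eqF.
Qed.

Lemma om_mono N d k h h' : 0 < d -> 0 <= h <= h' -> om N d k h <= om N d k h'.
Proof.
move=> d0 /andP[h0 hh]; apply: lerD; first by rewrite ler_pM2r ?invr_gt0.
rewrite ler_pM2l ?expR_gt0//; apply: ge0_ler_powR; rewrite ?nnegrE//; try lra; exact: le_trans hh.
Qed.

Lemma om_gpos N d k : 0 < d -> gpos (om N d k).
Proof. by move=> d0 h h0; exact: om_ge0. Qed.

Definition Ep i j f g : R -> C := cprim (fun r => ce (phase alpha beta i j * r) * (f i r * g j r)).

(** Zero before [t0] and constant after [t1], so that the operators of consecutive windows add up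
    ([BM_cat]). *)
Definition Bt (t0 t1 : R) i j f g k : R -> C :=
  fun t => (0 +i* k%:~R)%C * (Ep i j f g (clip t0 t1 t) - Ep i j f g t0).

(** Mean zero is built in: the input modes 0 are left out, and the factor k removes the output mode
    0. The lower bound of the phase requires nonzero frequencies. *)
Definition BM (M : nat) (t0 t1 : R) f g : int -> R -> C := fun k t =>
  \sum_(i <- ZM M) \sum_(j <- ZM M)
    (if [&& i + j == k, i != 0 & j != 0] then Bt t0 t1 i j f g k t else 0).

Definition phase_ok N0 Ca := [/\ 1 <= N0, 1 <= Ca &
  forall a b k, a != 0 -> b != 0 -> k != 0 -> a + b = k -> N0 <= (mx3 a b k)%:R ->
  phase alpha beta a b != 0 /\ per (phase alpha beta a b) <= Ca * g3 R a b k].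

Lemma g3_gt0 i j k : i != 0 -> j != 0 -> k != 0 -> 0 < g3 R i j k.
Proof.
move=> i0 j0 k0; have [h1 h2] := mnmx_gt0 i0 j0 k0.
by rewrite /g3 invr_gt0 mulr_gt0 ?exprn_gt0 ?ltr0n.
Qed.

Lemma phase_okP : alpha != 0 -> exists N0, exists Ca, phase_ok N0 Ca.
Proof.
move=> a0; have [N0 [N1 [c [c0 hc]]]] := phase_lower beta a0.
exists N0, (Num.max 1 (2 * pi / c)); split=> //; first by rewrite le_max lexx.
move=> a b k az bz kz e hN; have := hc a b k az bz kz e hN.
have g0 := g3_gt0 az bz kz.
have cg : 0 < c / g3 R a b k by rewrite divr_gt0.
move=> h; have P0 : 0 < `|phase alpha beta a b| by exact: lt_le_trans h.
split; first by rewrite -normr_gt0.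
apply: (@le_trans _ _ (2 * pi / c * g3 R a b k)); last first.
  by rewrite ler_pM2r// le_max lexx orbT.
rewrite -[leRHS]mulrA /per ler_pM2l ?mulr_gt0 ?pi_gt0//.
have -> : c^-1 * g3 R a b k = (c / g3 R a b k)^-1 by rewrite invf_div mulrC.
by rewrite lef_pV2 ?posrE.
Qed.

Variables (N0 Ca : R).
Hypothesis hok : phase_ok N0 Ca.
Variables (N d D : R).
Hypothesis hN : N0 <= N.
Hypothesis d0 : 0 < d.
Hypothesis dD : d <= D * expR (- (5 / 2) * ln N).
Hypothesis D1 : 1 <= D.

Let N1 : 1 <= N. Proof. by case: hok => h _ _; exact: le_trans hN. Qed.
Let C1 : 1 <= Ca. Proof. by case: hok. Qed.

Lemma Ep_cC i j f g A B o1 o2 : osmall o1 -> osmall o2 -> @Hol R A o1 (f i) -> @Hol R B o2 (g j) ->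
  cC (fun r => ce (phase alpha beta i j * r) * (f i r * g j r)).
Proof.
move=> s1 s2 h1 h2; apply: cCM; first exact: cC_ce.
by apply: cCM; [exact: Hol_cont h1|exact: Hol_cont h2].
Qed.

Definition Kab i j k : R := kap3 R i j (- k) + kap3 R j i (- k).

(** Below [N] the trivial bound and [ker_low] suffice. Above, [osc] adds the oscillation of f_i g_j
    over a period to the boundary term, and [ker_high] converts the total into the modulus of the
    output mode. The size is then the modulus over the whole window, where om_k(d) <= 2 D: hence the
    factor 2 D over the constant [CC] of the increments. *)
Lemma Bt_Hol t0 t1 i j k f g A B : t0 <= t1 -> t1 - t0 <= d ->
  i != 0 -> j != 0 -> k != 0 -> i + j = k ->
  Hol A (om N d i) (f i) -> Hol B (om N d j) (g j) ->
  Hol (32 * Ca * D ^+ 2 * (br N k * (Kab i j k * ((A / br N i) * (B / br N j))))) (om N d k) (Bt t0 t1 i j f g k).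
Proof.
move=> t01 td i0 j0 k0 e hf hg.
have N0' : 0 < N by have := N1; lra.
have Ca1 := C1; have D1' := D1; have dD' := dD; have d0' := d0.
have A0 := Hol_ge0 hf; have B0 := Hol_ge0 hg.
have bi : 0 < br N i by rewrite lt_max N0'.
have bj : 0 < br N j by rewrite lt_max N0'.
have bk : 0 < br N k by rewrite lt_max N0'.
have cc := Ep_cC (om_small N i d0) (om_small N j d0) hf hg.
have [E0 dE] := cprimP cc; rewrite -/(Ep i j f g) in E0 dE.
have [f1 f2] := hf; have [g1 g2] := hg.
have AB r : nc (f i r * g j r) <= A * B by rewrite ncM; apply: ler_pM; rewrite ?nc_ge0.
have Kp : 0 <= Kab i j k by rewrite addr_ge0 ?kap3_ge0.
have DAB : 0 <= 8 * Ca * D * Kab i j k by rewrite !mulr_ge0//; lra.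
set CC := 16 * Ca * D * (br N k * (Kab i j k * ((A / br N i) * (B / br N j)))).
have step x y h : t0 <= x <= t1 -> t0 <= y <= t1 -> x <= y -> h = y - x ->
  ab R k * nc (Ep i j f g y - Ep i j f g x) <= CC * om N d k h.
  move=> /andP[x1 x2] /andP[y1 y2] xy eh.
  have h0 : 0 <= h by lra.
  have hd : h <= d by lra.
  have triv : nc (Ep i j f g y - Ep i j f g x) <= 2 * (A * B) * h.
    by rewrite eh; apply: osc_triv dE xy _ => r _; exact: AB.
  have CCE : CC * om N d k h = 2 * (A * B) * br N k / (br N i * br N j) * (8 * Ca * D * Kab i j k * om N d k h).
    by rewrite /CC; field; rewrite !gt_eqF.
  have pre : 0 <= 2 * (A * B) * br N k / (br N i * br N j).
    by rewrite !mulr_ge0// ?invr_ge0 ?mulr_ge0// ltW.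
  have abE J : ab R k * (2 * (A * B) * J) = 2 * (A * B) * br N k / (br N i * br N j) * (Cker N i j k * J).
    by rewrite /Cker; field; rewrite !gt_eqF.
  have Ok := om_ge0 N k h0 d0.
  have [LN|NL] := leP (mx3 i j k)%:R N.
    have := ker_low i0 j0 k0 e N1 d0 dD D1 (h := h) _ LN; rewrite h0 hd => /(_ isT) kl.
    rewrite CCE; apply: (@le_trans _ _ (ab R k * (2 * (A * B) * h))).
      by apply: ler_wpM2l.
    rewrite abE; apply: ler_wpM2l => //; apply: (le_trans kl).
    rewrite -/(Kab i j k); apply: ler_wpM2r => //.
    by rewrite ler_wpM2r//; nra.
  have [_ _ /(_ i j k i0 j0 k0 e _)] := hok; case; first by apply: le_trans hN _; exact: ltW.
  move=> ph0 hper; set P := per _ in hper.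
  have P0 : 0 < P by exact: per_gt0.
  have hP : 0 < P <= Ca * g3 R i j k by rewrite P0.
  have hh : 0 <= h <= d by rewrite h0.
  have kh := ker_high i0 j0 k0 e N1 d0 dD D1 C1 hP hh NL.
  set W := A * B * (om N d i P + om N d j P).
  have W0 : 0 <= W by rewrite mulr_ge0 ?mulr_ge0// addr_ge0// om_ge0// ltW.
  have osc1 : nc (Ep i j f g y - Ep i j f g x) <= 2 * (A * B) * P + 2 * W * h.
    rewrite eh; apply: (osc ph0 dE xy W0) => [r _|r r' _ _ rr]; first exact: AB.
    rewrite (_ : f i r * g j r - f i r' * g j r' = (f i r - f i r') * g j r + f i r' * (g j r - g j r')); last by ring.
    apply: le_trans (ncD _ _) _; rewrite !ncM /W mulrDr; apply: lerD.
      rewrite mulrAC; apply: ler_pM; rewrite ?nc_ge0//.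
      apply: le_trans (f2 _ _) _; apply: ler_wpM2l => //; apply: om_mono => //.
      by rewrite normr_ge0.
    rewrite -mulrA; apply: ler_pM; rewrite ?nc_ge0//.
    apply: le_trans (g2 _ _) _; apply: ler_wpM2l => //; apply: om_mono => //.
    by rewrite normr_ge0.
  rewrite CCE; apply: (@le_trans _ _ (ab R k * (2 * (A * B) * (Num.min h P + h * (om N d i P + om N d j P))))).
    apply: ler_wpM2l => //; rewrite mulrDr.
    have e2 : 2 * (A * B) * (h * (om N d i P + om N d j P)) = 2 * W * h by rewrite /W; ring.
    rewrite e2; have W2 : 0 <= 2 * W * h by apply: mulr_ge0 => //; apply: mulr_ge0.
    rewrite /Num.min; case: ifP => _; [apply: (le_trans triv); by rewrite lerDl|exact: osc1].
  by rewrite abE; apply: ler_wpM2l.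
have step2 t s : ab R k * nc (Ep i j f g (clip t0 t1 t) - Ep i j f g (clip t0 t1 s)) <=
   CC * om N d k `|clip t0 t1 t - clip t0 t1 s|.
  have ct := clip_in t t01; have cs := clip_in s t01.
  have [h|/ltW h] := leP (clip t0 t1 s) (clip t0 t1 t).
    by apply: step => //; rewrite ger0_norm// subr_ge0.
  by rewrite ncBC distrC; apply: step => //; rewrite ger0_norm// subr_ge0.
have CC0 : 0 <= CC by rewrite /CC !mulr_ge0 ?invr_ge0//; lra.
have nck : nc (0 +i* k%:~R : C)%C = ab R k by rewrite nc_i /ab -intr_norm pmulrn abszE.
have C2 : 32 * Ca * D ^+ 2 * (br N k * (Kab i j k * ((A / br N i) * (B / br N j)))) = 2 * D * CC.
  by rewrite /CC; ring.
rewrite C2; split=> [t|t s].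
  rewrite /Bt ncM nck -[X in _ - Ep _ _ _ _ X](@clip_id _ t0 t1); last by rewrite lexx.
  apply: le_trans (step2 _ _) _; rewrite mulrC; apply: ler_wpM2r => //.
  set h := `| _ |.
  have /andP[h1 h2] : 0 <= h <= d.
    rewrite /h (@clip_id _ t0 t1 t0) ?lexx//.
    have /andP[c1 c2] := clip_in t t01.
    by rewrite normr_ge0 ger0_norm ?subr_ge0//; lra.
  apply: (@le_trans _ _ (om N d k d)); first by apply: om_mono => //; rewrite h1.
  have N1' := N1.
  have dd : d <= D.
    apply: (le_trans dD); rewrite ler_piMr//; first by lra.
    rewrite -[leRHS]expR0 ler_expR; have := ln_ge0 N1; lra.
  rewrite /om divff ?gt_eqF//.
  have e1 : expR (- (1 / 2) * ln (br N k)) <= 1.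
    rewrite -[leRHS]expR0 ler_expR; have : 0 <= ln (br N k) by rewrite ln_ge0// le_max N1'.
    lra.
  have e2 : d `^ (2 / 5) <= D.
    apply: (@le_trans _ _ (D `^ (2 / 5))).
      by apply: ge0_ler_powR; rewrite ?nnegrE//; try exact: ltW; lra.
    by rewrite -[leRHS](@powRr1 _ D); [apply: ler_powR => //; lra|lra].
  have e3 : expR (- (1 / 2) * ln (br N k)) * d `^ (2 / 5) <= 1 * D.
    by apply: ler_pM; rewrite ?expR_ge0 ?powR_ge0.
  by lra.
rewrite /Bt -mulrBr ncM nck.
rewrite (_ : _ - _ - _ = Ep i j f g (clip t0 t1 t) - Ep i j f g (clip t0 t1 s)); last by ring.
apply: le_trans (step2 _ _) _.
apply: (@le_trans _ _ (CC * om N d k `|t - s|)).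
  by apply: ler_wpM2l => //; apply: om_mono => //; rewrite normr_ge0 clip_lip.
by apply: ler_wpM2r; [exact: om_ge0|rewrite ler_peMl//; lra].
Qed.

End Bop.

(** * Bilinearity, locality and gauge bound of the truncated Duhamel operator *)

Section BMlin.
Variable R : realType.
Notation C := R[i].
Variables (alpha beta : R).
Implicit Types (v f g : int -> R -> C) (i j k : int) (N d D Ca t s X Y : R).
Notation BM := (BM alpha beta).
Notation Ep := (Ep alpha beta).

Lemma Hol_sum (o : R -> R) (I : Type) (r : seq I) (A : I -> R) (h : I -> R -> C) :
  gpos o -> (forall x, Hol (A x) o (h x)) -> Hol (\sum_(x <- r) A x) o (fun t => \sum_(x <- r) h x t).
Proof.
move=> go hA; elim: r => [|x r IH].
  rewrite big_nil (_ : (fun t => _) = fun=> 0); last by apply/funext => t; rewrite big_nil.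
  by rewrite -nc0; exact: Hol_cst.
rewrite big_cons (_ : (fun t => _) = fun t => h x t + \sum_(y <- r) h y t).
  exact: HolD.
by apply/funext => t; rewrite big_cons.
Qed.

Definition cont v := forall k, cC (v k).

Lemma Ep_cont i j f g : cont f -> cont g ->
  cC (fun r => ce (phase alpha beta i j * r) * (f i r * g j r)).
Proof. by move=> h1 h2; apply: cCM; [exact: cC_ce|exact: cCM]. Qed.

Lemma EpP i j f g : cont f -> cont g -> Ep i j f g 0 = 0 /\
  dC (Ep i j f g) (fun r => ce (phase alpha beta i j * r) * (f i r * g j r)).
Proof. by move=> h1 h2; exact: cprimP (Ep_cont i j h1 h2). Qed.

Lemma dC_ext (F f g : R -> C) : (forall t, f t = g t) -> dC F f -> dC F g.
Proof. by move=> h dF t; rewrite -h; exact: dF. Qed.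

Lemma Ep_linl i j f f' g (z : C) : cont f -> cont f' -> cont g ->
  Ep i j (fun k t => z * f k t + f' k t) g = fun t => z * Ep i j f g t + Ep i j f' g t.
Proof.
move=> h1 h2 h3; have [p1 q1] := EpP i j h1 h3; have [p2 q2] := EpP i j h2 h3.
apply: cprim_uniq; last by rewrite p1 p2 mulr0 addr0.
  apply: (@Ep_cont i j (fun k t => z * f k t + f' k t) g) => // k.
  by apply: cCD => //; apply: cCM => //; exact: cC_cst.
by apply: dC_ext (dCD (dCZ z q1) q2) => t; ring.
Qed.

Lemma Ep_linr i j f g g' (z : C) : cont f -> cont g -> cont g' ->
  Ep i j f (fun k t => z * g k t + g' k t) = fun t => z * Ep i j f g t + Ep i j f g' t.
Proof.
move=> h1 h2 h3; have [p1 q1] := EpP i j h1 h2; have [p2 q2] := EpP i j h1 h3.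
apply: cprim_uniq; last by rewrite p1 p2 mulr0 addr0.
  apply: (@Ep_cont i j f (fun k t => z * g k t + g' k t)) => // k.
  by apply: cCD => //; apply: cCM => //; exact: cC_cst.
by apply: dC_ext (dCD (dCZ z q1) q2) => t; ring.
Qed.

Lemma BM_linl M t0 t1 f f' g (z : C) k t : cont f -> cont f' -> cont g ->
  BM M t0 t1 (fun k t => z * f k t + f' k t) g k t = z * BM M t0 t1 f g k t + BM M t0 t1 f' g k t.
Proof.
move=> h1 h2 h3; rewrite /BM mulr_sumr -big_split; apply: eq_bigr => i _ /=.
rewrite mulr_sumr -big_split; apply: eq_bigr => j _ /=; case: ifP => _; last by rewrite mulr0 addr0.
by rewrite /Bt Ep_linl//; ring.
Qed.

Lemma BM_linr M t0 t1 f g g' (z : C) k t : cont f -> cont g -> cont g' ->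
  BM M t0 t1 f (fun k t => z * g k t + g' k t) k t = z * BM M t0 t1 f g k t + BM M t0 t1 f g' k t.
Proof.
move=> h1 h2 h3; rewrite /BM mulr_sumr -big_split; apply: eq_bigr => i _ /=.
rewrite mulr_sumr -big_split; apply: eq_bigr => j _ /=; case: ifP => _; last by rewrite mulr0 addr0.
by rewrite /Bt Ep_linr//; ring.
Qed.

Lemma BM_sub M t0 t1 f g f' g' k t : cont f -> cont g -> cont f' -> cont g' ->
  BM M t0 t1 f g k t - BM M t0 t1 f' g' k t =
  BM M t0 t1 (fun k t => f k t - f' k t) g k t + BM M t0 t1 f' (fun k t => g k t - g' k t) k t.
Proof.
move=> h1 h2 h3 h4.
have e1 : (fun k t => f k t - f' k t) = (fun k t => -1 * f' k t + f k t).
  by apply/funext => k'; apply/funext => t'; ring.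
have e2 : (fun k t => g k t - g' k t) = (fun k t => -1 * g' k t + g k t).
  by apply/funext => k'; apply/funext => t'; ring.
by rewrite e1 e2 BM_linl// BM_linr//; ring.
Qed.

(** The primitives start at time 0 and may differ; only their increments from [t0] agree. *)
Lemma BM_local M t0 t1 f g f' g' k t : t0 <= t1 -> cont f -> cont g -> cont f' -> cont g' ->
  (forall k t, t0 <= t <= t1 -> f k t = f' k t) -> (forall k t, t0 <= t <= t1 -> g k t = g' k t) ->
  BM M t0 t1 f g k t = BM M t0 t1 f' g' k t.
Proof.
move=> t01 h1 h2 h3 h4 ef eg; apply: eq_bigr => i _; apply: eq_bigr => j _; case: ifP => // _.
rewrite /Bt; congr (_ * _).
have [_ q1] := EpP i j h1 h2; have [_ q2] := EpP i j h3 h4.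
have := dCD q1 (dCZ (-1) q2) => q3.
have /andP[c1 c2] := clip_in t t01.
have := @dC_mvt R _ _ t0 (clip t0 t1 t) 0 c1 q3; rewrite mulr0 mul0r => hm.
have h0 : nc (Ep i j f g (clip t0 t1 t) + -1 * Ep i j f' g' (clip t0 t1 t) -
  (Ep i j f g t0 + -1 * Ep i j f' g' t0)) <= 0.
  apply: hm => r /andP[r1 r2]; have rr : t0 <= r <= t1 by rewrite r1 (le_trans r2 c2).
  by rewrite ef// eg// mulN1r subrr nc0.
have := nc_eq0 (le_anti (introT andP (conj h0 (nc_ge0 _)))).
by move=> h; apply/eqP; rewrite -subr_eq0; apply/eqP; rewrite -[RHS]h; ring.
Qed.

Lemma BM_cat M t0 t1 t2 f g k t : t0 <= t1 -> t1 <= t2 ->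
  BM M t0 t2 f g k t = BM M t0 t1 f g k t + BM M t1 t2 f g k t.
Proof.
move=> h1 h2; rewrite /BM -big_split; apply: eq_bigr => i _ /=.
rewrite -big_split; apply: eq_bigr => j _ /=; case: ifP => _; last by rewrite addr0.
rewrite /Bt -mulrDr; congr (_ * _).
have [h|/ltW h] := leP t t1.
  have -> : clip t1 t2 t = t1 by apply/max_idPl; rewrite ge_min h.
  have -> : clip t0 t2 t = clip t0 t1 t.
    by rewrite /clip (min_idPl h) (min_idPl (le_trans h h2)).
  by ring.
have -> : clip t0 t1 t = t1 by rewrite /clip (min_idPr h); apply/max_idPr.
have -> : clip t0 t2 t = clip t1 t2 t.
  have hm : t1 <= Num.min t t2 by rewrite le_min h.
  by rewrite /clip (max_idPr hm) (max_idPr (le_trans h1 hm)).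
by ring.
Qed.

Lemma BM_before M t0 t1 f g k t : t <= t0 -> t0 <= t1 -> BM M t0 t1 f g k t = 0.
Proof.
move=> h1 h2; apply: big1 => i _; apply: big1 => j _; case: ifP => // _.
rewrite /Bt (_ : clip t0 t1 t = t0) ?subrr ?mulr0//.
by apply/max_idPl; rewrite ge_min h1.
Qed.

Lemma BM_clip M t0 t1 f g k t : t0 <= t1 -> BM M t0 t1 f g k (clip t0 t1 t) = BM M t0 t1 f g k t.
Proof.
by move=> h; apply: eq_bigr => i _; apply: eq_bigr => j _; case: ifP => // _; rewrite /Bt clip_clip.
Qed.

(** Only modes up to [M] enter, so once the inputs are cut at [M] the range may be enlarged. This
    puts truncations at two levels under one operator. *)
Lemma BM_proj M M' t0 t1 f g k t : (M <= M')%N ->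
  BM M t0 t1 f g k t = BM M' t0 t1 (proj M f) (proj M g) k t.
Proof.
move=> MM.
have ez i j (F G : int -> R -> C) : (F i = fun=> 0) \/ (G j = fun=> 0) -> Ep i j F G = fun=> 0.
  move=> h; rewrite /Ep /Ep.
  have -> : (fun r : R => ce (phase alpha beta i j * r) * (F i r * G j r)) = fun=> 0.
    by apply/funext => r; case: h => ->; rewrite ?mul0r ?mulr0.
  by apply: cprim_uniq => //; [exact: cC_cst|exact: dC_cst].
have ext (F : int -> C) : (forall i, (M < `|i|)%N -> F i = 0) -> \sum_(i <- ZM M) F i = \sum_(i <- ZM M') F i.
  move=> hF; rewrite [RHS](bigID (fun i => (`|i| <= M)%N)) /= [X in _ = _ + X]big1 ?addr0; last first.
    by move=> i; rewrite -ltnNge => /hF.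
  rewrite -[RHS]big_filter; apply: perm_big; apply: uniq_perm; rewrite ?filter_uniq ?uniq_ZM//.
  move=> i; rewrite mem_filter !mem_ZM; apply/idP/andP => [h|[]//]; split=> //; exact: leq_trans MM.
rewrite /BM /BM.
have -> : \sum_(i <- ZM M') \sum_(j <- ZM M')
   (if [&& i + j == k, i != 0 & j != 0] then Bt alpha beta t0 t1 i j (proj M f) (proj M g) k t else 0) =
  \sum_(i <- ZM M) \sum_(j <- ZM M)
   (if [&& i + j == k, i != 0 & j != 0] then Bt alpha beta t0 t1 i j (proj M f) (proj M g) k t else 0).
  rewrite -ext; last first.
    move=> i hi; apply: big1 => j _; case: ifP => // _; rewrite /Bt ez ?subrr ?mulr0//.
    by left; rewrite projE leqNgt hi.
  apply: eq_bigr => i _; rewrite -ext// => j hj; case: ifP => // _; rewrite /Bt ez ?subrr ?mulr0//.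
  by right; rewrite projE leqNgt hj.
rewrite big_seq [RHS]big_seq; apply: eq_bigr => i hi; rewrite big_seq [RHS]big_seq; apply: eq_bigr => j hj.
case: ifP => // _; rewrite mem_ZM in hi; rewrite mem_ZM in hj.
by rewrite /Bt /Ep !projE hi hj.
Qed.

Lemma br_gt0 N k : 0 < N -> 0 < br N k.
Proof. by move=> h; rewrite lt_max h. Qed.

Definition wt (G : int -> R) N k := G k / br N k.

(** The condition under which a frequency weight passes through a convolution. *)
Definition submul (G : int -> R) (CG : R) := [/\ 0 <= CG, forall k, 0 < G k &
  forall i j k, i != 0 -> j != 0 -> k != 0 -> i + j = k -> G k <= CG * (G i * G j)].

Definition CB Ca D CG : R := 24 * (32 * Ca * D ^+ 2) * CG.

(** Summed over pairs, [Bt_Hol] bounds the operator by a convolution with kernel [Kab], that is two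
    copies of [kap3]; each costs 12 in [ell2_conv], whence the 24 in [CB]. *)
Lemma BM_bd N0 Ca N d D G CG M t0 t1 f g X Y :
  phase_ok alpha beta N0 Ca -> N0 <= N -> 0 < d -> d <= D * expR (- (5 / 2) * ln N) -> 1 <= D ->
  submul G CG -> t0 <= t1 -> t1 - t0 <= d ->
  bd (wt G N) (om N d) f X -> bd (wt G N) (om N d) g Y ->
  bd (wt G N) (om N d) (BM M t0 t1 f g) (CB Ca D CG * X * Y).
Proof.
move=> hok hN d0 dD D1 [CG0 G0 Gs] t01 td [X0 [A hA eA]] [Y0 [B hB eB]].
have [N01 Ca1 _] := hok.
have N1 : 1 <= N by exact: le_trans hN.
have N0' : 0 < N by lra.
have br0 k := @br_gt0 N k N0'.
have w0 k : 0 < wt G N k by rewrite divr_gt0.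
have Ca0 : 0 <= Ca by lra.
have D20 : 0 <= D ^+ 2 by exact: sqr_ge0.
pose c1 := 32 * Ca * D ^+ 2.
have c10 : 0 <= c1 by rewrite mulr_ge0// mulr_ge0.
have K0 : 0 <= CB Ca D CG by rewrite /CB -/c1 mulr_ge0// mulr_ge0.
have KXY : 0 <= CB Ca D CG * X * Y by rewrite mulr_ge0// mulr_ge0.
split => //.
pose T i j k := c1 * (br N k * (Kab R i j k * ((A i / br N i) * (B j / br N j)))).
have Kp i j k : 0 <= Kab R i j k by rewrite addr_ge0 ?kap3_ge0.
have A0 i : 0 <= A i by have [] := hA i.
have B0 i : 0 <= B i by have [] := hB i.
have ai i : 0 <= A i / br N i by rewrite divr_ge0// ltW.
have bi i : 0 <= B i / br N i by rewrite divr_ge0// ltW.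
have T0 i j k : 0 <= T i j k by rewrite mulr_ge0// mulr_ge0 ?(ltW (br0 _))// mulr_ge0// mulr_ge0.
pose AB k := if k == 0 then 0 else \sum_(i <- ZM M) \sum_(j <- ZM M)
  (if [&& i + j == k, i != 0 & j != 0] then T i j k else 0).
have AB0 k : 0 <= AB k.
  by rewrite /AB; case: ifP => // _; apply: sumr_ge0 => i _; apply: sumr_ge0 => j _; case: ifP.
exists AB => [k|].
  split=> //; rewrite /AB; case: eqP => [->|/eqP k0].
    have -> : BM M t0 t1 f g 0 = fun=> 0.
      apply/funext => t; apply: big1 => i _; apply: big1 => j _; case: ifP => // _.
      by rewrite /Bt mulr0z mul0r.
    by rewrite -nc0; apply: Hol_cst; exact: om_gpos.
  have go := om_gpos N k d0.
  apply: (@Hol_sum (om N d k) _ (ZM M) (fun i => \sum_(j <- ZM M) _) (fun i t => \sum_(j <- ZM M) _)) => // i.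
  apply: (@Hol_sum (om N d k) _ (ZM M) (fun j => if _ then T i j k else 0)
    (fun j t => if [&& i + j == k, i != 0 & j != 0] then Bt alpha beta t0 t1 i j f g k t else 0)) => // j.
  case: ifP => [/and3P[/eqP e i0 j0]|_]; last by rewrite -nc0; exact: Hol_cst.
  have [_ h1] := hA i; have [_ h2] := hB j.
  exact: (Bt_Hol hok hN d0 dD D1 t01 td i0 j0 k0 e h1 h2).
pose x i := wt G N i * A i; pose y j := wt G N j * B j.
have x0 i : 0 <= x i by rewrite mulr_ge0// ltW.
have y0 j : 0 <= y j by rewrite mulr_ge0// ltW.
pose S1 k := (c1 * CG) * \sum_(i <- ZM M) \sum_(j <- ZM M)
     (if i + j == k then kap3 R i j (- k) * (x i * y j) else 0).
pose S2 k := (c1 * CG) * \sum_(i <- ZM M) \sum_(j <- ZM M)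
     (if i + j == k then kap3 R i j (- k) * (y i * x j) else 0).
have cc0 : 0 <= c1 * CG by rewrite mulr_ge0.
have S10 k : 0 <= S1 k.
  rewrite mulr_ge0//; apply: sumr_ge0 => i _; apply: sumr_ge0 => j _; case: ifP => // _.
  by rewrite mulr_ge0 ?kap3_ge0// mulr_ge0.
have S20 k : 0 <= S2 k.
  rewrite mulr_ge0//; apply: sumr_ge0 => i _; apply: sumr_ge0 => j _; case: ifP => // _.
  by rewrite mulr_ge0 ?kap3_ge0// mulr_ge0.
have e1 : ell2 S1 (12 * (c1 * CG) * (X * Y)) by apply: (@ell2_conv R M S1 x y).
have e2 : ell2 S2 (12 * (c1 * CG) * (Y * X)) by apply: (@ell2_conv R M S2 y x).
have e12 := ell2D (mulr_ge0 (mulr_ge0 (ler0n _ 12) cc0) (mulr_ge0 X0 Y0))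
   (mulr_ge0 (mulr_ge0 (ler0n _ 12) cc0) (mulr_ge0 Y0 X0)) e1 e2.
have CE : 12 * (c1 * CG) * (X * Y) + 12 * (c1 * CG) * (Y * X) = CB Ca D CG * X * Y by rewrite /CB /c1; ring.
rewrite CE in e12; apply: ell2_le e12; last by rewrite KXY lexx.
move=> k; apply/andP; split; first by rewrite mulr_ge0// ltW.
have -> : S2 k = (c1 * CG) * \sum_(i <- ZM M) \sum_(j <- ZM M)
     (if i + j == k then kap3 R j i (- k) * (x i * y j) else 0).
  rewrite /S2; congr (_ * _); rewrite exchange_big /=; apply: eq_bigr => i _; apply: eq_bigr => j _.
  by rewrite addrC [y j * _]mulrC.
rewrite /AB; case: eqP => [_|/eqP k0].
  rewrite mulr0 addr_ge0//.
  rewrite mulr_ge0//; apply: sumr_ge0 => i _; apply: sumr_ge0 => j _; case: ifP => // _.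
  by rewrite mulr_ge0 ?kap3_ge0// mulr_ge0.
rewrite /S1 -mulrDr -big_split mulr_sumr [leRHS]mulr_sumr; apply: ler_sum => i _ /=.
rewrite -big_split mulr_sumr [leRHS]mulr_sumr; apply: ler_sum => j _ /=.
case: (i + j =P k) => [e|_] /=; last by rewrite mulr0 addr0 mulr0.
case: ifP => [/andP[i0 j0]|_]; last first.
  rewrite mulr0; apply: mulr_ge0 => //; apply: addr_ge0; apply: mulr_ge0; rewrite ?kap3_ge0//; exact: mulr_ge0.
have -> : wt G N k * T i j k = c1 * (Kab R i j k * (A i / br N i * (B j / br N j))) * G k.
  by rewrite /T /wt; field; rewrite !gt_eqF.
rewrite -mulrDl /x /y /wt.
have -> : c1 * CG * ((kap3 R i j (- k) + kap3 R j i (- k)) * (G i / br N i * A i * (G j / br N j * B j))) =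
   c1 * (Kab R i j k * (A i / br N i * (B j / br N j))) * (CG * (G i * G j)).
  by rewrite /Kab; field; rewrite !gt_eqF.
apply: ler_wpM2l; last exact: Gs.
by rewrite mulr_ge0// mulr_ge0// mulr_ge0.
Qed.

End BMlin.

(** * Picard iteration *)

Section picard.
Variable R : realType.
Notation C := R[i].
Implicit Types (v f g u : int -> R -> C) (c d a K X Y : R).
Variables (w : int -> R) (O : int -> R -> R).
Hypothesis w0 : forall k, 0 < w k.
Hypothesis O0 : forall k, gpos (O k).
Notation bd := (bd w O).

Lemma bd_closed v c : 0 <= c -> (forall d, 0 < d -> bd v (c + d)) -> bd v c.
Proof.
move=> c0 h; have h1 : bd v (c + 1) by exact: h.
have [p1 p2 _] := bd_nu w0 O0 h1.
split=> //; exists (NU O v) => // M.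
apply/ler_addgt0Pr => e e0.
(* Chosen so that (c + d)^2 <= c^2 + e. *)
pose d := Num.min 1 (e / (2 * c + 1)).
have c1 : 0 < 2 * c + 1 by lra.
have d0 : 0 < d by rewrite lt_min ltr01 divr_gt0.
have [_ _ p3] := bd_nu w0 O0 (h d d0).
apply: (le_trans (p3 M)).
have d1 : d <= 1 by rewrite ge_min lexx.
have d2 : d * (2 * c + 1) <= e by rewrite -ler_pdivlMr// ge_min lexx orbT.
nra.
Qed.

Lemma bd_zero v : (forall d, 0 < d -> bd v d) -> forall k t, v k t = 0.
Proof.
move=> h k t; apply: nc_eq0; apply: le_anti; rewrite nc_ge0 andbT.
apply/ler_addgt0Pr => e e0; rewrite add0r.
have := @bd_pt _ _ _ w0 _ _ k t (h (e * w k) (mulr_gt0 e0 (w0 k))).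
by rewrite mulfK// gt_eqF.
Qed.

(** After n applications the excess over 2 r is at most x0 / 2^n. A contraction inequality is thus
    closed from any finite bound, small or not. *)
Lemma bd_contract v x0 r : 0 <= r -> bd v x0 -> (forall x, bd v x -> bd v (r + x / 2)) -> bd v (2 * r).
Proof.
move=> r0 h0 hs; have x00 : 0 <= x0 by case: h0.
have hn n : bd v (2 * r + x0 / 2 ^+ n).
  elim: n => [|n IH]; first by apply: (bd_le w0) h0; rewrite expr0 divr1; lra.
  apply: (bd_le w0) (hs _ IH); rewrite exprS.
  have -> : x0 / (2 * 2 ^+ n) = x0 / 2 ^+ n / 2 by field; rewrite expf_neq0.
  lra.
apply: bd_closed; first by rewrite mulr_ge0.
move=> d d0; have [n hd] : exists n : nat, x0 / 2 ^+ n <= d.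
  pose n := (Num.truncn (x0 / d)).+1; exists n.
  have /andP[_ h2] := truncn_itv (divr_ge0 x00 (ltW d0)).
  rewrite ler_pdivrMr ?exprn_gt0// mulrC -ler_pdivrMr//; apply: (le_trans (ltW h2)).
  by rewrite -natrX ler_nat ltnW// ltn_expl.
by apply: (bd_le w0) (hn n); rewrite lerD2l.
Qed.

(** A subsequence with rate 2^{-j} reduces this to [bd_complete]. *)
Lemma bd_complete_eps (v : nat -> int -> R -> C) :
  (forall d, 0 < d -> exists n0, forall n m, (n0 <= n)%N -> (n <= m)%N ->
     bd (fun k t => v m k t - v n k t) d) ->
  exists u, forall d, 0 < d -> exists n0, forall n, (n0 <= n)%N -> bd (fun k t => u k t - v n k t) d.
Proof.
move=> h.
have p0 (j : nat) : 0 < (2 ^+ j)^-1 :> R by rewrite invr_gt0 exprn_gt0.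
have /choice[N hN] : forall j : nat, exists n0, forall n m, (n0 <= n)%N -> (n <= m)%N ->
     bd (fun k t => v m k t - v n k t) ((2 ^+ j)^-1) by move=> j; exact: h.
pose n j := (\max_(i < j.+1) N i)%N.
have nN j : (N j <= n j)%N by rewrite /n; apply: (@leq_bigmax _ (fun i : 'I_j.+1 => N i) ord_max).
have nm i j : (i <= j)%N -> (n i <= n j)%N.
  move=> ij; apply/bigmax_leqP => k _.
  have kj : (k < j.+1)%N by exact: leq_trans (ltn_ord k) _.
  exact: (@leq_bigmax _ (fun i : 'I_j.+1 => N i) (Ordinal kj)).
have hlim (d : R) : 0 < d -> exists n0, forall n, (n0 <= n)%N -> (2 ^+ n)^-1 <= d.
  move=> d0; exists (Num.truncn (d^-1)).+1 => m hm.
  have di : 0 <= d^-1 by rewrite invr_ge0 ltW.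
  have /andP[_ h2] := truncn_itv di.
  rewrite -[d]invrK lef_pV2 ?posrE ?exprn_gt0 ?invr_gt0//; apply: (le_trans (ltW h2)).
  by rewrite -natrX ler_nat (leq_trans hm)// ltnW// ltn_expl.
have [u hu] := @bd_complete R w O w0 O0 (fun j => v (n j)) (fun j => (2 ^+ j)^-1)
  (fun i j ij => hN i _ _ (nN i) (nm i j ij)) hlim.
exists u => d d0; have d20 : 0 < d / 2 by rewrite divr_gt0.
have [j hj] := hlim _ d20; exists (n j) => m hm.
have h1 := hu j; have h2 := bdBC w0 (hN j _ _ (nN j) hm).
have := bdD w0 h1 h2 => /(bd_le w0 (e := d)) hh.
have jj := hj j (leqnn j).
apply: (bd_ext _ (hh _)); [move=> k t; ring|lra].
Qed.

(** Bilinearity enters only through the difference identity of contraction arguments, and only for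
    inputs of finite gauge, where the pointwise limits that define [Binf] are known to exist. *)
Definition bilop (B : (int -> R -> C) -> (int -> R -> C) -> int -> R -> C) K :=
  [/\ 0 <= K,
   forall f g X Y, bd f X -> bd g Y -> bd (B f g) (K * X * Y) &
   forall f g f' g' X Y X' Y', bd f X -> bd g Y -> bd f' X' -> bd g' Y' -> forall k t,
     B f g k t - B f' g' k t = B (fun k t => f k t - f' k t) g k t + B f' (fun k t => g k t - g' k t) k t].

Lemma bilop_dist B K f g f' g' X Y X' dX dY : bilop B K -> bd f X -> bd g Y -> bd f' X' ->
  (exists Y', bd g' Y') ->
  bd (fun k t => f k t - f' k t) dX -> bd (fun k t => g k t - g' k t) dY ->
  bd (fun k t => B f g k t - B f' g' k t) (K * dX * Y + K * X' * dY).
Proof.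
move=> [K0 b1 b2] hf hg hf' [Y' hg'] hd1 hd2.
apply: (bd_ext (u := fun k t => B (fun k t => f k t - f' k t) g k t + B f' (fun k t => g k t - g' k t) k t)).
  by move=> k t; rewrite -(b2 _ _ _ _ _ _ _ _ hf hg hf' hg').
by apply: bdD => //; apply: b1.
Qed.

(** The ball of radius 2 a is stable because a + 4 K a^2 <= 2 a, and distances are halved in it
    because 4 K a <= 1/2. *)
Lemma picard B K al a : bilop B K -> bd al a -> 8 * K * a <= 1 ->
  exists v, bd v (2 * a) /\ forall k t, v k t = al k t + B v v k t.
Proof.
move=> hB ha Ka; have [K0 b1 b2] := hB; have a0 : 0 <= a by case: ha.
pose F v := fun k t => al k t + B v v k t.
pose V n := iter n F al.
have hV n : bd (V n) (2 * a).
  elim: n => [|n IH]; first by apply: (bd_le w0) ha; lra.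
  have := bdD w0 ha (b1 _ _ _ _ IH IH) => /(bd_le w0); apply.
  by nra.
have hd n : bd (fun k t => V n.+1 k t - V n k t) (a / 2 ^+ n).
  elim: n => [|n IH].
    apply: (bd_ext (u := B al al)); first by move=> k t; rewrite /V /= /F; ring.
    by apply: (bd_le w0) (b1 _ _ _ _ ha ha); rewrite expr0 divr1; nra.
  have := bilop_dist hB (hV n.+1) (hV n.+1) (hV n) (ex_intro _ _ (hV n)) IH IH.
  move=> h; have := h => /(bd_le w0 (e := a / 2 ^+ n.+1)) h2.
  apply: (bd_ext _ (h2 _)); first by move=> k t; rewrite /V /= /F; ring.
  rewrite exprS.
  have -> : a / (2 * 2 ^+ n) = a / 2 ^+ n / 2 by field; rewrite expf_neq0.
  have : 0 <= a / 2 ^+ n by rewrite divr_ge0// exprn_ge0.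
  set y := a / _; nra.
have hnm n m : (n <= m)%N -> bd (fun k t => V m k t - V n k t) (2 * (a / 2 ^+ n)).
  move=> nm; have : bd (fun k t => V m k t - V n k t) (2 * (a / 2 ^+ n) - 2 * (a / 2 ^+ m)).
    elim: m nm => [|m IH].
      rewrite leqn0 => /eqP ->; rewrite subrr.
      by apply: (bd_ext (u := fun _ _ => 0)); [move=> k t; rewrite subrr|exact: bd0].
    rewrite leq_eqVlt => /predU1P[e|].
      rewrite e [X in bd _ X]subrr.
      by apply: (bd_ext (u := fun _ _ => 0)); [move=> k t; rewrite subrr|exact: bd0].
    rewrite ltnS => /IH h; have := bdD w0 h (hd m).
    move=> /(bd_le w0 (e := 2 * (a / 2 ^+ n) - 2 * (a / 2 ^+ m.+1))) h2.
    apply: (bd_ext _ (h2 _)); first by move=> k t; ring.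
    rewrite exprS (_ : a / (2 * 2 ^+ m) = a / 2 ^+ m / 2); last by field; rewrite expf_neq0.
    lra.
  apply: (bd_le w0).
  have : 0 <= a / 2 ^+ m by rewrite divr_ge0// exprn_ge0.
  lra.
have hlim (d : R) : 0 < d -> exists n0, forall n, (n0 <= n)%N -> 2 * (a / 2 ^+ n) <= d.
  move=> d0; exists (Num.truncn (2 * a / d)).+1 => m hm.
  have di : 0 <= 2 * a / d by rewrite divr_ge0 ?mulr_ge0// ltW.
  have /andP[_ h2] := truncn_itv di.
  rewrite mulrA ler_pdivrMr ?exprn_gt0// [d * _]mulrC -ler_pdivrMr//; apply: (le_trans (ltW h2)).
  by rewrite -natrX ler_nat (leq_trans hm)// ltnW// ltn_expl.
have [u hu] := bd_complete w0 O0 hnm hlim.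
have hu2 : bd u (2 * a).
  apply: bd_closed; first by rewrite mulr_ge0.
  move=> d d0; have [n0 hn] := hlim _ d0.
  have := bdD w0 (hu n0) (hV n0) => /(bd_le w0 (e := 2 * a + d)) h2.
  apply: (bd_ext _ (h2 _)); first by move=> k t; ring.
  by have := hn n0 (leqnn _); lra.
exists u; split=> // k t.
apply/eqP; rewrite -subr_eq0; apply/eqP.
have := @bd_zero (fun k t => u k t - (al k t + B u u k t)); apply => d d0.
have d20 : 0 < d / 2 by rewrite divr_gt0.
have [n0 hn] := hlim _ d20.
have e1 := hn n0 (leqnn _); have e2 := hn n0.+1 (leqnSn _).
have h1 := hu n0.+1.
have h2 := bilop_dist hB (hV n0) (hV n0) hu2 (ex_intro _ _ hu2) (bdBC w0 (hu n0)) (bdBC w0 (hu n0)).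
have := bdD w0 h1 h2 => /(bd_le w0 (e := d)) h3.
apply: (bd_ext _ (h3 _)); first by move=> k' t'; rewrite /V /= /F; ring.
set y := 2 * (a / 2 ^+ n0) in e1 *; set z := 2 * (a / 2 ^+ n0.+1) in e2 *.
have y0 : 0 <= y by rewrite mulr_ge0// divr_ge0// exprn_ge0.
have : K * y * (2 * a) + K * (2 * a) * y <= y * (1 / 2) by nra.
nra.
Qed.

(** Subtracting the equations bounds the distance x by r1 + r2 + x / 2, and [bd_contract] concludes.
    The two operators are compared at the single field [v], which is the sense in which Galerkin
    operators converge. *)
Lemma picard_stable B K B' al al' v v' a r1 r2 : bilop B K -> bilop B' K -> 8 * K * a <= 1 -> 0 <= a ->
  bd v (2 * a) -> bd v' (2 * a) ->
  (forall k t, v k t = al k t + B v v k t) -> (forall k t, v' k t = al' k t + B' v' v' k t) ->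
  bd (fun k t => al k t - al' k t) r1 -> bd (fun k t => B v v k t - B' v v k t) r2 ->
  bd (fun k t => v k t - v' k t) (2 * (r1 + r2)).
Proof.
move=> hB hB' Ka a0 hv hv' ev ev' h1 h2.
have r10 : 0 <= r1 by case: h1. have r20 : 0 <= r2 by case: h2.
have K0 : 0 <= K by case: hB.
apply: (@bd_contract _ (2 * a + 2 * a)); first exact: addr_ge0.
  exact: bdB.
move=> x hx; have x0 : 0 <= x by case: hx.
have h3 := bilop_dist hB' hv hv hv' (ex_intro _ _ hv') hx hx.
have := bdD w0 (bdD w0 h1 h2) h3 => /(bd_le w0 (e := r1 + r2 + x / 2)) h4.
apply: (bd_ext _ (h4 _)).
  by move=> k t; rewrite [in RHS]ev [in RHS]ev'; ring.
rewrite lerD2l; nra.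
Qed.

End picard.

Section limC.
Variable R : realType.
Notation C := R[i].

(** A total limit operator, with value 0 where no limit exists. *)
Definition limC (u : nat -> C) : C :=
  xget 0 [set z | forall e : R, 0 < e -> exists n0, forall n, (n0 <= n)%N -> nc (u n - z) <= e].

Lemma limCP (u : nat -> C) z :
  (forall e : R, 0 < e -> exists n0, forall n, (n0 <= n)%N -> nc (u n - z) <= e) -> limC u = z.
Proof.
move=> h.
have h' : forall e : R, 0 < e -> exists n0, forall n, (n0 <= n)%N -> nc (u n - limC u) <= e.
  pose S : set C := [set z | forall e : R, 0 < e -> exists n0, forall n, (n0 <= n)%N -> nc (u n - z) <= e].
  have hex : exists z, S z by exists z.
  exact: (@xgetPex _ 0 S hex).
apply/eqP; rewrite -subr_eq0; apply/eqP/nc_eq0/le_anti; rewrite nc_ge0 andbT.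
apply/ler_addgt0Pr => e e0; rewrite add0r.
have e20 : 0 < e / 2 by rewrite divr_gt0.
have [n1 h1] := h _ e20; have [n2 h2] := h' _ e20.
have := h1 (maxn n1 n2) (leq_maxl _ _); have := h2 (maxn n1 n2) (leq_maxr _ _).
have ez : limC u - z = (u (maxn n1 n2) - z) - (u (maxn n1 n2) - limC u) by ring.
have := ncB (u (maxn n1 n2) - z) (u (maxn n1 n2) - limC u); rewrite -ez.
lra.
Qed.

End limC.

(** * The energy estimate *)

Section ekernels.
Variable R : realType.
Implicit Types (a b c k : int) (N d D Ca P x y L : R).

Definition kk a b c : R := kap3 R a b c + kap3 R b a c.

Lemma kk_ge0 a b c : 0 <= kk a b c.
Proof. by rewrite addr_ge0 ?kap3_ge0. Qed.

Lemma mn3N a b c : (mn3 a b (- c) = mn3 a b c) * (mx3 a b (- c) = mx3 a b c).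
Proof. by rewrite /mn3 /mx3 abszN. Qed.

Lemma kk_low a b c x y : a != 0 -> b != 0 -> c != 0 -> a + b + c = 0 ->
  (mn3 a b c)%:R = expR x -> (mx3 a b c)%:R = expR y ->
  expR (- (2 / 5) * x - 1 / 10 * y) <= kk a b c.
Proof.
move=> a0 b0 c0 e ex ey.
have ee : a + b = - c by move: e; clear; lia.
have := mnmx_cases ee; rewrite !mn3N abszN => h.
have [aL bL cL] := mx3_le a b c.
have [al bl cl] := mn3_le a b c.
have S u v : u != 0 -> mn3 a b c = `|u|%N -> (mn3 a b c <= `|v|)%N -> (`|v| <= mx3 a b c)%N ->
   expR (- (2 / 5) * x - 1 / 10 * y) <= sig R u v.
  move=> u0 e1 h1 h2; apply: sig_le => //; rewrite -?e1//; first by rewrite /ab -e1.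
  by rewrite -ey /ab ler_nat.
have p1 := sig_ge0 R a c; have p2 := sig_ge0 R b a; have p3 := sig_ge0 R c b.
have q1 := sig_ge0 R b c; have q2 := sig_ge0 R a b; have q3 := sig_ge0 R c a.
rewrite /kk /kap3; case: h => -[e1 _ _].
- have := S a c a0 e1 cl cL; lra.
- have := S b a b0 e1 al aL; lra.
- have := S c b c0 e1 bl bL; lra.
Qed.

(** The smallest frequency has bracket exp z with z = max (ln N, x); the two other brackets are at
    most L = exp y. *)
Lemma br_prod N a b c x y : a != 0 -> b != 0 -> c != 0 -> a + b + c = 0 -> 1 <= N -> N < (mx3 a b c)%:R ->
  (mn3 a b c)%:R = expR x -> (mx3 a b c)%:R = expR y ->
  exists z, [/\ br N a * (br N b * br N c) <= expR (z + 2 * y), 0 <= x <= z, ln N <= z <= y,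
   expR z <= br N a & expR z <= br N b /\ expR z <= br N c].
Proof.
move=> a0 b0 c0 e N1 NL ex ey.
have ee : a + b = - c by move: e; clear; lia.
have N0 : 0 < N by lra.
have [aL bL cL] := mx3_le a b c.
have [al bl cl] := mn3_le a b c.
have [mn0 mx0] := mnmx_gt0 a0 b0 c0.
have eN : N = expR (ln N) by rewrite lnK// posrE.
pose z := Num.max (ln N) x.
have ez : expR z = Num.max N (expR x).
  by rewrite /z; case: (leP (ln N) x) => h; [rewrite (max_idPr _)// {1}eN ler_expR|rewrite (max_idPl _) -?eN// eN ler_expR ltW].
have x0 : 0 <= x by rewrite -ler_expR -ex expR0 ler1n.
have xy : x <= y by rewrite -ler_expR -ex -ey ler_nat (leq_trans al).
have ny : ln N <= y by rewrite -ler_expR -eN -ey ltW.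
have up q : (`|q| <= mx3 a b c)%N -> br N q <= expR y.
  by move=> h; rewrite /br ge_max -ey (ltW NL) /ab ler_nat.
have lo q : (mn3 a b c <= `|q|)%N -> expR z <= br N q.
  by move=> h; rewrite ez /br ge_max !le_max lexx /= -ex /ab ler_nat h orbT.
have mid q : mn3 a b c = `|q|%N -> br N q = expR z by move=> h; rewrite ez /br -ex h.
have p q : 0 <= br N q by rewrite ltW// lt_max N0.
have Ez : 0 <= expR z by exact: expR_ge0.
have Ey : 0 <= expR y by exact: expR_ge0.
exists z; split.
- have -> : z + 2 * y = z + (y + y) by lra.
  have := mnmx_cases ee; rewrite !mn3N abszN !expRD; case=> -[e1 _ _].
  + by rewrite (mid a)//; apply: ler_wpM2l => //; apply: ler_pM; rewrite ?up.
  + by rewrite (mid b)// mulrCA; apply: ler_wpM2l => //; apply: ler_pM; rewrite ?up.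
  + by rewrite (mid c)// mulrA mulrC; apply: ler_wpM2l => //; apply: ler_pM; rewrite ?up.
- by rewrite x0 le_max lexx orbT.
- by rewrite le_max lexx /= ge_max ny.
- exact: lo.
- by split; exact: lo.
Qed.

Lemma g3E a b c x y : (mn3 a b c)%:R = expR x -> (mx3 a b c)%:R = expR y -> g3 R a b c = expR (- (x + 4 * y)).
Proof. by move=> ex ey; rewrite /g3 ex ey -expRM_natl -expRD -expRN; congr expR; lra. Qed.

Lemma om_exp N d q P Ca z G : 1 <= Ca -> 0 < N -> expR z <= br N q -> d = expR (- (5 / 2) * ln N) ->
  0 < P <= Ca * expR G ->
  om N d q P <= Ca * (expR (G + 5 / 2 * ln N) + expR (- (1 / 2) * z + 2 / 5 * G)).
Proof.
move=> C1 N0 hz dE hP; have d0 : 0 < d by rewrite dE expR_gt0.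
have Ca0 : 0 <= Ca by lra.
apply: le_trans (om_period N q d0 (expR_gt0 G) C1 hP) _.
apply: ler_wpM2l => //; apply: lerD.
  by rewrite dE -expRN -expRD ler_expR; lra.
rewrite expR_powR -expRD ler_expR lerD2r.
have : ln (expR z) <= ln (br N q) by rewrite ler_ln ?posrE ?expR_gt0 ?br_gt0.
by rewrite expRK; lra.
Qed.

(** The factor l / L^2 is the size of the symmetrised energy multiplier ([lam_sum]). The first bound
    serves the boundary term of an oscillatory integral, the second its interior term, which is
    still to be multiplied by the length of the window. *)
Lemma ker_E12 N d Ca P a b c : a != 0 -> b != 0 -> c != 0 -> a + b + c = 0 ->
  1 <= N -> d = expR (- (5 / 2) * ln N) -> 1 <= Ca -> 0 < P <= Ca * g3 R a b c -> N < (mx3 a b c)%:R ->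
  let Q := (mn3 a b c)%:R / (mx3 a b c)%:R ^+ 2 * (br N a * (br N b * br N c)) in
  Q * P <= Ca * d * kk a b c /\ Q * (om N d a P + (om N d b P + om N d c P)) <= 6 * Ca * kk a b c.
Proof.
move=> a0 b0 c0 e N1 dE C1 hP NL Q.
have [mn0 mx0] := mnmx_gt0 a0 b0 c0.
have [x x0 ex] := natr_expR R mn0; have [y y0 ey] := natr_expR R mx0.
have [z [hz /andP[_ xz] /andP[nz zy] ha [hb hc]]] := br_prod a0 b0 c0 e N1 NL ex ey.
have N0 : 0 < N by lra.
have n0 : 0 <= ln N by rewrite ln_ge0.
have hk := kk_low a0 b0 c0 e ex ey.
have Ca0 : 0 <= Ca by lra.
have Q0 : 0 <= Q.
  by rewrite /Q mulr_ge0 ?divr_ge0 ?exprn_ge0// !mulr_ge0// ltW ?br_gt0.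
have hQ : Q <= expR (x + z).
  rewrite /Q ex ey -expRM_natl -expRN -expRD.
  have -> : x + z = (x - 2%:R * y) + (z + 2 * y) by lra.
  by rewrite [leRHS]expRD ler_pM2l ?expR_gt0.
rewrite (g3E ex ey) in hP; have /andP[P0 hP'] := hP.
split.
  apply: (@le_trans _ _ (expR (x + z) * (Ca * expR (- (x + 4 * y))))).
    by apply: ler_pM => //; exact: ltW.
  rewrite mulrCA -expRD -mulrA; apply: ler_wpM2l => //.
  apply: (@le_trans _ _ (d * expR (- (2 / 5) * x - 1 / 10 * y))).
    by rewrite dE -expRD ler_expR; lra.
  by apply: ler_wpM2l => //; rewrite dE expR_ge0.
have o q : expR z <= br N q -> Q * om N d q P <= 2 * Ca * kk a b c.
  move=> hq; apply: (@le_trans _ _ (expR (x + z) * (Ca * (expR (- (x + 4 * y) + 5 / 2 * ln N) +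
       expR (- (1 / 2) * z + 2 / 5 * - (x + 4 * y)))))).
    by apply: ler_pM => //; [apply: om_ge0; rewrite ?dE ?expR_gt0//; exact: ltW|exact: om_exp hP].
  rewrite mulrCA mulrDr -!expRD (_ : 2 * Ca * _ = Ca * (kk a b c + kk a b c)); last by ring.
  apply: ler_wpM2l => //; apply: lerD; apply: le_trans hk; rewrite ler_expR; lra.
have := o _ ha; have := o _ hb; have := o _ hc.
move: (om N d a P) (om N d b P) (om N d c P) (kk a b c) => u v w q; lra.
Qed.

(** For two high inputs with a much lower output: the first bound is for the normal form, the second
    for its remainder, and the third for the sum of |k| times the normal form, where the decay |k| /
    L^2 is needed by [schur]. *)
Lemma ker_E34 N d Ca P a b k : a != 0 -> b != 0 -> k != 0 -> a + b = k ->
  1 <= N -> d = expR (- (5 / 2) * ln N) -> 1 <= Ca -> 0 < P <= Ca * g3 R a b k -> N < (mx3 a b k)%:R ->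
  (8 * `|k| < mx3 a b k)%N ->
  [/\ Cker N a b k * P <= Ca * d * kk a b (- k),
      Cker N a b k * (om N d a P + om N d b P) <= 6 * Ca * kk a b (- k) &
      ab R k ^+ 2 * (br N a * br N b) * P <= Ca * (ab R k / (mx3 a b k)%:R ^+ 2)].
Proof.
move=> a0 b0 k0 e N1 dE C1 hP NL k8.
have k0' : - k != 0 by rewrite oppr_eq0.
have e' : a + b + - k = 0 by rewrite e subrr.
have [mn0 mx0] := mnmx_gt0 a0 b0 k0.
have [x x0 ex] := natr_expR R mn0; have [y y0 ey] := natr_expR R mx0.
have := br_prod a0 b0 k0' e' N1; rewrite !mn3N => /(_ x y NL ex ey).
move=> [z [_ /andP[_ xz] /andP[nz zy] ha [hb hk]]].
have [m1 [m2 m3]] : mn3 a b k = `|k|%N /\ (mx3 a b k <= 2 * `|a|)%N /\ (mx3 a b k <= 2 * `|b|)%N.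
  by case: (mnmx_cases e) => -[m1 m2 m3] //; exfalso; move: k8 mx0 m3; clear; lia.
have N0 : 0 < N by lra.
have n0 : 0 <= ln N by rewrite ln_ge0.
have hkk := @kk_low a b (- k) x y a0 b0 k0' e'; rewrite !mn3N in hkk; have {}hkk := hkk ex ey.
have Ca0 : 0 <= Ca by lra.
have [aL bL kL] := mx3_le a b k.
have /andP[a2 a3] := br_big N1 NL aL m2.
have /andP[b2 b3] := br_big N1 NL bL m3.
rewrite ey in a2 a3 b2 b3.
have ek : ab R k = expR x by rewrite -ex m1.
have brk : br N (- k) = br N k by rewrite /br /ab abszN.
rewrite brk in hk.
have ba := br_gt0 a N0; have bb := br_gt0 b N0; have bk := br_gt0 k N0.
rewrite (g3E ex ey) in hP; have /andP[P0 hP'] := hP.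
have hC : Cker N a b k <= expR (x - z + 2 * y).
  rewrite /Cker (_ : x - z + 2 * y = (x - z) + (y + y)); last lra.
  rewrite [leRHS]expRD; apply: ler_pM; first by rewrite divr_ge0// ltW// ab_gt0.
  - by rewrite mulr_ge0// ltW.
  - by rewrite ek expRD expRN ler_wpM2l ?expR_ge0// lef_pV2 ?posrE ?expR_gt0.
  - by rewrite expRD; apply: ler_pM => //; exact: ltW.
have C0 : 0 <= Cker N a b k by rewrite /Cker !mulr_ge0 ?invr_ge0 ?ltW// ab_gt0.
split.
- apply: (@le_trans _ _ (expR (x - z + 2 * y) * (Ca * expR (- (x + 4 * y))))).
    by apply: ler_pM => //; exact: ltW.
  rewrite mulrCA -expRD -mulrA; apply: ler_wpM2l => //.
  apply: (@le_trans _ _ (d * expR (- (2 / 5) * x - 1 / 10 * y))).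
    by rewrite dE -expRD ler_expR; lra.
  by apply: ler_wpM2l => //; rewrite dE expR_ge0.
- have ly : expR (y - ln 2) = expR y / 2 by rewrite expRD expRN lnK// posrE.
  have l2 : ln 2 <= 1 :> R by rewrite -ler_expR lnK ?posrE//; apply: le_trans (expR_ge1Dx 1); lra.
  have o q : expR y / 2 <= br N q -> Cker N a b k * om N d q P <= 3 * Ca * kk a b (- k).
    move=> hq; rewrite -ly in hq.
    apply: (@le_trans _ _ (expR (x - z + 2 * y) * (Ca * (expR (- (x + 4 * y) + 5 / 2 * ln N) +
       expR (- (1 / 2) * (y - ln 2) + 2 / 5 * - (x + 4 * y)))))).
      by apply: ler_pM => //; [apply: om_ge0; rewrite ?dE ?expR_gt0//; exact: ltW|exact: om_exp hP].
    have e2 : expR (ln 2) = 2 :> R by rewrite lnK// posrE.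
    rewrite mulrCA mulrDr -!expRD (_ : 3 * Ca * _ = Ca * (kk a b (- k) + 2 * kk a b (- k))); last by ring.
    apply: ler_wpM2l => //; apply: lerD; first by apply: le_trans hkk; rewrite ler_expR; lra.
    apply: (@le_trans _ _ (2 * expR (- (2 / 5) * x - 1 / 10 * y))); last by rewrite ler_pM2l.
    by rewrite -e2 -expRD ler_expR e2; have := ln_ge0 (ler1n R 2); lra.
  by have := o _ a2; have := o _ b2; move: (om N d a P) (om N d b P) (kk a b (- k)) => u v q; lra.
- apply: (@le_trans _ _ (expR (2 * x) * expR (2 * y) * (Ca * expR (- (x + 4 * y))))).
    apply: ler_pM => //; [|exact: ltW|].
      by rewrite mulr_ge0 ?sqr_ge0// mulr_ge0// ltW.
    rewrite ek -expRM_natl; apply: ler_wpM2l; first exact: expR_ge0.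
    by rewrite (_ : 2 * y = y + y) ?expRD; [apply: ler_pM => //; exact: ltW|lra].
  rewrite ek ey -expRM_natl -expRN -!expRD mulrCA -expRD; apply: ler_wpM2l => //.
  by rewrite ler_expR; lra.
Qed.

(** The multiplier that the weight 1/[c]^2 produces in the energy identity, set to zero on the
    interactions with low output [c] that the normal form removes. *)
Definition lam N a b c : R :=
  if (N < (mx3 a b c)%:R) && (8 * `|c| < mx3 a b c)%N then 0 else c%:~R / br N c ^+ 2.

(** The slopes of x / max(N, x)^2 are 1 / N^2 before N and - 1 / x^2 after it; on x >= L / 2 both
    are at most 4 / L^2 in size. *)
Lemma ratio_lip N L x y : 1 <= N -> 0 < L -> L / 2 <= x -> L / 2 <= y ->
  `|x / Num.max N x ^+ 2 - y / Num.max N y ^+ 2| <= 8 * `|x - y| / L ^+ 2.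
Proof.
move=> N1 L0; wlog xy : x y / y <= x => [hw hx hy|hx hy].
  have [h|/ltW h] := leP y x; first exact: hw.
  by rewrite distrC [`|x - y|]distrC; exact: hw.
have x0 : 0 < x by lra. have y0 : 0 < y by lra.
set p := Num.max N x; set q := Num.max N y.
have qp : q <= p by rewrite /p /q ge_max !le_max lexx xy orbT.
have px : x <= p by rewrite le_max lexx orbT.
have qy : y <= q by rewrite le_max lexx orbT.
have pq : p - q <= x - y.
  by rewrite /p /q; case: (leP N x); case: (leP N y); lra.
have p0 : 0 < p by lra. have q0 : 0 < q by lra.
rewrite [`|x - y|]ger0_norm ?subr_ge0// ler_norml.
have L20 : 0 < L ^+ 2 by rewrite exprn_gt0.
have pq4 : L ^+ 2 <= 4 * (p * q).
  have : (L / 2) * (L / 2) <= p * q by apply: ler_pM; lra.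
  by lra.
have pp4 : L ^+ 2 <= 4 * (p * p).
  have : (L / 2) * (L / 2) <= p * p by apply: ler_pM; lra.
  by lra.
have i1 : (p * q)^-1 <= 4 / L ^+ 2.
  by rewrite ler_pdivlMr// mulrC ler_pdivrMr ?mulr_gt0.
have i2 : (p * p)^-1 <= 4 / L ^+ 2.
  by rewrite ler_pdivlMr// mulrC ler_pdivrMr ?mulr_gt0.
have d0 : 0 <= x - y by lra.
apply/andP; split.
  rewrite lerNl opprB.
  apply: (@le_trans _ _ (2 * (x - y) * (p * q)^-1)); last first.
    rewrite (_ : 8 * (x - y) / L ^+ 2 = 2 * (x - y) * (4 / L ^+ 2)); last by field; rewrite gt_eqF.
    by apply: ler_wpM2l; rewrite ?mulr_ge0.
  have e : 2 * (x - y) / (p * q) - (y / q ^+ 2 - x / p ^+ 2) =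
     (2 * (x - y) * p * q - y * (p ^+ 2) + x * q ^+ 2) / (p ^+ 2 * q ^+ 2) by field; rewrite !gt_eqF.
  rewrite -subr_ge0 e; apply: divr_ge0; last by rewrite mulr_ge0 ?sqr_ge0.
  have h2 : 0 <= (x - y - (p - q)) * (p * q) by rewrite !mulr_ge0 ?(ltW p0) ?(ltW q0)//; lra.
  have h3 : 0 <= (q - y) * ((p - q) * (p + q)) by rewrite !mulr_ge0//; lra.
  have h5 : 0 <= (x - y - (p - q)) * (q * q) by rewrite !mulr_ge0//; lra.
  have h6 : 0 <= (x - y) * (p * q) by rewrite !mulr_ge0// ltW.
  clearbody p q; clear -h2 h3 h5 h6; lra.
apply: (@le_trans _ _ ((x - y) * (p * p)^-1)).
  rewrite mulrBl -expr2 lerB// ler_pM2l// lef_pV2 ?posrE ?exprn_gt0//.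
  by apply: lerXn2r; rewrite ?nnegrE //; exact: ltW.
apply: (@le_trans _ _ ((x - y) * (4 / L ^+ 2))); first exact: ler_wpM2l.
have L2i : 0 <= (L ^+ 2)^-1 by rewrite invr_ge0 ltW.
have := mulr_ge0 d0 L2i; lra.
Qed.

(** Below [N] all brackets equal [N] and the sum is (a + b + c) / N^2 = 0. Above, if l is much
    smaller than L, the term of the small leg is dropped by [lam] and the two others have opposite
    signs and nearly equal sizes, so [ratio_lip] leaves l / L^2. If l is comparable to L, each term
    is at most 1 / l, which is of that order. *)
Lemma lam_sum N a b c : 1 <= N -> a != 0 -> b != 0 -> c != 0 -> a + b + c = 0 ->
  ((mx3 a b c)%:R <= N -> lam N a b c + lam N b c a + lam N c a b = 0) /\
  `|lam N a b c + lam N b c a + lam N c a b| <= 200 * ((mn3 a b c)%:R / (mx3 a b c)%:R ^+ 2).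
Proof.
move=> N1 a0 b0 c0 e; have ee : a + b = - c by move: e; clear; lia.
have N0 : 0 < N by lra.
have r1 u v w : mx3 u v w = mx3 v w u by rewrite /mx3 maxnC -maxnA.
have r2 u v w : mn3 u v w = mn3 v w u by rewrite /mn3 minnC -minnA.
have [aL bL cL] := mx3_le a b c.
have [al bl cl] := mn3_le a b c.
have [mn0 mx0] := mnmx_gt0 a0 b0 c0.
have low : (mx3 a b c)%:R <= N -> lam N a b c + lam N b c a + lam N c a b = 0.
  move=> LN; have f q : (`|q| <= mx3 a b c)%N -> br N q = N.
    by move=> h; apply/max_idPl; apply: le_trans LN; rewrite ler_nat.
  rewrite /lam -(r1 a b c) (r1 c a b) ltNge LN /= !f// -!mulrDl -!intrD.
  by rewrite (_ : c + a + b = 0) ?mul0r//; move: e; clear; lia.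
split=> //; set L : R := (mx3 a b c)%:R; set l : R := (mn3 a b c)%:R.
have L0 : 0 < L by rewrite ltr0n.
have l0 : 0 < l by rewrite ltr0n.
have [LN|NL] := leP L N; first by rewrite low// normr0 mulr_ge0// divr_ge0 ?exprn_ge0// ltW.
have nab q : `|q%:~R : R| = ab R q by rewrite /ab -intr_norm pmulrn abszE.
have X q : q != 0 -> (mn3 a b c <= `|q|)%N -> `|q%:~R / br N q ^+ 2| <= 1 / l.
  move=> q0 lq; have q1 := ab_gt0 R q0; have b1 := br_gt0 q N0.
  have qb : ab R q <= br N q by rewrite le_max lexx orbT.
  have lq' : l <= ab R q by rewrite ler_nat.
  have i0 : 0 <= (br N q ^+ 2)^-1 by rewrite invr_ge0 sqr_ge0.
  rewrite normrM nab (ger0_norm i0).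
  rewrite ler_pdivrMr ?exprn_gt0// mulrC mul1r ler_pdivlMr//.
  by rewrite expr2; apply: ler_pM => //; first [exact: le_trans qb|exact: ltW].
have [big|small] := leqP (mx3 a b c) (8 * mn3 a b c)%N.
  have L8 : L <= 8 * l by rewrite /L /l -natrM ler_nat.
  have Y p q r : mx3 p q r = mx3 a b c -> r != 0 -> (mn3 a b c <= `|r|)%N -> `|lam N p q r| <= 64 * (l / L ^+ 2).
    move=> em rz rl; rewrite /lam; case: ifP => _.
      by rewrite normr0 mulr_ge0// divr_ge0 ?exprn_ge0// ltW.
    apply: le_trans (X _ rz rl) _.
    rewrite ler_pdivrMr// mulrAC mulrA ler_pdivlMr ?exprn_gt0// mul1r.
    have : L * L <= (8 * l) * (8 * l) by apply: ler_pM => //; exact: ltW.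
    lra.
  have y1 := Y a b c erefl c0 cl; have y2 := Y b c a (esym (r1 a b c)) a0 al.
  have y3 := Y c a b (r1 c a b) b0 bl.
  have p0 : 0 <= l / L ^+ 2 by rewrite divr_ge0 ?exprn_ge0// ltW.
  have t1 := ler_normD (lam N a b c + lam N b c a) (lam N c a b).
  have t2 := ler_normD (lam N a b c) (lam N b c a).
  by lra.
(* one small leg, dropped; the two others nearly cancel *)
have core p q r : r != 0 -> q != 0 -> mx3 a b c = mx3 p q r -> mn3 a b c = `|p|%N -> p + q + r = 0 ->
   (mx3 a b c <= 2 * `|q|)%N -> (mx3 a b c <= 2 * `|r|)%N ->
   `|lam N p q r + lam N q r p + lam N r p q| <= 200 * (l / L ^+ 2).
  move=> r0 q0 em en es hq hr.
  rewrite /lam -(r1 p q r) (r1 r p q) -em -/L NL -en small /= !ifF; last first.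
  - by apply/negbTE; move: hr mx0; clear; lia.
  - by apply/negbTE; move: hq mx0; clear; lia.
  rewrite addr0.
  have hq' : L / 2 <= ab R q by rewrite ler_pdivrMr// -natrM ler_nat mulnC.
  have hr' : L / 2 <= ab R r by rewrite ler_pdivrMr// -natrM ler_nat mulnC.
  have := ratio_lip N1 L0 hr' hq'; rewrite -/(br N r) -/(br N q).
  have -> : `|ab R r - ab R q| = l.
    rewrite /l en /ab; have [qp|qn] := leP 0 q.
      have -> : `|r|%N%:R = (- r)%:~R :> R.
        by rewrite pmulrn abszE ler0_norm//; move: qp small hr mx0 es; rewrite en; clear; lia.
      rewrite (_ : `|q|%N%:R = q%:~R :> R); last by rewrite pmulrn abszE ger0_norm.
      by rewrite -intrB (_ : - r - q = p) ?nab//; move: es; clear; lia.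
    have -> : `|r|%N%:R = r%:~R :> R.
      by rewrite pmulrn abszE ger0_norm//; move: qn small hr mx0 es; rewrite en; clear; lia.
    rewrite (_ : `|q|%N%:R = (- q)%:~R :> R); last by rewrite pmulrn abszE ltr0_norm.
    by rewrite -intrB (_ : r - - q = - p) ?rmorphN ?normrN ?nab//; move: es; clear; lia.
  have -> : `|r%:~R / br N r ^+ 2 + q%:~R / br N q ^+ 2| = `|ab R r / br N r ^+ 2 - ab R q / br N q ^+ 2|.
    have [qp|qn] := leP 0 q.
      have -> : ab R r = (- r)%:~R.
        by rewrite /ab pmulrn abszE ler0_norm//; move: qp small hr mx0 es; rewrite en; clear; lia.
      rewrite (_ : ab R q = q%:~R :> R); last by rewrite /ab pmulrn abszE ger0_norm.
      by rewrite rmorphN /= -normrN; congr `| _ |; ring.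
    have -> : ab R r = r%:~R.
      by rewrite /ab pmulrn abszE ger0_norm//; move: qn small hr mx0 es; rewrite en; clear; lia.
    rewrite (_ : ab R q = (- q)%:~R :> R); last by rewrite /ab pmulrn abszE ltr0_norm.
    by rewrite rmorphN /=; congr `| _ |; ring.
  have p0 : 0 <= l / L ^+ 2 by rewrite divr_ge0 ?sqr_ge0// ltW.
  move=> h; apply: (le_trans h); lra.
have := mnmx_cases ee; rewrite !mn3N abszN; case=> -[e1 e2 e3].
- exact: core.
- rewrite (_ : _ + _ = lam N b c a + lam N c a b + lam N a b c); last by ring.
  by apply: core => //; move: e; clear; lia.
- rewrite (_ : _ + _ = lam N c a b + lam N a b c + lam N b c a); last by ring.
  by apply: core => //; move: e; clear; lia.
Qed.

End ekernels.

(** * The real inner product of complex numbers, and derivatives of energies *)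

Section dot.
Variable R : realType.
Notation C := R[i].
Implicit Types (z w : C).

Definition dot z w : R := complex.Re z * complex.Re w + complex.Im z * complex.Im w.

Lemma dotBr z w w' : dot z (w - w') = dot z w - dot z w'.
Proof. by rewrite /dot ReD ImD ReN ImN; ring. Qed.

Lemma dotDl z z' w : dot (z + z') w = dot z w + dot z' w.
Proof. by rewrite /dot ReD ImD; ring. Qed.

Lemma dot_suml (I : Type) (s : seq I) (F : I -> C) w :
  dot (\sum_(i <- s) F i) w = \sum_(i <- s) dot (F i) w.
Proof.
elim: s => [|i s IH]; first by rewrite !big_nil /dot /= !mul0r addr0.
by rewrite !big_cons dotDl IH.
Qed.

Lemma dot_le z w : `|dot z w| <= nc z * nc w.
Proof.
rewrite -[leRHS]ger0_norm ?mulr_ge0 ?nc_ge0// -ler_sqr ?nnegrE// !real_normK ?num_real//.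
rewrite exprMn !sqr_nc /dot -subr_ge0.
rewrite (_ : _ - _ = (complex.Re z * complex.Im w - complex.Im z * complex.Re w) ^+ 2) ?sqr_ge0//.
by ring.
Qed.

Lemma dot_conj (x : R) z w : dot ((0 +i* x)%C * z) w = - x * complex.Im (z * conjc w).
Proof. by case: z => a b; case: w => c e; rewrite /dot /=; ring. Qed.

Lemma dR_sqr_nc (F f : R -> C) : dC F f ->
  forall t, is_derive t (1 : R) (fun s => nc (F s) ^+ 2) (2 * dot (f t) (F t)).
Proof.
move=> dF t; have [h1 h2] := dF t.
have h1' := is_deriveM h1 h1; have h2' := is_deriveM h2 h2.
have := is_deriveD h1' h2'.
rewrite (_ : _ + _ = fun s => nc (F s) ^+ 2); last first.
  by apply/funext => s; rewrite sqr_nc !expr2.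
move=> h; apply: (@is_derive_eq _ _ _ _ _ _ _ _ h).
by rewrite /GRing.scale /= /dot; ring.
Qed.

Lemma dR_sum (I : Type) (s : seq I) (F : I -> R -> R) (f : I -> R) (t : R) :
  (forall i, is_derive t (1 : R) (F i) (f i)) ->
  is_derive t (1 : R) (fun r => \sum_(i <- s) F i r) (\sum_(i <- s) f i).
Proof.
move=> h; elim: s => [|i s IH].
  rewrite big_nil (_ : (fun r => _) = cst 0); first exact: is_derive_cst.
  by apply/funext => r; rewrite big_nil.
rewrite big_cons (_ : (fun r => _) = F i + (fun r => \sum_(j <- s) F j r)); first exact: is_deriveD.
by apply/funext => r; rewrite big_cons.
Qed.

Lemma dR_mul (c : R) (F : R -> R) (f t : R) : is_derive t (1 : R) F f ->
  is_derive t (1 : R) (fun r => c * F r) (c * f).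
Proof. by move=> h; exact: (is_deriveZ c h). Qed.

Lemma dR_tri M (m : int -> int -> int -> R) (F : int -> int -> int -> R -> R) (f : int -> int -> int -> R) t :
  (forall a b c, is_derive t (1 : R) (F a b c) (f a b c)) ->
  is_derive t (1 : R) (fun r => tri M (fun a b c => m a b c * F a b c r)) (tri M (fun a b c => m a b c * f a b c)).
Proof.
move=> h; apply: dR_sum => a; apply: dR_sum => b; apply: dR_sum => c.
by case: ifP => _; [exact: dR_mul|exact: is_derive_cst].
Qed.

End dot.

(** * Convolution sums used by the energy estimate *)

Section sums.
Variable R : realType.
Implicit Types (i j k : int) (a : int -> R).

Lemma conv_kk M (b a : int -> R) (X K : R) :
  (forall k, 0 <= a k) -> (forall k, 0 <= b k) -> 0 <= X -> 0 <= K -> ell2 a X ->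
  (forall k, b k <= K * \sum_(i <- ZM M) \sum_(j <- ZM M)
     (if i + j == k then kk R i j (- k) * (a i * a j) else 0)) ->
  ell2 b (24 * K * X ^+ 2).
Proof.
move=> a0 b0 X0 K0 ea hb.
rewrite (_ : 24 * K * X ^+ 2 = 12 * (2 * K) * (X * X)); last by ring.
apply: (@ell2_conv _ M b a a) => // [|k]; first by rewrite mulr_ge0.
apply: (le_trans (hb k)); rewrite [2 * K]mulrC -mulrA; apply: ler_wpM2l => //.
set S1 := (Y in 2 * Y); have -> : 2 * S1 = S1 + S1 by ring.
have e : S1 = \sum_(i <- ZM M) \sum_(j <- ZM M) (if i + j == k then kap3 R j i (- k) * (a i * a j) else 0).
  rewrite /S1 exchange_big; apply: eq_bigr => i _; apply: eq_bigr => j _.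
  by rewrite (addrC j i) [a j * a i]mulrC.
rewrite {2}e /S1 -big_split; apply: ler_sum => i _ /=.
rewrite -big_split; apply: ler_sum => j _ /=.
by case: ifP => _; rewrite ?addr0// /kk mulrDl.
Qed.

Lemma sum_ell2_mul M (x y : int -> R) (X Y : R) : 0 <= X -> 0 <= Y -> ell2 x X -> ell2 y Y ->
  \sum_(k <- ZM M) x k * y k <= X * Y.
Proof.
move=> X0 Y0 ex ey; apply: (le_trans (cauchy_schwarz_sqrt _ _ _)).
by apply: ler_pM; rewrite ?sqrtr_ge0// sqrt_ell2.
Qed.

Lemma sum_one M (e : int) (c : R) : 0 <= c -> \sum_(j <- ZM M) (if j == e then c else 0) <= c.
Proof. by move=> c0; rewrite (sum_eq_ZM M e (fun=> c)); case: ifP. Qed.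

Lemma conv_pt M a (X : R) k : ell2 a X ->
  \sum_(i <- ZM M) \sum_(j <- ZM M) (if i + j == k then a i * a j else 0) <= X ^+ 2.
Proof.
move=> ea.
have h1 : \sum_(i <- ZM M) \sum_(j <- ZM M) (if i + j == k then a i ^+ 2 else 0) <= X ^+ 2.
  apply: le_trans (ea M); apply: ler_sum => i _.
  apply: le_trans (@sum_one M (k - i) (a i ^+ 2) (sqr_ge0 _)); apply: ler_sum => j _.
  by rewrite (_ : (i + j == k) = (j == k - i))//; apply/eqP/eqP => [<-|->]; ring.
have h2 : \sum_(i <- ZM M) \sum_(j <- ZM M) (if i + j == k then a j ^+ 2 else 0) <= X ^+ 2.
  rewrite exchange_big /=; apply: le_trans h1; apply: ler_sum => i _; apply: ler_sum => j _.
  by rewrite addrC.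
have h3 : 2 * (\sum_(i <- ZM M) \sum_(j <- ZM M) (if i + j == k then a i * a j else 0)) <=
  \sum_(i <- ZM M) \sum_(j <- ZM M) (if i + j == k then a i ^+ 2 else 0) +
  \sum_(i <- ZM M) \sum_(j <- ZM M) (if i + j == k then a j ^+ 2 else 0).
  rewrite mulr_sumr -big_split; apply: ler_sum => i _ /=; rewrite mulr_sumr -big_split; apply: ler_sum => j _ /=.
  by case: ifP => _; [have := sqr_ge0 (a i - a j); lra|rewrite mulr0 addr0].
by lra.
Qed.

(** With a_i a_j <= (a_i^2 + a_j^2) / 2 and |k| / L^2 <= 1 / |i|, each a_i^2 is counted, with weight
    1 / |i|, for the outputs |k| <= |i|: at most 2 |i| + 1 <= 3 |i| of them. *)
Lemma schur M a (X : R) : ell2 a X ->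
  \sum_(k <- ZM M) \sum_(i <- ZM M) \sum_(j <- ZM M)
    (if [&& i + j == k, i != 0, j != 0, k != 0 & (8 * `|k| < mx3 i j k)%N]
     then ab R k / (mx3 i j k)%:R ^+ 2 * (a i * a j) else 0) <= 3 * X ^+ 2.
Proof.
move=> ea.
pose G i j k := if [&& i + j == k, i != 0 & (`|k| <= `|i|)%N] then (ab R i)^-1 * a i ^+ 2 else 0.
have G0 i j k : 0 <= G i j k by rewrite /G; case: ifP => // _; rewrite mulr_ge0 ?sqr_ge0 ?invr_ge0.
have h1 : \sum_(k <- ZM M) \sum_(i <- ZM M) \sum_(j <- ZM M) G i j k <= 3 * X ^+ 2.
  rewrite exchange_big /=; apply: (@le_trans _ _ (\sum_(i <- ZM M) 3 * a i ^+ 2)); last first.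
    by rewrite -mulr_sumr ler_wpM2l.
  apply: ler_sum => i _; have [->|i0] := eqVneq i 0.
    rewrite big1 => [|k _]; first by apply: mulr_ge0 => //; exact: sqr_ge0.
    by rewrite big1// => j _; rewrite /G eqxx andbF.
  have ai := ab_gt0 R i0.
  apply: (@le_trans _ _ (\sum_(k <- ZM M) if k \in ZM `|i| then (ab R i)^-1 * a i ^+ 2 else 0)).
    apply: ler_sum => k _; rewrite mem_ZM; case: ifP => hk; last first.
      by rewrite big1// => j _; rewrite /G hk !andbF.
    have := @sum_one M (k - i) ((ab R i)^-1 * a i ^+ 2); rewrite mulr_ge0 ?sqr_ge0 ?invr_ge0// => /(_ isT).
    apply: le_trans; apply: ler_sum => j _; rewrite /G i0 hk /= andbT.
    by rewrite (_ : (i + j == k) = (j == k - i))//; apply/eqP/eqP => [<-|->]; ring.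
  apply: (@le_trans _ _ (\sum_(k <- ZM `|i|) (ab R i)^-1 * a i ^+ 2)).
    rewrite -big_mkcond /= -big_filter.
    apply: (@ler_sum_inj _ _ _ _ _ id (fun=> (ab R i)^-1 * a i ^+ 2)); rewrite ?filter_uniq ?uniq_ZM//.
      by move=> _; rewrite mulr_ge0 ?sqr_ge0 ?invr_ge0.
    by move=> k; rewrite mem_filter => /andP[->].
  rewrite big_const_seq count_predT iter_addr_0 /ZM -lock size_map size_iota -[leLHS]mulr_natl [leLHS]mulrA.
  apply: ler_wpM2r; rewrite ?sqr_ge0// ler_pdivrMr// /ab -natrM ler_nat.
  by move: i0; clear; lia.
have h2 : \sum_(k <- ZM M) \sum_(i <- ZM M) \sum_(j <- ZM M) G j i k <= 3 * X ^+ 2.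
  by apply: le_trans h1; apply: ler_sum => k _; rewrite exchange_big.
set S := \sum_(k <- ZM M) _.
suff : 2 * S <= \sum_(k <- ZM M) \sum_(i <- ZM M) \sum_(j <- ZM M) G i j k +
   \sum_(k <- ZM M) \sum_(i <- ZM M) \sum_(j <- ZM M) G j i k by lra.
rewrite /S mulr_sumr -big_split; apply: ler_sum => k _ /=; rewrite mulr_sumr -big_split; apply: ler_sum => i _ /=.
rewrite mulr_sumr -big_split; apply: ler_sum => j _ /=.
case: ifP => [/and5P[e i0 j0 k0 k8]|_]; last by rewrite mulr0 addr_ge0.
have [ki kj] : (`|k| <= `|i|)%N /\ (`|k| <= `|j|)%N.
  by move: e i0 j0 k0 k8; rewrite /mx3; clear; lia.
rewrite /G (addrC j i) e i0 j0 ki kj /=.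
have L0 : 0 < (mx3 i j k)%:R :> R by rewrite ltr0n; move: k8; clear; lia.
have [iL jL kL] := mx3_le i j k.
have u q : q != 0 -> (`|k| <= `|q|)%N -> (`|q| <= mx3 i j k)%N -> ab R k / (mx3 i j k)%:R ^+ 2 <= (ab R q)^-1.
  move=> q0 kq qL; have q1 := ab_gt0 R q0.
  rewrite ler_pdivrMr ?exprn_gt0// mulrC ler_pdivlMr//; rewrite /ab -natrM -natrX ler_nat -mulnn.
  by apply: leq_mul => //; exact: leq_trans kL.
have := u i i0 ki iL; have := u j j0 kj jL.
have w0 : 0 <= ab R k / (mx3 i j k)%:R ^+ 2 by rewrite divr_ge0.
move: (ab R k / _) (ab R i)^-1 (ab R j)^-1 w0 => x y z x0 xz xy.
have h3 := mulr_ge0 x0 (sqr_ge0 (a i - a j)).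
have h4 := ler_wpM2r (sqr_ge0 (a i)) xy.
have h5 := ler_wpM2r (sqr_ge0 (a j)) xz.
rewrite sqrrB in h3; rewrite mulrDr mulrBr in h3.
have e3 : x * (a i * a j *+ 2) = 2 * (x * (a i * a j)) by ring.
by lra.
Qed.

End sums.

Section shift.
Variable R : realType.
Notation C := R[i].

Lemma dC_shift (F f : R -> C) (p : R) : dC F f -> dC (fun t => F (t + p)) (fun t => f (t + p)).
Proof.
move=> dF t; have [h1 h2] := dF (t + p).
have d1 : is_derive t (1 : R) (fun t => t + p) 1.
  have h := is_deriveD (is_derive_id t (1 : R)) (is_derive_cst p t (1 : R)).
  by apply: (@is_derive_eq _ _ _ _ _ _ _ _ h); rewrite addr0.
split.
  have := @is_derive1_comp _ (@complex.Re R \o F) (fun t => t + p) t _ _ h1 d1.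
  by rewrite mulr1.
have := @is_derive1_comp _ (@complex.Im R \o F) (fun t => t + p) t _ _ h2 d1.
by rewrite mulr1.
Qed.

Lemma dCB (F G f g : R -> C) : dC F f -> dC G g -> dC (fun t => F t - G t) (fun t => f t - g t).
Proof.
move=> h1 h2; have := dCD h1 (dCZ (-1) h2).
rewrite (_ : (fun t => F t + -1 * G t) = fun t => F t - G t); last by apply/funext => t; rewrite mulN1r.
by rewrite (_ : (fun t => f t + -1 * g t) = fun t => f t - g t)//; apply/funext => t; rewrite mulN1r.
Qed.

Lemma dC_lin (z : C) : dC (fun t : R => (t%:C)%C * z) (fun=> z).
Proof.
have h : dC (fun t : R => (t%:C)%C) (fun=> 1).
  move=> t; split => /=; [exact: is_derive_id|exact: is_derive_cst].
move=> t; have := dCM h (dC_cst z) t.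
by rewrite mul1r mulr0 addr0.
Qed.
End shift.

(** * Variation of the weighted energy over one window *)

Section window.
Variable R : realType.
Notation C := R[i].
Variables (alpha beta N0 Ca N : R) (M : nat).
Hypothesis hok : phase_ok alpha beta N0 Ca.
Hypothesis hN : N0 <= N.
Implicit Types (i j k a b c : int) (t s r : R).
Notation d := (expR (- (5 / 2) * ln N)).
Notation phase := (phase alpha beta).

Variables (w v q : int -> R -> C) (A : int -> R) (X t0 t1 : R).
Hypothesis X0 : 0 <= X.
Hypothesis hA : forall k, 0 <= A k /\ Hol (A k) (om N d k) (w k).
Hypothesis eA : ell2 (fun k => A k / br N k) X.
Hypothesis w_0 : forall t, w 0 t = 0.
Hypothesis w_conj : forall k t, w (- k) t = conjc (w k t).

Let N1 : 1 <= N. Proof. by case: hok => h _ _; exact: le_trans hN. Qed.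
Let C1 : 1 <= Ca. Proof. by case: hok. Qed.
Let Np : 0 < N. Proof. exact: lt_le_trans N1. Qed.
Let d0 : 0 < d. Proof. exact: expR_gt0. Qed.
Let Ca0 : 0 <= Ca. Proof. exact: le_trans C1. Qed.
Let A0 k : 0 <= A k. Proof. by case: (hA k). Qed.
Let br0 k : 0 < br N k. Proof. exact: br_gt0. Qed.
Let d_le1 : d <= 1.
Proof. by rewrite -[leRHS]expR0 ler_expR; have := ln_ge0 N1; lra. Qed.

Definition am k : R := A k / br N k.
Let am0 k : 0 <= am k. Proof. by rewrite divr_ge0// ltW. Qed.
Let amE k : A k = br N k * am k. Proof. by rewrite /am mulrC divfK// gt_eqF. Qed.

Lemma wcont : cont w.
Proof. by move=> k; have [_ h] := hA k; exact: Hol_cont (om_small N k d0) h. Qed.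

Definition Ph i j t : C := ce (phase i j * t) * (w i t * w j t).
Definition Pr i j := per (phase i j).
Definition EE i j := cprim (Ep alpha beta i j w w).
(** The normal form: a primitive minus its average over the following period. It has the size of the
    amplitude times a period. Its derivative is [Ph - rr], where [rr] averages the oscillating
    product over a full period and is therefore small by the modulus of continuity of [w] alone. *)
Definition nn i j t : C := Ep alpha beta i j w w t - ((Pr i j)^-1%:C)%C * (EE i j (t + Pr i j) - EE i j t).
Definition rr i j t : C := ((Pr i j)^-1%:C)%C * (Ep alpha beta i j w w (t + Pr i j) - Ep alpha beta i j w w t).
Definition hh i j k := (N < (mx3 i j k)%:R) && (8 * `|k| < mx3 i j k)%N.
Definition ok i j k := [&& i + j == k, i != 0, j != 0 & k != 0].
Definition pr (c : int -> int -> R -> C) (B : int -> int -> int -> bool) k t : C :=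
  \sum_(i <- ZM M) \sum_(j <- ZM M) (if ok i j k && B i j k then (0 +i* k%:~R)%C * c i j t else 0).

Lemma okP i j k : ok i j k -> [/\ i + j = k, i != 0, j != 0 & k != 0].
Proof. by move=> /and4P[/eqP]; split. Qed.

Lemma dC_pr (F f : int -> int -> R -> C) B k : (forall i j, dC (F i j) (f i j)) -> dC (pr F B k) (pr f B k).
Proof.
move=> h; apply: dC_sum => i; apply: dC_sum => j; case: (ok i j k && B i j k); last exact: dC_cst.
exact: dCZ.
Qed.

Lemma EpP' i j : dC (Ep alpha beta i j w w) (Ph i j).
Proof. by have [_ h] := EpP alpha beta i j wcont wcont. Qed.

Lemma nn_rr i j : dC (nn i j) (fun t => Ph i j t - rr i j t).
Proof.
have h1 := EpP' i j; have [_ h2] := cprimP (dC_cont h1).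
apply: dCB; first exact: h1.
by apply: dCZ; apply: dCB; [exact: (dC_shift _ h2)|exact: h2].
Qed.

Lemma hh_per i j k : ok i j k -> N < (mx3 i j k)%:R ->
  phase i j != 0 /\ 0 < Pr i j <= Ca * g3 R i j k.
Proof.
move=> /okP[e i0 j0 k0] h; have [_ _ hp] := hok.
have [p1 p2] := hp i j k i0 j0 k0 e (le_trans hN (ltW h)).
by split=> //; rewrite /Pr per_gt0.
Qed.

Lemma Ph_le i j t : nc (Ph i j t) <= A i * A j.
Proof.
have [_ [f1 _]] := hA i; have [_ [g1 _]] := hA j.
by rewrite /Ph !ncM nc_ce mul1r; apply: ler_pM; rewrite ?nc_ge0.
Qed.

Lemma pair_osc i j P r r' : 0 <= P -> `|r - r'| <= P ->
  nc (w i r * w j r - w i r' * w j r') <= A i * A j * (om N d i P + om N d j P).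
Proof.
move=> P0 rr'; have [_ [f1 f2]] := hA i; have [_ [g1 g2]] := hA j.
rewrite (_ : _ - _ = (w i r - w i r') * w j r + w i r' * (w j r - w j r')); last by ring.
apply: le_trans (ncD _ _) _; rewrite !ncM mulrDr; apply: lerD.
  rewrite mulrAC; apply: ler_pM; rewrite ?nc_ge0//.
  apply: le_trans (f2 _ _) _; apply: ler_wpM2l => //; apply: om_mono => //.
  by rewrite normr_ge0.
rewrite -mulrA; apply: ler_pM; rewrite ?nc_ge0//.
apply: le_trans (g2 _ _) _; apply: ler_wpM2l => //; apply: om_mono => //.
by rewrite normr_ge0.
Qed.

Lemma nn_le i j k t : ok i j k -> N < (mx3 i j k)%:R -> nc (nn i j t) <= 4 * (A i * A j) * Pr i j.
Proof.
move=> h hm; have [_ /andP[P0 _]] := hh_per h hm.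
set P := Pr i j in P0 *.
have h1 := EpP' i j; have [_ h2] := cprimP (dC_cont h1); rewrite -/(EE i j) in h2.
(* The current value of the primitive is subtracted inside the average, so that only its increments
   over less than one period remain. *)
have h3 := dCB h2 (dC_lin (Ep alpha beta i j w w t)).
have tP : t <= t + P by lra.
have := dC_mvt (M := 2 * (A i * A j) * P) tP h3.
have AA : 0 <= A i * A j by rewrite mulr_ge0.
have hE s : t <= s <= t + P -> nc (Ep alpha beta i j w w s - Ep alpha beta i j w w t) <= 2 * (A i * A j) * P.
  move=> /andP[s1 s2]; apply: le_trans (osc_triv (A := A i * A j) h1 s1 _) _.
    move=> r _; have [_ [f1 _]] := hA i; have [_ [g1 _]] := hA j.
    by rewrite ncM; apply: ler_pM; rewrite ?nc_ge0.
  by apply: ler_wpM2l; rewrite ?mulr_ge0//; lra.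
move=> /(_ hE) hm2.
have Pi0 : 0 < P^-1 by rewrite invr_gt0.
have -> : nn i j t = - ((P^-1%:C)%C * (EE i j (t + P) - ((t + P)%:C)%C * Ep alpha beta i j w w t -
   (EE i j t - (t%:C)%C * Ep alpha beta i j w w t))).
  have e : (P^-1%:C)%C * (P%:C)%C = 1 :> C.
    by apply: cplx_eq; rewrite /= ?mulr0 ?mul0r ?subr0 ?addr0// mulVf// gt_eqF.
  have eT : ((t + P)%:C)%C = (t%:C)%C + (P%:C)%C by apply: cplx_eq; rewrite /= ?addr0.
  rewrite /nn -/P eT.
  move: (Ep _ _ _ _ _ _ t) (EE i j t) (EE i j (t + P)) (t%:C)%C (P%:C)%C (P^-1%:C)%C e => E0 F0 F1 tc pc pi e.
  transitivity (pi * pc * E0 - pi * (F1 - F0)); last by ring.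
  by rewrite e mul1r.
rewrite ncN ncM nc_real gtr0_norm//.
apply: (@le_trans _ _ (P^-1 * (2 * (2 * (A i * A j) * P) * (t + P - t)))).
  by apply: ler_wpM2l => //; exact: ltW.
have -> : P^-1 * (2 * (2 * (A i * A j) * P) * (t + P - t)) = 4 * (A i * A j) * P by field; rewrite gt_eqF.
by [].
Qed.

Lemma rr_le i j k t : ok i j k -> N < (mx3 i j k)%:R ->
  nc (rr i j t) <= 2 * (A i * A j * (om N d i (Pr i j) + om N d j (Pr i j))).
Proof.
move=> h hm; have [ph /andP[P0 _]] := hh_per h hm.
have h1 := EpP' i j.
have Pi0 : 0 < (Pr i j)^-1 by rewrite invr_gt0.
rewrite /rr ncM nc_real gtr0_norm//.
rewrite mulrC ler_pdivrMr//; apply: (osc_one ph h1) => r hr.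
have /andP[r1 r2] : t <= r <= t + Pr i j := hr.
by apply: pair_osc; [exact: ltW|rewrite ger0_norm; lra].
Qed.

Lemma pr_bound (c : int -> int -> R -> C) (B : int -> int -> int -> bool) k t K : 0 <= K ->
  (forall i j, ok i j k -> B i j k -> ab R k * nc (c i j t) <= br N k * (K * kk R i j (- k) * (am i * am j))) ->
  nc (pr c B k t) <= br N k * (K * \sum_(i <- ZM M) \sum_(j <- ZM M)
     (if i + j == k then kk R i j (- k) * (am i * am j) else 0)).
Proof.
move=> K0 h; apply: le_trans (nc_sum _ _) _; rewrite mulrA mulr_sumr; apply: ler_sum => i _.
apply: le_trans (nc_sum _ _) _; rewrite mulr_sumr; apply: ler_sum => j _.
have z : 0 <= br N k * K * (if i + j == k then kk R i j (- k) * (am i * am j) else 0).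
  rewrite mulr_ge0// ?mulr_ge0 ?(ltW (br0 _))//; case: ifP => // _.
  by rewrite mulr_ge0 ?kk_ge0// mulr_ge0.
case: ifP => [/andP[ho Bh]|_]; last by rewrite nc0.
have [e _ _ _] := okP ho.
rewrite e eqxx ncM nc_i (_ : `|k%:~R| = ab R k); last by rewrite /ab -intr_norm pmulrn abszE.
by apply: (le_trans (h i j ho Bh)); rewrite !mulrA.
Qed.

(** [K1], for the normal form, contains the window length. [K2], for its remainder, does not, but
    the remainder is integrated over the window. *)
Definition K1 := 4 * Ca * d.
Definition K2 := 12 * Ca.
Definition cv k := \sum_(i <- ZM M) \sum_(j <- ZM M) (if i + j == k then kk R i j (- k) * (am i * am j) else 0).
Definition bN k := K1 * cv k.
Definition bR k := K2 * cv k.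

Lemma cv0 k : 0 <= cv k.
Proof.
apply: sumr_ge0 => i _; apply: sumr_ge0 => j _; case: ifP => // _.
by rewrite mulr_ge0 ?kk_ge0// mulr_ge0.
Qed.
Let K10 : 0 <= K1. Proof. by rewrite /K1 mulr_ge0 ?mulr_ge0// ltW. Qed.
Let K20 : 0 <= K2. Proof. by rewrite /K2 mulr_ge0. Qed.
Lemma bN0 k : 0 <= bN k. Proof. by rewrite mulr_ge0 ?cv0. Qed.
Lemma bR0 k : 0 <= bR k. Proof. by rewrite mulr_ge0 ?cv0. Qed.

Lemma ell_bN : ell2 bN (24 * K1 * X ^+ 2).
Proof. by apply: (@conv_kk R M bN am) => // k; exact: bN0. Qed.
Lemma ell_bR : ell2 bR (24 * K2 * X ^+ 2).
Proof. by apply: (@conv_kk R M bR am) => // k; exact: bR0. Qed.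

Lemma CkerE i j k (W : R) : ab R k * (A i * A j * W) = br N k * (Cker N i j k * W * (am i * am j)).
Proof. by rewrite (amE i) (amE j) /Cker; field; rewrite gt_eqF. Qed.

Lemma n_le k t : nc (pr nn hh k t) <= br N k * bN k.
Proof.
apply: pr_bound => // i j ho /andP[h1 h2].
have [e i0 j0 k0] := okP ho; have [_ hP] := hh_per ho h1.
have [k1 _ _] := ker_E34 i0 j0 k0 e N1 erefl C1 hP h1 h2.
apply: (@le_trans _ _ (ab R k * (A i * A j * (4 * Pr i j)))).
  by apply: ler_wpM2l => //; apply: (le_trans (nn_le t ho h1)); rewrite [4 * (A i * A j)]mulrC mulrA.
rewrite CkerE; apply: ler_wpM2l; first exact: ltW.
apply: ler_wpM2r; first by rewrite mulr_ge0.
by rewrite /K1; have := k1; set c := Cker _ _ _ _ * _; rewrite mulrCA -/c; lra.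
Qed.

Lemma r_le k t : nc (pr rr hh k t) <= br N k * bR k.
Proof.
apply: pr_bound => // i j ho /andP[h1 h2].
have [e i0 j0 k0] := okP ho; have [_ hP] := hh_per ho h1.
have [_ k1 _] := ker_E34 i0 j0 k0 e N1 erefl C1 hP h1 h2.
set W := om N d i (Pr i j) + om N d j (Pr i j) in k1.
apply: (@le_trans _ _ (ab R k * (A i * A j * (2 * W)))).
  by apply: ler_wpM2l => //; apply: (le_trans (rr_le t ho h1)); rewrite -/W mulrCA.
rewrite CkerE; apply: ler_wpM2l; first exact: ltW.
apply: ler_wpM2r; first by rewrite mulr_ge0.
by rewrite /K2 mulrCA; lra.
Qed.

(** Outside the removed region both inputs have brackets at most 8 [k], so the output pays for their
    weights and the bare convolution of the constants [am] is enough. *)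
Lemma Q_le k t : nc (pr Ph (fun i j k => ~~ hh i j k) k t) <= 64 * ab R k * br N k ^+ 2 * X ^+ 2.
Proof.
have K0 : 0 <= 64 * ab R k * br N k ^+ 2 by rewrite mulr_ge0 ?sqr_ge0// mulr_ge0.
apply: (@le_trans _ _ (64 * ab R k * br N k ^+ 2 *
   \sum_(i <- ZM M) \sum_(j <- ZM M) (if i + j == k then am i * am j else 0))); last first.
  by apply: ler_wpM2l => //; exact: conv_pt.
apply: le_trans (nc_sum _ _) _; rewrite mulr_sumr; apply: ler_sum => i _.
apply: le_trans (nc_sum _ _) _; rewrite mulr_sumr; apply: ler_sum => j _.
case: ifP => [/andP[ho]|_]; last first.
  by rewrite nc0 mulr_ge0//; case: ifP => // _; rewrite mulr_ge0.
have [e i0 j0 k0] := okP ho; rewrite e eqxx negb_and -leNgt -leqNgt => hb.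
rewrite ncM nc_i (_ : `|k%:~R| = ab R k); last by rewrite /ab -intr_norm pmulrn abszE.
apply: (@le_trans _ _ (ab R k * (A i * A j))); first by apply: ler_wpM2l => //; exact: Ph_le.
rewrite (amE i) (amE j).
have [iL jL kL] := mx3_le i j k.
have u m : (`|m| <= mx3 i j k)%N -> br N m <= 8 * br N k.
  move=> hm; rewrite /br ge_max; apply/andP; split.
    by apply: (@le_trans _ _ (8 * N)); [have := Np; lra|rewrite ler_pM2l// le_max lexx].
  apply: (@le_trans _ _ (mx3 i j k)%:R); first by rewrite ler_nat.
  case/orP: hb => hb.
    apply: (le_trans hb); apply: (@le_trans _ _ (8 * N)); [have := Np; lra|].
    by rewrite ler_pM2l// le_max lexx.
  apply: (@le_trans _ _ (8 * ab R k)); first by rewrite /ab -natrM ler_nat.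
  by rewrite ler_pM2l// le_max lexx orbT.
have -> : ab R k * (br N i * am i * (br N j * am j)) = (br N i * br N j) * (ab R k * (am i * am j)) by ring.
have -> : 64 * ab R k * br N k ^+ 2 * (am i * am j) = (8 * br N k * (8 * br N k)) * (ab R k * (am i * am j)) by ring.
apply: ler_wpM2r; first by apply: mulr_ge0 => //; apply: mulr_ge0.
by apply: ler_pM; first [exact: ltW|exact: u].
Qed.

(** The quartic error pairs the normal form with [Q_le], whose bound contains |k|; hence this sum of
    absolute values with the factor |k|. *)
Lemma T2_le t : \sum_(k <- ZM M) ab R k * nc (pr nn hh k t) <= 12 * Ca * X ^+ 2.
Proof.
have -> : 12 * Ca * X ^+ 2 = 4 * Ca * (3 * X ^+ 2) by ring.
apply: (@le_trans _ _ (4 * Ca * \sum_(k <- ZM M) \sum_(i <- ZM M) \sum_(j <- ZM M)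
    (if [&& i + j == k, i != 0, j != 0, k != 0 & (8 * `|k| < mx3 i j k)%N]
     then ab R k / (mx3 i j k)%:R ^+ 2 * (am i * am j) else 0))); last first.
  by apply: ler_wpM2l; [rewrite mulr_ge0|exact: schur].
rewrite mulr_sumr; apply: ler_sum => k _.
apply: (le_trans (ler_wpM2l (ler0n _ _) (nc_sum _ _))); rewrite !mulr_sumr; apply: ler_sum => i _.
apply: (le_trans (ler_wpM2l (ler0n _ _) (nc_sum _ _))); rewrite !mulr_sumr; apply: ler_sum => j _.
case: ifP => [/andP[ho /andP[h1 h2]]|_]; last first.
  rewrite nc0 mulr0; apply: mulr_ge0; first by rewrite mulr_ge0.
  by case: ifP => // _; apply: mulr_ge0; [apply: divr_ge0 => //; exact: sqr_ge0|exact: mulr_ge0].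
have [e i0 j0 k0] := okP ho; have [_ hP] := hh_per ho h1.
have [_ _ k1] := ker_E34 i0 j0 k0 e N1 erefl C1 hP h1 h2.
rewrite ifT; last by rewrite e eqxx i0 j0 k0 h2.
rewrite ncM nc_i (_ : `|k%:~R| = ab R k); last by rewrite /ab -intr_norm pmulrn abszE.
apply: (@le_trans _ _ (ab R k * (ab R k * (4 * (A i * A j) * Pr i j)))).
  by do 2 apply: ler_wpM2l => //; exact: nn_le _ ho h1.
rewrite (amE i) (amE j).
have -> : ab R k * (ab R k * (4 * (br N i * am i * (br N j * am j)) * Pr i j)) =
   4 * (am i * am j) * (ab R k ^+ 2 * (br N i * br N j) * Pr i j) by ring.
have -> : 4 * Ca * (ab R k / (mx3 i j k)%:R ^+ 2 * (am i * am j)) =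
   4 * (am i * am j) * (Ca * (ab R k / (mx3 i j k)%:R ^+ 2)) by ring.
by apply: ler_wpM2l => //; do 2 apply: mulr_ge0 => //.
Qed.

(** On triples of zero sum this product and its phase are invariant under rotation ([Sp_rot]), which
    allows the multipliers of the three positions to be added before any estimate. *)
Definition Sp a b c t : C := ce (phase a b * t) * (w a t * (w b t * w c t)).
Definition S3 a b c := cprim (Sp a b c).
Definition lsum a b c := lam N a b c + lam N b c a + lam N c a b.
(** The cubic part of the energy variation, integrated in time. It is subtracted from the energy
    before differentiation and estimated afterwards as an oscillatory integral. *)
Definition H t := 2 / 3 * tri M (fun a b c => lsum a b c * complex.Im (S3 a b c t)).

Lemma Sp_cont a b c : cC (Sp a b c).
Proof. by apply: cCM; [exact: cC_ce|apply: cCM; [exact: wcont|apply: cCM; exact: wcont]]. Qed.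

Lemma S3P a b c : dC (S3 a b c) (Sp a b c).
Proof. by have [_ h] := cprimP (Sp_cont a b c). Qed.

Lemma Sp_rot a b c t : a + b + c = 0 -> Sp a b c t = Sp b c a t.
Proof.
move=> e; rewrite /Sp (_ : phase a b = phase b c); last first.
  have e1 : c = - (a + b) by move: e; clear; lia.
  by rewrite /phase e1 !rmorphD /= !rmorphN /= !rmorphD /=; ring.
by ring.
Qed.

(** By reality, testing against w_k is multiplying by w_c with c = -k. Rotation invariance then
    replaces the multiplier by the mean of its three rotations: 2 [lam] becomes 2/3 [lsum]. *)
Lemma cubic t : \sum_(k <- ZM M) 2 * br N k ^- 2 * dot (pr Ph (fun i j k => ~~ hh i j k) k t) (w k t) =
  2 / 3 * tri M (fun a b c => lsum a b c * complex.Im (Sp a b c t)).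
Proof.
have -> : tri M (fun a b c => lsum a b c * complex.Im (Sp a b c t)) =
   3 * tri M (fun a b c => lam N a b c * complex.Im (Sp a b c t)).
  have e1 : tri M (fun a b c => lam N a b c * complex.Im (Sp a b c t)) =
            tri M (fun a b c => lam N b c a * complex.Im (Sp a b c t)).
    by rewrite tri_rot; apply: eq_tri => a b c _ _ _ e; rewrite (Sp_rot t e).
  have e2 : tri M (fun a b c => lam N a b c * complex.Im (Sp a b c t)) =
            tri M (fun a b c => lam N c a b * complex.Im (Sp a b c t)).
    rewrite e1 tri_rot; apply: eq_tri => a b c _ _ _ e; rewrite (Sp_rot t e)//.
  rewrite (_ : 3 * _ = tri M (fun a b c => lam N a b c * complex.Im (Sp a b c t)) +
     tri M (fun a b c => lam N a b c * complex.Im (Sp a b c t)) + tri M (fun a b c => lam N a b c * complex.Im (Sp a b c t))); last by ring.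
  rewrite {2}e1 {2}e2 -!triD; apply: eq_tri => a b c _ _ _ _.
  by rewrite /lsum !mulrDl.
rewrite (_ : 2 / 3 * (3 * _) = 2 * tri M (fun a b c => lam N a b c * complex.Im (Sp a b c t))); last by field.
rewrite -(sum_ZM_opp M) mulr_sumr.
under [RHS]eq_bigr => a _ do rewrite exchange_big.
rewrite -mulr_sumr exchange_big /= mulr_sumr; apply: eq_bigr => c _.
rewrite /pr dot_suml !mulr_sumr; apply: eq_bigr => i _.
rewrite dot_suml !mulr_sumr; apply: eq_bigr => j _.
have -> : br N (- c) = br N c by rewrite /br /ab abszN.
have dot0 z : dot 0 z = 0 :> R by rewrite /dot /= !mul0r addr0.
have z0 k : k = 0 -> w k t = 0 by move=> ->; exact: w_0.
have [e|ne] := eqVneq (i + j + c) 0; last first.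
  rewrite /ok (_ : (i + j == - c) = false) ?dot0 ?mulr0//.
  by apply/negbTE; rewrite -subr_eq0 opprK.
have [i0|i0] := eqVneq i 0.
  by rewrite /ok i0 eqxx andbF dot0 /Sp (z0 0)// ?mul0r ?mulr0 /= ?mulr0 ?mul0r.
have [j0|j0] := eqVneq j 0.
  by rewrite /ok j0 eqxx !andbF dot0 /Sp (z0 0)// ?mul0r ?mulr0 /= ?mulr0 ?mul0r.
have [c0|c0] := eqVneq c 0.
  by rewrite /ok c0 oppr0 eqxx !andbF dot0 /Sp (z0 0)// ?mulr0 /= ?mulr0 ?mul0r.
rewrite /ok i0 j0 oppr_eq0 c0 (_ : (i + j == - c) = true); last by rewrite -subr_eq0 opprK e.
rewrite /= /hh mn3N abszN /lam; case: ifP => [/negbTE ->|/negbFE ->]; last by rewrite dot0 mul0r !mulr0.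
rewrite dot_conj w_conj conjcK rmorphN /= opprK.
rewrite (_ : Sp i j c t = Ph i j t * w c t); last by rewrite /Sp /Ph; ring.
by ring.
Qed.

Lemma tri_kk : tri M (fun a b c => kk R a b c * (am a * (am b * am c))) <= 24 * X ^+ 3.
Proof.
have h := @tri_kap R M am am am X X X am0 am0 am0 X0 X0 X0 eA eA eA.
have e1 : tri M (fun a b c => kk R a b c * (am a * (am b * am c))) =
   tri M (fun a b c => kap3 R a b c * (am a * am b * am c)) + tri M (fun a b c => kap3 R b a c * (am b * am a * am c)).
  by rewrite -triD; apply: eq_tri => a b c _ _ _ _; rewrite /kk; ring.
rewrite e1 -(triC12 M (fun a b c => kap3 R a b c * (am a * am b * am c))).
by have e3 : X ^+ 3 = X * X * X; [ring|rewrite e3; lra].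
Qed.

(** Triples below [N] cancel exactly. For the others [osc] applies: by [ker_E12] the boundary terms
    cost 2 and the interior terms, over a time at most [d], cost 12, which gives the 14; [tri_kk]
    sums them. *)
Lemma H_incr s t : s <= t -> t - s <= d -> `|H t - H s| <= 2 / 3 * (200 * (14 * Ca * d) * (24 * X ^+ 3)).
Proof.
move=> st td.
rewrite /H -mulrBr (_ : tri M _ - tri M _ = tri M (fun a b c => lsum a b c * complex.Im (S3 a b c t - S3 a b c s))); last first.
  rewrite -[X in _ - X]mul1r -mulNr -triZ -triD; apply: eq_tri => a b c _ _ _ _.
  by rewrite ImD ImN; ring.
rewrite normrM ger0_norm; last by lra.
have X3 : 0 <= X ^+ 3 by rewrite exprn_ge0.
apply: ler_wpM2l; first lra.
apply: le_trans (tri_norm _ _) _.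
have K0 : 0 <= 200 * (14 * Ca * d) by rewrite mulr_ge0// mulr_ge0 ?(ltW d0)// mulr_ge0.
apply: le_trans (ler_wpM2l K0 tri_kk); rewrite -triZ; apply: ler_tri => a b c _ _ _ e.
rewrite normrM.
have am3 : 0 <= am a * (am b * am c) by apply: mulr_ge0 => //; apply: mulr_ge0.
have nn0 : 0 <= 200 * (14 * Ca * d) * (kk R a b c * (am a * (am b * am c))).
  by apply: mulr_ge0 => //; apply: mulr_ge0 => //; exact: kk_ge0.
have z0 : (a == 0) || (b == 0) || (c == 0) -> S3 a b c t - S3 a b c s = 0.
  move=> h; have -> : S3 a b c = fun=> 0; last by rewrite subrr.
  apply: cprim_uniq => //; first exact: Sp_cont.
  apply: dC_ext (dC_cst 0) => r; rewrite /Sp.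
  by case/orP: h => [/orP[]|] /eqP ->; rewrite w_0 ?mul0r ?mulr0 ?mul0r ?mulr0.
have [h|] := boolP ((a == 0) || (b == 0) || (c == 0)); first by rewrite z0// normr0 mulr0.
rewrite !negb_or => /andP[/andP[a0 b0] c0].
have [l1 l2] := lam_sum N1 a0 b0 c0 e; rewrite -/(lsum a b c) in l1 l2.
have [LN|NL] := leP (mx3 a b c)%:R N; first by rewrite l1// normr0 mul0r.
have e' : a + b = - c by move: e; clear; lia.
have oo : ok a b (- c) by rewrite /ok e' eqxx a0 b0 oppr_eq0.
have := hh_per oo; rewrite mn3N => /(_ NL) [ph].
have -> : g3 R a b (- c) = g3 R a b c by rewrite /g3 !mn3N.
move=> hP; have /andP[P0 _] := hP; set P := Pr a b in hP P0.
have [k1 k2] := ker_E12 a0 b0 c0 e N1 erefl C1 hP NL.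
set om3 := om N d a P + (om N d b P + om N d c P) in k2.
have om30 : 0 <= om3 by apply: addr_ge0; [|apply: addr_ge0]; apply: om_ge0 => //; exact: ltW.
have AA : 0 <= A a * (A b * A c) by apply: mulr_ge0 => //; apply: mulr_ge0.
have osc3 : nc (S3 a b c t - S3 a b c s) <= 2 * (A a * (A b * A c)) * P + 2 * (A a * (A b * A c) * om3) * (t - s).
  have [_ [f1 f2]] := hA a; have [_ [g1 g2]] := hA b; have [_ [h1 h2]] := hA c.
  apply: (osc ph (@S3P a b c) st) => [|r _|r r' _ _ rr']; first by rewrite mulr_ge0.
    by rewrite !ncM; apply: ler_pM; rewrite ?mulr_ge0 ?nc_ge0//; apply: ler_pM; rewrite ?nc_ge0.
  rewrite (_ : _ - _ = w a r * w b r * (w c r - w c r') + (w a r * w b r - w a r' * w b r') * w c r'); last by ring.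
  have eW : A a * (A b * A c) * om3 = A a * A b * (A c * om N d c P) +
      A a * A b * (om N d a P + om N d b P) * A c.
    by rewrite /om3; move: (om N d a P) (om N d b P) (om N d c P) => x y z; ring.
  rewrite eW; apply: le_trans (ncD _ _) _; apply: lerD; rewrite ncM.
    rewrite ncM; apply: ler_pM; rewrite ?mulr_ge0 ?nc_ge0//; first by apply: ler_pM; rewrite ?nc_ge0.
    apply: le_trans (h2 _ _) _; apply: ler_wpM2l => //; apply: om_mono => //.
    by rewrite normr_ge0.
  by apply: ler_pM; rewrite ?nc_ge0//; apply: pair_osc => //; exact: ltW.
have Im1 := Im_le (S3 a b c t - S3 a b c s).
set ll := (mn3 a b c)%:R / (mx3 a b c)%:R ^+ 2 in k1 k2 l2.
set bbb := br N a * (br N b * br N c) in k1 k2.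
have -> : 200 * (14 * Ca * d) * (kk R a b c * (am a * (am b * am c))) =
   200 * (2 * (Ca * d * kk R a b c) + 2 * (6 * Ca * kk R a b c) * d) * (am a * (am b * am c)) by ring.
have ll0 : 0 <= ll by rewrite divr_ge0 ?sqr_ge0.
apply: (@le_trans _ _ (200 * ll * (2 * (A a * (A b * A c)) * P + 2 * (A a * (A b * A c) * om3) * d))).
  apply: ler_pM => //; apply: (le_trans Im1); apply: (le_trans osc3); rewrite lerD2l.
  by apply: ler_wpM2l => //; apply: mulr_ge0 => //; apply: mulr_ge0.
have -> : A a * (A b * A c) = bbb * (am a * (am b * am c)) by rewrite !amE /bbb; ring.
have -> : 200 * ll * (2 * (bbb * (am a * (am b * am c))) * P + 2 * (bbb * (am a * (am b * am c)) * om3) * d) =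
  200 * (2 * (ll * bbb * P) + 2 * (ll * bbb * om3) * d) * (am a * (am b * am c)) by ring.
apply: ler_wpM2r => //; rewrite ler_pM2l//; apply: lerD; first by rewrite ler_pM2l.
by rewrite ler_pM2r// ler_pM2l.
Qed.

Hypothesis t01 : t0 <= t1.
Hypothesis td : t1 - t0 <= d.
Hypothesis dv : forall k, dC (v k) (q k).
Hypothesis vw : forall k t, t0 <= t <= t1 -> v k t = w k t.
Hypothesis vq : forall k t, k \in ZM M -> t0 <= t <= t1 -> q k t = pr Ph (fun _ _ _ => true) k t.

Definition Eb t := \sum_(k <- ZM M) (nc (w k t) / br N k) ^+ 2.
(** The energy of the normal form variable. It is written with [v], differentiable at all times,
    which agrees on the window with the stopped field [w]. *)
Definition Ey t := \sum_(k <- ZM M) br N k ^- 2 * nc (v k t - pr nn hh k t) ^+ 2.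

Lemma pr_split k t : pr Ph (fun _ _ _ => true) k t - pr (fun i j t => Ph i j t - rr i j t) hh k t =
  pr Ph (fun i j k => ~~ hh i j k) k t + pr rr hh k t.
Proof.
apply/eqP; rewrite subr_eq; apply/eqP; rewrite /pr -!big_split; apply: eq_bigr => i _ /=.
rewrite -!big_split; apply: eq_bigr => j _ /=; case: (ok i j k); case: (hh i j k) => /=; ring.
Qed.

Let w_le k t : nc (w k t) <= br N k * am k.
Proof. by rewrite -amE; have [_ [h _]] := hA k. Qed.

(** A difference of squares x^2 - y^2 in which |x - y| is at most the normal form, which carries the
    factor [d] through [K1]. *)
Lemma Ey_Eb t : t0 <= t <= t1 -> `|Ey t - Eb t| <= 24 * K1 * X ^+ 2 * (2 * X + 24 * K1 * X ^+ 2).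
Proof.
move=> ht; rewrite /Ey /Eb -sumrB.
have X20 : 0 <= 24 * K1 * X ^+ 2 by rewrite mulr_ge0 ?sqr_ge0// mulr_ge0.
have e2 : ell2 (fun k => 2 * am k + bN k) (2 * X + 24 * K1 * X ^+ 2).
  by apply: ell2D => //; [rewrite mulr_ge0|exact: ell2Z|exact: ell_bN].
have S0 : 0 <= 2 * X + 24 * K1 * X ^+ 2 by rewrite addr_ge0// mulr_ge0.
apply: le_trans (sum_ell2_mul M X20 S0 ell_bN e2).
apply: le_trans (ler_norm_sum _ _ _) _; apply: ler_sum => k _.
rewrite vw// expr_div_n [X in _ - X]mulrC -mulrBr normrM ger0_norm ?invr_ge0 ?sqr_ge0//.
rewrite mulrC ler_pdivrMr ?exprn_gt0//.
have h1 := n_le k t; have h2 := w_le k t.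
have n1 := nc_ge0 (w k t - pr nn hh k t); have n2 := nc_ge0 (w k t); have n3 := nc_ge0 (pr nn hh k t).
have t1' := ncB (w k t) (pr nn hh k t).
have t2' : nc (w k t) <= nc (w k t - pr nn hh k t) + nc (pr nn hh k t).
  by rewrite -{1}[w k t](subrK (pr nn hh k t)) ncD.
have b0 := br0 k.
set x := nc (w k t - _) in n1 t1' t2' *; set y := nc (w k t) in h2 n2 t1' t2' *; set z := nc (pr _ _ _ _) in h1 n3 t1' t2'.
have -> : bN k * (2 * am k + bN k) * br N k ^+ 2 = br N k * bN k * (2 * (br N k * am k) + br N k * bN k) by ring.
apply: (@le_trans _ _ (z * (2 * y + z))).
  rewrite (_ : x ^+ 2 - y ^+ 2 = (x - y) * (x + y)); last by ring.
  rewrite normrM [`|x + y|]ger0_norm ?addr_ge0//; apply: ler_pM; rewrite ?addr_ge0//.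
    by rewrite ler_norml; apply/andP; split; lra.
  by lra.
by apply: ler_pM; rewrite ?addr_ge0 ?mulr_ge0//; apply: lerD => //; rewrite ler_pM2l.
Qed.

Definition Cen := 2 / 3 * (200 * (14 * Ca) * 24) + 2 * (96 * Ca * (2 + 96 * Ca)) + (128 * (12 * Ca) + 2 * (24 * (12 * Ca)) * (1 + 96 * Ca)).

(** The derivative of [Ey - H] consists of the remainder [rr] tested against the corrected field,
    and of the kept interactions tested against the normal form. Both are at most a multiple of X^3
    at each time, hence d X^3 over the window, like [Ey - Eb] and the increment of [H]. The
    condition X <= 1 turns fourth powers into cubes. *)
Lemma energy_window t : X <= 1 -> t0 <= t <= t1 -> `|Eb t - Eb t0| <= Cen * d * X ^+ 3.
Proof.
move=> X1 /andP[t0t tt1].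
have X30 : 0 <= X ^+ 3 by rewrite exprn_ge0.
have X20 : 0 <= X ^+ 2 by rewrite exprn_ge0.
have X43 : X ^+ 4 <= X ^+ 3 by rewrite exprS ler_piMl.
have d0' := d0; have d1 := d_le1; have Ca0' := Ca0.
have B t' : t0 <= t' <= t1 -> `|Ey t' - Eb t'| <= 96 * Ca * (2 + 96 * Ca) * d * X ^+ 3.
  move=> h; apply: (le_trans (Ey_Eb h)).
  rewrite /K1 (_ : 24 * (4 * Ca * d) * X ^+ 2 * (2 * X + 24 * (4 * Ca * d) * X ^+ 2) =
    (96 * Ca * d) * (2 * X ^+ 3 + 96 * Ca * (d * X ^+ 4))); last by ring.
  rewrite (_ : 96 * Ca * (2 + 96 * Ca) * d * X ^+ 3 = (96 * Ca * d) * (2 * X ^+ 3 + 96 * Ca * X ^+ 3)); last by ring.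
  apply: ler_wpM2l; first by rewrite mulr_ge0 ?(ltW d0)// mulr_ge0.
  rewrite lerD2l; apply: ler_wpM2l; first by rewrite mulr_ge0.
  by apply: le_trans X43; rewrite ler_piMl// exprn_ge0.
have dy k : dC (fun t => v k t - pr nn hh k t) (fun t => q k t - pr (fun i j t => Ph i j t - rr i j t) hh k t).
  by apply: dCB => //; apply: dC_pr => i j; exact: nn_rr.
pose g s := \sum_(k <- ZM M) br N k ^- 2 * (2 * dot (q k s - pr (fun i j t => Ph i j t - rr i j t) hh k s) (v k s - pr nn hh k s))
   - 2 / 3 * tri M (fun a b c => lsum a b c * complex.Im (Sp a b c s)).
have dE s : is_derive s (1 : R) (fun t => Ey t - H t) (g s).
  have h1 : is_derive s (1 : R) Ey (\sum_(k <- ZM M) br N k ^- 2 * (2 * dot (q k s - pr (fun i j t => Ph i j t - rr i j t) hh k s) (v k s - pr nn hh k s))).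
    by apply: dR_sum => k; apply: dR_mul; exact: dR_sqr_nc (dy k) s.
  have h2 : is_derive s (1 : R) H (2 / 3 * tri M (fun a b c => lsum a b c * complex.Im (Sp a b c s))).
    by apply: dR_mul; apply: dR_tri => a b c; have [] := S3P a b c s.
  exact: (is_deriveB h1 h2).
have hg s : t0 <= s <= t -> `|g s| <= (128 * (12 * Ca) + 2 * (24 * (12 * Ca)) * (1 + 96 * Ca)) * X ^+ 3.
  move=> /andP[s0 s1]; have hs : t0 <= s <= t1 by rewrite s0 (le_trans s1).
  (* By [cubic] the derivative of [H] is the product of the kept interactions with [w] itself, which
     cancels. *)
  have -> : g s = \sum_(k <- ZM M) 2 * br N k ^- 2 *
     (dot (pr rr hh k s) (w k s - pr nn hh k s) - dot (pr Ph (fun i j k => ~~ hh i j k) k s) (pr nn hh k s)).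
    rewrite /g -cubic -sumrB big_seq [RHS]big_seq; apply: eq_bigr => k kM.
    by rewrite vq// vw// pr_split dotDl !dotBr; ring.
  have -> : (128 * (12 * Ca) + 2 * (24 * (12 * Ca)) * (1 + 96 * Ca)) * X ^+ 3 = 128 * (12 * Ca) * X ^+ 3 + 2 * (24 * (12 * Ca)) * (1 + 96 * Ca) * X ^+ 3 by ring.
  under eq_bigr => k _ do rewrite mulrBr.
  rewrite sumrB addrC; apply: le_trans (ler_normD _ _) _; rewrite normrN; apply: lerD.
    apply: le_trans (ler_norm_sum _ _ _) _.
    apply: (@le_trans _ _ (128 * X ^+ 2 * \sum_(k <- ZM M) ab R k * nc (pr nn hh k s))).
      rewrite mulr_sumr; apply: ler_sum => k _.
      have bi : 0 <= br N k ^- 2 by rewrite invr_ge0 exprn_ge0// ltW.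
      rewrite normrM ger0_norm ?mulr_ge0//.
      apply: (@le_trans _ _ (2 * br N k ^- 2 * (64 * ab R k * br N k ^+ 2 * X ^+ 2 * nc (pr nn hh k s)))).
        apply: ler_wpM2l; first by rewrite mulr_ge0.
        by apply: (le_trans (dot_le _ _)); apply: ler_wpM2r; [exact: nc_ge0|exact: Q_le].
      by rewrite le_eqVlt; apply/orP; left; apply/eqP; field; rewrite gt_eqF.
    apply: (@le_trans _ _ (128 * X ^+ 2 * (12 * Ca * X ^+ 2))).
      by apply: ler_wpM2l; [rewrite mulr_ge0|exact: T2_le].
    rewrite (_ : 128 * X ^+ 2 * (12 * Ca * X ^+ 2) = 128 * (12 * Ca) * X ^+ 4); last by ring.
    by apply: ler_wpM2l => //; rewrite mulr_ge0.
  have R0 : 0 <= 24 * K2 * X ^+ 2 by rewrite mulr_ge0// mulr_ge0.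
  have N0' : 0 <= 24 * K1 * X ^+ 2 by rewrite mulr_ge0// mulr_ge0.
  have e2 : ell2 (fun k => am k + bN k) (X + 24 * K1 * X ^+ 2) by apply: ell2D => //; exact: ell_bN.
  apply: (@le_trans _ _ (2 * (24 * K2 * X ^+ 2 * (X + 24 * K1 * X ^+ 2)))); last first.
    rewrite /K1 /K2 (_ : 2 * (24 * (12 * Ca) * X ^+ 2 * (X + 24 * (4 * Ca * d) * X ^+ 2)) =
      2 * (24 * (12 * Ca)) * (X ^+ 3 + 96 * Ca * (d * X ^+ 4))); last by ring.
    rewrite -[leRHS]mulrA; apply: ler_wpM2l; first by do 3! apply: mulr_ge0 => //.
    rewrite [leRHS]mulrDl [1 * X ^+ 3]mul1r lerD2l; apply: ler_wpM2l; first by rewrite mulr_ge0.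
    by apply: le_trans X43; rewrite ler_piMl// exprn_ge0.
  have := sum_ell2_mul M R0 (addr_ge0 X0 N0') ell_bR e2 => /(ler_wpM2l (ler0n _ 2)); apply: le_trans.
  rewrite mulr_sumr; apply: le_trans (ler_norm_sum _ _ _) _; apply: ler_sum => k _.
  have bi : 0 <= br N k ^- 2 by rewrite invr_ge0 exprn_ge0// ltW.
  rewrite normrM ger0_norm ?mulr_ge0// -mulrA ler_pM2l//.
  apply: (@le_trans _ _ (br N k ^- 2 * (br N k * bR k * (br N k * am k + br N k * bN k)))).
    apply: ler_wpM2l => //; apply: (le_trans (dot_le _ _)); apply: ler_pM; rewrite ?nc_ge0 ?r_le//.
    by apply: (le_trans (ncB _ _)); apply: lerD; [exact: w_le|exact: n_le].
  by rewrite le_eqVlt; apply/orP; left; apply/eqP; field; rewrite gt_eqF.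
have := mvt_le t0t dE hg.
have b1 := B t _; have b2 := B t0 _; rewrite lexx t01 in b2; rewrite t0t tt1 in b1.
have {}b1 := b1 isT; have {}b2 := b2 isT.
have td' : t - t0 <= d by apply: le_trans td; rewrite lerD2r.
have b3 := H_incr t0t td'.
have b4 : (128 * (12 * Ca) + 2 * (24 * (12 * Ca)) * (1 + 96 * Ca)) * X ^+ 3 * (t - t0) <= (128 * (12 * Ca) + 2 * (24 * (12 * Ca)) * (1 + 96 * Ca)) * X ^+ 3 * d.
  apply: ler_wpM2l => //; apply: mulr_ge0 => //.
  by apply: addr_ge0; [|apply: mulr_ge0; [|apply: addr_ge0 => //]]; do ?apply: mulr_ge0 => //.
move=> b5; have b6 := le_trans b5 b4.
have -> : Cen * d * X ^+ 3 = 96 * Ca * (2 + 96 * Ca) * d * X ^+ 3 + 96 * Ca * (2 + 96 * Ca) * d * X ^+ 3 +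
  2 / 3 * (200 * (14 * Ca * d) * (24 * X ^+ 3)) + (128 * (12 * Ca) + 2 * (24 * (12 * Ca)) * (1 + 96 * Ca)) * X ^+ 3 * d by rewrite /Cen; ring.
move: b1 b2 b3 b6.
set u1 := 96 * Ca * _ * _ * _; set u2 := 2 / 3 * _; set u3 := _ * X ^+ 3 * d.
rewrite !ler_norml => /andP[? ?] /andP[? ?] /andP[? ?] /andP[? ?]; apply/andP; split; lra.
Qed.

End window.

(** * Limits of Galerkin operators *)

Section gauges.
Variable R : realType.
Notation C := R[i].
Implicit Types (v f g : int -> R -> C) (i j k : int) (c a b : R).

Lemma bd_conv (w w' : int -> R) (O O' : int -> R -> R) v c a b :
  (forall k, 0 < w k) -> (forall k, 0 < w' k) -> (forall k, gpos (O' k)) ->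
  0 <= a -> 1 <= b -> (forall k, w' k <= a * w k) -> (forall k h, 0 <= h -> O k h <= b * O' k h) ->
  bd w O v c -> bd w' O' v (a * (b * c)).
Proof.
move=> w0 w0' O0 a0 b1 hw hO [c0 [A hA eA]].
have b0 : 0 <= b by lra.
split; first by rewrite !mulr_ge0.
exists (fun k => b * A k) => [k|].
  have [A0 [h1 h2]] := hA k; split; first exact: mulr_ge0.
  split=> [t|t s]; first by apply: (le_trans (h1 t)); rewrite ler_peMl.
  apply: (le_trans (h2 t s)); rewrite [b * A k]mulrC -mulrA; apply: ler_wpM2l => //.
  by apply: hO; rewrite normr_ge0.
have := ell2Z (a * b) eA; rewrite -mulrA; apply: ell2_le; last by rewrite lexx !mulr_ge0.
move=> k; have [A0 _] := hA k; apply/andP; split; first by rewrite !mulr_ge0// ltW.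
have -> : a * b * (w k * A k) = a * w k * (b * A k) by ring.
by apply: ler_wpM2r => //; exact: mulr_ge0.
Qed.

Lemma bd_cst (w : int -> R) (O : int -> R -> R) (z : int -> C) c :
  (forall k, gpos (O k)) -> 0 <= c -> ell2 (fun k => w k * nc (z k)) c -> bd w O (fun k _ => z k) c.
Proof.
move=> O0 c0 e; split=> //; exists (fun k => nc (z k)) => // k; split; first exact: nc_ge0.
exact: Hol_cst.
Qed.

Lemma bd_at (w : int -> R) (O : int -> R -> R) v c t : (forall k, 0 < w k) ->
  bd w O v c -> 0 <= c /\ ell2 (fun k => w k * nc (v k t)) c.
Proof.
move=> w0 [c0 [A hA eA]]; split=> //; apply: ell2_le eA; last by rewrite c0 lexx.
move=> k; have [A0 [h1 _]] := hA k; rewrite mulr_ge0 ?nc_ge0 ?(ltW (w0 k))//=.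
by rewrite ler_pM2l.
Qed.

Lemma bd_comp (w : int -> R) (O : int -> R -> R) v c (h : R -> R) :
  (forall k x y, 0 <= x <= y -> O k x <= O k y) -> (forall t s, `|h t - h s| <= `|t - s|) ->
  bd w O v c -> bd w O (fun k t => v k (h t)) c.
Proof.
move=> O1 hh [c0 [A hA eA]]; split=> //; exists A => // k; have [A0 [h1 h2]] := hA k.
split=> //; split=> [t|t s]; first exact: h1.
apply: (le_trans (h2 _ _)); apply: ler_wpM2l => //; apply: O1.
by rewrite normr_ge0 hh.
Qed.

(** The fixed points of this involution are the coefficients of real-valued functions. *)
Definition bar v : int -> R -> C := fun k t => conjc (v (- k) t).

Lemma bd_bar (w : int -> R) (O : int -> R -> R) v c :
  (forall k, w (- k) = w k) -> (forall k, O (- k) = O k) -> bd w O v c -> bd w O (bar v) c.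
Proof.
move=> we Oe [c0 [A hA eA]]; split=> //; exists (fun k => A (- k)) => [k|M].
  have [A0 [h1 h2]] := hA (- k); split=> //; split=> [t|t s]; rewrite /bar.
    by rewrite nc_conj.
  by rewrite -Oe; have := h2 t s; rewrite -rmorphB /= nc_conj.
rewrite -(sum_ZM_opp M); under eq_bigr do rewrite opprK we; exact: eA.
Qed.

Lemma conj_dC (F f : R -> C) : dC F f -> dC (fun t => conjc (F t)) (fun t => conjc (f t)).
Proof.
move=> dF t; have [h1 h2] := dF t; split.
  have -> : @complex.Re R \o (fun t => conjc (F t)) = @complex.Re R \o F.
    by apply/funext => s /=; case: (F s).
  have -> : complex.Re (conjc (f t)) = complex.Re (f t) by case: (f t).
  exact: h1.
have -> : @complex.Im R \o (fun t => conjc (F t)) = fun s => - complex.Im (F s).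
  by apply/funext => s /=; case: (F s).
have -> : complex.Im (conjc (f t)) = - complex.Im (f t) by case: (f t).
exact: (is_deriveN h2).
Qed.

Lemma br_even (N : R) k : br N (- k) = br N k.
Proof. by rewrite /br /ab abszN. Qed.

Lemma om_even (N d : R) k : om N d (- k) = om N d k.
Proof. by apply/funext => h; rewrite /om br_even. Qed.

End gauges.

Section limits.
Variable R : realType.
Notation C := R[i].

Definition lims (u : nat -> C) (z : C) := forall e : R, 0 < e -> exists n0, forall n, (n0 <= n)%N -> nc (u n - z) <= e.

Lemma limsD u v z z' : lims u z -> lims v z' -> lims (fun n => u n + v n) (z + z').
Proof.
move=> h1 h2 e e0; have e2 : 0 < e / 2 by rewrite divr_gt0.
have [n1 k1] := h1 _ e2; have [n2 k2] := h2 _ e2.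
exists (maxn n1 n2) => n; rewrite geq_max => /andP[m1 m2].
rewrite (_ : _ - _ = (u n - z) + (v n - z')); last by ring.
by apply: (le_trans (ncD _ _)); have := k1 n m1; have := k2 n m2; lra.
Qed.

Lemma limsZ u z c : lims u z -> lims (fun n => c * u n) (c * z).
Proof.
move=> h e e0; have c1 : 0 < nc c + 1 by have := nc_ge0 c; lra.
have e1 : 0 < e / (nc c + 1) by rewrite divr_gt0.
have [n0 hn] := h _ e1; exists n0 => n /hn h1.
rewrite -mulrBr ncM; apply: (@le_trans _ _ ((nc c + 1) * (e / (nc c + 1)))).
  by apply: ler_pM; rewrite ?nc_ge0//; lra.
by rewrite mulrC divfK// gt_eqF.
Qed.

Lemma lims_conj u z : lims u z -> lims (fun n => conjc (u n)) (conjc z).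
Proof. by move=> h e e0; have [n0 hn] := h _ e0; exists n0 => n /hn; rewrite -rmorphB /= nc_conj. Qed.

Lemma lims_uniq u z z' : lims u z -> lims u z' -> z = z'.
Proof. by move=> h1 h2; rewrite -(limCP h1) (limCP h2). Qed.

Lemma lims_cst z : lims (fun=> z) z.
Proof. by move=> e e0; exists 0%N => n _; rewrite subrr nc0 ltW. Qed.

End limits.

(** * The Duhamel operator as the limit of its truncations *)

Section Binf.
Variable R : realType.
Notation C := R[i].
Variables (alpha beta : R).
Implicit Types (v f g : int -> R -> C) (i j k : int) (t s : R).
Notation BM := (BM alpha beta).

(** A pointwise limit, which is a limit in gauge for inputs of finite gauge ([Binf_cvg]). [Bgal]
    cuts the output as well, as the Galerkin equation requires. *)
Definition Binf t0 t1 f g : int -> R -> C := fun k t => limC (fun M => BM M t0 t1 f g k t).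
Definition Bgal M t0 t1 f g : int -> R -> C := proj M (BM M t0 t1 f g).

Lemma phaseN i j : phase alpha beta (- i) (- j) = - phase alpha beta i j.
Proof. by rewrite /phase -opprD !rmorphN /= !rmorphD /=; ring. Qed.

(** Conjugation reverses the frequencies, and the phase is odd. *)
Lemma Ep_bar i j f g t : cont f -> cont g ->
  Ep alpha beta i j (bar f) (bar g) t = conjc (Ep alpha beta (- i) (- j) f g t).
Proof.
move=> cf cg; have [h1 h2] := EpP alpha beta (- i) (- j) cf cg.
have := conj_dC h2 => h3.
have cb f' : cont f' -> cont (bar f').
  move=> cf' k; have [a b] := cf' (- k); split.
    have -> : @complex.Re R \o bar f' k = @complex.Re R \o f' (- k); last exact: a.
    by apply/funext => r; rewrite /bar /=; case: (f' _ _).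
  have -> : @complex.Im R \o bar f' k = fun x => - (@complex.Im R \o f' (- k)) x.
    by apply/funext => r; rewrite /bar /=; case: (f' _ _).
  by move=> x; apply: continuousN; exact: b.
suff -> : Ep alpha beta i j (bar f) (bar g) = fun t => conjc (Ep alpha beta (- i) (- j) f g t) by [].
apply: cprim_uniq; last by rewrite h1 conjc0.
  by apply: (@Ep_cont R alpha beta i j (bar f) (bar g)); exact: cb.
apply: dC_ext h3 => r; rewrite /bar phaseN mulNr ceN !rmorphM /=.
by rewrite opprK.
Qed.

Lemma BM_bar M t0 t1 f g k t : cont f -> cont g ->
  BM M t0 t1 (bar f) (bar g) k t = bar (BM M t0 t1 f g) k t.
Proof.
move=> cf cg; rewrite /bar /BM rmorph_sum -[RHS](sum_ZM_opp M); apply: eq_bigr => i _ /=.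
rewrite rmorph_sum -[RHS](sum_ZM_opp M); apply: eq_bigr => j _ /=.
rewrite -opprD eqr_opp !oppr_eq0; case: ifP => _; last by rewrite conjc0.
rewrite /Bt !Ep_bar// rmorphM rmorphB /=; congr (_ * _).
by rewrite rmorphN /= opprK.
Qed.

Lemma BM_0 M t0 t1 f g t : BM M t0 t1 f g 0 t = 0.
Proof. by apply: big1 => i _; apply: big1 => j _; case: ifP => // _; rewrite /Bt mulr0z mul0r. Qed.

Lemma Binf_0 t0 t1 f g t : Binf t0 t1 f g 0 t = 0.
Proof. by apply: limCP => e e0; exists 0%N => n _; rewrite BM_0 subrr nc0 ltW. Qed.

Lemma Binf_before t0 t1 f g k t : t <= t0 -> t0 <= t1 -> Binf t0 t1 f g k t = 0.
Proof. by move=> h1 h2; apply: limCP => e e0; exists 0%N => n _; rewrite BM_before// subrr nc0 ltW. Qed.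

Lemma Binf_clip t0 t1 f g k t : t0 <= t1 -> Binf t0 t1 f g k (clip t0 t1 t) = Binf t0 t1 f g k t.
Proof. by move=> h; rewrite /Binf; congr limC; apply/funext => M; rewrite BM_clip. Qed.

Lemma Binf_local t0 t1 f g f' g' k t : t0 <= t1 -> cont f -> cont g -> cont f' -> cont g' ->
  (forall k t, t0 <= t <= t1 -> f k t = f' k t) -> (forall k t, t0 <= t <= t1 -> g k t = g' k t) ->
  Binf t0 t1 f g k t = Binf t0 t1 f' g' k t.
Proof.
by move=> h h1 h2 h3 h4 e1 e2; rewrite /Binf; congr limC; apply/funext => M; exact: BM_local.
Qed.

Lemma bd_cont G N d f X : 0 < d -> bd (wt G N) (om N d) f X -> cont f.
Proof. by move=> d0 [_ [A hA _]] k; have [_ h] := hA k; exact: Hol_cont (om_small N k d0) h. Qed.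

Section gauge.
Variables (N0 Ca N d D : R) (G : int -> R) (CG : R) (t0 t1 : R).
Hypothesis hok : phase_ok alpha beta N0 Ca.
Hypothesis hN : N0 <= N.
Hypothesis d0 : 0 < d.
Hypothesis dD : d <= D * expR (- (5 / 2) * ln N).
Hypothesis D1 : 1 <= D.
Hypothesis hG : submul G CG.
Hypothesis t01 : t0 <= t1.
Hypothesis td : t1 - t0 <= d.
Notation w := (wt G N).
Notation O := (om N d).
Notation K := (CB Ca D CG).

Let Np : 0 < N. Proof. by case: hok => h _ _; exact: lt_le_trans (le_trans h hN). Qed.
Let w0 k : 0 < w k. Proof. by case: hG => _ h _; rewrite divr_gt0// br_gt0. Qed.
Let O0 k : gpos (O k). Proof. exact: om_gpos. Qed.
Let Bbd M f g X Y : bd w O f X -> bd w O g Y -> bd w O (BM M t0 t1 f g) (K * X * Y).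
Proof. exact: (BM_bd _ hok). Qed.
Let cc f X : bd w O f X -> cont f. Proof. exact: bd_cont. Qed.
Let K0 : 0 <= K.
Proof.
case: hok => _ h _; case: hG => h' _ _; have D1' := D1.
by rewrite /CB !mulr_ge0// ?exprn_ge0//; lra.
Qed.

(** By [BM_proj] both truncations are the operator at level m, applied to (f, g) and to their
    projections; the difference is as small as the tails of f and g. *)
Lemma BM_cauchy f g X Y e : bd w O f X -> bd w O g Y -> 0 < e ->
  exists n0, forall n m, (n0 <= n)%N -> (n <= m)%N ->
    bd w O (fun k t => BM m t0 t1 f g k t - BM n t0 t1 f g k t) e.
Proof.
move=> hf hg e0; have X0 : 0 <= X by case: hf. have Y0 : 0 <= Y by case: hg.
have KK := K0.
pose r := e / (K * (X + Y) + 1).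
have p0 : 0 < K * (X + Y) + 1 by apply: ltr_wpDl => //; rewrite mulr_ge0// addr_ge0.
have r0 : 0 < r by rewrite divr_gt0.
have [n1 h1] := bd_tail O0 hf r0; have [n2 h2] := bd_tail O0 hg r0.
exists (maxn n1 n2) => n m; rewrite geq_max => /andP[a1 a2] nm.
have hf1 := h1 n a1; have hg1 := h2 n a2.
have pf := bd_proj O0 n hf; have pg := bd_proj O0 n hg.
have := bdD w0 (Bbd m hf1 hg) (Bbd m pf hg1) => /(bd_le w0 (e := e)) hh.
apply: (bd_ext _ (hh _)).
  by move=> k t; rewrite (BM_proj alpha beta t0 t1 f g k t nm) -BM_sub//; [exact: cc hf|exact: cc hg|exact: cc pf|exact: cc pg].
have : r * (K * (X + Y) + 1) = e by rewrite /r divfK// gt_eqF.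
have rr := ltW r0.
by move=> <-; nra.
Qed.

Lemma Binf_cvg f g X Y e : bd w O f X -> bd w O g Y -> 0 < e ->
  exists n0, forall n, (n0 <= n)%N -> bd w O (fun k t => Binf t0 t1 f g k t - BM n t0 t1 f g k t) e.
Proof.
move=> hf hg; move: e.
have [u hu] := @bd_complete_eps R w O w0 O0 (fun n => BM n t0 t1 f g) (fun e e0 => BM_cauchy hf hg e0).
suff -> : Binf t0 t1 f g = u by exact: hu.
apply/funext => k; apply/funext => t; apply: limCP => e e0.
have [n0 hn] := hu (e * w k) (mulr_gt0 e0 (w0 k)); exists n0 => n /hn h.
by have := bd_pt w0 k t h; rewrite mulfK ?gt_eqF// ncBC.
Qed.

Lemma Binf_lims f g X Y k t : bd w O f X -> bd w O g Y -> lims (fun M => BM M t0 t1 f g k t) (Binf t0 t1 f g k t).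
Proof.
move=> hf hg e e0.
have [n0 hn] := Binf_cvg hf hg (mulr_gt0 e0 (w0 k)); exists n0 => n /hn h.
by have := bd_pt w0 k t h; rewrite mulfK ?gt_eqF// ncBC.
Qed.

Lemma Binf_bd f g X Y : bd w O f X -> bd w O g Y -> bd w O (Binf t0 t1 f g) (K * X * Y).
Proof.
move=> hf hg; have h := Bbd 0 hf hg; have c0 : 0 <= K * X * Y by case: h.
apply: bd_closed => // e e0; have [n0 /(_ n0 (leqnn _)) h1] := Binf_cvg hf hg e0.
have := bdD w0 h1 (Bbd n0 hf hg); rewrite addrC; apply: bd_ext => k t; ring.
Qed.

Lemma bilop_Binf : bilop w O (Binf t0 t1) K.
Proof.
split=> // [f g X Y|f g f' g' X Y X' Y' hf hg hf' hg' k t]; first exact: Binf_bd.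
have h1 := Binf_lims k t hf hg; have h2 := Binf_lims k t hf' hg'.
have h3 := Binf_lims k t (bdB w0 hf hf') hg; have h4 := Binf_lims k t hf' (bdB w0 hg hg').
apply: (@lims_uniq R (fun M => BM M t0 t1 f g k t - BM M t0 t1 f' g' k t)).
  have := limsD h1 (limsZ (-1) h2).
  rewrite mulN1r (_ : (fun n => _) = fun M => BM M t0 t1 f g k t - BM M t0 t1 f' g' k t)//.
  by apply/funext => M; rewrite mulN1r.
have := limsD h3 h4; rewrite (_ : (fun n => _) = fun M => BM M t0 t1 f g k t - BM M t0 t1 f' g' k t)//.
by apply/funext => M; rewrite -BM_sub//; [exact: cc hf|exact: cc hg|exact: cc hf'|exact: cc hg'].
Qed.

Lemma bilop_Bgal M : bilop w O (Bgal M t0 t1) K.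
Proof.
split=> // [f g X Y hf hg|f g f' g' X Y X' Y' hf hg hf' hg' k t].
  by apply: bd_proj => //; exact: Bbd.
rewrite /Bgal /proj; case: ifP => _; last by rewrite subrr addr0.
by rewrite BM_sub//; [exact: cc hf|exact: cc hg|exact: cc hf'|exact: cc hg'].
Qed.

Lemma Bgal_cvg f g X Y e : bd w O f X -> bd w O g Y -> 0 < e ->
  exists n0, forall n, (n0 <= n)%N -> bd w O (fun k t => Binf t0 t1 f g k t - Bgal n t0 t1 f g k t) e.
Proof.
move=> hf hg e0; have e2 : 0 < e / 2 by rewrite divr_gt0.
have [n1 h1] := bd_tail O0 (Binf_bd hf hg) e2; have [n2 h2] := Binf_cvg hf hg e2.
exists (maxn n1 n2) => n; rewrite geq_max => /andP[/h1 a1 /h2 a2].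
have := bdD w0 a1 (bd_proj O0 n a2) => /(bd_le w0 (e := e)) hh.
apply: (bd_ext _ (hh _)); last lra.
by move=> k t; rewrite /Bgal /proj; case: ifP => _; ring.
Qed.

Lemma Binf_bar f g X Y k t : bd w O f X -> bd w O g Y -> (forall k, G (- k) = G k) ->
  Binf t0 t1 (bar f) (bar g) k t = bar (Binf t0 t1 f g) k t.
Proof.
move=> hf hg Ge; have we k' : w (- k') = w k' by rewrite /wt Ge br_even.
have h1 := Binf_lims k t (bd_bar we (om_even N d) hf) (bd_bar we (om_even N d) hg).
have h2 := lims_conj (Binf_lims (- k) t hf hg).
apply: lims_uniq h1 _; rewrite (_ : (fun M => _) = fun M => conjc (BM M t0 t1 f g (- k) t))//.
by apply/funext => M; rewrite BM_bar//; [exact: cc hf|exact: cc hg].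
Qed.

End gauge.
End Binf.

(** * Gluing of windows *)

Section weights.
Variable R : realType.
Implicit Types (i j k : int) (eta sg : R).
Notation jb := (japanese_bracket R).

Lemma jbE k : jb k = Num.sqrt (1 + ab R k ^+ 2).
Proof. by rewrite /japanese_bracket /ab -intr_norm pmulrn abszE. Qed.

Lemma jb_ge1 k : 1 <= jb k.
Proof. by rewrite jbE -[leLHS]sqrtr1 ler_wsqrtr// lerDl sqr_ge0. Qed.

Lemma jb_gt0 k : 0 < jb k. Proof. exact: lt_le_trans (jb_ge1 k). Qed.

Lemma jb_even k : jb (- k) = jb k.
Proof. by rewrite !jbE /ab abszN. Qed.

Lemma jb_ge k : ab R k <= jb k.
Proof. by rewrite jbE -[leLHS]ger0_norm// -sqrtr_sqr ler_wsqrtr// lerDr. Qed.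

Lemma jb_le k : jb k <= 1 + ab R k.
Proof.
rewrite jbE -[leRHS]ger0_norm ?addr_ge0// -sqrtr_sqr ler_wsqrtr// sqrrD expr1n mul1r.
by rewrite -addrA lerD2l lerDr mulrn_wge0.
Qed.

Lemma jb_add i j k : i + j = k -> (`|i| <= `|j|)%N -> jb k <= 2 * jb j.
Proof.
move=> e ij; rewrite !jbE -[2 in leRHS]ger0_norm// -sqrtr_sqr -sqrtrM ?sqr_ge0// ler_wsqrtr//.
have h : ab R k <= 2 * ab R j by rewrite /ab -natrM ler_nat; move: e ij; clear; lia.
have h2 : ab R k * ab R k <= (2 * ab R j) * (2 * ab R j) by apply: ler_pM.
by lra.
Qed.

(** Here sg = s + 1 is the regularity above the level -1 at which the energy is controlled. Letting
    eta tend to 0 makes the extra regularity cost as little as desired, while the constant 2^sg of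
    [submul_Gw] is independent of eta. *)
Definition Gw sg eta k : R := 1 + eta * jb k `^ sg.

Lemma Gw_gt0 sg eta k : 0 < eta -> 0 < Gw sg eta k.
Proof. by move=> h; rewrite ltr_pwDl// mulr_ge0 ?powR_ge0// ltW. Qed.

(** The larger input accounts for the bracket of the output, up to the factor 2, and the weight of
    the other input is at least 1. *)
Lemma submul_Gw sg eta : 0 <= sg -> 0 < eta -> submul (Gw sg eta) (2 `^ sg).
Proof.
move=> s0 e0; split=> [|k|]; [exact: powR_ge0|exact: Gw_gt0|].
have p2 : 1 <= 2 `^ sg :> R.
  by rewrite -[leLHS](powRr0 (2 : R)); apply: ler_powR => //; lra.
have key i j k : i + j = k -> (`|i| <= `|j|)%N -> Gw sg eta k <= 2 `^ sg * (Gw sg eta i * Gw sg eta j).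
  move=> e ij.
  have h : jb k `^ sg <= 2 `^ sg * jb j `^ sg.
    rewrite -powRM ?(ltW (jb_gt0 _))//; apply: ge0_ler_powR; rewrite ?nnegrE ?mulr_ge0 ?(ltW (jb_gt0 _))//.
    exact: jb_add e ij.
  have gi : 1 <= Gw sg eta i by rewrite lerDl mulr_ge0 ?powR_ge0// ltW.
  apply: (@le_trans _ _ (2 `^ sg * Gw sg eta j)); last first.
    by apply: ler_wpM2l; [exact: powR_ge0|apply: ler_peMl => //; apply: ltW; exact: Gw_gt0].
  rewrite /Gw; have h2 : eta * jb k `^ sg <= eta * (2 `^ sg * jb j `^ sg) by rewrite ler_pM2l.
  by rewrite mulrDr mulr1 mulrCA; apply: lerD.
move=> i j k _ _ _ e; have [h|/ltnW h] := leqP `|i| `|j|; first exact: key.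
by rewrite [Gw sg eta i * _]mulrC; apply: key => //; rewrite addrC.
Qed.

Lemma submul_1 : submul (fun=> 1 : R) 1.
Proof. by split=> // *; rewrite !mulr1. Qed.

Lemma br_scale (N0 N : R) k : 0 < N0 -> N0 <= N -> br N0 k <= br N k /\ br N k <= N / N0 * br N0 k.
Proof.
move=> h0 h; split; first by rewrite /br ge_max !le_max h lexx orbT.
have h1 : 1 <= N / N0 by rewrite ler_pdivlMr// mul1r.
rewrite /br ge_max; apply/andP; split.
  apply: (@le_trans _ _ (N / N0 * N0)); first by rewrite divfK// gt_eqF.
  by rewrite ler_pM2l ?le_max ?lexx// (lt_le_trans ltr01).
apply: (@le_trans _ _ (1 * Num.max N0 (ab R k))); first by rewrite mul1r le_max lexx orbT.
by apply: ler_wpM2r => //; rewrite le_max ltW.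
Qed.

(** With [om_comp], shows that all the gauges are equivalent, with constants depending on N and eta.
    Finiteness and convergence are therefore expressed in the reference gauge, that of [N0], eta = 1
    and delta = T. *)
Lemma wt_comp sg eta (N0 N : R) k : 0 < N0 -> N0 <= N -> 0 < eta <= 1 ->
  wt (Gw sg eta) N k <= wt (Gw sg 1) N0 k /\ wt (Gw sg 1) N0 k <= N / N0 / eta * wt (Gw sg eta) N k.
Proof.
move=> h0 h /andP[e0 e1]; have [b1 b2] := br_scale k h0 h.
have p0 := br_gt0 k h0; have p1 : 0 < br N k by exact: lt_le_trans b1.
have j0 := powR_ge0 (jb k) sg.
have g0 : 0 <= Gw sg eta k by rewrite ltW// Gw_gt0.
have g1 : Gw sg eta k <= Gw sg 1 k by rewrite /Gw lerD2l ler_wpM2r.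
have g2 : Gw sg 1 k <= eta^-1 * Gw sg eta k.
  rewrite /Gw mulrDr mulr1 mulrA mulVf ?gt_eqF// lerD2r -[leLHS]mul1r.
  by rewrite mul1r -invr1 lef_pV2 ?posrE.
have N00 : 0 <= N / N0 by rewrite divr_ge0// ltW// (lt_le_trans h0).
rewrite /wt; split.
  by apply: ler_pM => //; [rewrite invr_ge0 ltW|rewrite lef_pV2 ?posrE].
have -> : N / N0 / eta * (Gw sg eta k / br N k) = (eta^-1 * Gw sg eta k) * (N / N0 / br N k) by ring.
apply: ler_pM => //; [by rewrite ltW// Gw_gt0|by rewrite invr_ge0 ltW|].
by rewrite ler_pdivlMr// mulrC ler_pdivrMr.
Qed.

Lemma om_comp (N0 N d T : R) k h : 0 < N0 -> N0 <= N -> 0 < d -> 0 < T -> 0 <= h ->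
  om N d k h <= (1 + T / d) * om N0 T k h.
Proof.
move=> h0 hN d0 T0 hh; have [b1 _] := br_scale k h0 hN.
have p0 := br_gt0 k h0; have p1 : 0 < br N k by exact: lt_le_trans b1.
have hT : h / d = T / d * (h / T) by field; rewrite !gt_eqF.
have q : 0 <= h / T by rewrite divr_ge0// ltW.
have Td : 0 <= T / d by rewrite divr_ge0// ltW.
have e1 : expR (- (1 / 2) * ln (br N k)) * h `^ (2 / 5) <= expR (- (1 / 2) * ln (br N0 k)) * h `^ (2 / 5).
  apply: ler_wpM2r; first exact: powR_ge0.
  rewrite ler_expR; have : ln (br N0 k) <= ln (br N k) by rewrite ler_ln ?posrE.
  lra.
have e2 : 0 <= expR (- (1 / 2) * ln (br N0 k)) * h `^ (2 / 5) by rewrite mulr_ge0 ?expR_ge0 ?powR_ge0.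
rewrite /om hT; move: (expR _ * _) (expR _ * _) e1 e2 => x y xy y0.
have : 0 <= T / d * x by exact: mulr_ge0.
lra.
Qed.

Lemma wt_gt0 (G : int -> R) CG (N : R) k : submul G CG -> 0 < N -> 0 < wt G N k.
Proof. by move=> [_ g0 _] N0; rewrite divr_gt0// br_gt0. Qed.

End weights.

(** * Solutions glued from consecutive windows, their stability and their energy *)

Section windows.
Variable R : realType.
Notation C := R[i].
Variables (alpha beta N0 Ca sg T N : R) (nW : nat).
Hypothesis hok : phase_ok alpha beta N0 Ca.
Hypothesis hN : N0 <= N.
Hypothesis sg0 : 0 <= sg.
Hypothesis T0 : 0 < T.
Hypothesis nW0 : (0 < nW)%N.
Notation d := (expR (- (5 / 2) * ln N)).
Hypothesis TW : T / nW%:R <= d.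
Notation K := (CB Ca 1 (2 `^ sg)).
Implicit Types (u v f g : int -> R -> C) (phi a : int -> C) (i j : nat) (k : int) (t e r rho eta : R).

Definition tt i : R := i%:R * (T / nW%:R).

Let N00 : 0 < N0. Proof. by case: hok => h _ _; lra. Qed.
Let Np : 0 < N. Proof. exact: lt_le_trans hN. Qed.
Let d0 : 0 < d. Proof. exact: expR_gt0. Qed.
Let h0 : 0 < T / nW%:R. Proof. by rewrite divr_gt0// ltr0n. Qed.

Lemma tt_le i j : (i <= j)%N -> tt i <= tt j.
Proof. by move=> h; rewrite ler_pM2r// ler_nat. Qed.
Lemma tt_ge0 i : 0 <= tt i. Proof. by rewrite mulr_ge0// ltW. Qed.
Lemma tt0 : tt 0 = 0. Proof. by rewrite /tt mul0r. Qed.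
Lemma ttT : tt nW = T. Proof. by rewrite /tt mulrC divfK// pnatr_eq0 -lt0n. Qed.
Lemma tt_step i : tt i.+1 - tt i <= d.
Proof. by rewrite /tt -mulrBl -natrB// subSnn mul1r. Qed.
Let ttS i : tt i <= tt i.+1. Proof. exact: tt_le. Qed.

Definition win j u : int -> R -> C := fun k t => u k (clip (tt j) (tt j.+1) t).

Notation bdw eta := (bd (wt (Gw sg eta) N) (om N d)).
Notation bdX := (bd (wt (Gw sg 1) N0) (om N0 T)).
Notation wX := (wt (Gw sg 1) N0).
Let w0 eta k : 0 < eta -> 0 < wt (Gw sg eta) N k.
Proof. by move=> e0; exact: wt_gt0 (submul_Gw sg0 e0) Np. Qed.
Let wX0 k : 0 < wX k. Proof. exact: wt_gt0 (submul_Gw sg0 ltr01) N00. Qed.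
Let O0 k : gpos (om N d k). Proof. exact: om_gpos. Qed.
Let OX0 k : gpos (om N0 T k). Proof. exact: om_gpos. Qed.

(** The common interface of the limit operator and of the Galerkin operators: continuation and
    stability are proved for both at once. *)
Definition opok (op : R -> R -> (int -> R -> C) -> (int -> R -> C) -> int -> R -> C) :=
  [/\ forall eta t0 t1, 0 < eta -> t0 <= t1 -> t1 - t0 <= d ->
        bilop (wt (Gw sg eta) N) (om N d) (op t0 t1) K,
      forall t0 t1 f g k t, t0 <= t1 -> op t0 t1 f g k (clip t0 t1 t) = op t0 t1 f g k t,
      forall t0 t1 f g k, t0 <= t1 -> op t0 t1 f g k t0 = 0,
      forall t0 t1 f g t, op t0 t1 f g 0 t = 0 &
      forall eta t0 t1 f g X Y k t, 0 < eta -> t0 <= t1 -> t1 - t0 <= d -> bdw eta f X -> bdw eta g Y ->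
        op t0 t1 (bar f) (bar g) k t = bar (op t0 t1 f g) k t].

Definition realz u := (forall t, u 0 t = 0) /\ bar u = u.

(** A solution on the first [i] windows, stopped afterwards, with gauge at most [e] on each. The
    parameter eta may change with the window, since it is chosen in terms of the part already
    built. *)
Definition good op u phi i e :=
  [/\ forall k, u k 0 = phi k, forall k t, u k t = u k (clip 0 (tt i) t), realz u,
      exists c, bdX u c &
      forall j, (j < i)%N -> exists eta, [/\ 0 < eta <= 1, bdw eta (win j u) e &
        forall k t, win j u k t = u k (tt j) + op (tt j) (tt j.+1) (win j u) (win j u) k t]].

Lemma opok_Binf : opok (Binf alpha beta).
Proof.
have [N01 Ca1 _] := hok.
have dD : d <= 1 * d by rewrite mul1r.
split=> [eta t0 t1 e0 h1 h2|t0 t1 f g k t h1|t0 t1 f g k h1|t0 t1 f g t|eta t0 t1 f g X Y k t e0 h1 h2 hf hg].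
- by apply: (bilop_Binf (D := 1) hok hN) => //; exact: submul_Gw.
- exact: Binf_clip.
- by rewrite Binf_before.
- exact: Binf_0.
- apply: (Binf_bar (D := 1) hok hN d0 dD (lexx 1) (submul_Gw sg0 e0) h1 h2 k t hf hg).
  by move=> k'; rewrite /Gw jb_even.
Qed.

Lemma BgalE M t0 t1 f g k t : Bgal alpha beta M t0 t1 f g k t =
  if (`|k| <= M)%N then BM alpha beta M t0 t1 f g k t else 0.
Proof. by []. Qed.

Lemma opok_Bgal M : opok (Bgal alpha beta M).
Proof.
have [N01 Ca1 _] := hok.
have dD : d <= 1 * d by rewrite mul1r.
split=> [eta t0 t1 e0 h1 h2|t0 t1 f g k t h1|t0 t1 f g k h1|t0 t1 f g t|eta t0 t1 f g X Y k t e0 h1 h2 hf hg].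
- by apply: (bilop_Bgal (D := 1) hok hN) => //; exact: submul_Gw.
- by rewrite !BgalE; case: ifP => // _; exact: BM_clip.
- by rewrite !BgalE; case: ifP => // _; rewrite BM_before.
- by rewrite BgalE BM_0.
- have cf := bd_cont d0 hf; have cg := bd_cont d0 hg.
  by rewrite /bar !BgalE abszN; case: ifP => _; [exact: BM_bar|rewrite conjc0].
Qed.

(** The conjugate field solves the same equation with the same data, so [picard_stable] with zero
    differences identifies the two. *)
Lemma data_real op a e eta j v : opok op -> 0 < eta -> 8 * K * e <= 1 -> a 0 = 0 -> (forall k, conjc (a (- k)) = a k) ->
  bdw eta v (2 * e) -> (forall k t, v k t = a k + op (tt j) (tt j.+1) v v k t) -> 0 <= e -> realz v.
Proof.
move=> [p1 _ _ p4 p5] e0 Ke a0 ar hv ev e1; split=> [t|]; first by rewrite ev a0 p4 addr0.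
have we k : wt (Gw sg eta) N (- k) = wt (Gw sg eta) N k by rewrite /wt br_even /Gw jb_even.
have hb := bd_bar we (om_even N d) hv.
have hB := p1 eta (tt j) (tt j.+1) e0 (ttS j) (tt_step j).
have z X : bdw eta X 0 = bdw eta X 0 by [].
have := @picard_stable R _ _ (fun k => w0 k e0) O0 _ _ _ (fun k _ => a k) (fun k _ => a k) (bar v) v e 0 0
  hB hB Ke e1 hb hv.
have e2 k t : bar v k t = a k + op (tt j) (tt j.+1) (bar v) (bar v) k t.
  by rewrite (p5 eta _ _ _ _ _ _ _ _ e0 (ttS j) (tt_step j) hv hv) /bar [in LHS]ev rmorphD /= ar.
have bz : bdw eta (fun _ _ => 0) 0 by exact: bd0.
move=> /(_ e2 ev (bd_ext _ bz) (bd_ext _ bz)) h.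
have {}h : bdw eta (fun k t => bar v k t - v k t) 0.
  by have := h (fun k t => esym (subrr _)) (fun k t => esym (subrr _)); rewrite addr0 mulr0.
apply/funext => k; apply/funext => t; apply/eqP; rewrite -subr_eq0; apply/eqP.
apply: nc_eq0; apply: le_anti; rewrite nc_ge0 andbT.
by have := bd_pt (fun k => w0 k e0) k t h; rewrite mul0r.
Qed.

Lemma picard_real op a e eta j : opok op -> 0 < eta -> 0 <= e -> 8 * K * e <= 1 ->
  a 0 = 0 -> (forall k, conjc (a (- k)) = a k) -> ell2 (fun k => wt (Gw sg eta) N k * nc (a k)) e ->
  exists v, [/\ bdw eta v (2 * e), forall k t, v k t = a k + op (tt j) (tt j.+1) v v k t & realz v].
Proof.
move=> hop e0 e1 Ke a0 ar ea; have [p1 _ _ _ _] := hop.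
have hB := p1 eta (tt j) (tt j.+1) e0 (ttS j) (tt_step j).
have [v [hv ev]] := picard (fun k => w0 k e0) O0 hB (bd_cst O0 e1 ea) Ke.
by exists v; split=> //; exact: (data_real (a := a) hop e0 Ke a0 ar hv ev).
Qed.

Lemma bdw_X eta v c : 0 < eta <= 1 -> bdw eta v c -> bdX v (N / N0 / eta * ((1 + T / d) * c)).
Proof.
move=> he; have /andP[e0 e1] := he; apply: bd_conv => //.
- by move=> k; exact: w0.
- by rewrite !divr_ge0// ltW.
- by rewrite lerDl divr_ge0// ltW.
- by move=> k; have [] := @wt_comp R sg eta N0 N k N00 hN he.
- by move=> k h hh; exact: om_comp.
Qed.

Lemma ell_Xw eta (b : int -> R) c : 0 < eta <= 1 -> (forall k, 0 <= b k) -> 0 <= c ->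
  ell2 (fun k => wX k * b k) c -> ell2 (fun k => wt (Gw sg eta) N k * b k) c.
Proof.
move=> he b0 c0; apply: ell2_le; last by rewrite c0 lexx.
move=> k; have [h _] := @wt_comp R sg eta N0 N k N00 hN he; have /andP[e0 e1] := he.
by rewrite ler_wpM2r// andbT mulr_ge0// ltW// w0.
Qed.

Lemma clip_hi (x y t : R) : y <= t -> x <= y -> clip x y t = y.
Proof. by move=> h1 h2; rewrite /clip (min_idPr h1); apply/max_idPr. Qed.

Lemma clip_lo (x y t : R) : t <= x -> clip x y t = x.
Proof. by move=> h1; apply/max_idPl; rewrite ge_min h1. Qed.

Lemma ext op u phi i e eta v : opok op -> good op u phi i e -> 0 < eta <= 1 -> bdw eta v e ->
  (forall k t, v k t = u k (tt i) + op (tt i) (tt i.+1) v v k t) -> realz v ->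
  good op (fun k t => u k t + (v k t - u k (tt i))) phi i.+1 e.
Proof.
move=> [p1 p2 p3 p4 p5] [g1 g2 [g3 g3'] [c g4] g5] he hv ev [v1 v2].
have vc k t : v k (clip (tt i) (tt i.+1) t) = v k t by rewrite [LHS]ev [RHS]ev p2.
have va k t : t <= tt i -> v k t = u k (tt i).
  by move=> h; rewrite -vc clip_lo// ev p3// addr0.
have ua k t : tt i <= t -> u k t = u k (tt i).
  by move=> h; rewrite g2 clip_hi// tt_ge0.
pose U k t := u k t + (v k t - u k (tt i)).
have Ul k t : t <= tt i -> U k t = u k t by move=> h; rewrite /U va// subrr addr0.
have Ur k t : tt i <= t -> U k t = v k t by move=> h; rewrite /U ua//; ring.
have wl j : (j < i)%N -> win j U = win j u.
  move=> ji; apply/funext => k; apply/funext => t; rewrite /win Ul//.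
  have /andP[_ h] := clip_in t (ttS j); apply: le_trans h _; exact: tt_le.
have wr : win i U = v.
  apply/funext => k; apply/funext => t; rewrite /win Ur ?vc//.
  by have /andP[] := clip_in t (ttS i).
split.
- by move=> k; rewrite -/(U k 0) Ul ?tt_ge0.
- move=> k t; rewrite -!/(U k _).
  have c1 := clip_in t (tt_ge0 i.+1); have /andP[c2 c3] := c1.
  have [h|/ltW h] := leP t (tt i).
    have h' : clip 0 (tt i.+1) t <= tt i by rewrite /clip ge_max tt_ge0 ge_min h.
    have e1 : clip 0 (tt i.+1) t = clip 0 (tt i) t.
      by rewrite /clip (min_idPl (le_trans h (ttS i))) (min_idPl h).
    by rewrite !Ul// e1 -[RHS]g2.
  have h' : tt i <= clip 0 (tt i.+1) t by rewrite /clip le_max le_min h ttS orbT.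
  rewrite !Ur// -[LHS]vc -[RHS]vc; congr (v k _).
  have t0 := le_trans (tt_ge0 i) h.
  have m0 : 0 <= Num.min t (tt i.+1) by rewrite le_min t0 tt_ge0.
  by rewrite /clip (max_idPr m0) -minA minxx.
- split=> [t|]; first by rewrite g3 v1 g3; ring.
  apply/funext => k; apply/funext => t; rewrite /bar rmorphD rmorphB /=.
  have e1 t' : conjc (u (- k) t') = u k t' by rewrite -[in RHS]g3'.
  have e2 : conjc (v (- k) t) = v k t by rewrite -[in RHS]v2.
  by rewrite !e1 e2.
- have hv' := bdw_X he hv.
  have [c0 eu] := bd_at (tt i) wX0 g4.
  exists (c + (N / N0 / eta * ((1 + T / d) * e) + c)).
  by apply: bdD => //; apply: bdB => //; exact: bd_cst.
- move=> j; rewrite ltnS leq_eqVlt => /predU1P[->|ji].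
    exists eta; rewrite -/U wr; split=> // k t.
    by rewrite -/(U k (tt i)) Ul//; exact: ev.
  have [eta' [h1 h2 h3]] := g5 j ji; exists eta'; rewrite -/U wl//; split=> // k t.
  by rewrite -/(U k (tt j)) Ul ?tt_le//; exact: ltnW.
Qed.

(** Peels off the last window and writes [u] as the sum that [ext] forms. *)
Lemma restr op u phi i e : good op u phi i.+1 e ->
  good op (fun k t => u k (clip 0 (tt i) t)) phi i e /\
  forall k t, u k t = u k (clip 0 (tt i) t) + (win i u k t - u k (tt i)).
Proof.
move=> [g1 g2 [g3 g3'] [c g4] g5].
have wE j : (j < i)%N -> win j (fun k t => u k (clip 0 (tt i) t)) = win j u.
  move=> ji; apply/funext => k; apply/funext => t; rewrite /win (@clip_id _ 0)//.
  have /andP[c1 c2] := clip_in t (ttS j).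
  by rewrite (le_trans (tt_ge0 j) c1) (le_trans c2)// tt_le.
split; last first.
  move=> k t; rewrite g2; have [h|/ltW h] := leP t (tt i).
    rewrite /win (clip_lo _ h) subrr addr0.
    have e1 : Num.min t (tt i.+1) = t by apply/min_idPl; exact: le_trans (ttS i).
    by rewrite /clip e1 (min_idPl h).
  rewrite /win (clip_hi h (tt_ge0 i)); have t0 := le_trans (tt_ge0 i) h.
  have m0 : 0 <= Num.min t (tt i.+1) by rewrite le_min t0 tt_ge0.
  have m1 : tt i <= Num.min t (tt i.+1) by rewrite le_min h ttS.
  by rewrite /clip (max_idPr m0) (max_idPr m1); ring.
split.
- by move=> k; rewrite clip_lo.
- by move=> k t; rewrite clip_clip// tt_ge0.
- split=> [t|]; first exact: g3.
  apply/funext => k; apply/funext => t.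
  by rewrite -[in RHS]g3'.
- by exists c; apply: bd_comp g4 => [k x y|t s]; [exact: om_mono|exact: clip_lip].
- move=> j ji; have [eta [h1 h2 h3]] := g5 j (leqW ji); exists eta; rewrite wE//; split=> // k t.
  by rewrite (@clip_id _ 0); [exact: h3|rewrite tt_ge0 tt_le// ltnW].
Qed.

Section stab.
Variable opS : nat -> R -> R -> (int -> R -> C) -> (int -> R -> C) -> int -> R -> C.
Hypothesis hop : forall m, opok (opS m).
Hypothesis hcv : forall eta j f X e, 0 < eta -> bdw eta f X -> 0 < e ->
  exists m0, forall m, (m0 <= m)%N -> bdw eta (fun k t =>
    Binf alpha beta (tt j) (tt j.+1) f f k t - opS m (tt j) (tt j.+1) f f k t) e.

(** Induction on windows. A nearby field starts the next window with size at most 2 e, Picard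
    iteration gives it size 4 e there, and [picard_stable] compares it with [u]. The sizes do not
    grow from window to window, because each one starts again from the bound [e] on [u]. With
    Galerkin operators this gives approximation; with the limit operator, continuous dependence. *)
Lemma stab e : 0 < e -> 16 * K * e <= 1 -> forall i u phi, good (Binf alpha beta) u phi i e ->
  forall rho, 0 < rho -> exists2 delta, 0 < delta & exists m0, forall m phi', (m0 <= m)%N ->
    phi' 0 = 0 -> (forall k, conjc (phi' (- k)) = phi' k) ->
    ell2 (fun k => wX k * nc (phi' k - phi k)) delta ->
    exists u', good (opS m) u' phi' i (4 * e) /\ bdX (fun k t => u' k t - u k t) rho.
Proof.
move=> e0 Ke; have e0' := ltW e0; elim=> [|i IH] u phi hg rho r0.
  have [g1 g2 _ _ _] := hg.
  exists rho => //; exists 0%N => m phi' _ p0 pr ed.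
  have uE k t : u k t = phi k by rewrite g2 tt0 /clip -g1; congr (u k _); rewrite /Num.min /Num.max; do ?case: ifP; lra.
  have bX : bdX (fun k t => phi' k - u k t) rho.
    by apply: (bd_ext _ (bd_cst OX0 (ltW r0) ed)) => k t; rewrite uE.
  exists (fun k _ => phi' k); split; last exact: bX.
  have [_ _ [g3 _] [c g4] _] := hg.
  split=> //; [split=> //; by apply/funext => k; apply/funext => t; rewrite /bar pr|].
  exists (rho + c); apply: (bd_ext _ (bdD wX0 bX g4)) => k t; ring.
have [hgi dec] := restr hg.
have [g1 g2 [g3 g3'] [c g4] g5] := hg.
have [eta [he hw wE]] := g5 i (ltnSn i); have /andP[eta0 eta1] := he.
pose Lc := N / N0 / eta * (1 + T / d).
have Lc0 : 0 <= Lc.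
  by rewrite mulr_ge0 ?divr_ge0 ?(ltW N00) ?(ltW Np) ?(ltW eta0)// addr_ge0// divr_ge0// ltW.
(* The contributions collected at the end amount to (4 Lc + 2) r1; r1 <= e keeps the perturbed datum
   below 2 e. *)
pose r1 := Num.min (rho / (5 * Lc + 2)) e.
have p1 : 0 < 5 * Lc + 2 by lra.
have r10 : 0 < r1 by rewrite lt_min divr_gt0.
have r1e : r1 <= e by rewrite ge_min lexx orbT.
have r1r : r1 * (5 * Lc + 2) <= rho by rewrite -ler_pdivlMr// ge_min lexx.
have [delta dl0 [m1 hm1]] := IH _ _ hgi r1 r10.
have [m2 hm2] := hcv i eta0 hw r10.
exists delta => //; exists (maxn m1 m2) => m phi'; rewrite geq_max => /andP[mm1 mm2] p0 pr ed.
have [u' [hu' du']] := hm1 m phi' mm1 p0 pr ed.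
have [q1 q2 [q3 q3'] [c' q4] q5] := hu'.
have uii k : u k (clip 0 (tt i) (tt i)) = u k (tt i) by rewrite clip_hi// tt_ge0.
have [_ da] := bd_at (tt i) wX0 du'.
have {}da : ell2 (fun k => wX k * nc (u' k (tt i) - u k (tt i))) r1.
  by move=> M'; have := da M'; under eq_bigr do rewrite uii.
have da' := ell_Xw he (fun k => nc_ge0 _) (ltW r10) da.
have [_ ua] := bd_at (tt i) (fun k => w0 k eta0) hw.
have {}ua : ell2 (fun k => wt (Gw sg eta) N k * nc (u k (tt i))) e.
  by move=> M'; have := ua M'; under eq_bigr do rewrite /win clip_lo//.
have a2 : ell2 (fun k => wt (Gw sg eta) N k * nc (u' k (tt i))) (2 * e).
  apply: ell2_le (ell2D (ltW r10) e0' da' ua); last by rewrite addr_ge0//=; lra.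
  move=> k; rewrite mulr_ge0 ?nc_ge0 ?(ltW (w0 k eta0))//= -mulrDr ler_pM2l ?w0//.
  by rewrite -{1}[u' k (tt i)](subrK (u k (tt i))) ncD.
have Ke2 : 8 * K * (2 * e) <= 1 by lra.
have e20 : 0 <= 2 * e by lra.
have u'r k : conjc (u' (- k) (tt i)) = u' k (tt i) by rewrite -[in RHS]q3'.
have [v' [hv' ev' rv']] := picard_real i (hop m) eta0 e20 Ke2 (q3 (tt i)) u'r a2.
have e4 : 2 * (2 * e) = 4 * e by ring.
rewrite e4 in hv'.
exists (fun k t => u' k t + (v' k t - u' k (tt i))); split; first exact: ext (hop m) hu' he hv' ev' rv'.
have [pp1 _ _ _ _] := hop m; have [bb1 _ _ _ _] := opok_Binf.
have hB := bb1 eta (tt i) (tt i.+1) eta0 (ttS i) (tt_step i).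
have hB' := pp1 eta (tt i) (tt i.+1) eta0 (ttS i) (tt_step i).
have hw4 : bdw eta (win i u) (2 * (2 * e)) by apply: (bd_le (fun k => w0 k eta0)) hw; lra.
have hv4 : bdw eta v' (2 * (2 * e)) by rewrite e4.
have dcst : bdw eta (fun k _ => u k (tt i) - u' k (tt i)) r1.
  apply: bd_cst => //; first exact: ltW.
  by move=> M'; under eq_bigr do rewrite ncBC; exact: da'.
have dv := picard_stable (fun k => w0 k eta0) O0 hB hB' Ke2 e20 hw4 hv4 wE ev' dcst (hm2 m mm2).
have dvX := bdw_X he (bdBC (fun k => w0 k eta0) dv).
have dX := bd_cst OX0 (ltW r10) da.
have := bdD wX0 du' (bdB wX0 dvX dX) => /(bd_le wX0 (e := rho)) h.
apply: (bd_ext _ (h _)).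
  by move=> k t; rewrite [u k t]dec; ring.
apply: le_trans r1r; rewrite (_ : N / N0 / eta * _ = Lc * (2 * (r1 + r1))); last by rewrite /Lc; ring.
have : 0 <= r1 * Lc by rewrite mulr_ge0// ltW.
lra.
Qed.
End stab.

Lemma pr_Ep M t0 t1 f k t : t0 <= t <= t1 ->
  BM alpha beta M t0 t1 f f k t =
  pr M (fun x y => Ep alpha beta x y f f) (fun _ _ _ => true) k t -
  pr M (fun x y => Ep alpha beta x y f f) (fun _ _ _ => true) k t0.
Proof.
move=> ht; rewrite /BM /pr -sumrB; apply: eq_bigr => i _; rewrite -sumrB; apply: eq_bigr => j _.
rewrite /Bt clip_id// /ok andbT.
have [->|k0] := eqVneq k 0; first by rewrite !andbF mulr0z mul0r subr0; case: ifP.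
by rewrite andbT; case: ifP => _; rewrite ?mulrBr// subr0.
Qed.

(** [energy_window] is applied to the stopped field w of each window and to [V], which rebuilds it
    from primitives that are not stopped and is thus differentiable at all times. *)
Lemma energy_good M u phi i X : good (Bgal alpha beta M) u phi i X -> 0 <= X <= 1 ->
  forall j, (j <= i)%N ->
  \sum_(k <- ZM M) (nc (u k (tt j)) / br N k) ^+ 2 <=
  \sum_(k <- ZM M) (nc (phi k) / br N k) ^+ 2 + j%:R * (Cen Ca * d * X ^+ 3).
Proof.
move=> [g1 g2 [g3 g3'] _ g5] /andP[X0 X1]; elim=> [|j IH] hj.
  by rewrite tt0 mul0r addr0; under eq_bigr do rewrite g1.
have [eta [/andP[e0 e1] [_ [A hA eA]] hw]] := g5 j hj.
have {}IH := IH (ltnW hj).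
set w := win j u in hA eA hw.
have eA' : ell2 (fun k => A k / br N k) X.
  apply: ell2_le eA; last by rewrite X0 lexx.
  move=> k; have [A0 _] := hA k; have b0 := br_gt0 k Np; rewrite divr_ge0 ?(ltW b0)//= mulrC.
  apply: ler_wpM2r => //; rewrite /wt ler_peMl ?invr_ge0 ?(ltW b0)//.
  by rewrite lerDl mulr_ge0 ?powR_ge0// ltW.
have cw t : w 0 t = 0 by exact: g3.
have rw k t : w (- k) t = conjc (w k t).
  by rewrite /w /win -[in RHS]g3' /bar conjcK.
pose pE := pr M (fun x y => Ep alpha beta x y w w) (fun _ _ _ => true).
pose V k t := u k (tt j) + (if (`|k| <= M)%N then pE k t - pE k (tt j) else 0).
pose Q k t : C := if (`|k| <= M)%N then pr M (Ph alpha beta w) (fun _ _ _ => true) k t else 0.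
have dV k : dC (V k) (Q k).
  rewrite /V /Q; case: (`|k| <= M)%N; last first.
    by have := dC_cst (u k (tt j)); rewrite (_ : (fun t => _ + 0) = fun=> u k (tt j))//; apply/funext => t; rewrite addr0.
  have h1 : dC (pE k) (pr M (Ph alpha beta w) (fun _ _ _ => true) k).
    by apply: dC_pr => i' j'; exact: (EpP' alpha beta (N := N) (A := A)).
  have := dCD (dC_cst (u k (tt j))) (dCB h1 (dC_cst (pE k (tt j)))).
  by apply: dC_ext => t; rewrite add0r subr0.
have Vw k t : tt j <= t <= tt j.+1 -> V k t = w k t.
  move=> ht; rewrite hw /V BgalE; case: ifP => // _.
  by rewrite /pE -(pr_Ep M w k ht).
have Vq k t : k \in ZM M -> tt j <= t <= tt j.+1 -> Q k t = pr M (Ph alpha beta w) (fun _ _ _ => true) k t.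
  by rewrite mem_ZM /Q => ->.
have := @energy_window R alpha beta N0 Ca N M hok hN w V Q A X (tt j) (tt j.+1) X0 hA eA' cw rw (ttS j) (tt_step j)
  dV Vw Vq (tt j.+1) X1.
rewrite ttS lexx => /(_ isT); rewrite /Eb.
have e3 : forall k, w k (tt j) = u k (tt j) by move=> k; rewrite /w /win clip_lo.
have e4 : forall k, w k (tt j.+1) = u k (tt j.+1) by move=> k; rewrite /w /win clip_hi.
under eq_bigr do rewrite e4; under [X in _ - X]eq_bigr do rewrite e3.
move=> h; have := le_trans (ler_norm _) h => h'.
have : j.+1%:R * (Cen Ca * d * X ^+ 3) = j%:R * (Cen Ca * d * X ^+ 3) + Cen Ca * d * X ^+ 3.
  by rewrite -addn1 natrD mulrDl mul1r.
move: IH h'; move: (Cen Ca * d * X ^+ 3) (_ * _) (j.+1%:R * _) => x y z; lra.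
Qed.

Lemma Bgal_conv : forall eta j f (X e : R), 0 < eta -> bdw eta f X -> 0 < e ->
  exists m0, forall m, (m0 <= m)%N -> bdw eta (fun k t =>
    Binf alpha beta (tt j) (tt j.+1) f f k t - Bgal alpha beta m (tt j) (tt j.+1) f f k t) e.
Proof.
move=> eta j f X e e0 hf ee; have dD : d <= 1 * d by rewrite mul1r.
exact: (Bgal_cvg hok hN d0 dD (lexx 1) (submul_Gw sg0 e0) (ttS j) (tt_step j) hf hf ee).
Qed.

Lemma Binf_conv : forall eta j f (X e : R), 0 < eta -> bdw eta f X -> 0 < e ->
  exists m0, forall m : nat, (m0 <= m)%N -> bdw eta (fun k t =>
    Binf alpha beta (tt j) (tt j.+1) f f k t - Binf alpha beta (tt j) (tt j.+1) f f k t) e.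
Proof.
move=> eta j f X e e0 hf ee; exists 0%N => m _.
by apply: (bd_ext (u := fun _ _ => 0)); [move=> k t; rewrite subrr|exact: bd0 (ltW ee)].
Qed.

(** The part already built has size 6 eps, so its Galerkin approximations have size 24 eps by
    [stab]. Their energy, with weight 1/[k], stays below eps^2 + 3 eps^2 = (2 eps)^2, and so does
    that of the limit. A small eta adds at most eps, and Picard iteration from a datum of size 3 eps
    gives a next window of size 6 eps again. Galerkin fields are used because the energy identity
    differentiates finite sums. *)
Lemma good_exists phi eps Phi : 0 < eps -> 16 * K * (6 * eps) <= 1 -> 24 * eps <= 1 ->
  nW%:R * (Cen Ca * d * (24 * eps) ^+ 3) <= 3 * eps ^+ 2 ->
  phi 0 = 0 -> (forall k, conjc (phi (- k)) = phi k) -> 0 <= Phi ->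
  ell2 (fun k => wX k * nc (phi k)) Phi -> ell2 (fun k => nc (phi k) / br N k) eps ->
  forall i, (i <= nW)%N -> exists u, good (Binf alpha beta) u phi i (6 * eps).
Proof.
move=> ep0 Ke e24 en p0 pr Phi0 eP eN; elim=> [|i IH] hi.
  exists (fun k _ => phi k); split=> //.
    by split=> //; apply/funext => k; apply/funext => t; rewrite /bar pr.
  by exists Phi; exact: bd_cst.
have [u hu] := IH (ltnW hi).
have [g1 g2 [g3 g3'] [c g4] g5] := hu.
have e60 : 0 < 6 * eps by lra.
have C0 : 0 <= Cen Ca * d * (24 * eps) ^+ 3.
  have Ca1 : 0 <= Ca by case: hok => _ h _; lra.
  rewrite mulr_ge0 ?exprn_ge0 ?mulr_ge0 ?(ltW d0) ?(ltW ep0)// /Cen.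
  have h1 : 0 <= 96 * Ca by rewrite mulr_ge0.
  have h2 : 0 <= 96 * Ca * (96 * Ca) by rewrite mulr_ge0.
  have h3 : 0 <= 2 * (24 * (12 * Ca)) * (96 * Ca) by rewrite mulr_ge0// !mulr_ge0.
  lra.
(* the energy bound of the Galerkin approximations passes to the limit *)
have base : ell2 (fun k => nc (u k (tt i)) / br N k) (2 * eps).
  move=> M'; rewrite -[leLHS]sqr_sqrtr; last by apply: sumr_ge0 => k _; exact: sqr_ge0.
  rewrite ler_sqr ?nnegrE ?sqrtr_ge0 ?mulr_ge0 ?(ltW ep0)//.
  apply/ler_addgt0Pr => rho r0.
  have [delta d1 [m0 hm0]] := stab opok_Bgal Bgal_conv e60 Ke hu r0.
  have z : ell2 (fun k => wX k * nc (phi k - phi k)) delta.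
    by move=> M''; rewrite big1 ?sqr_ge0// => k _; rewrite subrr nc0 mulr0 expr0n.
  have [u' [hu' du']] := hm0 (maxn m0 M') phi (leq_maxl _ _) p0 pr z.
  have e44 : 4 * (6 * eps) = 24 * eps by ring.
  rewrite e44 in hu'.
  have X01 : 0 <= 24 * eps <= 1 by rewrite e24 andbT; lra.
  have en1 := energy_good hu' X01 (leqnn i).
  have en2 : \sum_(k <- ZM (maxn m0 M')) (nc (u' k (tt i)) / br N k) ^+ 2 <= (2 * eps) ^+ 2.
    apply: (le_trans en1); have := eN (maxn m0 M').
    have : i%:R * (Cen Ca * d * (24 * eps) ^+ 3) <= nW%:R * (Cen Ca * d * (24 * eps) ^+ 3).
      by apply: ler_wpM2r => //; rewrite ler_nat ltnW.
    by rewrite exprMn; lra.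
  have [_ da] := bd_at (tt i) wX0 du'.
  have s1 : Num.sqrt (\sum_(k <- ZM M') (nc (u' k (tt i)) / br N k) ^+ 2) <= 2 * eps.
    rewrite -[leRHS]ger0_norm ?mulr_ge0 ?(ltW ep0)// -sqrtr_sqr ler_wsqrtr//.
    by apply: le_trans en2; apply: ler_sum_ZM; [exact: leq_maxr|move=> k; exact: sqr_ge0].
  have s2 : Num.sqrt (\sum_(k <- ZM M') (wX k * nc (u' k (tt i) - u k (tt i))) ^+ 2) <= rho.
    by apply: sqrt_ell2 => //; exact: ltW.
  apply: (@le_trans _ _ (Num.sqrt (\sum_(k <- ZM M') (nc (u' k (tt i)) / br N k + wX k * nc (u' k (tt i) - u k (tt i))) ^+ 2))).
    rewrite ler_wsqrtr// ler_sum// => k _.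
    have b0 := br_gt0 k Np; have wk := ltW (wX0 k).
    have n0 y : 0 <= nc y / br N k by rewrite divr_ge0 ?nc_ge0// ltW.
    rewrite ler_sqr ?nnegrE; [|exact: n0|by apply: addr_ge0 => //; apply: mulr_ge0 => //; exact: nc_ge0].
    apply: (@le_trans _ _ (nc (u' k (tt i)) / br N k + (br N k)^-1 * nc (u' k (tt i) - u k (tt i)))).
      rewrite [_^-1 * _]mulrC -mulrDl ler_wpM2r ?invr_ge0 ?(ltW b0)//.
      by rewrite -{1}[u k (tt i)](subKr (u' k (tt i))) ncB.
    rewrite lerD2l; apply: ler_wpM2r; first exact: nc_ge0.
    have [b1 _] := br_scale k N00 hN.
    have g0 : 1 <= Gw sg 1 k by rewrite lerDl mulr_ge0 ?powR_ge0.
    rewrite /wt; apply: (@le_trans _ _ (br N0 k)^-1); first by rewrite lef_pV2 ?posrE ?br_gt0.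
    by rewrite ler_peMl// invr_ge0 ltW// br_gt0.
  apply: le_trans (minkowski (ZM M') (fun k => nc (u' k (tt i)) / br N k) (fun k => wX k * nc (u' k (tt i) - u k (tt i)))) _.
  exact: lerD.
have [c0 uc] := bd_at (tt i) wX0 g4.
(* The bound [c] of the part already built is finite but uncontrolled; eta reduces its cost to at
   most eps. *)
pose eta := Num.min 1 (eps / (c + 1)).
have c1 : 0 < c + 1 by lra.
have eta0 : 0 < eta by rewrite lt_min ltr01 divr_gt0.
have eta1 : eta <= 1 by rewrite ge_min lexx.
have etac : eta * (c + 1) <= eps by rewrite -ler_pdivlMr// ge_min lexx orbT.
have a2 : ell2 (fun k => wt (Gw sg eta) N k * nc (u k (tt i))) (3 * eps).
  have ep2 : 0 <= 2 * eps by lra. have ec0 : 0 <= eta * c by rewrite mulr_ge0// ltW.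
  apply: ell2_le (ell2D ep2 ec0 base (ell2Z eta uc)); last first.
    rewrite addr_ge0//=; have : eta * c <= eta * (c + 1) by rewrite ler_pM2l//; lra.
    lra.
  move=> k; rewrite mulr_ge0 ?nc_ge0 ?(ltW (w0 k eta0))//=.
  have b0 := br_gt0 k Np.
  have [b1 _] := br_scale k N00 hN.
  have q1 : japanese_bracket R k `^ sg / br N k <= wX k.
    apply: ler_pM; rewrite ?powR_ge0 ?invr_ge0 ?(ltW b0)//; first by rewrite /Gw mul1r lerDr.
    by rewrite lef_pV2 ?posrE ?br_gt0.
  rewrite /wt [Gw _ _ _]/(1 + eta * japanese_bracket R k `^ sg).
  have -> : (1 + eta * japanese_bracket R k `^ sg) / br N k * nc (u k (tt i)) =
     nc (u k (tt i)) / br N k + eta * (japanese_bracket R k `^ sg / br N k * nc (u k (tt i))) by ring.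
  by rewrite lerD2l ler_pM2l// ler_wpM2r ?nc_ge0.
have K0 : 0 <= K.
  have [pp _ _ _ _] := opok_Binf.
  by have [] := pp 1 (tt 0) (tt 1) ltr01 (ttS 0) (tt_step 0).
have Kep : 0 <= K * eps by apply: mulr_ge0 => //; exact: ltW.
have Ke3 : 8 * K * (3 * eps) <= 1 by move: (K) Ke Kep => x ? ?; lra.
have e30 : 0 <= 3 * eps by lra.
have ur k : conjc (u (- k) (tt i)) = u k (tt i) by rewrite -[in RHS]g3'.
have [v [hv ev rv]] := picard_real i opok_Binf eta0 e30 Ke3 (g3 (tt i)) ur a2.
have e6 : 2 * (3 * eps) = 6 * eps by ring.
rewrite e6 in hv.
exists (fun k t => u k t + (v k t - u k (tt i))).
by apply: ext opok_Binf hu _ hv ev rv; rewrite eta0 eta1.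
Qed.

End windows.

(** * Well-posedness on [0, T] for Fourier coefficients *)

Section core.
Variable R : realType.
Notation C := R[i].
Variables (alpha beta N0 Ca sg T : R).
Hypothesis hok : phase_ok alpha beta N0 Ca.
Hypothesis sg0 : 0 <= sg.
Hypothesis T0 : 0 < T.
Notation wX := (wt (Gw sg 1) N0).
Notation bdX := (bd (wt (Gw sg 1) N0) (om N0 T)).
Notation B := (Binf alpha beta).
(** Makes [0, T] admissible as a single window at level [N0], at the price of a large constant:
    enough for the operator to be bounded and continuous on the whole interval. *)
Definition DT : R := 1 + T * expR (5 / 2 * ln N0).
Notation KX := (CB Ca DT (2 `^ sg)).
Implicit Types (u v f g : int -> R -> C) (phi a : int -> C) (i j : nat) (k : int) (t e r rho eta N : R).

Let N01 : 1 <= N0. Proof. by case: hok. Qed.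
Let N00 : 0 < N0. Proof. exact: lt_le_trans N01. Qed.
Let wX0 k : 0 < wX k. Proof. exact: wt_gt0 (submul_Gw sg0 ltr01) N00. Qed.
Let OX0 k : gpos (om N0 T k). Proof. exact: om_gpos. Qed.
Let DT1 : 1 <= DT. Proof. by rewrite /DT lerDl mulr_ge0 ?expR_ge0// ltW. Qed.
Let TD : T <= DT * expR (- (5 / 2) * ln N0).
Proof.
rewrite /DT mulrDl mul1r -mulrA -expRD (_ : 5 / 2 * ln N0 + - (5 / 2) * ln N0 = 0); last by ring.
by rewrite expR0 mulr1 lerDr expR_ge0.
Qed.
Let sG : submul (Gw sg (1 : R)) (2 `^ sg). Proof. exact: submul_Gw. Qed.

Lemma X_bilop t0 t1 : t0 <= t1 -> t1 - t0 <= T -> bilop wX (om N0 T) (B t0 t1) KX.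
Proof. by move=> h1 h2; exact: (bilop_Binf hok (lexx N0) T0 TD DT1 sG h1 h2). Qed.

Lemma X_cvg f g c c' e : bdX f c -> bdX g c' -> 0 < e ->
  exists n0, forall n, (n0 <= n)%N -> bdX (fun k t => B 0 T f g k t - Bgal alpha beta n 0 T f g k t) e.
Proof.
move=> hf hg e0; have h1 : 0 <= T by exact: ltW. have h2 : T - 0 <= T by rewrite subr0.
exact: (Bgal_cvg hok (lexx N0) T0 TD DT1 sG h1 h2 hf hg e0).
Qed.

Lemma X_lims t0 t1 f g c c' k t : t0 <= t1 -> t1 - t0 <= T -> bdX f c -> bdX g c' ->
  lims (fun M => BM alpha beta M t0 t1 f g k t) (B t0 t1 f g k t).
Proof. by move=> h1 h2 hf hg; exact: (Binf_lims hok (lexx N0) T0 TD DT1 sG h1 h2 k t hf hg). Qed.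

(** What passing between the equation on [0, T] and those on the windows requires: additivity over
    consecutive intervals, locality, vanishing before the interval and constancy after it. *)
Definition catop (op : R -> R -> (int -> R -> C) -> (int -> R -> C) -> int -> R -> C) :=
  [/\ forall t0 t1 t2 f c k t, 0 <= t0 -> t0 <= t1 -> t1 <= t2 -> t2 <= T -> bdX f c ->
        op t0 t2 f f k t = op t0 t1 f f k t + op t1 t2 f f k t,
      forall t0 t1 f g c c' k t, t0 <= t1 -> bdX f c -> bdX g c' ->
        (forall k t, t0 <= t <= t1 -> f k t = g k t) -> op t0 t1 f f k t = op t0 t1 g g k t,
      forall t0 t1 f k t, t0 <= t1 -> t <= t0 -> op t0 t1 f f k t = 0 &
      forall t0 t1 f k t, t0 <= t1 -> op t0 t1 f f k (clip t0 t1 t) = op t0 t1 f f k t].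

Lemma catop_Binf : catop B.
Proof.
split=> [t0 t1 t2 f c k t a0 a1 a2 a3 hf|t0 t1 f g c c' k t a1 hf hg h|t0 t1 f k t a1 a2|t0 t1 f k t a1].
- have a4 : t1 - t0 <= T by lra. have a5 : t2 - t1 <= T by lra. have a6 : t2 - t0 <= T by lra.
  apply: lims_uniq (X_lims k t (le_trans a1 a2) a6 hf hf) _.
  have := limsD (X_lims k t a1 a4 hf hf) (X_lims k t a2 a5 hf hf).
  rewrite (_ : (fun n => _) = fun M => BM alpha beta M t0 t2 f f k t)//.
  by apply/funext => M; rewrite (BM_cat _ _ _ _ _ _ _ a1 a2).
- have cf := bd_cont T0 hf; have cg := bd_cont T0 hg; exact: Binf_local.
- exact: Binf_before.
- exact: Binf_clip.
Qed.

Lemma catop_Bgal M : catop (Bgal alpha beta M).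
Proof.
split=> [t0 t1 t2 f c k t a0 a1 a2 a3 hf|t0 t1 f g c c' k t a1 hf hg h|t0 t1 f k t a1 a2|t0 t1 f k t a1].
- by rewrite !BgalE; case: ifP => _; rewrite ?addr0//; exact: BM_cat.
- have cf := bd_cont T0 hf; have cg := bd_cont T0 hg.
  by rewrite !BgalE; case: ifP => // _; exact: BM_local.
- by rewrite !BgalE BM_before// if_same.
- by rewrite !BgalE BM_clip.
Qed.

Section part.
Variables (nW : nat).
Hypothesis nW0 : (0 < nW)%N.
Notation tt := (tt T nW).
Notation win := (win T nW).
Let ttS i : tt i <= tt i.+1. Proof. exact: tt_le. Qed.
Let ttT' : tt nW = T. Proof. exact: ttT. Qed.
Let tt0' : tt 0 = 0. Proof. exact: tt0. Qed.
Let ttlT i : (i <= nW)%N -> tt i <= T.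
Proof. by move=> h; rewrite -[leRHS]ttT'; exact: tt_le. Qed.
Let ttg i : 0 <= tt i. Proof. exact: tt_ge0. Qed.

(** At the end of window i the operator over the past has reached u - phi and stays there, so the
    equation of the next window continues the global one. *)
Lemma glob_eq op u c phi : catop op -> bdX u c -> (forall k, u k 0 = phi k) ->
  (forall j, (j < nW)%N -> forall k t, win j u k t = u k (tt j) + op (tt j) (tt j.+1) (win j u) (win j u) k t) ->
  forall k t, 0 <= t <= T -> u k t = phi k + op 0 T u u k t.
Proof.
move=> [c1 c2 c3 c4] hu u0 hw.
suff H i : (i <= nW)%N -> forall k t, 0 <= t <= tt i -> u k t = phi k + op 0 (tt i) u u k t.
  by have := H nW (leqnn _); rewrite ttT'.
elim: i => [|i IH] hi k t; rewrite ?tt0'.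
  move=> /andP[? ?]; have -> : t = 0 by lra.
  by rewrite c3// u0 addr0.
move=> /andP[t0 t1]; have ti := ttlT hi.
have {}IH := IH (ltnW hi).
rewrite (c1 0 (tt i) (tt i.+1) u c)//.
have [h|/ltW h] := leP t (tt i).
  by rewrite (c3 (tt i))// addr0 IH// t0.
have e1 : op 0 (tt i) u u k t = u k (tt i) - phi k.
  rewrite -(c4 0 (tt i))// clip_hi// IH ?lexx ?ttg//.
  by rewrite [RHS]addrC addKr.
rewrite e1 (c2 (tt i) (tt i.+1) u (win i u) c c)//.
- have := hw i hi k t; rewrite {1}/win clip_id ?h// => ->.
  by ring.
- by apply: bd_comp hu => [k' x y|t' s]; [exact: om_mono|exact: clip_lip].
- by move=> k' t' ht; rewrite /win clip_id.
Qed.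

Lemma eq_win op u c phi j : catop op -> bdX u c -> (forall k t, 0 <= t <= T -> u k t = phi k + op 0 T u u k t) ->
  (j < nW)%N -> forall k t, win j u k t = u k (tt j) + op (tt j) (tt j.+1) (win j u) (win j u) k t.
Proof.
move=> [c1 c2 c3 c4] hu heq hj k t.
have tj := ttlT hj.
have tj' : tt j <= T by apply: le_trans tj.
have hw : bdX (win j u) c by apply: bd_comp hu => [k' x y|t' s]; [exact: om_mono|exact: clip_lip].
have dec s : op 0 T u u k s = op 0 (tt j) u u k s + op (tt j) (tt j.+1) u u k s + op (tt j.+1) T u u k s.
  by rewrite (c1 0 (tt j) T u c)// (c1 (tt j) (tt j.+1) T u c)// addrA.
have /andP[s0 s1] := clip_in t (ttS j).
rewrite -[op (tt j) _ (win j u) _ k t](c4 _ _ _ _ _ (ttS j)) /win; set s := clip _ _ _ in s0 s1 *.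
rewrite -(c2 (tt j) (tt j.+1) u (win j u) c c)//; last by move=> k' t' ht; rewrite /win clip_id.
rewrite [LHS]heq; last by rewrite (le_trans (ttg j) s0) (le_trans s1).
rewrite [u k (tt j)]heq; last by rewrite ttg tj'.
rewrite !dec (c3 (tt j.+1) T)// (c3 (tt j.+1) T _ _ (tt j))// (c3 (tt j) (tt j.+1) _ _ (tt j))//.
rewrite -[op 0 (tt j) u u k s](c4 _ _ _ _ _ (ttg j)) clip_hi//.
by ring.
Qed.

Lemma uniq_part u u' (c c' : R) phi (w : int -> R) (O : int -> R -> R) (K a : R) :
  (forall k, 0 < w k) -> (forall k, gpos (O k)) ->
  (forall j, (j < nW)%N -> bilop w O (B (tt j) (tt j.+1)) K) -> 8 * K * a <= 1 -> 0 <= a ->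
  bdX u c -> bdX u' c' ->
  (forall k t, 0 <= t <= T -> u k t = phi k + B 0 T u u k t) ->
  (forall k t, 0 <= t <= T -> u' k t = phi k + B 0 T u' u' k t) ->
  (forall j, bd w O (win j u) (2 * a)) -> (forall j, bd w O (win j u') (2 * a)) ->
  forall k t, 0 <= t <= T -> u k t = u' k t.
Proof.
move=> w0 O0 hB Ka a0 hu hu' e1 e2 b1 b2.
have z v : bdX v c \/ bdX v c' -> (forall k t, 0 <= t <= T -> v k t = phi k + B 0 T v v k t) -> forall k, v k 0 = phi k.
  by move=> _ ev k; rewrite ev ?lexx ?(ltW T0)// Binf_before ?addr0// ltW.
suff H i : (i <= nW)%N -> forall k t, 0 <= t <= tt i -> u k t = u' k t.
  by have := H nW (leqnn _); rewrite ttT'.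
elim: i => [|i IH] hi k t; rewrite ?tt0'.
  move=> /andP[? ?]; have -> : t = 0 by lra.
  by rewrite (z u)//; [rewrite (z u')//; right|left].
move=> /andP[t0 t1]; have {}IH := IH (ltnW hi).
have [h|/ltW h] := leP t (tt i); first by apply: IH; rewrite t0.
have q1 := eq_win catop_Binf hu e1 hi; have q2 := eq_win catop_Binf hu' e2 hi.
have zz : bd w O (fun _ _ => 0) 0 by exact: bd0.
have d1 : bd w O (fun k t => u k (tt i) - u' k (tt i)) 0.
  by apply: bd_ext zz => k' t'; rewrite IH ?subrr// ttg lexx.
have d2 : bd w O (fun k t => B (tt i) (tt i.+1) (win i u) (win i u) k t - B (tt i) (tt i.+1) (win i u) (win i u) k t) 0.
  by apply: bd_ext zz => k' t'; rewrite subrr.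
have := picard_stable w0 O0 (hB i hi) (hB i hi) Ka a0 (b1 i) (b2 i) q1 q2 d1 d2.
rewrite addr0 mulr0 => hd; have := bd_pt w0 k t hd; rewrite mul0r /win clip_id ?h// => hz.
apply/eqP; rewrite -subr_eq0; apply/eqP/nc_eq0/le_anti; by rewrite hz nc_ge0.
Qed.

End part.

(** Let q^2 be the quotient of the brackets at levels N and N0. Restoring the modulus at level N
    multiplies the constants by q, and the weight decreases by q^2: the net gain 1 / q is at most
    [b] on the modes of [P]. *)
Lemma scale_bd u (c : R) N (b : R) (P : pred int) : 1 <= N -> N0 <= N -> T^-1 <= N -> bdX u c -> 0 <= b ->
  (forall k, P k -> br N0 k <= b ^+ 2 * br N k) ->
  bd (wt (fun=> 1) N) (om N (expR (- (5 / 2) * ln N))) (fun k t => if P k then u k t else 0) (b * c).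
Proof.
move=> N1 hN NT [c0 [A hA eA]] b0 hP; set d := expR _.
have d0 : 0 < d by exact: expR_gt0.
have Np : 0 < N by lra.
have dT : d <= T.
  rewrite -[T]invrK -[leLHS]invrK lef_pV2 ?posrE ?invr_gt0//.
  apply: (le_trans NT); rewrite /d -expRN -[N in leLHS](@lnK _ N) ?posrE// ler_expR.
  by have := ln_ge0 N1; lra.
pose q k := expR (1 / 2 * (ln (br N k) - ln (br N0 k))).
have q1 k : 1 <= q k.
  rewrite -[leLHS]expR0 ler_expR; have [h _] := br_scale k N00 hN.
  have : ln (br N0 k) <= ln (br N k) by rewrite ler_ln ?posrE ?br_gt0.
  lra.
have qq k : q k * q k * br N0 k = br N k.
  have e0 := @br_expR R N0 k N00; have e1 := @br_expR R N k Np.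
  by rewrite [X in _ * X]e0 [RHS]e1 /q -!expRD; congr expR; lra.
split; first exact: mulr_ge0.
exists (fun k => if P k then A k * q k else 0) => [k|].
  have [A0 [h1 h2]] := hA k; have q0 : 0 <= q k by exact: expR_ge0.
  case: (P k); last by split=> //; rewrite -(@nc0 R); apply: Hol_cst; exact: om_gpos.
  split; first exact: mulr_ge0.
  split=> [t|t s]; first by apply: (le_trans (h1 t)); rewrite ler_peMr.
  apply: (le_trans (h2 t s)); rewrite -mulrA; apply: ler_wpM2l => //.
  have hh := normr_ge0 (t - s); move: `|t - s| hh => h hh.
  rewrite /om mulrDr; apply: lerD.
    apply: (@le_trans _ _ (h / d)); last by rewrite ler_peMl// divr_ge0// ltW.
    by apply: ler_wpM2l => //; rewrite lef_pV2 ?posrE.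
  rewrite mulrA; apply: ler_wpM2r; first exact: powR_ge0.
  rewrite /q -expRD ler_expR; lra.
have := ell2Z b eA; apply: ell2_le; last by rewrite lexx mulr_ge0.
move=> k; have [A0 _] := hA k; have bN := br_gt0 k Np; have bN0 := br_gt0 k N00.
have w1 : 0 <= wt (fun=> 1) N k by rewrite /wt divr_ge0// ltW.
have wb : 0 <= b * (wX k * A k) by apply: mulr_ge0 => //; apply: mulr_ge0 => //; exact: ltW.
case: ifP => hk; last by rewrite mulr0 lexx.
have q0 : 0 < q k by exact: expR_gt0.
apply/andP; split; first by apply: mulr_ge0 => //; apply: mulr_ge0 => //; exact: ltW.
have g1 : 1 <= Gw sg 1 k by rewrite lerDl mulr_ge0 ?powR_ge0.
have h1 := hP k hk; rewrite -(qq k) in h1.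
have bq : 1 <= b * q k.
  have : 1 <= (b * q k) ^+ 2.
    have : 1 * br N0 k <= (b * q k) ^+ 2 * br N0 k by rewrite mul1r; apply: (le_trans h1); rewrite exprMn; lra.
    by rewrite ler_pM2r.
  by rewrite -{1}(expr1n _ 2) ler_sqr ?nnegrE// mulr_ge0// ltW.
have -> : wt (fun=> 1) N k * (A k * q k) = A k / br N0 k * (q k)^-1.
  by rewrite /wt -(qq k) mul1r; field; rewrite !gt_eqF.
have -> : b * (wX k * A k) = A k / br N0 k * (Gw sg 1 k * b) by rewrite /wt; ring.
apply: ler_wpM2l; first by rewrite divr_ge0// ltW.
have bq0 : 0 <= b * q k by lra.
by rewrite -[leLHS]mul1r ler_pdivrMr// -mulrA; apply: (le_trans bq); rewrite ler_peMl.
Qed.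

(** Modes beyond some M are small as a tail, and the finitely many others gain a negative power of N
    by [scale_bd]. It serves for the data, and in [X_uniq] for arbitrary solutions. *)
Lemma small_scale u c e : bdX u c -> 0 < e -> exists N1, forall N, N1 <= N -> 1 <= N -> N0 <= N -> T^-1 <= N ->
  bd (wt (fun=> 1) N) (om N (expR (- (5 / 2) * ln N))) u e.
Proof.
move=> hu e0; have c0 : 0 <= c by case: hu.
have e2 : 0 < e / 2 by rewrite divr_gt0.
have [M /(_ M (leqnn _)) hM] := bd_tail OX0 hu e2.
pose b := e / 2 / (c + 1).
have c1 : 0 < c + 1 by lra.
have b0 : 0 < b by rewrite divr_gt0.
have bc : b * (c + 1) = e / 2 by rewrite divfK// gt_eqF.
exists ((N0 + M%:R) / b ^+ 2) => N hN N1 NN0 NT.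
have h1 : forall k, xpredT k -> br N0 k <= 1 ^+ 2 * br N k.
  by move=> k _; rewrite expr1n mul1r; have [] := br_scale k N00 NN0.
have h2 : forall k, (`|k| <= M)%N -> br N0 k <= b ^+ 2 * br N k.
  move=> k hk; apply: (@le_trans _ _ (N0 + M%:R)).
    rewrite /br ge_max lerDl ler0n /=; apply: (@le_trans _ _ M%:R); first by rewrite ler_nat.
    by rewrite lerDr ltW.
  have : N0 + M%:R <= N * b ^+ 2 by rewrite -ler_pdivrMr// exprn_gt0.
  move=> h; apply: (le_trans h); rewrite mulrC ler_pM2l ?exprn_gt0//.
  by rewrite le_max lexx.
have k1 := scale_bd N1 NN0 NT hM (ler0n _ 1) h1.
have k2 := scale_bd N1 NN0 NT hu (ltW b0) h2.
have w0 k : 0 < wt (fun=> 1 : R) N k by rewrite divr_gt0// br_gt0//; lra.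
have := bdD w0 k1 k2 => /(bd_le w0 (e := e)) h.
apply: (bd_ext _ (h _)); first by move=> k t; rewrite /proj; case: ifP => _; ring.
by lra.
Qed.

(** Two solutions of any size are both small at a common high level N, where [uniq_part] applies on
    every window. Uniqueness therefore holds in the whole space, not only among small or constructed
    solutions. *)
Lemma X_uniq u u' c c' phi : bdX u c -> bdX u' c' ->
  (forall k t, 0 <= t <= T -> u k t = phi k + B 0 T u u k t) ->
  (forall k t, 0 <= t <= T -> u' k t = phi k + B 0 T u' u' k t) ->
  forall k t, 0 <= t <= T -> u k t = u' k t.
Proof.
move=> hu hu' e1 e2.
pose K := CB Ca 1 1 : R.
have K0 : 0 <= K.
  have Ca0 : 0 <= Ca by case: hok => _ h _; lra.
  by rewrite /K /CB expr1n !mulr1 !mulr_ge0.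
pose a := (8 * K + 1)^-1.
have a0 : 0 < a by rewrite invr_gt0; lra.
have Ka : 8 * K * a <= 1 by rewrite ler_pdivrMr; lra.
have a20 : 0 < 2 * a by lra.
have [N1 h1] := small_scale hu a20; have [N2 h2] := small_scale hu' a20.
pose N := Num.max (Num.max 1 N0) (Num.max T^-1 (Num.max N1 N2)).
have [n1 [n2 [n3 [n4 n5]]]] : 1 <= N /\ N0 <= N /\ T^-1 <= N /\ N1 <= N /\ N2 <= N.
  by rewrite /N !le_max !lexx ?orbT.
have {}h1 := h1 N n4 n1 n2 n3; have {}h2 := h2 N n5 n1 n2 n3.
set d := expR _ in h1 h2; have d0 : 0 < d by exact: expR_gt0.
pose nW := (Num.truncn (T / d)).+1.
have nW0 : (0 < nW)%N by [].
have TW : T / nW%:R <= d.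
  have /andP[_ h] := truncn_itv (divr_ge0 (ltW T0) (ltW d0)).
  by rewrite ler_pdivrMr ?ltr0n// mulrC -ler_pdivrMr// ltW.
have Np : 0 < N by lra.
have w0 k : 0 < wt (fun=> 1 : R) N k by rewrite divr_gt0// br_gt0.
have O0 k : gpos (om N d k) by exact: om_gpos.
have dD : d <= 1 * expR (- (5 / 2) * ln N) by rewrite mul1r.
apply: (@uniq_part nW nW0 u u' c c' phi _ _ K a w0 O0 _ Ka (ltW a0) hu hu' e1 e2).
- move=> j hj; apply: (bilop_Binf hok n2 d0 dD (lexx 1) (@submul_1 R)); first exact: tt_le.
  exact: tt_step.
- by move=> j; apply: bd_comp h1 => [k x y|t s]; [exact: om_mono|exact: clip_lip].
- by move=> j; apply: bd_comp h2 => [k x y|t s]; [exact: om_mono|exact: clip_lip].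
Qed.

End core.

(** * Existence, uniqueness and continuous dependence in Fourier variables *)

Section wp.
Variable R : realType.
Notation C := R[i].
Variables (alpha beta N0 Ca sg T : R).
Hypothesis hok : phase_ok alpha beta N0 Ca.
Hypothesis sg0 : 0 <= sg.
Hypothesis T0 : 0 < T.
Notation wX := (wt (Gw sg 1) N0).
Notation bdX := (bd (wt (Gw sg 1) N0) (om N0 T)).
Notation B := (Binf alpha beta).
Implicit Types (u v f g : int -> R -> C) (phi : int -> C) (i j : nat) (k : int) (t rho : R).

Definition data phi := [/\ phi 0 = 0, forall k, conjc (phi (- k)) = phi k &
  exists2 c : R, 0 <= c & ell2 (fun k => wX k * nc (phi k)) c].

Definition stopped u := forall k t, u k t = u k (clip 0 T t).

Definition sol phi u := [/\ stopped u, realz u, exists c, bdX u c &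
  forall k t, 0 <= t <= T -> u k t = phi k + B 0 T u u k t].

Let N01 : 1 <= N0. Proof. by case: hok. Qed.
Let N00 : 0 < N0. Proof. exact: lt_le_trans N01. Qed.
Let wX0 k : 0 < wX k. Proof. exact: wt_gt0 (submul_Gw sg0 ltr01) N00. Qed.
Let OX0 k : gpos (om N0 T k). Proof. exact: om_gpos. Qed.
Notation K := (CB Ca 1 (2 `^ sg)).

(** The energy condition is cubic against quadratic in eps, hence satisfied by small eps. *)
Lemma eps_exists (x y : R) : 0 <= x -> 0 <= y -> exists eps : R,
  [/\ 0 < eps, 16 * x * (6 * eps) <= 1, 24 * eps <= 1 & y * (24 * eps) ^+ 3 <= 3 * eps ^+ 2].
Proof.
move=> x0 y0; pose z := 24 * (24 * 24) * y + 96 * x + 24.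
have y2 : 0 <= 24 * (24 * 24) * y by apply: mulr_ge0 => //; lra.
have z0 : 0 < z by rewrite /z; lra.
have ez : z = 24 * (24 * 24) * y + 96 * x + 24 by [].
clearbody z; exists z^-1.
have i0 : 0 < z^-1 by rewrite invr_gt0.
have zz : z * z^-1 = 1 by rewrite divff// gt_eqF.
have x1 : 0 <= x * z^-1 by rewrite mulr_ge0// ltW.
have y1 : 0 <= y * z^-1 by rewrite mulr_ge0// ltW.
have e1 : 24 * (24 * 24) * (y * z^-1) + 96 * (x * z^-1) + 24 * z^-1 = 1 by have := congr1 (fun r => r * z^-1) ez; rewrite zz => h; rewrite [RHS]h; ring.
clear zz; move: (z^-1) i0 x1 y1 e1 => v i0 x1 y1 e1.
split=> //; [lra|lra|].
have -> : y * (24 * v) ^+ 3 = 24 * (24 * 24) * (y * v) * v ^+ 2 by move: (24 : R) => c; ring.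
by apply: ler_wpM2r; [rewrite exprn_ge0// ltW|lra].
Qed.

(** Besides the solution and its stability, it records approximations with finitely many modes given
    by Duhamel integrals: they will place the solution in the closure of the smooth functions. *)
Lemma sol_exists phi : data phi -> exists2 u, sol phi u &
  (forall rho, 0 < rho -> exists m m' f c, [/\ bdX f c, realz f, stopped f &
     bdX (fun k t => u k t - (if (`|k| <= m')%N then phi k + Bgal alpha beta m 0 T f f k t else 0)) rho]) /\
  (forall rho, 0 < rho -> exists2 delta, 0 < delta & forall phi', data phi' ->
     ell2 (fun k => wX k * nc (phi' k - phi k)) delta ->
     exists2 u', sol phi' u' & bdX (fun k t => u' k t - u k t) rho).
Proof.
move=> [p0 pr [Phi Phi0 eP]].
have Ca0 : 0 <= Ca by case: hok => _ h _; lra.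
have K0 : 0 <= K by rewrite /CB !mulr_ge0 ?powR_ge0// exprn_ge0.
have C0 : 0 <= Cen Ca.
  have h1 : 0 <= 96 * Ca by rewrite mulr_ge0.
  have h2 : 0 <= 96 * Ca * (96 * Ca) by rewrite mulr_ge0.
  have h3 : 0 <= 2 * (24 * (12 * Ca)) * (96 * Ca) by rewrite mulr_ge0// !mulr_ge0.
  rewrite /Cen; lra.
have TC0 : 0 <= (T + 1) * Cen Ca by rewrite mulr_ge0// addr_ge0// ltW.
have [eps [ep0 Ke e24 en]] := eps_exists K0 TC0.
have hphi : bdX (fun k _ => phi k) Phi by exact: bd_cst.
have [N1 hN1] := small_scale hok sg0 T0 hphi ep0.
pose N := Num.max (Num.max 1 N0) (Num.max T^-1 N1).
have [n1 [n2 [n3 n4]]] : 1 <= N /\ N0 <= N /\ T^-1 <= N /\ N1 <= N.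
  by rewrite /N !le_max !lexx ?orbT.
have {}hN1 := hN1 N n4 n1 n2 n3.
set d := expR _ in hN1; have d0 : 0 < d by exact: expR_gt0.
have d1 : d <= 1 by rewrite -[leRHS]expR0 ler_expR; have := ln_ge0 n1; lra.
pose nW := (Num.truncn (T / d)).+1.
have nW0 : (0 < nW)%N by [].
have /andP[tr1 tr2] := truncn_itv (divr_ge0 (ltW T0) (ltW d0)).
have TW : T / nW%:R <= d by rewrite ler_pdivrMr ?ltr0n// mulrC -ler_pdivrMr// ltW.
(* The number of windows times the factor [d] of the energy increment is bounded independently of
   [N]. This is why eps could be fixed before [N]. *)
have nWd : nW%:R * d <= T + 1.
  rewrite /nW -addn1 natrD mulrDl mul1r; apply: lerD => //.
  by rewrite -ler_pdivlMr.
have Np : 0 < N by lra.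
have w10 k : 0 < wt (fun=> 1 : R) N k by rewrite divr_gt0// br_gt0.
have [_ eN] := bd_at 0 w10 hN1.
have eN' : ell2 (fun k => nc (phi k) / br N k) eps.
  by move=> M; have := eN M; under eq_bigr do rewrite /wt mul1r mulrC.
have en' : nW%:R * (Cen Ca * d * (24 * eps) ^+ 3) <= 3 * eps ^+ 2.
  apply: le_trans en; set E3 := (24 * eps) ^+ 3.
  have E30 : 0 <= Cen Ca * E3 by rewrite mulr_ge0// exprn_ge0// mulr_ge0// ltW.
  have -> : nW%:R * (Cen Ca * d * E3) = nW%:R * d * (Cen Ca * E3) by ring.
  have -> : (T + 1) * Cen Ca * E3 = (T + 1) * (Cen Ca * E3) by ring.
  exact: ler_wpM2r.
have [u hu] := good_exists hok n2 sg0 T0 nW0 TW ep0 Ke e24 en' p0 pr Phi0 eP eN' (leqnn nW).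
have ttT' : tt T nW nW = T by exact: ttT.
have good_eq op psi v e : catop N0 sg T op -> (forall t0 t1 f g k t, t0 <= t1 -> op t0 t1 f g k (clip t0 t1 t) = op t0 t1 f g k t) ->
    good N0 sg T N nW op v psi nW e -> forall k t, v k t = psi k + op 0 T v v k t.
  move=> hc hcl [g1 g2 [g3 g3'] [c g4] g5] k t; rewrite g2 ttT'.
  rewrite -[op 0 T v v k t](hcl 0 T)//; last exact: ltW.
  apply: (glob_eq T0 nW0 hc g4 g1); last by apply: clip_in; exact: ltW.
  by move=> j hj k' t'; have [eta [_ _ h]] := g5 j hj.
have good_sol psi v e : good N0 sg T N nW B v psi nW e -> sol psi v.
  move=> hg; have [g1 g2 g3 g4 g5] := hg; split=> //; first by move=> k t; rewrite g2 ttT'.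
  move=> k t _; apply: good_eq hg k t; first exact: (catop_Binf hok).
  by move=> t0 t1 f g k' t' h; exact: Binf_clip.
have e60 : 0 < 6 * eps by lra.
exists u; first exact: good_sol hu.
split=> rho r0.
  have r2 : 0 < rho / 2 by rewrite divr_gt0.
  have [delta dl0 [m0 hm0]] := stab hok n2 sg0 T0 nW0 TW (fun m => opok_Bgal hok n2 sg0 m)
    (Bgal_conv hok n2 sg0 T0 nW0 TW) e60 Ke hu r2.
  have z : ell2 (fun k => wX k * nc (phi k - phi k)) delta.
    by move=> M''; rewrite big1 ?sqr_ge0// => k _; rewrite subrr nc0 mulr0 expr0n.
  have [f [hf df]] := hm0 m0 phi (leqnn _) p0 pr z.
  have fE := good_eq _ _ _ _ (catop_Bgal alpha beta N0 sg T0 m0) _ hf.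
  have [q1 q2 q3 [c q4] q5] := hf.
  have [m' /(_ m' (leqnn _)) hm'] := bd_tail OX0 q4 r2.
  exists m0, m', f, c; split=> //; first by move=> k t; rewrite q2 ttT'.
  have := bdD wX0 (bdBC wX0 df) hm' => /(bd_le wX0 (e := rho)) h.
  apply: (bd_ext _ (h _)); last lra.
  move=> k t; rewrite /proj; case: ifP => _; last by ring.
  rewrite -fE; first by ring.
  by move=> t0 t1 f' g k' t' h'; rewrite !BgalE BM_clip.
have [delta dl0 [m0 hm0]] := stab hok n2 sg0 T0 nW0 TW (fun m => opok_Binf hok n2 sg0)
    (@Binf_conv R alpha beta sg T N nW) e60 Ke hu r0.
exists delta => // phi' [p0' pr' _] hd.
have [u' [hu' du']] := hm0 m0 phi' (leqnn _) p0' pr' hd.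
by exists u' => //; exact: good_sol hu'.
Qed.

Lemma sol_uniq phi u u' : sol phi u -> sol phi u' -> u = u'.
Proof.
move=> [s1 _ [c h1] e1] [s2 _ [c' h2] e2]; apply/funext => k; apply/funext => t.
rewrite s1 s2; apply: (X_uniq hok sg0 T0 h1 h2 e1 e2).
by apply: clip_in; exact: ltW.
Qed.

End wp.

(** * Weierstrass approximation *)

Section bernstein.
Variable R : realType.
Implicit Types (f h : R -> R) (x y c e : R).

Lemma unif_cont f (a b e : R) : continuous f -> 0 < e ->
  exists2 d, 0 < d & forall x y, a <= x <= b -> `|x - y| < d -> `|f x - f y| <= e.
Proof.
move=> cf e0.
have := @segment_compact R a b; rewrite compact_near_coveringP => nc.
have := nc R (0^'+) (fun d x => forall y, `|x - y| < d -> `|f x - f y| <= e) _.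
case.
  move=> x _; have e2 : 0 < e / 2 by rewrite divr_gt0.
  have /cvgrPdist_lt /(_ _ e2) := cf x => /nbhs_ballP[r r0 hr].
  have r2 : 0 < r / 2 by rewrite divr_gt0.
  exists (ball x (r / 2), [set d | 0 < d < r / 2]) => /=.
    split; first exact: nbhsx_ballx.
    near=> d; apply/andP; split; [by near: d; exact: nbhs_right_gt|by near: d; exact: nbhs_right_lt].
  move=> [x' d] /= [bx' /andP[d0 dr]] y hy.
  have h1 : `|f x - f x'| < e / 2.
    by apply: hr; apply: lt_trans bx' _; lra.
  have h2 : `|f x - f y| < e / 2.
    apply: hr; rewrite /ball /=; have := ler_distD x' x y; rewrite /ball /= in bx'; lra.
  by have := ler_distD (f x) (f x') (f y); rewrite [`|f x' - f x|]distrC; lra.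
move=> d /= d0 hd; exists (d / 2); first by rewrite divr_gt0.
move=> x y hx hxy.
have dd : ball (0 : R) d (d / 2) by rewrite /ball /= sub0r normrN gtr0_norm; lra.
have d2 : 0 < d / 2 by rewrite divr_gt0.
by apply: (hd (d / 2) dd d2 x) => //=; rewrite in_itv.
Unshelve. all: by end_near. Qed.

Lemma seg_bounded f (a b : R) : continuous f -> exists2 H, 0 <= H & forall x, a <= x <= b -> `|f x| <= H.
Proof.
move=> cf; have [ab|ba] := leP a b; last first.
  by exists 0 => // x /andP[h1 h2]; have := le_trans h1 h2; rewrite leNgt ba.
have cn : {within `[a, b], continuous (fun x => `|f x|)}.
  by apply: continuous_subspaceT => x; apply: continuous_comp; [exact: cf|exact: norm_continuous].
have [c _ hc] := EVT_max ab cn.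
exists `|f c|; first exact: normr_ge0.
by move=> x hx; apply: hc; rewrite in_itv.
Qed.

(** The Bernstein sum, that is the expectation of [f] at a binomial variable, by conditioning on one
    trial. The recursion gives positivity and the variance by induction, without binomial
    coefficients. *)
Fixpoint bernE n (f : nat -> R) x : R :=
  if n is m.+1 then x * bernE m (fun k => f k.+1) x + (1 - x) * bernE m f x else f 0%N.

Fixpoint Epoly n (f : nat -> R) : {poly R} :=
  if n is m.+1 then 'X * Epoly m (fun k => f k.+1) + (1 - 'X) * Epoly m f else (f 0%N)%:P.

Lemma EpolyE n (f : nat -> R) x : (Epoly n f).[x] = bernE n f x.
Proof. by elim: n f => [|n IH] f /=; rewrite !hornerE// !IH. Qed.

Lemma bernE_le n (f g : nat -> R) x : 0 <= x <= 1 -> (forall k, (k <= n)%N -> f k <= g k) -> bernE n f x <= bernE n g x.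
Proof.
move=> hx; have /andP[x0 x1] := hx; elim: n f g => [|n IH] f g h /=; first exact: h.
apply: lerD; apply: ler_wpM2l; rewrite ?subr_ge0//; apply: IH => k hk; apply: h => //.
exact: leqW.
Qed.

Lemma bernE_aff n (a b : R) (f : nat -> R) x : bernE n (fun k => a + b * f k) x = a + b * bernE n f x.
Proof. by elim: n f => [//|n IH] f /=; rewrite !IH; ring. Qed.

Lemma bernE_sqr n c x : bernE n (fun k => (k%:R - c) ^+ 2) x = n%:R * (x * (1 - x)) + (n%:R * x - c) ^+ 2.
Proof.
elim: n c => [|n IH] c /=; first by rewrite mulr0n; ring.
rewrite (_ : (fun k => _) = fun k : nat => (k%:R - (c - 1)) ^+ 2); last first.
  apply/funext => k; have ek : k.+1%:R = k%:R + 1 :> R by rewrite natr1.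
  by rewrite ek; congr (_ ^+ 2); ring.
have en : n.+1%:R = n%:R + 1 :> R by rewrite natr1.
by rewrite !IH en; ring.
Qed.

(** Chebyshev's argument: the expectation of the quadratic term of the hypothesis is c x (1 - x) /
    n, at most e for large n. *)
Lemma bernstein h e c : 0 < e -> 0 <= c ->
  (forall x y, 0 <= x <= 1 -> 0 <= y <= 1 -> `|h y - h x| <= e + c * (y - x) ^+ 2) ->
  exists p : {poly R}, forall x, 0 <= x <= 1 -> `|p.[x] - h x| <= 2 * e.
Proof.
move=> e0 c0 hh; pose n := (Num.truncn (c / e)).+1.
have n0 : 0 < n%:R :> R by rewrite ltr0n.
have cn : c <= e * n%:R.
  have /andP[_ h1] := truncn_itv (divr_ge0 c0 (ltW e0)).
  by rewrite mulrC -ler_pdivrMr// ltW.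
exists (Epoly n (fun k => h (k%:R / n%:R))) => x hx; rewrite EpolyE; have /andP[x0 x1] := hx.
pose q := c / n%:R ^+ 2.
have q0 : 0 <= q by rewrite divr_ge0// exprn_ge0// ltW.
have P k : (k <= n)%N -> `|h (k%:R / n%:R) - h x| <= e + q * (k%:R - n%:R * x) ^+ 2.
  move=> kn; have k1 : 0 <= (k%:R : R) / n%:R <= 1.
    by rewrite divr_ge0 ?(ltW n0)//= ler_pdivrMr// mul1r ler_nat.
  apply: (le_trans (hh x _ hx k1)); rewrite lerD2l /q.
  by rewrite le_eqVlt; apply/orP; left; apply/eqP; field; rewrite gt_eqF.
have S : bernE n (fun k => e + q * (k%:R - n%:R * x) ^+ 2) x <= 2 * e.
  rewrite bernE_aff bernE_sqr subrr expr0n addr0.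
  have -> : q * (n%:R * (x * (1 - x))) = c / n%:R * (x * (1 - x)) by rewrite /q; field; rewrite gt_eqF.
  have h1 : c / n%:R <= e by rewrite ler_pdivrMr.
  have h2 : 0 <= c / n%:R by rewrite divr_ge0// ltW.
  have h3 : x * (1 - x) <= 1 by nra.
  have h4 : 0 <= x * (1 - x) by rewrite mulr_ge0// subr_ge0.
  have : c / n%:R * (x * (1 - x)) <= e * 1 by apply: ler_pM.
  lra.
have E1 : bernE n (fun k => h (k%:R / n%:R)) x - h x = bernE n (fun k => - h x + 1 * h (k%:R / n%:R)) x.
  by rewrite bernE_aff mul1r addrC.
have up : bernE n (fun k => - h x + 1 * h (k%:R / n%:R)) x <= 2 * e.
  apply: le_trans S; apply: bernE_le => // k kn; have := P k kn; rewrite ler_norml => /andP[_]; lra.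
have dn : - (2 * e) <= bernE n (fun k => - h x + 1 * h (k%:R / n%:R)) x.
  have := @bernE_le n (fun k => 0 + -1 * (e + q * (k%:R - n%:R * x) ^+ 2)) (fun k => - h x + 1 * h (k%:R / n%:R)) x hx.
  rewrite bernE_aff => hle; apply: le_trans (hle _); first by lra.
  by move=> k kn; have := P k kn; rewrite ler_norml => /andP[]; lra.
by rewrite E1 ler_norml dn up.
Qed.

(** Close points are covered by uniform continuity, distant ones by the quadratic term of
    [bernstein]; an affine change of variable leads to [0, 1]. *)
Lemma weierstrass f (a b e : R) : continuous f -> a < b -> 0 < e ->
  exists p : {poly R}, forall x, a <= x <= b -> `|p.[x] - f x| <= e.
Proof.
move=> cf ab e0; have L0 : 0 < b - a by lra.
have e4 : 0 < e / 2 by rewrite divr_gt0.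
have [d d0 hd] := unif_cont a b cf e4.
have [H H0 hH] := seg_bounded a b cf.
pose h y := f (a + (b - a) * y).
have I y : 0 <= y <= 1 -> a <= a + (b - a) * y <= b by move=> /andP[y0 y1]; apply/andP; split; nra.
pose c := 2 * H / d ^+ 2 * (b - a) ^+ 2.
have c0 : 0 <= c by rewrite mulr_ge0 ?exprn_ge0 ?divr_ge0 ?mulr_ge0 ?(ltW L0) ?(ltW d0).
have [x y hx hy|p hp] := @bernstein h (e / 2) c e4 c0.
  have [hxy|hxy] := ltP `|(a + (b - a) * y) - (a + (b - a) * x)| d.
    apply: (le_trans (hd _ _ (I y hy) hxy)); rewrite lerDl mulr_ge0 ?sqr_ge0//.
  have h1 : `|h y - h x| <= 2 * H.
    apply: (le_trans (ler_normB _ _)); have := hH _ (I y hy); have := hH _ (I x hx); rewrite /h; lra.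
  apply: (le_trans h1); rewrite -[leLHS]add0r; apply: lerD; first exact: ltW.
  have -> : c * (y - x) ^+ 2 = 2 * H * (((b - a) * (y - x)) ^+ 2 / d ^+ 2) by rewrite /c; field; rewrite gt_eqF.
  rewrite ler_peMr ?mulr_ge0// ler_pdivlMr ?exprn_gt0// mul1r -[leRHS]real_normK ?num_real//.
  rewrite ler_sqr ?nnegrE ?(ltW d0)//; apply: (le_trans hxy).
  by rewrite (_ : _ - _ = (b - a) * (y - x)) ?lexx//; ring.
exists (p \Po ((b - a)^-1 *: ('X - a%:P))) => x /andP[xa xb].
rewrite horner_comp !hornerE.
have i1 : 0 <= (b - a)^-1 * (x - a) <= 1.
  rewrite mulr_ge0 ?invr_ge0 ?(ltW L0) ?subr_ge0//= mulrC ler_pdivrMr// mul1r; lra.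
have ex : a + (b - a) * ((b - a)^-1 * (x - a)) = x by field; rewrite gt_eqF.
have := hp _ i1; rewrite /h ex.
by have -> : 2 * (e / 2) = e by field.
Qed.

End bernstein.

(** * Trigonometric approximation of continuous periodic functions *)

Section trig.
Variable R : realType.
Implicit Types (f g : R -> R) (x y e : R).

Inductive trig : (R -> R) -> Prop :=
| trig_cos (k : int) : trig (fun x => cos (k%:~R * x))
| trig_sin (k : int) : trig (fun x => sin (k%:~R * x))
| trig_lin (a : R) f g : trig f -> trig g -> trig (fun x => a * f x + g x).

Lemma trig_ext f g : (forall x, f x = g x) -> trig f -> trig g.
Proof. by move=> h; rewrite (_ : f = g)//; apply/funext. Qed.

Lemma trig_0 : trig (fun=> 0).
Proof. by apply: trig_ext (trig_sin 0) => x; rewrite mul0r sin0. Qed.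

Lemma trigZ (a : R) f : trig f -> trig (fun x => a * f x).
Proof. by move=> h; apply: trig_ext (trig_lin a h trig_0) => x; rewrite addr0. Qed.

Lemma trigD f g : trig f -> trig g -> trig (fun x => f x + g x).
Proof. by move=> h1 h2; apply: trig_ext (trig_lin 1 h1 h2) => x; rewrite mul1r. Qed.

Lemma kp1 (k : int) x : (k + 1)%:~R * x = k%:~R * x + x.
Proof. by rewrite intrD mulrDl mul1r. Qed.

Lemma km1 (k : int) x : (k - 1)%:~R * x = k%:~R * x - x.
Proof. by rewrite intrB mulrBl mul1r. Qed.

Lemma trig_mulcos f : trig f -> trig (fun x => cos x * f x).
Proof.
elim=> [k|k|a u v _ h1 _ h2].
- have := trigD (trigZ (1 / 2) (trig_cos (k + 1))) (trigZ (1 / 2) (trig_cos (k - 1))).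
  apply: trig_ext => x; rewrite kp1 km1 cosD cosB; by field.
- have := trigD (trigZ (1 / 2) (trig_sin (k + 1))) (trigZ (1 / 2) (trig_sin (k - 1))).
  apply: trig_ext => x; rewrite kp1 km1 sinD sinB; by field.
- by apply: trig_ext (trig_lin a h1 h2) => x; ring.
Qed.

Lemma trig_mulsin f : trig f -> trig (fun x => sin x * f x).
Proof.
elim=> [k|k|a u v _ h1 _ h2].
- have := trigD (trigZ (1 / 2) (trig_sin (k + 1))) (trigZ (- (1 / 2)) (trig_sin (k - 1))).
  apply: trig_ext => x; rewrite kp1 km1 sinD sinB; by field.
- have := trigD (trigZ (- (1 / 2)) (trig_cos (k + 1))) (trigZ (1 / 2) (trig_cos (k - 1))).
  apply: trig_ext => x; rewrite kp1 km1 cosD cosB; by field.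
- by apply: trig_ext (trig_lin a h1 h2) => x; ring.
Qed.

Lemma trig_poly (p : {poly R}) : trig (fun x => p.[(1 + cos x) / 2]).
Proof.
elim/poly_ind: p => [|p c IH]; first by apply: trig_ext trig_0 => x; rewrite horner0.
have h1 := trigD (trigZ (1 / 2) IH) (trigZ (1 / 2) (trig_mulcos IH)).
have h2 := trigD h1 (trigZ c (trig_cos 0)).
by apply: trig_ext h2 => x; rewrite hornerD hornerM hornerX hornerC mulr0z mul0r cos0; lra.
Qed.

Lemma trig_shift f y : trig f -> trig (fun x => f (x + y)).
Proof.
elim=> [k|k|a u v _ h1 _ h2].
- have := trigD (trigZ (cos (k%:~R * y)) (trig_cos k)) (trigZ (- sin (k%:~R * y)) (trig_sin k)).
  by apply: trig_ext => x; rewrite mulrDr cosD; ring.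
- have := trigD (trigZ (sin (k%:~R * y)) (trig_cos k)) (trigZ (cos (k%:~R * y)) (trig_sin k)).
  by apply: trig_ext => x; rewrite mulrDr sinD; ring.
- exact: trig_lin.
Qed.

Definition approx f := forall e, 0 < e -> exists2 g, trig g & forall x, `|g x - f x| <= e.

Lemma period_red x : exists2 y, - pi <= y <= pi & forall f, periodic f (pi *+ 2) -> f x = f y.
Proof.
have p0 : 0 < pi *+ 2 :> R by rewrite mulrn_wgt0// pi_gt0.
pose z := (x + pi) / (pi *+ 2); pose n := Num.floor z.
exists (x - n%:~R * (pi *+ 2)).
  have h1 := Num.Theory.floor_le z; have h2 := Num.Theory.floorD1_gt z.
  rewrite -/n in h1 h2.
  rewrite ler_pdivlMr// in h1; rewrite ltr_pdivrMr// rmorphD /= mulrDl mul1r in h2.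
  move: h1 h2; rewrite mulr2n => h1 h2; apply/andP; split; lra.
move=> f pf; have em (m : nat) : (Posz m)%:~R * (pi *+ 2) = pi *+ 2 *+ m :> R by rewrite -[RHS]mulr_natl.
case: n => m.
  by rewrite em -[in LHS](subrK (pi *+ 2 *+ m) x) periodicn.
by rewrite NegzE mulrNz mulNr opprK em periodicn.
Qed.

(** An even periodic function is a function of (1 + cos x) / 2, to which [bernstein] applies. The
    inverse cosine is not Lipschitz, but angles at distance at least d have cosines at distance at
    least 2 m, and such pairs fall under the quadratic term. *)
Lemma approx_even f : continuous f -> periodic f (pi *+ 2) -> (forall x, f (- x) = f x) -> approx f.
Proof.
move=> cf pf ev e e0; have e4 : 0 < e / 2 by rewrite divr_gt0.
have pi0 := pi_gt0 R.
have [d0 d00 hd] := unif_cont 0 pi cf e4.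
pose d := Num.min d0 1.
have dp : 0 < d by rewrite lt_min d00 ltr01.
have dd0 : d <= d0 by rewrite ge_min lexx.
have d1 : d <= 1 by rewrite ge_min lexx orbT.
clearbody d.
have [H H0 hH] := seg_bounded 0 pi cf.
pose h y := f (acos (2 * y - 1)).
have A y : 0 <= y <= 1 -> 0 <= acos (2 * y - 1) <= pi /\ cos (acos (2 * y - 1)) = 2 * y - 1.
  by move=> hy; apply: acos_def; lra.
have s0 : 0 < sin (d / 2) by apply: sin_gt0_pi; have := pihalf_ge1 R; lra.
pose m := sin (d / 2) ^+ 2.
have m0 : 0 < m by rewrite exprn_gt0.
have ph1 := pihalf_ge1 R.
have slow th : d / 2 <= th <= pi - d / 2 -> sin (d / 2) <= sin th.
  move=> /andP[t1 t2]; have [tp|tp] := leP th (pi / 2).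
    move: t1; rewrite le_eqVlt => /predU1P[->//|t1].
    by apply/ltW; rewrite ltr_sin// in_itv /=; lra.
  have -> : sin th = sin (pi - th) by rewrite sinB sinpi cospi; lra.
  have : d / 2 <= pi - th by lra.
  rewrite le_eqVlt => /predU1P[->//|t3].
  by apply/ltW; rewrite ltr_sin// in_itv /=; lra.
have cosd x y : 0 <= x <= pi -> 0 <= y <= pi -> d <= y - x -> 2 * m <= cos x - cos y.
  move=> hx hy hxy.
  have -> : cos x - cos y = 2 * (sin ((x + y) / 2) * sin ((y - x) / 2)).
    have -> : cos x = cos ((x + y) / 2 - (y - x) / 2) by congr cos; lra.
    have -> : cos y = cos ((x + y) / 2 + (y - x) / 2) by congr cos; lra.
    by rewrite cosB cosD; lra.
  rewrite ler_pM2l// /m expr2; apply: ler_pM; rewrite ?(ltW s0)//; apply: slow; lra.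
pose c := 2 * H / m ^+ 2.
have c0 : 0 <= c by apply: divr_ge0; [apply: mulr_ge0|exact: sqr_ge0].
have [x y hx hy|p hp] := @bernstein R h (e / 2) c e4 c0.
  have [ax cx] := A x hx; have [ay cy] := A y hy.
  have [hxy|hxy] := ltP `|acos (2 * y - 1) - acos (2 * x - 1)| d0.
    by apply: (le_trans (hd _ _ ay hxy)); rewrite lerDl mulr_ge0 ?sqr_ge0.
  have h1 : `|h y - h x| <= 2 * H.
    apply: (le_trans (ler_normB _ _)); have := hH _ ay; have := hH _ ax; rewrite /h; lra.
  apply: (le_trans h1); rewrite -[leLHS]add0r; apply: lerD; first exact: ltW.
  have mm : m <= `|y - x|.
    have : 2 * m <= `|cos (acos (2 * y - 1)) - cos (acos (2 * x - 1))|.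
      have [le|le] := leP (acos (2 * x - 1)) (acos (2 * y - 1)).
        rewrite ger0_norm ?subr_ge0// in hxy; rewrite distrC; apply: le_trans (ler_norm _).
        by apply: cosd => //; lra.
      rewrite ltr0_norm ?subr_lt0// opprB in hxy; apply: le_trans (ler_norm _).
      by apply: cosd => //; lra.
    rewrite cx cy (_ : _ - _ = 2 * (y - x)); last by ring.
    by rewrite normrM gtr0_norm// ler_pM2l.
  have -> : c * (y - x) ^+ 2 = 2 * H * ((y - x) ^+ 2 / m ^+ 2) by rewrite /c; ring.
  rewrite ler_peMr ?mulr_ge0// ler_pdivlMr ?exprn_gt0// mul1r -[leRHS]real_normK ?num_real//.
  by rewrite ler_sqr ?nnegrE ?(ltW m0).
exists (fun x => p.[(1 + cos x) / 2]); first exact: trig_poly.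
move=> x; have [z hz zr] := period_red x.
have -> : cos x = cos z by apply: zr => r; exact: cosD2pi.
rewrite (zr f pf).
have [y hy [-> ->]] : exists2 y, 0 <= y <= pi & cos z = cos y /\ f z = f y.
  have [z0|z0] := leP 0 z; first by exists z => //; lra.
  by exists (- z); [lra|rewrite cosN ev].
have i1 : 0 <= (1 + cos y) / 2 <= 1 by have := cos_le1 y; have := cos_geN1 y; lra.
have := hp _ i1; rewrite /h (_ : 2 * ((1 + cos y) / 2) - 1 = cos y); last by field.
by rewrite cosK ?in_itv//= (_ : 2 * (e / 2) = e)//; field.
Qed.

Lemma approxD f g : approx f -> approx g -> approx (fun x => f x + g x).
Proof.
move=> hf hg e e0; have e2 : 0 < e / 2 by rewrite divr_gt0.
have [u tu hu] := hf _ e2; have [v tv hv] := hg _ e2.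
exists (fun x => u x + v x); first exact: trigD.
move=> x; rewrite (_ : _ - _ = (u x - f x) + (v x - g x)); last by ring.
by apply: (le_trans (ler_normD _ _)); have := hu x; have := hv x; lra.
Qed.

Lemma approx_sin f : approx f -> approx (fun x => sin x * f x).
Proof.
move=> hf e e0; have [u tu hu] := hf _ e0; exists (fun x => sin x * u x); first exact: trig_mulsin.
move=> x; rewrite -mulrBr normrM -[leRHS]mul1r; apply: ler_pM => //.
by rewrite ler_norml sin_geN1 sin_le1.
Qed.

Lemma continuousc f g : continuous f -> continuous g -> continuous (fun x => f (g x)).
Proof. by move=> h1 h2 x; apply: continuous_comp; [exact: h2|exact: h1]. Qed.

Lemma contM f g : continuous f -> continuous g -> continuous (fun x => f x * g x).
Proof. by move=> h1 h2 x; exact: (continuousM (h1 x) (h2 x)). Qed.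

Lemma contD f g : continuous f -> continuous g -> continuous (fun x => f x + g x).
Proof. by move=> h1 h2 x; exact: (continuousD (h1 x) (h2 x)). Qed.

Lemma contB f g : continuous f -> continuous g -> continuous (fun x => f x - g x).
Proof. by move=> h1 h2 x; exact: (continuousB (h1 x) (h2 x)). Qed.

Lemma contc (c : R) : continuous (fun _ : R => c).
Proof. by move=> x; exact: cvg_cst. Qed.

Lemma contid : continuous (fun x : R => x).
Proof. by move=> x; exact: cvg_id. Qed.

Lemma contN : continuous (fun x : R => - x).
Proof. by move=> x; apply: continuousN; exact: cvg_id. Qed.

(** Split [f] into its even and odd parts: the even part and sin times the odd part are even
    functions, and multiplication by sin preserves approximability. *)
Lemma approx_sin2 f : continuous f -> periodic f (pi *+ 2) -> approx (fun x => sin x ^+ 2 * f x).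
Proof.
move=> cf pf.
have cN : continuous (fun x => f (- x)) by exact: continuousc contN.
have pN : periodic (fun x => f (- x)) (pi *+ 2).
  by move=> x; rewrite opprD -(pf (- x - pi *+ 2)) subrK.
have csin : continuous (@sin R) by exact: continuous_sin.
have h1 : approx (fun x => 1 / 2 * (f x + f (- x))).
  apply: approx_even => [|x|x].
  - exact: (@contM (fun=> 1 / 2) (fun x => f x + f (- x)) (@contc _) (contD cf cN)).
  - by rewrite pf pN.
  - by rewrite opprK [f x + _]addrC.
have h2 : approx (fun x => sin x * (1 / 2 * (f x - f (- x)))).
  apply: approx_even => [|x|x].
  - exact: (@contM (@sin R) (fun x => 1 / 2 * (f x - f (- x))) csin (@contM (fun=> 1 / 2) (fun x => f x - f (- x)) (@contc _) (contB cf cN))).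
  - by rewrite pf pN sinD2pi.
  - by rewrite opprK sinN; ring.
have := approxD (approx_sin (approx_sin h1)) (approx_sin h2).
by rewrite (_ : (fun x => _) = fun x => sin x ^+ 2 * f x)//; apply/funext => x; lra.
Qed.

(** A shift by pi / 2 turns sin^2 into cos^2, and the two pieces add up to [f]. *)
Theorem trig_weierstrass f : continuous f -> periodic f (pi *+ 2) -> approx f.
Proof.
move=> cf pf.
pose g x := f (x - pi / 2).
have cg : continuous g.
  exact: (continuousc cf (contB contid (@contc _))).
have pg : periodic g (pi *+ 2) by move=> x; rewrite /g addrAC pf.
have h1 := approx_sin2 cf pf; have h2 := approx_sin2 cg pg.
have h3 : approx (fun x => cos x ^+ 2 * f x).
  move=> e e0; have [u tu hu] := h2 e e0; exists (fun x => u (x + pi / 2)); first exact: trig_shift.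
  by move=> x; have := hu (x + pi / 2); rewrite /g addrK sinDpihalf.
have := approxD h1 h3.
rewrite (_ : (fun x => _) = f)//; apply/funext => x.
by rewrite -mulrDl addrC cos2Dsin2 mul1r.
Qed.

End trig.

(** * Fourier coefficients of functions *)

Section integrals.
Variable R : realType.
Implicit Types (f g F : R -> R) (a b c e x t : R) (V : R -> R -> R).
Notation mu := (@lebesgue_measure R).

Lemma int_prim f F a b : a <= b -> continuous f -> (forall t, is_derive t (1 : R) F (f t)) ->
  \int[mu]_(x in `[a, b]) f x = F b - F a.
Proof.
move=> ab cf dF; have cF := dR_continuous dF.
move: ab; rewrite le_eqVlt => /predU1P[->|ab].
  by rewrite subrr set_itv1 Rintegral_set1.
rewrite /Rintegral (@continuous_FTC2 R f F a b ab) ?EFinB//.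
- exact: continuous_subspaceT.
- split; first by move=> t _; exact: ex_derive.
  + by apply: cvg_at_right_filter; exact: cF.
  + by apply: cvg_at_left_filter; exact: cF.
- by move=> t _; rewrite derive1E; exact: derive_val.
Qed.

Lemma int_primR f a b : a <= b -> continuous f -> \int[mu]_(x in `[a, b]) f x = primR f b - primR f a.
Proof. by move=> ab cf; apply: int_prim => //; have [] := primRP cf. Qed.

Lemma int_lin c f g a b : a <= b -> continuous f -> continuous g ->
  \int[mu]_(x in `[a, b]) (c * f x + g x) = c * \int[mu]_(x in `[a, b]) f x + \int[mu]_(x in `[a, b]) g x.
Proof.
move=> ab cf cg; have [_ df] := primRP cf; have [_ dg] := primRP cg.
rewrite (@int_prim _ (fun t => c * primR f t + primR g t))//.
- by rewrite !int_primR//; ring.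
- exact: (contD (contM (@contc _ c) cf) cg).
Qed.

Lemma int_bound f a b c : a <= b -> continuous f -> (forall x, a <= x <= b -> `|f x| <= c) ->
  `|\int[mu]_(x in `[a, b]) f x| <= c * (b - a).
Proof. by move=> ab cf h; have [_ df] := primRP cf; rewrite int_primR//; apply: mvt_le df h. Qed.

Lemma der_from_bound F t c :
  (forall e, 0 < e -> exists2 d, 0 < d & forall s, `|s - t| < d -> `|F s - F t - (s - t) * c| <= e * `|s - t|) ->
  is_derive t (1 : R) F c.
Proof.
move=> h.
have hc : (fun r => r^-1 *: ((F \o shift t) (r *: (1 : R)) - F t)) @ 0^' --> c.
  apply/cvgrPdist_le => e e0; have [d d0 hd] := h e e0.
  near=> r.
  have r0 : r != 0 by near: r; exact: nbhs_dnbhs_neq.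
  have rd : `|r| < d by near: r; apply: dnbhs0_lt.
  rewrite /= /shift /GRing.scale /= mulr1.
  have := hd (r + t); rewrite addrK => /(_ rd) h1.
  rewrite (_ : c - _ = - (r^-1 * (F (r + t) - F t - r * c))); last by field.
  by rewrite normrN normrM normfV mulrC ler_pdivrMr ?normr_gt0.
by apply: DeriveDef; [apply/cvg_ex; exists c|rewrite /derive; exact: cvg_lim hc].
Unshelve. all: by end_near. Qed.

Definition cont2 V := continuous (fun p : R * R => V p.1 p.2).

Lemma cont2_slice V t : cont2 V -> continuous (V t).
Proof.
move=> cV x; apply/cvgrPdist_lt => e e0.
have /cvgrPdist_lt /(_ _ e0) := cV (t, x) => -[[A B]] /= [At Bx] hAB.
near=> y; apply: (hAB (t, y)); split => /=; first exact: nbhs_singleton.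
by near: y.
Unshelve. all: by end_near. Qed.

Lemma cont2M V W : cont2 V -> cont2 W -> cont2 (fun t x => V t x * W t x).
Proof. by move=> h1 h2 p; exact: (continuousM (h1 p) (h2 p)). Qed.

Lemma cont2_x f : continuous f -> cont2 (fun _ x => f x).
Proof. by move=> cf p; apply: (@continuous_comp _ _ _ snd f); [exact: cvg_snd|exact: cf]. Qed.

Lemma unif2 V a b t e : cont2 V -> 0 < e ->
  exists2 d, 0 < d & forall s, `|s - t| < d -> forall x, a <= x <= b -> `|V s x - V t x| <= e.
Proof.
move=> cV e0.
have := @segment_compact R a b; rewrite compact_near_coveringP => nc.
have := nc R (nbhs t) (fun s x => `|V s x - V t x| <= e) _.
case.
  move=> x _; have e2 : 0 < e / 2 by rewrite divr_gt0.
  have /cvgrPdist_lt /(_ _ e2) := cV (t, x); rewrite /= => -[[A B]] /= [At Bx] hAB.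
  exists (B, A) => //= -[x' s] /= [Bx' As].
  have h1 := hAB (s, x') (conj As Bx'); have h2 := hAB (t, x') (conj (nbhs_singleton At) Bx').
  rewrite /= in h1 h2.
  by have := ler_distD (V t x) (V s x') (V t x'); rewrite [`|V s x' - V t x|]distrC; lra.
move=> d /= d0 hd; exists d => // s hs x hx.
by apply: (hd s) => //=; rewrite ?in_itv//= /ball /= distrC.
Qed.

Lemma bounded2 V a b T : cont2 V -> exists2 H, 0 <= H & forall t x, 0 <= t <= T -> a <= x <= b -> `|V t x| <= H.
Proof.
move=> cV.
have := @segment_compact R 0 T; rewrite compact_near_coveringP => nc.
have [] := nc nat \oo (fun n t => forall x, a <= x <= b -> `|V t x| <= n%:R) _.
  move=> t _; have [H H0 hH] := @seg_bounded R (V t) a b (@cont2_slice V t cV).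
  have [d d0 hd] := unif2 a b t cV (ltr01 : 0 < (1 : R)).
  exists (ball t d, [set n | (Num.truncn (H + 1) < n)%N]) => /=.
    split; first exact: nbhsx_ballx.
    by exists (Num.truncn (H + 1)).+1.
  move=> [s n] /= [bs hn] x hx.
  have h1 : `|V s x - V t x| <= 1 by apply: hd => //; rewrite distrC.
  have h2 := hH x hx.
  have /andP[_ h3] := truncn_itv (addr_ge0 H0 ler01).
  have h4 : (Num.truncn (H + 1)).+1%:R <= n%:R :> R by rewrite ler_nat.
  by have := ler_normD (V s x - V t x) (V t x); rewrite subrK; lra.
move=> n /= _ hn; exists n%:R => // t x ht hx.
by apply: (hn n (leqnn n) t) => //=; rewrite in_itv.
Qed.

(** At each x the mean value inequality is applied in time to V minus its linear part at t; the
    continuity of [Vt] in time is uniform over the compact range of x. *)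
Lemma diff_int V Vt a b : a <= b -> cont2 V -> cont2 Vt ->
  (forall t x, is_derive t (1 : R) (fun s => V s x) (Vt t x)) ->
  forall t, is_derive t (1 : R) (fun s => \int[mu]_(x in `[a, b]) V s x) (\int[mu]_(x in `[a, b]) Vt t x).
Proof.
move=> ab cV cVt dV t; apply: der_from_bound => e e0.
have L0 : 0 < b - a + 1 by lra.
have e1 : 0 < e / (b - a + 1) by rewrite divr_gt0.
have [d d0 hd] := unif2 a b t cVt e1.
exists d => // s hs.
have cs r := @cont2_slice V r cV; have ct r := @cont2_slice Vt r cVt.
have -> : \int[mu]_(x in `[a, b]) V s x - \int[mu]_(x in `[a, b]) V t x - (s - t) * \int[mu]_(x in `[a, b]) Vt t x =
   \int[mu]_(x in `[a, b]) (- (s - t) * Vt t x + (-1 * V t x + V s x)).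
  rewrite int_lin//; last exact: (contD (contM (@contc _ (-1)) (cs t)) (cs s)).
  by rewrite int_lin//; ring.
apply: (@le_trans _ _ (e / (b - a + 1) * `|s - t| * (b - a))).
  apply: int_bound => //.
    exact: (contD (contM (@contc _ (- (s - t))) (ct t)) (contD (contM (@contc _ (-1)) (cs t)) (cs s))).
  move=> x hx.
  have dh r : is_derive r (1 : R) (fun r => V r x - r * Vt t x) (Vt r x - Vt t x).
    have h1 := is_deriveB (dV r x) (is_deriveZ (Vt t x) (is_derive_id r (1 : R))).
    rewrite (_ : (fun r => _) = (V ^~ x) - (Vt t x \*: id)); last by apply/funext => y; rewrite /GRing.scale /= mulrC.
    by apply: (@is_derive_eq _ _ _ _ _ _ _ _ h1); rewrite /GRing.scale /= mulr1.
  rewrite (_ : - (s - t) * Vt t x + (-1 * V t x + V s x) = (V s x - s * Vt t x) - (V t x - t * Vt t x)); last by ring.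
  have [st|/ltW st] := leP t s.
    rewrite [`|s - t|]ger0_norm ?subr_ge0//; apply: (mvt_le st dh) => r /andP[r1 r2].
    by apply: hd => //; move: hs; rewrite !ger0_norm ?subr_ge0//; lra.
  rewrite distrC [`|s - t|]distrC [`|t - s|]ger0_norm ?subr_ge0//; apply: (mvt_le st dh) => r /andP[r1 r2].
  by apply: hd => //; move: hs; rewrite !ler0_norm ?subr_le0//; lra.
rewrite mulrAC; apply: ler_wpM2r => //.
by rewrite mulrAC ler_pdivrMr// ler_pM2l//; lra.
Qed.

End integrals.

(** * Fourier coefficients of continuous functions, Parseval's formula and decay *)

Section fourier.
Variable R : realType.
Notation C := R[i].
Implicit Types (f g v : R -> R) (k j : int) (x e : R).
Notation mu := (@lebesgue_measure R).
Notation J f := (\int[mu]_(x in `[0, pi *+ 2]) f x).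

Let p2 : 0 <= pi *+ 2 :> R. Proof. by rewrite mulrn_wge0// pi_ge0. Qed.
Let p20 : 0 < pi *+ 2 :> R. Proof. by rewrite mulrn_wgt0// pi_gt0. Qed.

Definition ck k x : R := cos (k%:~R * x).
Definition sk k x : R := sin (k%:~R * x).

Lemma is_derive_sk k x : is_derive x (1 : R) (sk k) (k%:~R * ck k x).
Proof.
have := is_derive_trig 0 1 k%:~R x; rewrite (_ : (fun y => _) = sk k); last first.
  by apply/funext => y; rewrite /sk mul0r add0r mul1r.
by move=> h; apply: (@is_derive_eq _ _ _ _ _ _ _ _ h); rewrite /ck; ring.
Qed.

Lemma is_derive_ck k x : is_derive x (1 : R) (ck k) (- k%:~R * sk k x).
Proof.
have := is_derive_trig 1 0 k%:~R x; rewrite (_ : (fun y => _) = ck k); last first.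
  by apply/funext => y; rewrite /ck mul0r addr0 mul1r.
by move=> h; apply: (@is_derive_eq _ _ _ _ _ _ _ _ h); rewrite /sk; ring.
Qed.

Lemma ck_cont k : continuous (ck k). Proof. exact: dR_continuous (is_derive_ck k). Qed.
Lemma sk_cont k : continuous (sk k). Proof. exact: dR_continuous (is_derive_sk k). Qed.
Lemma ck_per k : periodic (ck k) (pi *+ 2). Proof. exact: periodic_int (@cosD2pi R). Qed.
Lemma sk_per k : periodic (sk k) (pi *+ 2). Proof. exact: periodic_int (@sinD2pi R). Qed.
Lemma ck_le k x : `|ck k x| <= 1. Proof. by rewrite ler_norml cos_geN1 cos_le1. Qed.
Lemma sk_le k x : `|sk k x| <= 1. Proof. by rewrite ler_norml sin_geN1 sin_le1. Qed.

Lemma int_per f f' : (forall x, is_derive x (1 : R) f (f' x)) -> continuous f' -> periodic f (pi *+ 2) -> J f' = 0.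
Proof. by move=> df cf' pf; rewrite (int_prim p2 cf' df) -[X in f X]add0r pf subrr. Qed.

Lemma int_ck k : J (ck k) = if k == 0 then pi *+ 2 else 0.
Proof.
case: eqP => [->|/eqP k0].
  have h t : is_derive t (1 : R) (@id R) (ck 0 t) by rewrite /ck mulr0z mul0r cos0; exact: is_derive_id.
  by rewrite (int_prim p2 (@ck_cont 0) h) subr0.
have kr : k%:~R != 0 :> R by rewrite intr_eq0.
apply: (@int_per (fun x => k%:~R^-1 * sk k x)); [|exact: ck_cont|by move=> x; rewrite sk_per].
move=> x; have h := is_deriveZ (k%:~R^-1) (is_derive_sk k x).
by apply: (@is_derive_eq _ _ _ _ _ _ _ _ h); rewrite /GRing.scale /= mulKf.
Qed.

Lemma int_sk k : J (sk k) = 0.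
Proof.
have [->|k0] := eqVneq k 0.
  have h t : is_derive t (1 : R) (cst 0) (sk 0 t) by rewrite /sk mulr0z mul0r sin0; exact: is_derive_cst.
  by rewrite (int_prim p2 (@sk_cont 0) h) subr0.
have kr : k%:~R != 0 :> R by rewrite intr_eq0.
apply: (@int_per (fun x => - k%:~R^-1 * ck k x)); [|exact: sk_cont|by move=> x; rewrite ck_per].
move=> x; have h := is_deriveZ (- k%:~R^-1) (is_derive_ck k x).
by apply: (@is_derive_eq _ _ _ _ _ _ _ _ h); rewrite /GRing.scale /= mulNr mulNr mulrN opprK mulKf.
Qed.

Lemma J_lin c f g : continuous f -> continuous g -> J (fun x => c * f x + g x) = c * J f + J g.
Proof. exact: int_lin. Qed.

Lemma J_ext f g : (forall x, f x = g x) -> J f = J g.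
Proof. by move=> h; congr Rintegral; apply/funext. Qed.

Lemma J_Z c f : continuous f -> J (fun x => c * f x) = c * J f.
Proof.
move=> cf; rewrite (@J_ext _ (fun x => c * f x + sk 0 x)).
  by rewrite J_lin//; [rewrite int_sk addr0|exact: sk_cont].
by move=> x; rewrite /sk mulr0z mul0r sin0 addr0.
Qed.

Lemma J_le f c : continuous f -> (forall x, `|f x| <= c) -> `|J f| <= c * (pi *+ 2).
Proof. by move=> cf h; have := @int_bound R f 0 (pi *+ 2) c p2 cf (fun x _ => h x); rewrite subr0. Qed.

Definition dd k j : R := (k == j)%:R.

Lemma int_cc k j : J (fun x => ck k x * ck j x) = pi * (dd k j + dd k (- j)).
Proof.
rewrite (@J_ext _ (fun x => 1 / 2 * ck (k + j) x + 1 / 2 * ck (k - j) x)); last first.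
  by move=> x; rewrite /ck intrD intrB mulrDl mulrBl cosD cosB; field.
rewrite J_lin; [|exact: ck_cont|exact: (contM (@contc _ _) (@ck_cont _))].
rewrite J_Z ?int_ck; last exact: ck_cont.
rewrite addr_eq0 subr_eq0 /dd addrC mulr2n.
by case: (k == j); case: (k == - j) => /=; field.
Qed.

Lemma int_ss k j : J (fun x => sk k x * sk j x) = pi * (dd k j - dd k (- j)).
Proof.
rewrite (@J_ext _ (fun x => - (1 / 2) * ck (k + j) x + 1 / 2 * ck (k - j) x)); last first.
  by move=> x; rewrite /ck /sk intrD intrB mulrDl mulrBl cosD cosB; field.
rewrite J_lin; [|exact: ck_cont|exact: (contM (@contc _ _) (@ck_cont _))].
rewrite J_Z ?int_ck; last exact: ck_cont.
rewrite addr_eq0 subr_eq0 /dd addrC mulr2n.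
by case: (k == j); case: (k == - j) => /=; field.
Qed.

Lemma int_cs k j : J (fun x => ck k x * sk j x) = 0.
Proof.
rewrite (@J_ext _ (fun x => 1 / 2 * sk (k + j) x + - (1 / 2) * sk (k - j) x)); last first.
  by move=> x; rewrite /ck /sk intrD intrB mulrDl mulrBl sinD sinB; field.
rewrite J_lin; [|exact: sk_cont|exact: (contM (@contc _ _) (@sk_cont _))].
by rewrite J_Z ?int_sk ?mulr0 ?addr0//; exact: sk_cont.
Qed.

(** Unnormalised and with e^{+ikx}, so that Parseval's formula pairs it with [fh] without a
    conjugate. *)
Definition FF f k : C := (J (fun x => f x * ck k x) +i* J (fun x => f x * sk k x))%C.
Definition fh v k : C := fourier (distribution_of v) k.

Lemma fhE v k : fh v k = ((J (fun x => v x * ck k x) / (pi *+ 2)) +i* (- J (fun x => v x * sk k x) / (pi *+ 2)))%C.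
Proof. by []. Qed.

Lemma FF_lin c f g k : continuous f -> continuous g ->
  FF (fun x => c * f x + g x) k = (c%:C)%C * FF f k + FF g k.
Proof.
move=> cf cg; have h (q : R -> R) : continuous q ->
    J (fun x => (c * f x + g x) * q x) = c * J (fun x => f x * q x) + J (fun x => g x * q x).
  move=> cq; rewrite -J_lin; [|exact: contM|exact: contM].
  by apply: J_ext => x; ring.
apply: cplx_eq; rewrite ?ReD ?ImD ?cReM ?cImM /= h ?mul0r ?addr0 ?subr0//.
  exact: ck_cont.
exact: sk_cont.
Qed.

Lemma FF_le f k c : continuous f -> (forall x, `|f x| <= c) -> nc (FF f k) <= 4 * pi * c.
Proof.
move=> cf h; apply: (le_trans (nc_le _)) => /=.
have b (q : R -> R) : continuous q -> (forall x, `|q x| <= 1) -> `|J (fun x => f x * q x)| <= c * (pi *+ 2).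
  move=> cq hq; apply: J_le; first exact: contM.
  by move=> x; rewrite normrM -[leRHS]mulr1; apply: ler_pM.
have := b _ (@ck_cont k) (@ck_le k); have := b _ (@sk_cont k) (@sk_le k).
by rewrite mulr2n; lra.
Qed.

Lemma fh_conj v k : continuous v -> fh v (- k) = conjc (fh v k).
Proof.
move=> cv; have e1 : J (fun x => v x * ck (- k) x) = J (fun x => v x * ck k x).
  by apply: J_ext => x; rewrite /ck rmorphN /= mulNr cosN.
have e2 : J (fun x => v x * sk (- k) x) = - J (fun x => v x * sk k x).
  rewrite -[RHS]mulN1r -[RHS](J_Z (-1) (contM cv (@sk_cont k))).
  by apply: J_ext => x; rewrite /sk rmorphN /= mulNr sinN; ring.
by rewrite !fhE e1 e2; apply: cplx_eq => //=; rewrite mulNr.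
Qed.

Lemma FF_fh v k : FF v k = ((pi *+ 2)%:C)%C * conjc (fh v k).
Proof.
have n0 : pi *+ 2 != 0 :> R by rewrite gt_eqF.
rewrite fhE /FF; move: (J (fun x => v x * ck k x)) (J (fun x => v x * sk k x)) => A B.
by move: (pi *+ 2) n0 => q n0; apply: cplx_eq => /=; field.
Qed.

Lemma FF_ck j k : FF (ck j) k = ((pi * (dd j k + dd j (- k)))%:C)%C.
Proof. by apply: cplx_eq => /=; [exact: int_cc|exact: int_cs]. Qed.

Lemma FF_sk j k : FF (sk j) k = (0 +i* (pi * (dd j k - dd j (- k))))%C.
Proof.
apply: cplx_eq => /=; last exact: int_ss.
by rewrite -[RHS](int_cs k j); apply: J_ext => x; rewrite mulrC.
Qed.

Lemma trig_cont g : trig g -> continuous g.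
Proof.
elim=> [k|k|a u w _ h1 _ h2]; [exact: ck_cont|exact: sk_cont|].
exact: (contD (contM (@contc _ a) h1) h2).
Qed.

Lemma sum_dd M j (F : int -> R) : (`|j| <= M)%N ->
  \sum_(k <- ZM M) F k * (dd j k) = F j /\ \sum_(k <- ZM M) F k * (dd j (- k)) = F (- j).
Proof.
move=> jM; split.
  rewrite (bigD1_seq j) ?uniq_ZM ?mem_ZM//= /dd eqxx mulr1 big1 ?addr0// => k kj.
  by rewrite eq_sym (negbTE kj) mulr0.
rewrite (bigD1_seq (- j)) ?uniq_ZM ?mem_ZM ?abszN//= /dd opprK eqxx mulr1 big1 ?addr0// => k kj.
by rewrite -eqr_oppLR eq_sym (negbTE kj) mulr0.
Qed.

Lemma pair_trig v g : continuous v -> trig g -> exists M0, forall M, (M0 <= M)%N ->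
  complex.Re (\sum_(k <- ZM M) fh v k * FF g k) = J (fun x => v x * g x).
Proof.
move=> cv; have cpi (A : R) : pi * (A / (pi *+ 2) + A / (pi *+ 2)) = A.
  have p0 : pi != 0 :> R by rewrite gt_eqF// pi_gt0.
  by rewrite -mulr_natr; move: (@pi R) p0 => p p0; field.
elim=> [j|j|a u w hu [M1 h1] hw [M2 h2]].
- exists `|j|%N => M jM; rewrite Re_sum.
  under eq_bigr => k _ do rewrite -/(ck j) FF_ck cReM /= mulr0 subr0 mulrCA mulrDr.
  rewrite -mulr_sumr big_split /=; have [-> ->] := sum_dd (fun k => complex.Re (fh v k)) jM.
  by rewrite (fh_conj j cv) fhE /= -/(ck j) cpi.
- exists `|j|%N => M jM; rewrite Re_sum.
  under eq_bigr => k _ do rewrite -/(sk j) FF_sk cReM /= mulr0 sub0r mulrCA mulrBr.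
  rewrite sumrN -mulr_sumr sumrB; have [-> ->] := sum_dd (fun k => complex.Im (fh v k)) jM.
  by rewrite (fh_conj j cv) fhE /= -/(sk j) -[RHS]cpi; ring.
- exists (maxn M1 M2) => M; rewrite geq_max => /andP[m1 m2].
  have cu := trig_cont hu; have cw := trig_cont hw.
  have -> : J (fun x => v x * (a * u x + w x)) = a * J (fun x => v x * u x) + J (fun x => v x * w x).
    rewrite -J_lin; [|exact: contM|exact: contM].
    by apply: J_ext => x; ring.
  rewrite -(h1 M m1) -(h2 M m2) !Re_sum mulr_sumr -big_split; apply: eq_bigr => k _; cbv beta.
  rewrite FF_lin// mulrDr ReD; congr (_ + _).
  by rewrite mulrCA cReM /= mul0r subr0.
Qed.

(** Exact for trigonometric polynomials by [pair_trig]. Both sides are continuous in [f] for the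
    uniform norm, the sum because the coefficients of [v] are absolutely summable. *)
Lemma pairing v f (S : R) : continuous v -> (forall M, \sum_(k <- ZM M) nc (fh v k) <= S) ->
  continuous f -> periodic f (pi *+ 2) -> forall e, 0 < e -> exists M0, forall M, (M0 <= M)%N ->
  `|complex.Re (\sum_(k <- ZM M) fh v k * FF f k) - J (fun x => v x * f x)| <= e.
Proof.
move=> cv hS cf pf e e0.
have S0 : 0 <= S by apply: le_trans (hS 0%N); apply: sumr_ge0 => k _; exact: nc_ge0.
have [H H0 hH] := @seg_bounded R v 0 (pi *+ 2) cv.
pose K := S * (4 * pi) + H * (pi *+ 2) + 1.
have pi0 := pi_gt0 R.
have K1 : 0 <= S * (4 * pi) by rewrite mulr_ge0// mulr_ge0// ltW.
have K2 : 0 <= H * (pi *+ 2) by rewrite mulr_ge0.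
have K0 : 0 < K by rewrite /K; lra.
have e1 : 0 < e / K by rewrite divr_gt0.
have [g tg hg] := trig_weierstrass cf pf e1.
have [M0 hM] := pair_trig cv tg; exists M0 => M /hM hM1.
have cg := trig_cont tg.
have cd : continuous (fun x => -1 * g x + f x) by exact: (contD (contM (@contc _ (-1)) cg) cf).
have ed x : `|-1 * g x + f x| <= e / K.
  by rewrite (_ : _ + _ = - (g x - f x)) ?normrN//; ring.
have a1 : complex.Re (\sum_(k <- ZM M) fh v k * FF f k) - J (fun x => v x * g x) =
   complex.Re (\sum_(k <- ZM M) fh v k * FF (fun x => -1 * g x + f x) k).
  rewrite -hM1 !Re_sum -sumrB; apply: eq_bigr => k _.
  rewrite FF_lin// mulrDr ReD addrC; congr (_ + _).
  by rewrite mulrCA cReM /= mul0r subr0 mulN1r.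
have a2 : J (fun x => v x * f x) - J (fun x => v x * g x) = J (fun x => v x * (-1 * g x + f x)).
  have -> : J (fun x => v x * (-1 * g x + f x)) = J (fun x => -1 * (v x * g x) + v x * f x).
    by apply: J_ext => x; ring.
  by rewrite J_lin; [rewrite mulN1r addrC|exact: contM|exact: contM].
have b1 : `|complex.Re (\sum_(k <- ZM M) fh v k * FF (fun x => -1 * g x + f x) k)| <= S * (4 * pi * (e / K)).
  apply: (le_trans (Re_le _)); apply: (le_trans (nc_sum _ _)).
  apply: (@le_trans _ _ (\sum_(k <- ZM M) nc (fh v k) * (4 * pi * (e / K)))).
    by apply: ler_sum => k _; rewrite ncM; apply: ler_wpM2l; [exact: nc_ge0|exact: FF_le].
  by rewrite -mulr_suml; apply: ler_wpM2r; [apply: mulr_ge0; [apply: mulr_ge0 => //|]; exact: ltW|exact: hS].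
have b2 : `|J (fun x => v x * (-1 * g x + f x))| <= H * (e / K) * (pi *+ 2).
  have := @int_bound R (fun x => v x * (-1 * g x + f x)) 0 (pi *+ 2) (H * (e / K)) p2 (contM cv cd).
  rewrite subr0; apply=> x hx; rewrite normrM; apply: ler_pM => //; exact: hH.
have e2 : e / K * K = e by rewrite divfK// gt_eqF.
rewrite (_ : _ - _ = complex.Re (\sum_(k <- ZM M) fh v k * FF f k) - J (fun x => v x * g x) - (J (fun x => v x * f x) - J (fun x => v x * g x))); last by ring.
rewrite a1 a2; apply: (le_trans (ler_normB _ _)); rewrite -e2.
apply: (le_trans (lerD b1 b2)); rewrite /K.
move: (e / _) e1 => y y0.
have : 0 <= y by exact: ltW.
by rewrite le_eqVlt => _; nra.
Qed.

Lemma FF_der f f' k : (forall x, is_derive x (1 : R) f (f' x)) -> continuous f' -> periodic f (pi *+ 2) ->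
  nc (FF f' k) = ab R k * nc (FF f k).
Proof.
move=> df cf' pf; have cf := dR_continuous df.
have prod (q q' : R -> R) : (forall x, is_derive x (1 : R) q (q' x)) -> continuous q' -> periodic q (pi *+ 2) ->
    J (fun x => f' x * q x) = - J (fun x => f x * q' x).
  move=> dq cq' pq; have cq := dR_continuous dq.
  have := @int_per (fun x => f x * q x) (fun x => 1 * (f' x * q x) + f x * q' x).
  move=> h; apply/eqP; rewrite -addr_eq0; apply/eqP.
  rewrite -[X in X + _]mul1r -J_lin; [|exact: contM|exact: contM].
  apply: h; [|exact: (contD (contM (@contc _ 1) (contM cf' cq)) (contM cf cq'))|by move=> x; rewrite pf pq].
  move=> x; have h1 := is_deriveM (df x) (dq x).
  by apply: (@is_derive_eq _ _ _ _ _ _ _ _ h1); rewrite /GRing.scale /=; ring.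
have e1 := prod _ _ (is_derive_ck k) (contM (@contc _ (- k%:~R)) (@sk_cont k)) (@ck_per k).
have e2 := prod _ _ (is_derive_sk k) (contM (@contc _ k%:~R) (@ck_cont k)) (@sk_per k).
have z1 : J (fun x => f x * (- k%:~R * sk k x)) = - k%:~R * J (fun x => f x * sk k x).
  by rewrite -J_Z; [apply: J_ext => x; ring|exact: (contM cf (@sk_cont k))].
have z2 : J (fun x => f x * (k%:~R * ck k x)) = k%:~R * J (fun x => f x * ck k x).
  by rewrite -J_Z; [apply: J_ext => x; ring|exact: (contM cf (@ck_cont k))].
have -> : FF f' k = (0 +i* - k%:~R)%C * FF f k.
  by apply: cplx_eq; rewrite /FF ?cReM ?cImM /= ?e1 ?e2 ?z1 ?z2; ring.
by rewrite ncM nc_i normrN /ab -intr_norm pmulrn abszE.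
Qed.

Lemma FF_decay (D : nat -> R -> R) n k c : (forall m x, is_derive x (1 : R) (D m) (D m.+1 x)) ->
  (forall m, periodic (D m) (pi *+ 2)) -> (forall x, `|D n x| <= c) ->
  ab R k ^+ n * nc (FF (D 0%N) k) <= 4 * pi * c.
Proof.
move=> dD pD hc; have cD m := dR_continuous (dD m).
have -> : ab R k ^+ n * nc (FF (D 0%N) k) = nc (FF (D n) k).
  elim: n {hc} => [|n IH]; first by rewrite expr0 mul1r.
  by rewrite exprS -mulrA IH (@FF_der (D n) (D n.+1)).
exact: FF_le.
Qed.

End fourier.

(** * Series over the integers dominated by 1 / k^2 *)

Section series.
Variable R : realType.
Notation C := R[i].

Lemma sum_ZMS (V : nmodType) M (z : int -> V) :
  \sum_(k <- ZM M.+1) z k = \sum_(k <- ZM M) z k + (z M.+1%:Z + z (- M.+1%:Z)).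
Proof.
rewrite (perm_big (M.+1%:Z :: - M.+1%:Z :: ZM M)) /=; last first.
  apply: uniq_perm; rewrite ?uniq_ZM//=.
    by rewrite !inE !mem_ZM uniq_ZM; clear; lia.
  move=> k; rewrite !inE !mem_ZM; clear; lia.
by rewrite !big_cons addrA addrC.
Qed.

(** For x >= 1, 1 / x^2 <= 2 (1 / x - 1 / (x + 1)), and each x is counted with both signs. *)
Lemma tele (z : int -> C) c n m : 0 <= c -> (forall k, k != 0 -> nc (z k) <= c / ab R k ^+ 2) -> (n <= m)%N ->
  nc (\sum_(k <- ZM m) z k - \sum_(k <- ZM n) z k) <= 4 * c * (n.+1%:R^-1 - m.+1%:R^-1).
Proof.
move=> c0 hz; elim: m => [|m IH]; first by rewrite leqn0 => /eqP ->; rewrite !subrr nc0 mulr0.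
rewrite leq_eqVlt => /predU1P[->|]; first by rewrite !subrr nc0 mulr0.
rewrite ltnS => /IH h; rewrite sum_ZMS addrAC; apply: (le_trans (ncD _ _)).
have h1 := hz m.+1%:Z isT; have h2 := hz (- m.+1%:Z) isT.
rewrite /ab abszN -/(ab R m.+1%:Z) in h2.
have h3 := ncD (z m.+1%:Z) (z (- m.+1%:Z)).
have e : ab R m.+1%:Z = m.+1%:R by [].
rewrite e in h1 h2.
have p1 : 0 < m.+1%:R :> R by rewrite ltr0n.
have p2 : 0 < m.+2%:R :> R by rewrite ltr0n.
have e2 : m.+2%:R = m.+1%:R + 1 :> R by rewrite natr1.
have q : c / m.+1%:R ^+ 2 <= 2 * c * (m.+1%:R^-1 - m.+2%:R^-1).
  have p3 : 1 <= m.+1%:R :> R by rewrite ler1n.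
  rewrite e2; move: (m.+1%:R : R) p3 => x p3.
  have -> : 2 * c * (x^-1 - (x + 1)^-1) = c * (2 / (x * (x + 1))).
    by field; rewrite !gt_eqF//; lra.
  apply: ler_wpM2l => //; rewrite -[leLHS]mul1r ler_pdivrMr ?exprn_gt0//; last by lra.
  rewrite mulrAC ler_pdivlMr ?mulr_gt0//; [|lra|lra].
  by rewrite mul1r; nra.
move: (nc (_ - _)) (nc (z m.+1%:Z + _)) (nc (z m.+1%:Z)) (nc (z (- _))) h h1 h2 h3 => x1 x2 x3 x4 h h1 h2 h3.
move: (n.+1%:R^-1) (m.+1%:R^-1) (m.+2%:R^-1) (c / m.+1%:R ^+ 2) h h1 h2 q => y1 y2 y3 y4 h h1 h2 q; lra.
Qed.

Lemma ser_lims (z : int -> C) c : 0 <= c -> (forall k, k != 0 -> nc (z k) <= c / ab R k ^+ 2) ->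
  lims (fun M => \sum_(k <- ZM M) z k) (limC (fun M => \sum_(k <- ZM M) z k)) /\
  forall n, nc (limC (fun M => \sum_(k <- ZM M) z k) - \sum_(k <- ZM n) z k) <= 8 * c / n.+1%:R.
Proof.
move=> c0 hz; set S := fun M => _.
have T n m : (n <= m)%N -> nc (S m - S n) <= 4 * c / n.+1%:R.
  move=> nm; apply: (le_trans (tele c0 hz nm)); rewrite ler_wpM2l ?mulr_ge0//.
  by rewrite gerBl invr_ge0.
have e0 n : 0 <= 4 * c / n.+1%:R :> R by rewrite divr_ge0 ?mulr_ge0.
have [a ha] := @real_seq_center R (fun n => complex.Re (S n)) _ (fun n m nm => le_trans (Re_dist _ _) (T n m nm)) e0.
have [b hb] := @real_seq_center R (fun n => complex.Im (S n)) _ (fun n m nm => le_trans (Im_dist _ _) (T n m nm)) e0.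
have hl n : nc (S n - (a +i* b)%C) <= 8 * c / n.+1%:R.
  apply: (le_trans (nc_le _)); rewrite ReD ImD ReN ImN /=.
  rewrite (_ : 8 * c / n.+1%:R = 4 * c / n.+1%:R + 4 * c / n.+1%:R); first exact: lerD.
  by rewrite -!mulrDl -natrD.
have L : lims S (a +i* b)%C.
  move=> e ee; exists (Num.truncn (8 * c / e)) => n hn; apply: (le_trans (hl n)).
  have c8 : 0 <= 8 * c / e by rewrite divr_ge0 ?mulr_ge0// ltW.
  have /andP[_ h1] := truncn_itv c8.
  rewrite ler_pdivrMr ?ltr0n// [e * _]mulrC -ler_pdivrMr//; apply: (le_trans (ltW h1)).
  by rewrite ler_nat ltnS.
by rewrite (limCP L); split=> // n; rewrite ncBC; exact: hl.
Qed.

End series.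

(** * Banach spaces defined by gauges *)

(** An interface turning a relation of gauge at most c into a complete normed space: [gg_closed]
    makes the infimum of the admissible c admissible, and [gx] cuts out the subspace on which some c
    exists. *)
Record gauge_space (R : realType) (W : lmodType R) := GaugeSpace {
  gg : W -> R -> Prop;
  gx : W -> Prop;
  gx0 : gx 0;
  gxL : forall (a : R) x y, gx x -> gx y -> gx (a *: x + y);
  gg_fin : forall x, gx x -> exists c, gg x c;
  gg_ge0 : forall x c, gg x c -> 0 <= c;
  gg_le : forall x c d, c <= d -> gg x c -> gg x d;
  ggZ : forall x (a c : R), gg x c -> gg (a *: x) (`|a| * c);
  ggD : forall x y c d, gg x c -> gg y d -> gg (x + y) (c + d);
  gg_closed : forall x c, 0 <= c -> (forall d, 0 < d -> gg x (c + d)) -> gg x c;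
  gg_zero : forall x, gg x 0 -> x = 0;
  gg_complete : forall v : nat -> W, (forall n, gx (v n)) ->
    (forall d, 0 < d -> exists n0, forall n m, (n0 <= n)%N -> (n <= m)%N -> gg (v m - v n) d) ->
    exists2 u, gx u & forall d, 0 < d -> exists n0, forall n, (n0 <= n)%N -> gg (u - v n) d }.

Section gauge_type.
Variables (R : realType) (W : lmodType R) (S : gauge_space W).

Definition gpred : {pred W} := [pred x | `[< gx S x >]].

Lemma gpredE w : (w \in gpred) = `[< gx S w >]. Proof. by []. Qed.

Fact gpred_submod : submod_closed gpred.
Proof.
split; first by rewrite gpredE; apply/asboolP; exact: gx0.
by move=> a x y; rewrite !gpredE => /asboolP hx /asboolP hy; apply/asboolP; exact: gxL.
Qed.
HB.instance Definition _ := GRing.isSubmodClosed.Build R W gpred gpred_submod.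

Record gtype := GType { gval : W; gvalP : gval \in gpred }.
HB.instance Definition _ := [isSub for gval].
HB.instance Definition _ := [Choice of gtype by <:].
HB.instance Definition _ := [SubChoice_isSubLmodule of gtype by <:].

Lemma gvalE (x : gtype) : gx S (gval x).
Proof. by have := gvalP x; rewrite gpredE => /asboolP. Qed.

Lemma gtype_ex (w : W) : gx S w -> exists x : gtype, gval x = w.
Proof. by move=> h; have hp : w \in gpred; [rewrite gpredE; exact/asboolP|exists (GType hp)]. Qed.

Lemma gvalD (x y : gtype) : gval (x + y) = gval x + gval y. Proof. exact: (raddfD (\val : gtype -> W)). Qed.
Lemma gvalN (x : gtype) : gval (- x) = - gval x. Proof. exact: (raddfN (\val : gtype -> W)). Qed.
Lemma gvalB (x y : gtype) : gval (x - y) = gval x - gval y. Proof. by rewrite gvalD gvalN. Qed.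
Lemma gvalZ a (x : gtype) : gval (a *: x) = a *: gval x. Proof. first [exact: (linearZZ (\val : gtype -> W))|exact: GRing.valZ|by []]. Qed.

Definition gnorm (x : gtype) : R := inf [set c | gg S (gval x) c].

Lemma gnorm_le x c : gg S (gval x) c -> gnorm x <= c.
Proof.
move=> h; apply: ge_inf => //; exists 0 => d; exact: gg_ge0.
Qed.

Lemma gnormP x : gg S (gval x) (gnorm x).
Proof.
have hi : has_inf [set c | gg S (gval x) c].
  split; last by exists 0 => d; exact: gg_ge0.
  by have [c hc] := gg_fin (gvalE x); exists c.
apply: gg_closed => [|d d0]; first by apply: lb_le_inf; [case: hi|move=> c; exact: gg_ge0].
have [c hc hd] := inf_adherent d0 hi; apply: gg_le hc; exact: ltW.
Qed.

Lemma gnorm_ge0 x : 0 <= gnorm x. Proof. exact: gg_ge0 (gnormP x). Qed.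

Fact gnormD x y : gnorm (x + y) <= gnorm x + gnorm y.
Proof. by apply: gnorm_le; rewrite gvalD; apply: ggD; exact: gnormP. Qed.

Fact gnormZ (a : R) x : gnorm (a *: x) = `|a| * gnorm x.
Proof.
have le b y : gnorm (b *: y) <= `|b| * gnorm y by apply: gnorm_le; rewrite gvalZ; apply: ggZ; exact: gnormP.
apply/eqP; rewrite eq_le le /=.
have [->|a0] := eqVneq a 0; first by rewrite normr0 mul0r gnorm_ge0.
rewrite -ler_pdivlMl ?normr_gt0//.
by have := le a^-1 (a *: x); rewrite scalerA mulVf// scale1r normfV.
Qed.

Fact gnorm0_eq0 x : gnorm x = 0 -> x = 0.
Proof.
move=> h; apply: val_inj; apply: (@gg_zero _ _ S); rewrite -h; exact: gnormP.
Qed.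

HB.instance Definition _ := Lmodule_isNormed.Build R gtype gnormD gnormZ gnorm0_eq0.

Lemma gnormE (x : gtype) : `|x| = gnorm x. Proof. by []. Qed.

(** A Cauchy filter contains a ball of radius 1 / (n + 1) for each n; the centres form a Cauchy
    sequence, and its limit is the limit of the filter. *)
Fact gtype_complete (F : set_system gtype) : ProperFilter F -> cauchy F -> cvg F.
Proof.
move=> PF cF.
have hx (n : nat) : exists x : gtype, F (ball x n.+1%:R^-1).
  by move/cauchyP: cF => cF; apply: cF; rewrite invr_gt0 ltr0n.
have /choice [x hxn] := hx.
have small (d : R) : 0 < d -> exists n0, forall n, (n0 <= n)%N -> n.+1%:R^-1 <= d.
  move=> d0; have i0 : 0 <= d^-1 by rewrite invr_ge0 ltW.
  have /andP[_ h] := truncn_itv i0; exists (Num.truncn d^-1) => n hn.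
  rewrite -[leRHS]invrK lef_pV2 ?posrE ?invr_gt0 ?ltr0n//; apply: (le_trans (ltW h)).
  by rewrite ler_nat.
have dist n m : `|x m - x n| <= n.+1%:R^-1 + m.+1%:R^-1.
  have [y [h1 h2]] := @filter_ex _ F PF _ (filterI (hxn n) (hxn m)).
  move: h1 h2; rewrite -!ball_normE /= => h1 h2.
  have -> : x m - x n = (x m - y) - (x n - y) by rewrite opprB addrA subrK.
  by apply: (le_trans (ler_normB _ _)); rewrite addrC; apply: lerD; exact: ltW.
have [|u hu1 hu] := @gg_complete _ _ S (fun n => gval (x n)) (fun n => gvalE (x n)).
  move=> d d0; have d2 : 0 < d / 2 by rewrite divr_gt0.
  have [n0 hn0] := small _ d2; exists n0 => n m hn nm.
  rewrite -gvalB; apply: gg_le (gnormP _); rewrite -gnormE; apply: (le_trans (dist n m)).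
  by rewrite [leRHS]splitr; apply: lerD; [exact: hn0|exact: hn0 (leq_trans hn nm)].
have [z zu] := gtype_ex hu1.
apply/cvg_ex; exists z; apply/cvgrPdist_lt => e e0.
have e4 : 0 < e / 4 by rewrite divr_gt0.
have [n1 h1] := small _ e4; have [n2 h2] := hu _ e4.
pose n := maxn n1 n2.
have a1 := h1 n (leq_maxl _ _); have a2 := h2 n (leq_maxr _ _).
rewrite -zu -gvalB in a2; have a3 := gnorm_le a2; rewrite -gnormE in a3.
apply: filterS (hxn n) => y; rewrite -ball_normE /= => hy.
have -> : z - y = (z - x n) + (x n - y) by rewrite addrA subrK.
apply: (le_lt_trans (ler_normD _ _)); apply: (@lt_trans _ _ (e / 4 + e / 4)).
  exact: (ler_ltD a3 (lt_le_trans hy a1)).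
by have e0' : 0 < (e : R) := e0; move: (e : R) e0' => q q0; lra.
Qed.

HB.instance Definition _ := Uniform_isComplete.Build gtype gtype_complete.

End gauge_type.

(** * Smooth functions with finitely many modes *)

Section smooth.
Variable R : realType.
Notation C := R[i].
Implicit Types (V W : R -> R -> R) (p k t x : R) (A B : {poly R}) (AB : {poly R} * {poly R}).

Definition sm V := exists D : nat -> nat -> R -> R -> R,
  [/\ D 0%N 0%N = V, forall m n, continuous (fun p : R * R => D m n p.1 p.2),
      forall m n (t x : R), is_derive t (1 : R) (fun t' => D m n t' x) (D m.+1 n t x)
    & forall m n (t x : R), is_derive x (1 : R) (D m n t) (D m n.+1 t x)].

Lemma smD V W : sm V -> sm W -> sm (fun t x => V t x + W t x).
Proof.
move=> [D [d0 dc dt dx]] [E [e0 ec et ex]]; exists (fun m n t x => D m n t x + E m n t x); split.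
- by rewrite d0 e0.
- by move=> m n q; exact: (continuousD (dc m n q) (ec m n q)).
- by move=> m n t x; exact: (is_deriveD (dt m n t x) (et m n t x)).
- by move=> m n t x; exact: (is_deriveD (dx m n t x) (ex m n t x)).
Qed.

Lemma smM_slice V W : sm V -> sm W -> exists VW' : R -> R -> R, [/\ cont2 (fun t x => V t x * W t x), cont2 VW' &
  forall t x, is_derive t (1 : R) (fun s => V s x * W s x) (VW' t x)].
Proof.
move=> [D [d0 dc dt dx]] [E [e0 ec et ex]]; rewrite -d0 -e0.
exists (fun t x => D 0%N 0%N t x * E 1%N 0%N t x + E 0%N 0%N t x * D 1%N 0%N t x); split.
- exact: (cont2M (dc 0%N 0%N) (ec 0%N 0%N)).
- move=> q; apply: (@continuousD _ R _ (fun q : R * R => D 0%N 0%N q.1 q.2 * E 1%N 0%N q.1 q.2)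
    (fun q : R * R => E 0%N 0%N q.1 q.2 * D 1%N 0%N q.1 q.2)); exact: cont2M.
- by move=> t x; exact: (is_deriveM (dt 0%N 0%N t x) (et 0%N 0%N t x)).
Qed.

Definition theta p k t x : R := k * x - p * t.
(** The real part of (A + i B) e^{i (k x - p t)} with A, B polynomials in t: a family stable under
    both derivatives, which makes smoothness immediate. *)
Definition mode p k AB t x : R := AB.1.[t] * cos (theta p k t x) - AB.2.[t] * sin (theta p k t x).
Definition mdt p AB := (AB.1^`() + p *: AB.2, AB.2^`() - p *: AB.1)%R.
Definition mdx k AB := ((- k) *: AB.2, k *: AB.1)%R.

Lemma is_derive_horner A t : is_derive t (1 : R) (horner A) (A^`()).[t].
Proof.
elim/poly_ind: A t => [|A c IH] t.
  rewrite deriv0 horner0 (_ : horner 0 = cst 0); first exact: is_derive_cst.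
  by apply/funext => s; rewrite horner0.
rewrite (_ : horner (A * 'X + c%:P) = (horner A \* id) \+ cst c); last first.
  by apply/funext => s; rewrite /= hornerD hornerMX hornerC.
have h := is_deriveD (is_deriveM (IH t) (is_derive_id t (1 : R))) (is_derive_cst c t (1 : R)).
apply: (@is_derive_eq _ _ _ _ _ _ _ _ h).
rewrite derivD derivC !addr0 derivM derivX mulr1 hornerD hornerMX /GRing.scale /=; ring.
Qed.

Lemma cos_comp (f : R -> R) (df t : R) : is_derive t (1 : R) f df -> is_derive t (1 : R) (fun s => cos (f s)) (- sin (f t) * df).
Proof. by move=> h; exact: (@is_derive1_comp _ cos f). Qed.

Lemma sin_comp (f : R -> R) (df t : R) : is_derive t (1 : R) f df -> is_derive t (1 : R) (fun s => sin (f s)) (cos (f t) * df).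
Proof. by move=> h; exact: (@is_derive1_comp _ sin f). Qed.

Lemma theta_dt p k t x : is_derive t (1 : R) (fun s => theta p k s x) (- p).
Proof.
have h := is_deriveB (is_derive_cst (k * x) t (1 : R)) (is_deriveZ p (is_derive_id t (1 : R))).
by apply: (@is_derive_eq _ _ _ _ _ _ _ _ h); rewrite /GRing.scale /= mulr1 sub0r.
Qed.

Lemma theta_dx p k t x : is_derive x (1 : R) (theta p k t) k.
Proof.
have h := is_deriveB (is_deriveZ k (is_derive_id x (1 : R))) (is_derive_cst (p * t) x (1 : R)).
by apply: (@is_derive_eq _ _ _ _ _ _ _ _ h); rewrite /GRing.scale /= mulr1 subr0.
Qed.

Lemma mode_dt p k AB t x : is_derive t (1 : R) (fun s => mode p k AB s x) (mode p k (mdt p AB) t x).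
Proof.
have d1 := cos_comp (theta_dt p k t x); have d2 := sin_comp (theta_dt p k t x).
have h := is_deriveB (is_deriveM (is_derive_horner AB.1 t) d1) (is_deriveM (is_derive_horner AB.2 t) d2).
apply: (@is_derive_eq _ _ _ _ _ _ _ _ h).
rewrite /mode /mdt /= !hornerD hornerN !hornerZ /GRing.scale /=; ring.
Qed.

Lemma mode_dx p k AB t x : is_derive x (1 : R) (mode p k AB t) (mode p k (mdx k AB) t x).
Proof.
have d1 := cos_comp (theta_dx p k t x); have d2 := sin_comp (theta_dx p k t x).
have h := is_deriveB (is_deriveZ AB.1.[t] d1) (is_deriveZ AB.2.[t] d2).
apply: (@is_derive_eq _ _ _ _ _ _ _ _ h).
rewrite /mode /mdx /= !hornerZ /GRing.scale /=; ring.
Qed.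

Lemma mdt_mdx p k AB : mdt p (mdx k AB) = mdx k (mdt p AB).
Proof.
rewrite /mdt /mdx /=; congr pair; apply/polyP => i;
  rewrite !(coefD, coefN, coefZ, coef_deriv) -?mulrnAr; ring.
Qed.

Lemma mode_cont p k AB : cont2 (mode p k AB).
Proof.
have cfst : continuous (fun q : R * R => q.1) by move=> q; exact: cvg_fst.
have csnd : continuous (fun q : R * R => q.2) by move=> q; exact: cvg_snd.
have cth : continuous (fun q : R * R => theta p k q.1 q.2).
  move=> q; apply: (@continuousB _ R _ (fun q : R * R => k * q.2) (fun q : R * R => p * q.1)).
    exact: (continuousM (@cst_continuous _ _ k q) (csnd q)).
  exact: (continuousM (@cst_continuous _ _ p q) (cfst q)).
have comp (f : R -> R) (g : R * R -> R) : continuous f -> continuous g -> continuous (fun q => f (g q)).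
  by move=> cf cg q; apply: (@continuous_comp _ _ _ g f); [exact: cg|exact: cf].
move=> q; apply: (@continuousB _ R _ (fun q : R * R => AB.1.[q.1] * cos (theta p k q.1 q.2)) (fun q : R * R => AB.2.[q.1] * sin (theta p k q.1 q.2))).
  exact: (continuousM (comp _ _ (@continuous_horner R AB.1) cfst q) (comp _ _ (@continuous_cos R) cth q)).
exact: (continuousM (comp _ _ (@continuous_horner R AB.2) cfst q) (comp _ _ (@continuous_sin R) cth q)).
Qed.

Lemma sm_mode p k AB : sm (mode p k AB).
Proof.
exists (fun m n => mode p k (iter m (mdt p) (iter n (mdx k) AB))); split=> //.
- by move=> m n; exact: mode_cont.
- by move=> m n t x; exact: mode_dt.
- move=> m n t x.
  rewrite (_ : iter m _ (iter n.+1 _ _) = mdx k (iter m (mdt p) (iter n (mdx k) AB))); first exact: mode_dx.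
  by elim: m => //= m ->; rewrite mdt_mdx.
Qed.

Variable pk : int -> R.
Variable Q : int -> {poly R} * {poly R}.

Definition cQ j t : C := ce (- (t * pk j)) * ((Q j).1.[t] +i* (Q j).2.[t])%C.
Definition Vsum (r : seq int) t x : R := \sum_(j <- r) mode (pk j) j%:~R (Q j) t x.

Lemma mode_trig j t x : mode (pk j) j%:~R (Q j) t x = complex.Re (cQ j t) * ck j x + - complex.Im (cQ j t) * sk j x.
Proof.
by rewrite /mode /theta /cQ cReM cImM /= /ck /sk cosB sinB cosN sinN [pk j * t]mulrC; ring.
Qed.

Lemma Vsum_cons j r : Vsum (j :: r) = (fun t x => mode (pk j) j%:~R (Q j) t x + Vsum r t x).
Proof. by apply/funext => t; apply/funext => x; rewrite /Vsum big_cons. Qed.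

Lemma Vsum_nil : Vsum [::] = (fun _ _ => 0).
Proof. by apply/funext => t; apply/funext => x; rewrite /Vsum big_nil. Qed.

Lemma sm_Vsum r : sm (Vsum r).
Proof.
elim: r => [|j r IH]; last by rewrite Vsum_cons; exact: (smD (sm_mode _ _ _) IH).
rewrite Vsum_nil; exists (fun _ _ _ _ => 0); split=> //.
- by move=> m n q; exact: cst_continuous.
- by move=> m n t x; exact: is_derive_cst.
- by move=> m n t x; exact: is_derive_cst.
Qed.

Lemma Vsum_per r t : periodic (Vsum r t) (pi *+ 2).
Proof. by move=> x; apply: eq_bigr => j _; rewrite !mode_trig ck_per sk_per. Qed.

Lemma sm_slice V t : sm V -> continuous (V t).
Proof. by move=> [D [<- cD _ _]]; exact: (@cont2_slice R (D 0%N 0%N) t (cD 0%N 0%N)). Qed.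

Lemma fhFF (v : R -> R) (k : int) : fh v k = (((pi *+ 2)^-1)%:C)%C * conjc (FF v k).
Proof.
have n0 : pi *+ 2 != 0 :> R by rewrite gt_eqF// mulrn_wgt0// pi_gt0.
rewrite FF_fh; move: (fh v k) (pi *+ 2) n0 => [a b] q n0.
by apply: cplx_eq => /=; field.
Qed.

Lemma fh_lin (a : R) (f g : R -> R) (k : int) : continuous f -> continuous g ->
  fh (fun x => a * f x + g x) k = (a%:C)%C * fh f k + fh g k.
Proof.
move=> cf cg; rewrite !fhFF FF_lin// rmorphD rmorphM /= oppr0 mulrDr mulrCA //.
Qed.

Lemma fh_Vsum r t (k : int) : fh (Vsum r t) k =
  \sum_(j <- r) ((2^-1)%:C)%C * ((j == k)%:R * cQ j t + (j == - k)%:R * conjc (cQ j t)).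
Proof.
elim: r => [|j r IH].
  rewrite big_nil fhFF (_ : FF _ k = 0) ?conjc0 ?mulr0//.
  have := @FF_lin R (-1) (Vsum [::] t) (Vsum [::] t) k (@sm_slice _ t (sm_Vsum [::])) (@sm_slice _ t (sm_Vsum [::])).
  rewrite (_ : (fun x => _) = Vsum [::] t); last by apply/funext => x; rewrite !Vsum_nil mulr0 addr0.
  by rewrite rmorphN1 mulN1r addNr.
rewrite big_cons -IH {IH}.
have cr := @sm_slice _ t (sm_Vsum r).
rewrite (_ : Vsum (j :: r) t = (fun x => complex.Re (cQ j t) * ck j x + (- complex.Im (cQ j t) * sk j x + Vsum r t x))); last first.
  by apply/funext => x; rewrite Vsum_cons mode_trig addrA.
rewrite fh_lin; [|exact: ck_cont|exact: (contD (contM (@contc _ _) (@sk_cont _ j)) cr)].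
rewrite fh_lin//; last exact: sk_cont.
rewrite addrA; congr (_ + _); rewrite !fhFF FF_ck FF_sk /dd.
have n0 : pi != 0 :> R by rewrite gt_eqF// pi_gt0.
move: (cQ j t) => [a b]; rewrite -(mulr_natr pi 2); move: (@pi R : R) n0 => q n0.
by case: (j == k); case: (j == - k); apply: cplx_eq; rewrite /= ; field.
Qed.

End smooth.

(** * Approximation of C^1 fields with finitely many modes by smooth functions *)

Section closure.
Variable R : realType.
Notation C := R[i].
Variables (alpha beta N0 sg T : R).
Hypothesis N01 : 1 <= N0.
Hypothesis sg0 : 0 <= sg.
Hypothesis T0 : 0 < T.
Notation wX := (wt (Gw sg 1) N0).
Notation bdX := (bd (wt (Gw sg 1) N0) (om N0 T)).
Implicit Types (t s : R) (k : int).

Definition pk k : R := alpha * k%:~R ^+ 5 - beta * k%:~R ^+ 3.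

Lemma pkN k : pk (- k) = - pk k.
Proof. by rewrite /pk rmorphN /=; ring. Qed.

Lemma poly_prim (P : {poly R}) (c : R) : exists A : {poly R}, A^`() = P /\ A.[0] = c.
Proof.
exists (\poly_(i < (size P).+1) (if i is j.+1 then P`_j / i%:R else c)); split; last first.
  by rewrite horner_coef0 coef_poly.
apply/polyP => i; rewrite coef_deriv coef_poly ltnS.
case: ltnP => h; last by rewrite nth_default// mul0rn.
by rewrite -[_ *+ _]mulr_natr divfK// pnatr_eq0.
Qed.

Definition pairC (AB : {poly R} * {poly R}) t : C := (AB.1.[t] +i* AB.2.[t])%C.

(** The derivative is approximated uniformly and the approximation integrated: the difference is
    small in the Lipschitz norm, which dominates the modulus of the gauge. *)
Lemma poly_approx (Z g : R -> C) e : dC Z g -> cC g -> 0 < e ->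
  exists AB : {poly R} * {poly R}, Z 0 = pairC AB 0 /\
    forall s t, 0 <= s -> s <= t -> t <= T -> nc ((Z t - pairC AB t) - (Z s - pairC AB s)) <= e * (t - s).
Proof.
move=> dZ [c1 c2] e0; have e4 : 0 < e / 4 by rewrite divr_gt0.
have [P1 h1] := weierstrass c1 T0 e4; have [P2 h2] := weierstrass c2 T0 e4.
have [A [dA A0]] := poly_prim P1 (complex.Re (Z 0)).
have [B [dB B0]] := poly_prim P2 (complex.Im (Z 0)).
exists (A, B); split; first by apply: cplx_eq; rewrite /= ?A0 ?B0.
have dq : dC (pairC (A, B)) (pairC (P1, P2)).
  by move=> t; rewrite -dA -dB; split; exact: is_derive_horner.
have dd : dC (fun t => Z t + -1 * pairC (A, B) t) (fun t => g t + -1 * pairC (P1, P2) t) by exact: dCD dZ (dCZ (-1) dq).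
move=> s t s0 st tT.
have := @dC_mvt R _ _ s t (e / 2) st dd.
rewrite !mulN1r (_ : 2 * (e / 2) = e); last by field.
apply=> r /andP[sr rt]; rewrite mulN1r; apply: (le_trans (nc_le _)); rewrite ReD ImD ReN ImN /=.
have rT : 0 <= r <= T by apply/andP; split; [exact: le_trans sr|exact: le_trans tT].
have := h1 r rT; have := h2 r rT; rewrite /= [`|P1.[r] - _|]distrC [`|P2.[r] - _|]distrC; lra.
Qed.

Lemma ell2_fin (a : int -> R) M S : (forall k, 0 <= a k) -> (forall k, (M < `|k|)%N -> a k = 0) ->
  \sum_(k <- ZM M) a k <= S -> ell2 a S.
Proof.
move=> a0 az aS M'.
have sq (r : seq int) : \sum_(k <- r) a k ^+ 2 <= (\sum_(k <- r) a k) ^+ 2.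
  elim: r => [|k r IH]; first by rewrite !big_nil expr0n.
  rewrite !big_cons; have := a0 k; have : 0 <= \sum_(j <- r) a j by apply: sumr_ge0 => j _.
  move: (\sum_(j <- r) a j ^+ 2) (\sum_(j <- r) a j) (a k) IH => x y z h1 h2 h3; nra.
apply: (le_trans (sq _)); rewrite ler_sqr ?nnegrE ?sumr_ge0//; last first.
  by apply: le_trans aS; exact: sumr_ge0.
apply: le_trans aS; apply: (@ler_sum_inj _ _ _ _ _ id); rewrite ?uniq_ZM// => k _.
by rewrite mem_ZM -ltnNge; exact: az.
Qed.

(** The passage of a function to interaction variables, with the time stopped so that the result is
    a field on the whole line. *)
Definition coefV (V : R -> R -> R) : int -> R -> C :=
  fun k t => ce (clip 0 T t * pk k) * fh (V (clip 0 T t)) k.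

(** The modes are approximated separately, without regard to symmetry. The real function [Vsum]
    averages mode k with the conjugate of mode -k, which does no harm because [Z] has this symmetry
    on [0, T]. *)
Lemma C1_closure (Z g : int -> R -> C) M rho : (forall k, dC (Z k) (g k)) -> (forall k, cC (g k)) ->
  (forall t, Z 0 t = 0) -> (forall k t, 0 <= t <= T -> Z (- k) t = conjc (Z k t)) -> 0 < rho ->
  exists2 V, smooth_tx V & bdX (fun k t => (if (`|k| <= M)%N then Z k (clip 0 T t) else 0) - coefV V k t) rho.
Proof.
move=> dZ cg Z0 Zr rho0.
have N00 : 0 < N0 by exact: lt_le_trans N01.
have wX0 k : 0 < wX k by exact: wt_gt0 (submul_Gw sg0 ltr01) N00.
pose Sw := \sum_(k <- ZM M) wX k + 1.
have S0 : 0 <= \sum_(k <- ZM M) wX k by apply: sumr_ge0 => k _; exact: ltW.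
have Sw0 : 0 < Sw by rewrite /Sw; lra.
(* The gauge of the error is at most the Lipschitz constant [e] times T times the sum of the weights
   over the range. *)
pose e := rho / (Sw * T).
have e0 : 0 < e by rewrite divr_gt0// mulr_gt0.
have hQ k : exists AB : {poly R} * {poly R}, (k = 0 -> AB = (0, 0)) /\ (Z k 0 = pairC AB 0 /\
    forall s t, 0 <= s -> s <= t -> t <= T -> nc ((Z k t - pairC AB t) - (Z k s - pairC AB s)) <= e * (t - s)).
  have [->|/eqP k0] := eqVneq k 0; last by have [AB h] := poly_approx (dZ k) (cg k) e0; exists AB.
  exists (0, 0); split=> //; rewrite !Z0 /pairC /= horner0; split=> // s t s0 st tT.
  rewrite Z0 Z0 !horner0 subrr nc0 mulr_ge0 ?subr_ge0//; exact: ltW.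
have /choice [Q hQ1] := hQ.
have Q0 : Q 0 = (0, 0) by have [h _] := hQ1 0; exact: h.
have cQ0 t : cQ pk Q 0 t = 0 by rewrite /cQ Q0 /= !horner0 mulr0.
have fhV t k : fh (Vsum pk Q (ZM M) t) k =
    if (`|k| <= M)%N then ((2^-1)%:C)%C * (cQ pk Q k t + conjc (cQ pk Q (- k) t)) else 0.
  rewrite fh_Vsum; case: ifP => kM; last first.
    rewrite big_seq big1// => j; rewrite mem_ZM => jM.
    have -> : (j == k) = false by apply/negP => /eqP jk; rewrite jk kM in jM.
    have -> : (j == - k) = false by apply/negP => /eqP jk; rewrite jk abszN kM in jM.
    by rewrite !mul0r addr0 mulr0.
  rewrite -mulr_sumr big_split /=; congr (_ * (_ + _)).
    rewrite (bigD1_seq k) ?uniq_ZM ?mem_ZM//= eqxx mul1r big1 ?addr0// => j jk.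
    by rewrite (negbTE jk) mul0r.
  rewrite (bigD1_seq (- k)) ?uniq_ZM ?mem_ZM ?abszN//= eqxx mul1r big1 ?addr0// => j jk.
  by rewrite (negbTE jk) mul0r.
exists (Vsum pk Q (ZM M)).
  split; [exact: sm_Vsum|by move=> t; exact: Vsum_per|move=> t].
  have z : ((2^-1)%:C)%C * (0 + conjc 0) = 0 :> C by apply: cplx_eq => /=; ring.
  have n0 : - (0 : int) = 0 by [].
  apply: (etrans (fhV t 0)); rewrite n0.
  by rewrite cQ0 z.
pose E k t := Z k t - pairC (Q k) t.
have E0 k : E k 0 = 0 by have [_ [h _]] := hQ1 k; rewrite /E h subrr.
have hE k s t : 0 <= s <= T -> 0 <= t <= T -> nc (E k t - E k s) <= e * `|t - s|.
  move=> /andP[s0 sT] /andP[t0 tT]; have [_ [_ h]] := hQ1 k.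
  have [st|/ltW st] := leP s t; first by rewrite ger0_norm ?subr_ge0//; exact: h.
  by rewrite ncBC distrC ger0_norm ?subr_ge0//; exact: h.
have TT : 0 <= T by exact: ltW.
have cl t : 0 <= clip 0 T t <= T by exact: clip_in.
have e1 k t : (if (`|k| <= M)%N then Z k (clip 0 T t) else 0) - coefV (Vsum pk Q (ZM M)) k t =
   if (`|k| <= M)%N then ((2^-1)%:C)%C * (E k (clip 0 T t) + conjc (E (- k) (clip 0 T t))) else 0.
  rewrite /coefV fhV; case: ifP => _; last by rewrite mulr0 subr0.
  have cjM (z w : C) : conjc (z * w) = conjc z * conjc w by exact: rmorphM.
  have cjB (z w : C) : conjc (z - w) = conjc z - conjc w by exact: rmorphB.
  rewrite /E; move: (clip 0 T t) (cl t) => r hr; rewrite (Zr k r hr).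
  have a1 : ce (r * pk k) * cQ pk Q k r = pairC (Q k) r.
    by rewrite /cQ mulrA -ceD subrr ce0 mul1r.
  have a2 : ce (r * pk k) * conjc (cQ pk Q (- k) r) = conjc (pairC (Q (- k)) r).
    by rewrite /cQ cjM -ceN opprK pkN mulrN mulrA -ceD subrr ce0 mul1r.
  rewrite mulrCA mulrDr a1 a2 cjB conjcK.
  move: (Z k r) (pairC (Q k) r) (conjc (pairC (Q (- k)) r)) => [z1 z2] [y1 y2] [x1 x2].
  by apply: cplx_eq => /=; field.
have h2 : nc ((2^-1)%:C)%C = 2^-1 :> R by rewrite nc_real ger0_norm// invr_ge0.
apply: (bd_ext (u := fun k t => if (`|k| <= M)%N then ((2^-1)%:C)%C * (E k (clip 0 T t) + conjc (E (- k) (clip 0 T t))) else 0)).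
  by move=> k t; rewrite e1.
split; first exact: ltW.
exists (fun k => if (`|k| <= M)%N then e * T else 0) => [k|].
  case: ifP => kM; last first.
    by split=> //; split=> [t|t s]; rewrite ?subrr nc0 ?mul0r.
  have eT : 0 <= e * T by rewrite mulr_ge0// ltW.
  split=> //; split=> [t|t s].
    rewrite ncM h2; apply: (@le_trans _ _ (2^-1 * (e * T + e * T))); last by lra.
    rewrite ler_pM2l ?invr_gt0//; apply: (le_trans (ncD _ _)); rewrite nc_conj.
    have b j : nc (E j (clip 0 T t)) <= e * T.
      have z0 : 0 <= (0 : R) <= T by rewrite lexx.
      have := hE j 0 _ z0 (cl t); rewrite E0 !subr0 => h; apply: (le_trans h).
      have /andP[u1 u2] := cl t.
      by rewrite ler_pM2l// ger0_norm.
    by apply: lerD; exact: b.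
  rewrite -mulrBr ncM h2.
  have -> : E k (clip 0 T t) + conjc (E (- k) (clip 0 T t)) - (E k (clip 0 T s) + conjc (E (- k) (clip 0 T s))) =
     (E k (clip 0 T t) - E k (clip 0 T s)) + conjc (E (- k) (clip 0 T t) - E (- k) (clip 0 T s)).
    have cjB (z w : C) : conjc (z - w) = conjc z - conjc w by exact: rmorphB.
    by rewrite cjB; ring.
  have b j : nc (E j (clip 0 T t) - E j (clip 0 T s)) <= e * T * om N0 T k `|t - s|.
    apply: (le_trans (hE j _ _ (cl s) (cl t))); rewrite -mulrA ler_pM2l//.
    apply: (le_trans (clip_lip _ _ _ _)).
    have := @om_ge1 R N0 T k `|t - s| (normr_ge0 _); rewrite ler_pdivrMr// mulrC //.
  have := ncD (E k (clip 0 T t) - E k (clip 0 T s)) (conjc (E (- k) (clip 0 T t) - E (- k) (clip 0 T s))).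
  rewrite nc_conj; have := b k; have := b (- k).
  move: (nc (_ + _)) (nc (E k _ - _)) (nc (E (- k) _ - _)) (e * T * _) => x1 x2 x3 x4; lra.
apply: (@ell2_fin _ M).
- by move=> k; case: ifP => _; rewrite ?mulr0//; apply: mulr_ge0; [exact: ltW|rewrite mulr_ge0// ltW].
- by move=> k kM; rewrite leqNgt kM /= mulr0.
- rewrite big_seq (eq_bigr (fun k => e * T * wX k)); last by move=> k; rewrite mem_ZM => ->; rewrite mulrC.
  rewrite -big_seq -mulr_sumr.
  have -> : rho = e * T * Sw by rewrite /e; field; rewrite !gt_eqF.
  by apply: ler_wpM2l; [rewrite mulr_ge0// ltW|rewrite /Sw; lra].
Qed.

End closure.

(** * Smooth functions and their Duhamel integrals *)

Section decay.
Variable R : realType.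
Notation C := R[i].
Implicit Types (V W : R -> R -> R) (t x e : R) (k i j : int) (v w f : R -> R).
Notation mu := (@lebesgue_measure R).
Notation J f := (\int[mu]_(x in `[0, pi *+ 2]) f x).

Let p2 : 0 <= pi *+ 2 :> R. Proof. by rewrite mulrn_wge0// pi_ge0. Qed.
Let p20 : 0 < pi *+ 2 :> R. Proof. by rewrite mulrn_wgt0// pi_gt0. Qed.

Lemma is_derive_uniq f a b x : is_derive x (1 : R) f a -> is_derive x (1 : R) f b -> a = b.
Proof. by move=> h1 h2; rewrite -(@derive_val _ _ _ _ _ _ _ h1) -(@derive_val _ _ _ _ _ _ _ h2). Qed.

Lemma periodic_der f f' (P : R) : (forall x, is_derive x (1 : R) f (f' x)) -> periodic f P -> periodic f' P.
Proof.
move=> df pf x.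
have h1 : is_derive x (1 : R) (fun y => y + P) 1.
  have h := is_deriveD (is_derive_id x (1 : R)) (is_derive_cst P x (1 : R)).
  by apply: (@is_derive_eq _ _ _ _ _ _ _ _ h); rewrite addr0.
have := @is_derive1_comp _ f (fun y => y + P) x (f' (x + P)) 1 (df (x + P)) h1.
have -> : f \o (fun y => y + P) = f by apply/funext => y; exact: pf.
by rewrite mulr1 => h2; exact: (is_derive_uniq h2 (df x)).
Qed.

Lemma smooth_decay V T n : sm V -> (forall t, periodic (V t) (pi *+ 2)) ->
  exists2 H, 0 <= H & forall t k, 0 <= t <= T -> ab R k ^+ n * nc (fh (V t) k) <= H.
Proof.
move=> [D [D0 cD dt dx]] pV.
have pD m t : periodic (D 0%N m t) (pi *+ 2).
  elim: m => [|m IH]; first by rewrite D0; exact: pV.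
  exact: (periodic_der (dx 0%N m t) IH).
have [H H0 hH] := @bounded2 R (D 0%N n) (- pi) pi T (cD 0%N n).
exists (2 * H); first by rewrite mulr_ge0.
move=> t k ht; have b x : `|D 0%N n t x| <= H.
  by have [y hy e] := period_red x; rewrite (e _ (pD n t)); exact: hH.
have := @FF_decay R (fun m => D 0%N m t) n k H (fun m => dx 0%N m t) (fun m => pD m t) b.
rewrite D0 fhFF ncM nc_conj nc_real ger0_norm ?invr_ge0// mulrCA => h.
rewrite ler_pdivrMl//; apply: (le_trans h); rewrite -(mulr_natr pi 2); lra.
Qed.

Lemma dC_fh V Vt k : cont2 V -> cont2 Vt -> (forall t x, is_derive t (1 : R) (fun s => V s x) (Vt t x)) ->
  dC (fun t => fh (V t) k) (fun t => fh (Vt t) k).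
Proof.
move=> cV cVt dV t.
have h (q : R -> R) (c : R) : continuous q ->
    is_derive t (1 : R) (fun s => J (fun x => V s x * q x) * c) (J (fun x => Vt t x * q x) * c).
  move=> cq; have d := @diff_int R (fun s x => V s x * q x) (fun s x => Vt s x * q x) 0 (pi *+ 2) p2
    (cont2M cV (cont2_x cq)) (cont2M cVt (cont2_x cq)) _ t.
  have {d}d : is_derive t (1 : R) (fun s => J (fun x => V s x * q x)) (J (fun x => Vt t x * q x)).
    apply: d => s x; have h := is_deriveM (dV s x) (is_derive_cst (q x) s (1 : R)).
    by apply: (@is_derive_eq _ _ _ _ _ _ _ _ h); rewrite /GRing.scale /= mulr0 add0r mulrC.
  rewrite (_ : (fun s => _) = c \*: (fun s => J (fun x => V s x * q x))); last first.
    by apply/funext => s; rewrite /GRing.scale /= mulrC.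
  have h := is_deriveZ c d.
  by apply: (@is_derive_eq _ _ _ _ _ _ _ _ h); rewrite /GRing.scale /= mulrC.
split; first exact: (h _ _ (@ck_cont R k)).
have e1 : @complex.Im R \o (fun s => fh (V s) k) = (fun s => J (fun x => V s x * sk k x) * - (pi *+ 2)^-1).
  by apply/funext => s; rewrite mulrN -mulNr.
have e2 : complex.Im (fh (Vt t) k) = J (fun x => Vt t x * sk k x) * - (pi *+ 2)^-1 by rewrite mulrN -mulNr.
by rewrite e1 e2; exact: (h _ _ (@sk_cont R k)).
Qed.

Lemma sm_t V : sm V -> (forall t, periodic (V t) (pi *+ 2)) -> exists Vt, [/\ sm Vt, forall t, periodic (Vt t) (pi *+ 2) &
  forall k, dC (fun t => fh (V t) k) (fun t => fh (Vt t) k)].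
Proof.
move=> [D [D0 cD dt dx]] pV; exists (D 1%N 0%N); split.
- by exists (fun m => D m.+1); split.
- move=> t x; have h := dt 0%N 0%N t (x + pi *+ 2); have h' := dt 0%N 0%N t x.
  rewrite D0 in h h'; apply: is_derive_uniq h _; move: h'.
  by rewrite (_ : (fun s => V s (x + _)) = (fun s => V s x))//; apply/funext => s; exact: pV.
- by move=> k; apply: dC_fh; [rewrite -D0; exact: cD|exact: cD|rewrite -D0; exact: dt].
Qed.

Lemma sum_inv2 (a : int -> R) (c : R) M : 0 <= c -> (forall k, 0 <= a k) -> a 0 = 0 -> (forall k, k != 0 -> a k <= c / ab R k ^+ 2) ->
  \sum_(k <- ZM M) a k <= 4 * c.
Proof.
move=> c0 a0 az ha.
have hz k : k != 0 -> nc ((a k)%:C)%C <= c / ab R k ^+ 2 by move=> k0; rewrite nc_real ger0_norm// ha.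
have := @tele R (fun k => ((a k)%:C)%C) c 0 M c0 hz (leq0n M).
have z0 : \sum_(k <- ZM 0) ((a k)%:C)%C = 0 :> C.
  by rewrite big_seq big1// => k; rewrite mem_ZM leqn0 absz_eq0 => /eqP ->; rewrite az.
have e : \sum_(k <- ZM M) ((a k)%:C)%C = ((\sum_(k <- ZM M) a k)%:C)%C :> C by rewrite (rmorph_sum (real_complex R)).
rewrite z0 subr0 e nc_real ger0_norm ?sumr_ge0// => h; apply: (le_trans h).
by rewrite invr1 ler_piMr ?mulr_ge0// gerBl invr_ge0.
Qed.

Lemma FF_conj f k : continuous f -> FF f (- k) = conjc (FF f k).
Proof.
move=> cf; rewrite !FF_fh fh_conj//; move: (fh f k) => [a b].
by apply: cplx_eq => /=; ring.
Qed.

Lemma FF_shift w k i : continuous w ->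
  FF (fun x => w x * ck k x) i + (0 +i* -1)%C * FF (fun x => w x * sk k x) i = ((pi *+ 2)%:C)%C * fh w (k - i).
Proof.
move=> cw; have n0 : pi *+ 2 != 0 :> R by rewrite gt_eqF.
have cc : continuous (fun x => w x * ck k x * ck i x) by exact: (contM (contM cw (@ck_cont R k)) (@ck_cont R i)).
have cs : continuous (fun x => w x * ck k x * sk i x) by exact: (contM (contM cw (@ck_cont R k)) (@sk_cont R i)).
have sc : continuous (fun x => w x * sk k x * ck i x) by exact: (contM (contM cw (@sk_cont R k)) (@ck_cont R i)).
have ss : continuous (fun x => w x * sk k x * sk i x) by exact: (contM (contM cw (@sk_cont R k)) (@sk_cont R i)).
have e1 : J (fun x => w x * ck (k - i) x) = J (fun x => w x * ck k x * ck i x) + J (fun x => w x * sk k x * sk i x).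
  have := @J_lin R 1 _ _ cc ss; rewrite mul1r => <-; apply: J_ext => x.
  by rewrite /ck /sk intrB mulrBl cosB; ring.
have e2 : J (fun x => w x * sk (k - i) x) = J (fun x => w x * sk k x * ck i x) - J (fun x => w x * ck k x * sk i x).
  have := @J_lin R (-1) _ _ cs sc; rewrite mulN1r addrC => <-; apply: J_ext => x.
  by rewrite /ck /sk intrB mulrBl sinB; ring.
rewrite fhE e1 e2 /FF.
move: (J (fun x => w x * ck k x * ck i x)) (J (fun x => w x * ck k x * sk i x)) (J (fun x => w x * sk k x * ck i x)) (J (fun x => w x * sk k x * sk i x)) => a b c d.
by move: (pi *+ 2) n0 => q n0; apply: cplx_eq => /=; field.
Qed.

(** Parseval's formula for [v] against w cos(kx) and w sin(kx), whose coefficients combine into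
    shifted coefficients of [w] by [FF_shift]. *)
Lemma conv_lims v w k (S : R) : continuous v -> continuous w -> periodic w (pi *+ 2) ->
  (forall M, \sum_(k <- ZM M) nc (fh v k) <= S) ->
  lims (fun M => \sum_(i <- ZM M) fh v i * fh w (k - i)) (fh (fun x => v x * w x) k).
Proof.
move=> cv cw pw hS e e0.
have n0 : pi *+ 2 != 0 :> R by rewrite gt_eqF.
pose P f M := \sum_(i <- ZM M) fh v i * FF f i.
have Pr f M : continuous f -> complex.Im (P f M) = 0.
  move=> cf; have : conjc (P f M) = P f M.
    rewrite /P (rmorph_sum conjc) -[RHS](@sum_ZM_opp _ M (fun i => fh v i * FF f i)).
    by apply: eq_bigr => i _; rewrite rmorphM fh_conj// FF_conj.
  by case: (P f M) => a b [] h /=; lra.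
have cwc : continuous (fun x => w x * ck k x) by exact: (contM cw (@ck_cont R k)).
have cws : continuous (fun x => w x * sk k x) by exact: (contM cw (@sk_cont R k)).
have pwc : periodic (fun x => w x * ck k x) (pi *+ 2) by move=> x; rewrite pw ck_per.
have pws : periodic (fun x => w x * sk k x) (pi *+ 2) by move=> x; rewrite pw sk_per.
have ep : 0 < e * pi by rewrite mulr_gt0// pi_gt0.
have [M1 h1] := pairing cv hS cwc pwc ep; have [M2 h2] := pairing cv hS cws pws ep.
exists (maxn M1 M2) => M; rewrite geq_max => /andP[m1 m2].
have {}h1 := h1 M m1; have {}h2 := h2 M m2.
have e1 : ((pi *+ 2)%:C)%C * (\sum_(i <- ZM M) fh v i * fh w (k - i)) =
    P (fun x => w x * ck k x) M + (0 +i* -1)%C * P (fun x => w x * sk k x) M.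
  rewrite /P !mulr_sumr -big_split; apply: eq_bigr => i _ /=.
  by rewrite mulrCA -FF_shift// mulrDr [_ * (fh v i * _)]mulrCA.
have e2 : ((pi *+ 2)%:C)%C * fh (fun x => v x * w x) k =
    (J (fun x => v x * (w x * ck k x)) +i* - J (fun x => v x * (w x * sk k x)))%C.
  rewrite fhE; have -> : J (fun x => v x * w x * ck k x) = J (fun x => v x * (w x * ck k x)) by apply: J_ext => x; rewrite mulrA.
  have -> : J (fun x => v x * w x * sk k x) = J (fun x => v x * (w x * sk k x)) by apply: J_ext => x; rewrite mulrA.
  move: (J (fun x => v x * (w x * ck k x))) (J (fun x => v x * (w x * sk k x))) (pi *+ 2) n0 => a b q n0.
  by apply: cplx_eq => /=; field.
have e3 : nc (((pi *+ 2)%:C)%C * (\sum_(i <- ZM M) fh v i * fh w (k - i) - fh (fun x => v x * w x) k)) <= e * pi + e * pi.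
  rewrite mulrBr e1 e2; have i1 := Pr _ M cwc; have i2 := Pr _ M cws.
  move: h1 h2; rewrite -/(P (fun x => w x * ck k x) M) -/(P (fun x => w x * sk k x) M).
  move: i1 i2; move: (P (fun x => w x * ck k x) M) (P (fun x => w x * sk k x) M) (J (fun x => v x * (w x * ck k x))) (J (fun x => v x * (w x * sk k x))) => [a1 a2] [b1 b2] c d i1 i2 h1 h2.
  have j1 : a2 = 0 by [].
  have j2 : b2 = 0 by [].
  rewrite j1 j2 in h1 h2 *; apply: (le_trans (nc_le _)); rewrite /= in h1 h2 *.
  rewrite (_ : a1 + (0 * b1 - -1 * 0) - c = a1 - c); last by ring.
  rewrite (_ : 0 + (0 * 0 + -1 * b1) - - d = - (b1 - d)); last by ring.
  by rewrite normrN; exact: lerD.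
move: e3; rewrite ncM nc_real ger0_norm// -mulr2n -mulrnAr mulrC ler_pM2r//.
Qed.

(** The square range misses a tail in i and the pairs with |k - i| > M, both of order 1 / M. Since
    the rate depends only on [H], the limit can be taken under a time integral. *)
Lemma conv_rate v w k (H : R) M : continuous v -> continuous w -> periodic w (pi *+ 2) -> 0 <= H ->
  fh v 0 = 0 -> fh w 0 = 0 -> (forall i, ab R i ^+ 2 * nc (fh v i) <= H) -> (forall i, ab R i ^+ 2 * nc (fh w i) <= H) ->
  nc (\sum_(i <- ZM M) \sum_(j <- ZM M) (if [&& i + j == k, i != 0 & j != 0] then fh v i * fh w j else 0)
      - fh (fun x => v x * w x) k) <= 10 * H ^+ 2 / M.+1%:R.
Proof.
move=> cv cw pw H0 v0 w0 hv hw.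
have d2 (q : int -> C) i : i != 0 -> ab R i ^+ 2 * nc (q i) <= H -> nc (q i) <= H / ab R i ^+ 2.
  by move=> i0 h; rewrite ler_pdivlMr ?exprn_gt0 ?ab_gt0// mulrC.
have ab1 i : i != 0 -> 1 <= ab R i by move=> i0; rewrite /ab ler1n absz_gt0.
have bw i : nc (fh w i) <= H.
  have [->|i0] := eqVneq i 0; first by rewrite w0 nc0.
  apply: le_trans (hw i); rewrite ler_peMl ?nc_ge0//; exact: exprn_ege1 (ab1 i i0).
have bv i : nc (fh v i) <= H.
  have [->|i0] := eqVneq i 0; first by rewrite v0 nc0.
  apply: le_trans (hv i); rewrite ler_peMl ?nc_ge0//; exact: exprn_ege1 (ab1 i i0).
pose z i := fh v i * fh w (k - i).
have HH : 0 <= H ^+ 2 by exact: exprn_ge0.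
have hz i : i != 0 -> nc (z i) <= H ^+ 2 / ab R i ^+ 2.
  move=> i0; rewrite ncM expr2 mulrAC; apply: ler_pM; rewrite ?nc_ge0//; exact: d2.
have [L1 L2] := ser_lims HH hz.
have hS M' : \sum_(i <- ZM M') nc (fh v i) <= 4 * H.
  apply: sum_inv2 => //; [by move=> i; exact: nc_ge0|by rewrite v0 nc0|].
  by move=> i i0; exact: d2.
have L3 := lims_uniq L1 (conv_lims k cv cw pw hS).
have {}L2 := L2 M; rewrite L3 in L2.
have e1 : \sum_(i <- ZM M) \sum_(j <- ZM M) (if [&& i + j == k, i != 0 & j != 0] then fh v i * fh w j else 0) =
   \sum_(i <- ZM M) (if (`|k - i| <= M)%N then z i else 0).
  apply: eq_bigr => i _; case: ifP => hk.
    rewrite (bigD1_seq (k - i)) ?uniq_ZM ?mem_ZM//= big1 ?addr0; last first.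
      move=> j jk; rewrite (_ : (i + j == k) = false)//.
      by apply/negP => /eqP e; move: jk; rewrite -e addrAC subrr add0r eqxx.
    rewrite addrC subrK eqxx /=; rewrite /z; case: eqP => [->|_] /=; first by rewrite v0 mul0r.
    by case: eqP => [->|_] //=; rewrite w0 mulr0.
  rewrite big_seq big1// => j; rewrite mem_ZM => jM.
  rewrite (_ : (i + j == k) = false)//; apply/negP => /eqP e.
  by move: hk; rewrite -e addrAC subrr add0r jM.
have e2 : nc (\sum_(i <- ZM M) (if (`|k - i| <= M)%N then z i else 0) - \sum_(i <- ZM M) z i) <= 2 * H ^+ 2 / M.+1%:R.
  rewrite -sumrB; apply: (le_trans (nc_sum _ _)).
  have p1 : 0 < M.+1%:R :> R by rewrite ltr0n.
  apply: (@le_trans _ _ (\sum_(i <- ZM M) H ^+ 2 / M.+1%:R ^+ 2)).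
    apply: ler_sum => i _; case: ifPn => [_|]; first by rewrite subrr nc0 divr_ge0// exprn_ge0.
    rewrite -ltnNge => hk; rewrite sub0r ncN ncM expr2 -mulrA; apply: ler_pM; rewrite ?nc_ge0//.
    have ki : k - i != 0 by apply/eqP => e; rewrite e in hk.
    apply: (le_trans (d2 _ _ ki (hw _))); apply: ler_wpM2l => //.
    rewrite lef_pV2 ?posrE ?exprn_gt0 ?ab_gt0// ler_sqr ?nnegrE ?ler0n// /ab ler_nat //.
  rewrite big_const_seq count_predT iter_addr addr0.
  have -> : size (ZM M) = M.*2.+1 by rewrite /ZM -lock size_map size_iota.
  rewrite -[_ *+ M.*2.+1]mulr_natr (_ : 2 * H ^+ 2 / M.+1%:R = H ^+ 2 * (2 / M.+1%:R)); last by ring.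
  rewrite -mulrA; apply: ler_wpM2l => //.
  rewrite expr2 invfM -mulrA [2 / _]mulrC; apply: ler_wpM2l; first by rewrite invr_ge0 ltW.
  rewrite mulrC ler_pdivrMr// -natrM ler_nat mul2n -addnn -addnn; lia.
rewrite e1; have := ncD (\sum_(i <- ZM M) (if (`|k - i| <= M)%N then z i else 0) - \sum_(i <- ZM M) z i)
  (\sum_(i <- ZM M) z i - fh (fun x => v x * w x) k).
rewrite addrA subrK => h; apply: (le_trans h).
rewrite ncBC in L2; apply: (le_trans (lerD e2 L2)).
by rewrite -!mulrA -mulrDl -natrD.
Qed.

End decay.

(** * Finite gauge of smooth functions, and their Duhamel integrals through the limit operator *)

Section coefficients.
Variable R : realType.
Notation C := R[i].
Variables (alpha beta N0 Ca sg T : R).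
Hypothesis hok : phase_ok alpha beta N0 Ca.
Hypothesis sg0 : 0 <= sg.
Hypothesis T0 : 0 < T.
Notation wX := (wt (Gw sg 1) N0).
Notation bdX := (bd (wt (Gw sg 1) N0) (om N0 T)).
Notation pk := (pk alpha beta).
Notation coefV := (coefV alpha beta T).
Implicit Types (V W : R -> R -> R) (t r : R) (k i j : int).

Let N01 : 1 <= N0. Proof. by case: hok. Qed.
Let N00 : 0 < N0. Proof. exact: lt_le_trans N01. Qed.
Let TT : 0 <= T. Proof. exact: ltW. Qed.
Let wX0 k : 0 < wX k. Proof. exact: wt_gt0 (submul_Gw sg0 ltr01) N00. Qed.

Lemma coefV_stopped V : stopped T (coefV V).
Proof. by move=> k t; rewrite /coefV clip_clip. Qed.

Lemma coefV_real V : smooth_tx V -> realz (coefV V).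
Proof.
move=> [hs _ h0]; split=> [t|]; first by rewrite /coefV /fh h0 mulr0.
apply/funext => k; apply/funext => t; rewrite /bar /coefV pkN.
have cV := @sm_slice R V (clip 0 T t) hs.
have cjM (z w : C) : conjc (z * w) = conjc z * conjc w by exact: rmorphM.
by rewrite cjM fh_conj// conjcK -ceN mulrN opprK.
Qed.

Lemma wX_poly : exists m : nat, forall k, k != 0 -> wX k <= 2 * 2 ^+ m * ab R k ^+ m.
Proof.
exists (Num.truncn sg).+1 => k k0; set m := (Num.truncn sg).+1.
have hm : sg <= m%:R by have /andP[_ /ltW] := truncn_itv sg0.
have a1 : 1 <= ab R k by rewrite /ab ler1n absz_gt0.
have j1 := jb_ge1 R k; have j2 := jb_le R k.
have h1 : japanese_bracket R k `^ sg <= (2 * ab R k) ^+ m.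
  apply: (@le_trans _ _ (japanese_bracket R k `^ m%:R)); first exact: ler_powR.
  rewrite powR_mulrn; last by lra.
  by apply: lerXn2r; rewrite ?nnegrE; lra.
have h2 : 1 <= (2 * ab R k) ^+ m by apply: exprn_ege1; lra.
rewrite /wt /Gw mul1r; apply: (@le_trans _ _ (1 + japanese_bracket R k `^ sg)).
  rewrite ler_pdivrMr ?br_gt0// ler_peMr ?addr_ge0 ?powR_ge0//.
  by rewrite /br le_max N01.
by rewrite -mulrA -exprMn; lra.
Qed.

Lemma pk_le k : `|pk k| <= (`|alpha| + `|beta|) * ab R k ^+ 5.
Proof.
have [->|k0] := eqVneq k 0.
  by rewrite /pk mulr0z !expr0n !mulr0 subrr normr0 ?mulr0.
have a1 : 1 <= ab R k by rewrite /ab ler1n absz_gt0.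
have ek n : `|k%:~R ^+ n : R| = ab R k ^+ n by rewrite normrX -intr_norm -abszE.
rewrite /pk; apply: (le_trans (ler_normB _ _)); rewrite (normrM alpha) (normrM beta) !ek mulrDl lerD2l.
by apply: ler_wpM2l => //; apply: ler_weXn2l.
Qed.

(** Of the m + 6 powers of |k| gained from smoothness, m pay for the weight, five for the factor
    p(k) produced by the time derivative of the interaction variable, and one for square
    summability. *)
Lemma coefV_bd V : smooth_tx V -> exists c, bdX (coefV V) c.
Proof.
move=> [hs pV h0].
have [Vt [hst pVt dV]] := sm_t hs pV.
have [m hm] := wX_poly.
have [H1 H10 hH1] := @smooth_decay R V T (m + 6) hs pV.
have [H2 H20 hH2] := @smooth_decay R Vt T (m + 6) hst pVt.
pose Cp := `|alpha| + `|beta|.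
have Cp0 : 0 <= Cp by rewrite addr_ge0.
pose K := H1 + T * (2 * (Cp * H1 + H2)).
have K0 : 0 <= K by rewrite addr_ge0// mulr_ge0// mulr_ge0// addr_ge0// mulr_ge0.
pose F k t := ce (pk k * t) * fh (V t) k.
pose F' k t := ((0 +i* pk k)%C * ce (pk k * t)) * fh (V t) k + ce (pk k * t) * fh (Vt t) k.
have dF k : dC (F k) (F' k) by exact: dCM (dC_ce (pk k)) (dV k).
have eF k t : coefV V k t = F k (clip 0 T t) by rewrite /coefV /F mulrC [_ * pk k]mulrC mulrC.
have cl t : 0 <= clip 0 T t <= T by exact: clip_in.
pose A k := if k == 0 then 0 else K / ab R k ^+ m.+1.
have A0 k : 0 <= A k by rewrite /A; case: eqP => // _; rewrite divr_ge0// exprn_ge0.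
have b1 k t : k != 0 -> 0 <= t <= T -> nc (F k t) <= H1 / ab R k ^+ m.+1 /\ nc (F' k t) <= (Cp * H1 + H2) / ab R k ^+ m.+1.
  move=> k0 ht; have a1 : 1 <= ab R k by rewrite /ab ler1n absz_gt0.
  have a0 : 0 < ab R k by exact: ab_gt0.
  have am : 0 < ab R k ^+ m.+1 by exact: exprn_gt0.
  have a5 : 1 <= ab R k ^+ 5 by exact: exprn_ege1.
  have es : ab R k ^+ (m + 6) = ab R k ^+ 5 * ab R k ^+ m.+1 by rewrite -exprD; congr (_ ^+ _); rewrite addSnnS addnC.
  have q1 := hH1 t k ht; have q2 := hH2 t k ht; rewrite es -mulrA in q1; rewrite es -mulrA in q2.
  have n1 := nc_ge0 (fh (V t) k); have n2 := nc_ge0 (fh (Vt t) k).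
  have le5 (y H : R) : 0 <= y -> ab R k ^+ 5 * (ab R k ^+ m.+1 * y) <= H -> ab R k ^+ m.+1 * y <= H.
    by move=> y0; apply: le_trans; rewrite ler_peMl// mulr_ge0// ltW.
  split; first by rewrite ncM nc_ce mul1r ler_pdivlMr// mulrC; exact: le5.
  rewrite ler_pdivlMr//; apply: (@le_trans _ _ ((Cp * ab R k ^+ 5 * nc (fh (V t) k) + nc (fh (Vt t) k)) * ab R k ^+ m.+1)).
    rewrite ler_pM2r//; apply: (le_trans (ncD _ _)); rewrite !ncM nc_ce nc_i mulr1 mul1r lerD2r.
    by apply: ler_wpM2r => //; exact: pk_le.
  rewrite mulrDl; apply: lerD; last by rewrite mulrC; exact: le5.
  have aux (x y z u : R) : x * y * z * u = x * (y * (u * z)) by ring.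
  by rewrite aux; exact: ler_wpM2l.
have F0 t : F 0 t = 0 by rewrite /F /fh h0 mulr0.
exists (2 * (2 * 2 ^+ m * K)); split; first by rewrite !mulr_ge0// exprn_ge0.
exists A => [k|].
  split=> //; rewrite /A; case: eqP => [->|/eqP k0].
    by split=> [t|t s]; rewrite !eF !F0 ?subrr nc0 ?mul0r.
  have am : 0 < ab R k ^+ m.+1 by rewrite exprn_gt0// ab_gt0.
  have G0 : 0 <= Cp * H1 + H2 by rewrite addr_ge0// mulr_ge0.
  split=> [t|t s]; rewrite !eF.
    apply: (le_trans (b1 k _ k0 (cl t)).1); rewrite ler_pM2r ?invr_gt0// /K lerDl.
    by rewrite !mulr_ge0.
  have lip x y : 0 <= x -> x <= y -> y <= T -> nc (F k y - F k x) <= 2 * ((Cp * H1 + H2) / ab R k ^+ m.+1) * (y - x).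
    move=> x0 xy yT; apply: (dC_mvt xy (dF k)) => r /andP[xr ry].
    by apply: (b1 k r k0 _).2; apply/andP; split; [exact: le_trans xr|exact: le_trans yT].
  have h1 : nc (F k (clip 0 T t) - F k (clip 0 T s)) <= 2 * ((Cp * H1 + H2) / ab R k ^+ m.+1) * `|t - s|.
    apply: (@le_trans _ _ (2 * ((Cp * H1 + H2) / ab R k ^+ m.+1) * `|clip 0 T t - clip 0 T s|)); last first.
      by apply: ler_wpM2l; [rewrite mulr_ge0// divr_ge0// ltW|exact: clip_lip].
    have /andP[u1 u2] := cl t; have /andP[u3 u4] := cl s.
    have [ts|/ltW ts] := leP (clip 0 T t) (clip 0 T s).
      by rewrite ncBC distrC [`|_ - _|]ger0_norm ?subr_ge0//; exact: lip.
    by rewrite [`|_ - _|]ger0_norm ?subr_ge0//; exact: lip.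
  apply: (le_trans h1).
  have h2 : `|t - s| <= T * om N0 T k `|t - s|.
    by have := @om_ge1 R N0 T k `|t - s| (normr_ge0 _); rewrite ler_pdivrMr// mulrC.
  have o0 : 0 <= om N0 T k `|t - s| by exact: om_gpos.
  apply: (@le_trans _ _ (2 * ((Cp * H1 + H2) / ab R k ^+ m.+1) * (T * om N0 T k `|t - s|))).
    by apply: ler_wpM2l => //; rewrite mulr_ge0// divr_ge0// ltW.
  rewrite !mulrA; apply: ler_wpM2r => //; rewrite [_ * T]mulrC !mulrA; apply: ler_wpM2r; first by rewrite invr_ge0 ltW.
  by rewrite /K -mulrA lerDr.
move=> M; have Z0 : 0 <= 2 * 2 ^+ m * K by rewrite !mulr_ge0// exprn_ge0.
rewrite exprMn (_ : 2 ^+ 2 = 4 :> R); last by ring.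
apply: sum_inv2; first exact: exprn_ge0.
- by move=> k; exact: sqr_ge0.
- by rewrite /A eqxx mulr0 expr0n.
move=> k k0; rewrite /A (negbTE k0) -expr_div_n ler_sqr ?nnegrE; last 2 first.
- by apply: mulr_ge0; [exact: ltW (wX0 k)|rewrite divr_ge0// exprn_ge0//; exact: ler0n].
- by rewrite divr_ge0//; exact: ler0n.
have a0 : 0 < ab R k by exact: ab_gt0.
apply: (@le_trans _ _ (2 * 2 ^+ m * ab R k ^+ m * (K / ab R k ^+ m.+1))).
  by apply: ler_wpM2r; [rewrite divr_ge0// exprn_ge0// ltW|exact: hm].
rewrite exprS; have y0 : 0 < ab R k ^+ m by exact: exprn_gt0.
have -> // : 2 * 2 ^+ m * ab R k ^+ m * (K / (ab R k * ab R k ^+ m)) = 2 * 2 ^+ m * K / ab R k.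
move: (ab R k ^+ m) (2 ^+ m) (ab R k) a0 y0 => y z a a0 y0.
by field; rewrite !gt_eqF.
Qed.

Lemma CintE (F : R -> C) t : 0 <= t -> cC F -> Cintegral 0 t F = cprim F t.
Proof.
move=> t0 [c1 c2]; rewrite /Cintegral (int_primR t0 c1) (int_primR t0 c2).
have [z1 _] := primRP c1; have [z2 _] := primRP c2.
by apply: cplx_eq; rewrite /= ?z1 ?z2 subr0.
Qed.

(** The factor e^{i r p(k)} splits into the phase of the pair and the interaction factors of the two
    inputs, so the truncated operators are time integrals of truncated convolutions; [conv_rate]
    passes to the limit uniformly in time. *)
Lemma duhamel_coef V W t k : smooth_tx V -> smooth_tx W -> 0 <= t <= T ->
  duhamel alpha beta V W t k = U_mult alpha beta t k * Binf alpha beta 0 T (coefV V) (coefV W) k t.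
Proof.
move=> hV hW /andP[t0 tT].
have [[hs pV V0] [hs' pW W0]] := (hV, hW).
have [c hc] := coefV_bd hV; have [c' hc'] := coefV_bd hW.
have [VW' [cVW cVW' dVW]] := smM_slice hs hs'.
have [H1 H10 hH1] := @smooth_decay R V T 2 hs pV; have [H2 H20 hH2] := @smooth_decay R W T 2 hs' pW.
pose q r := fh (fun x => V r x * W r x) k.
have dq : dC q (fun r => fh (VW' r) k) by exact: dC_fh cVW cVW' dVW.
pose h r := ce (pk k * r) * ((0 +i* k%:~R)%C * q r).
have ch : cC h.
  by apply: cCM; [exact: cC_ce|apply: cCM; [exact: cC_cst|exact: dC_cont dq]].
have UE r : U_mult alpha beta r k = ce (- (r * pk k)) by [].
have [h0 dh] := cprimP ch.
have -> : duhamel alpha beta V W t k = U_mult alpha beta t k * cprim h t.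
  have e1 : (fun r => U_mult alpha beta (t - r) k * ((0 +i* k%:~R)%C * fourier (distribution_of (fun x => V r x * W r x)) k)) =
     (fun r => U_mult alpha beta t k * h r).
    apply/funext => r; rewrite !UE /h [RHS]mulrA -ceD; congr (ce _ * _); ring.
  rewrite /duhamel e1 CintE//; last by apply: cCM => //; exact: cC_cst.
  move: (U_mult alpha beta t k) => z.
  have cz : cC (fun r => z * h r) by exact: (cCM (cC_cst z) ch).
  have dz : dC (fun r => z * cprim h r) (fun r => z * h r) by exact: dCZ.
  have z0 : z * cprim h 0 = 0 by rewrite h0 mulr0.
  by rewrite (cprim_uniq cz dz z0).
congr (_ * _); set f := coefV V; set g := coefV W.
have cf : cont f by exact: (bd_cont T0 hc).
have cg : cont g by exact: (bd_cont T0 hc').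
have L1 := @X_lims R alpha beta N0 Ca sg T hok sg0 T0 0 T f g c c' k t TT _ hc hc'.
rewrite subr0 in L1; apply: lims_uniq (L1 (lexx T)) => {L1}.
pose G M r := \sum_(i <- ZM M) \sum_(j <- ZM M)
    (if [&& i + j == k, i != 0 & j != 0] then (0 +i* k%:~R)%C * Ep alpha beta i j f g r else 0).
pose G' M r := \sum_(i <- ZM M) \sum_(j <- ZM M)
    (if [&& i + j == k, i != 0 & j != 0] then (0 +i* k%:~R)%C * (ce (phase alpha beta i j * r) * (f i r * g j r)) else 0).
have cE i j : cC (fun r => ce (phase alpha beta i j * r) * (f i r * g j r)).
  by apply: cCM; [exact: cC_ce|apply: cCM; [exact: cf|exact: cg]].
have dG M : dC (G M) (G' M).
  apply: dC_sum => i; apply: dC_sum => j; case: [&& i + j == k, i != 0 & j != 0]; last exact: dC_cst.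
  by apply: dCZ; have [_ d] := cprimP (cE i j).
have eB M : BM alpha beta M 0 T f g k t = G M t.
  rewrite /BM /G; apply: eq_bigr => i _; apply: eq_bigr => j _; case: ifP => // _.
  rewrite /Bt clip_id ?t0//; congr (_ * _).
  by rewrite /Ep; have [-> _] := cprimP (cE i j); rewrite subr0.
have G0 M : G M 0 = 0.
  rewrite /G big1// => i _; rewrite big1// => j _; case: ifP => // _.
  by rewrite /Ep; have [-> _] := cprimP (cE i j); rewrite mulr0.
pose H := H1 + H2.
have HH : 0 <= H by rewrite addr_ge0.
have main M : nc (G M t - cprim h t) <= 2 * (ab R k * (10 * H ^+ 2 / M.+1%:R)) * T.
  have d1 := dCD (dG M) (dCZ (-1) dh).
  have := @dC_mvt R _ _ 0 t (ab R k * (10 * H ^+ 2 / M.+1%:R)) t0 d1.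
  rewrite G0 h0 mulr0 addr0 subr0 mulN1r subr0 => d2.
  apply: (@le_trans _ _ (2 * (ab R k * (10 * H ^+ 2 / M.+1%:R)) * t)); last first.
    by apply: ler_wpM2l => //; rewrite mulr_ge0// mulr_ge0// ?divr_ge0// ?mulr_ge0// ?exprn_ge0//; rewrite /ab.
  apply: d2 => r /andP[r0 rt].
  have rT : 0 <= r <= T by rewrite r0 (le_trans rt).
  have -> : G' M r = ((0 +i* k%:~R)%C * ce (pk k * r)) *
     \sum_(i <- ZM M) \sum_(j <- ZM M) (if [&& i + j == k, i != 0 & j != 0] then fh (V r) i * fh (W r) j else 0).
    rewrite /G' mulr_sumr; apply: eq_bigr => i _; rewrite mulr_sumr; apply: eq_bigr => j _.
    case: ifP => [/and3P[/eqP ij _ _]|_]; last by rewrite mulr0.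
    rewrite /f /g /coefV clip_id// -ij -[RHS]mulrA; congr (_ * _).
    have -> : ce (pk (i + j) * r) = ce (phase alpha beta i j * r) * (ce (r * pk i) * ce (r * pk j)).
      by rewrite -!ceD; congr ce; rewrite /phase -/(pk i) -/(pk j) -/(pk (i + j)); ring.
    ring.
  have -> : (0 +i* k%:~R)%C * ce (pk k * r) * (\sum_(i <- ZM M) \sum_(j <- ZM M)
        (if [&& i + j == k, i != 0 & j != 0] then fh (V r) i * fh (W r) j else 0)) + -1 * h r =
     ((0 +i* k%:~R)%C * ce (pk k * r)) * (\sum_(i <- ZM M) \sum_(j <- ZM M)
        (if [&& i + j == k, i != 0 & j != 0] then fh (V r) i * fh (W r) j else 0) - q r).
    by rewrite /h; ring.
  rewrite !ncM nc_ce nc_i mulr1.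
  have -> : `|k%:~R| = ab R k by rewrite -intr_norm -abszE.
  rewrite ler_wpM2l ?/ab//; apply: conv_rate => //.
  - exact: sm_slice.
  - exact: sm_slice.
  - by have := V0 r.
  - by have := W0 r.
  - by move=> i; apply: (le_trans (hH1 r i rT)); rewrite lerDl.
  - by move=> i; apply: (le_trans (hH2 r i rT)); rewrite lerDr.
move=> e e0; pose Y := 2 * (ab R k * (10 * H ^+ 2)) * T.
have Y0 : 0 <= Y by rewrite !mulr_ge0// exprn_ge0.
exists (Num.truncn (Y / e)) => M hM; rewrite eB; apply: (le_trans (main M)).
have -> : 2 * (ab R k * (10 * H ^+ 2 / M.+1%:R)) * T = Y / M.+1%:R by rewrite /Y; ring.
have Ye : 0 <= Y / e by rewrite divr_ge0// ltW.
have /andP[_ h1] := truncn_itv Ye.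
rewrite ler_pdivrMr ?ltr0n// [e * _]mulrC -ler_pdivrMr//; apply: (le_trans (ltW h1)).
by rewrite ler_nat ltnS.
Qed.

End coefficients.

(** * The solution space *)

Section hnorm.
Variable R : realType.
Notation C := R[i].
Implicit Types (s c : R) (phi psi : testfun R -> R) (k : int).
Notation jb := (japanese_bracket R).

Lemma seq_bound (r : seq int) : exists M, forall k, k \in r -> (`|k| <= M)%N.
Proof.
elim: r => [|j r [M IH]]; first by exists 0%N.
exists (maxn `|j| M) => k; rewrite inE leq_max => /predU1P[->|/IH ->]; by rewrite ?leqnn ?orbT.
Qed.

(** The extended sum is a supremum over finite sets of frequencies, each contained in some
    [ZM M]. *)
Lemma Hnorm_le s phi c : 0 <= c -> ell2 (fun k => jb k `^ s * nc (fourier phi k)) c ->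
  (Hdot_norm s phi <= c%:E)%E.
Proof.
move=> c0 h; rewrite /Hdot_norm; set e := (\esum_(k in _) _)%E.
have e1 : (e <= (c ^+ 2)%:E)%E.
  apply: ub_ereal_sup => _ [X [fX _] <-].
  rewrite fsumEFin// lee_fin fsbig_finite//.
  have [M hM] := seq_bound (finmap.enum_fset (fset_set X)).
  apply: le_trans (h M); apply: (@ler_sum_inj _ _ _ _ _ id); rewrite ?uniq_ZM ?finmap.fset_uniq//.
    by move=> k; exact: sqr_ge0.
  by move=> k /hM kM; rewrite mem_ZM kM.
have e0 : (0 <= e)%E by apply: esum_ge0 => k _; rewrite lee_fin sqr_ge0.
have fe : e \is a fin_num by rewrite ge0_fin_numE//; apply: le_lt_trans e1 _; rewrite ltry.
rewrite -(fineK fe) poweR_EFin lee_fin powR12_sqrt ?fine_ge0//.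
rewrite -(ger0_norm c0) -sqrtr_sqr ler_wsqrtr//.
by rewrite -lee_fin fineK.
Qed.

Lemma Hnorm_ge s phi c : 0 <= c -> fourier phi 0 = 0 -> (Hdot_norm s phi <= c%:E)%E ->
  ell2 (fun k => jb k `^ s * nc (fourier phi k)) c.
Proof.
move=> c0 f0; rewrite /Hdot_norm; set e := (\esum_(k in _) _)%E => h M.
have e1 : ((\sum_(k <- ZM M) (jb k `^ s * nc (fourier phi k)) ^+ 2)%:E <= e)%E.
  apply: esum_ge; exists [set` [seq k <- ZM M | k != 0]].
    by split; [exact: finite_seq|move=> k /=; rewrite mem_filter => /andP[]].
  rewrite -fsbig_seq ?filter_uniq ?uniq_ZM// sumEFin lee_fin big_filter [leRHS]big_mkcond; apply: ler_sum => k _.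
  by case: ifPn => //; rewrite negbK => /eqP ->; rewrite f0 nc0 mulr0 expr0n.
have e0 : (0 <= e)%E by apply: esum_ge0 => k _; rewrite lee_fin sqr_ge0.
clearbody e.
have fe : e \is a fin_num.
  rewrite ge0_fin_numE// ltey; apply/eqP => ee; move: h.
  by rewrite ee poweRyr ?invr_eq0// leye_eq.
have r0 : 0 <= fine e by exact: fine_ge0.
move: h e1; rewrite -(fineK fe) poweR_EFin !lee_fin powR12_sqrt// => h e1.
by apply: (le_trans e1); rewrite -(sqr_sqrtr r0) ler_sqr ?nnegrE ?sqrtr_ge0.
Qed.

Lemma Hdot_fin s phi : Hdot s phi -> exists2 c, 0 <= c & ell2 (fun k => jb k `^ s * nc (fourier phi k)) c.
Proof.
move=> [_ f0 fn]; have n0 : (0 <= Hdot_norm s phi)%E by exact: poweR_ge0.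
have ff : Hdot_norm s phi \is a fin_num by rewrite ge0_fin_numE.
exists (fine (Hdot_norm s phi)); first exact: fine_ge0.
by apply: Hnorm_ge; [exact: fine_ge0|exact: f0|rewrite fineK].
Qed.

Lemma fourierB phi psi k : fourier (phi - psi) k = fourier phi k - fourier psi k.
Proof. by apply: cplx_eq => /=; rewrite -[(phi - psi) _]/(phi _ - psi _); move: ((pi *+ 2)^-1) => q; ring. Qed.

(** Linearity is stated up to pointwise equality of test functions, so adding the null function
    sin(0 x) transfers values between equal test functions and gives the parity in k. *)
Lemma distr_conj phi k : is_distribution phi -> conjc (fourier phi (- k)) = fourier phi k.
Proof.
move=> [L _].
have z0 : phi (sin_tf R 0) = 0.
  have := L 1 (sin_tf R 0) (sin_tf R 0) (sin_tf R 0).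
  rewrite mul1r => h; have : phi (sin_tf R 0) = phi (sin_tf R 0) + phi (sin_tf R 0).
    by apply: h => x /=; rewrite mulr0z mul0r sin0 mul1r addr0.
  lra.
have e1 : phi (cos_tf R (- k)) = phi (cos_tf R k).
  rewrite (L 1 (cos_tf R k) (sin_tf R 0)) ?z0 ?mul1r ?addr0// => x /=.
  by rewrite mulr0z mul0r sin0 addr0 mul1r rmorphN /= mulNr cosN.
have e2 : phi (sin_tf R (- k)) = - phi (sin_tf R k).
  rewrite (L (-1) (sin_tf R k) (sin_tf R 0)) ?z0 ?mulN1r ?addr0// => x /=.
  by rewrite mulr0z mul0r sin0 addr0 mulN1r rmorphN /= mulNr sinN.
by rewrite /fourier e1 e2; apply: cplx_eq => //=; rewrite opprK mulNr.
Qed.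

End hnorm.

(** * The closure of the smooth functions in the reference gauge, and its stability *)

Section space.
Variable R : realType.
Notation C := R[i].
Variables (alpha beta N0 Ca sg T : R).
Hypothesis hok : phase_ok alpha beta N0 Ca.
Hypothesis sg0 : 0 <= sg.
Hypothesis T0 : 0 < T.
Notation wX := (wt (Gw sg 1) N0).
Notation bdX := (bd (wt (Gw sg 1) N0) (om N0 T)).
Notation pk := (pk alpha beta).
Notation coefV := (coefV alpha beta T).
Notation W := (int -> R -> Rcomplex R).
Notation jb := (japanese_bracket R).
Implicit Types (V : R -> R -> R) (t r : R) (k i j : int).

Let N01 : 1 <= N0. Proof. by case: hok. Qed.
Let N00 : 0 < N0. Proof. exact: lt_le_trans N01. Qed.
Let TT : 0 <= T. Proof. exact: ltW. Qed.
Let wX0 k : 0 < wX k. Proof. exact: wt_gt0 (submul_Gw sg0 ltr01) N00. Qed.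
Let OX0 k : gpos (om N0 T k). Proof. exact: om_gpos. Qed.
Let wXN k : wX (- k) = wX k. Proof. by rewrite /wt /Gw jb_even br_even. Qed.

Lemma jb_sg k : jb k `^ sg = jb k `^ (sg - 1) * jb k.
Proof.
rewrite -[X in _ = _ * X]powRr1 ?(ltW (jb_gt0 _ _))// -powRD ?subrK//.
by rewrite (gt_eqF (jb_gt0 _ _)) implybT.
Qed.

(** With [wX_up], the reference weight is equivalent to <k>^{sg - 1} = <k>^s: the power <k>^sg
    dominates 1, and [k] is comparable to <k>. *)
Lemma wX_low k : jb k `^ (sg - 1) <= N0 * wX k.
Proof.
have b0 := br_gt0 k N00; have p0 := powR_ge0 (jb k) (sg - 1).
rewrite /wt mulrA ler_pdivlMr// /Gw mul1r jb_sg.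
have hb : br N0 k <= N0 * jb k.
  have j1 := jb_ge1 R k; rewrite /br ge_max; apply/andP; split; first by rewrite ler_peMr// ltW.
  by apply: (le_trans (jb_ge R k)); rewrite ler_peMl// ltW// jb_gt0.
apply: (@le_trans _ _ (jb k `^ (sg - 1) * (N0 * jb k))); first exact: ler_wpM2l.
rewrite mulrCA; apply: ler_wpM2l; first exact: ltW.
by rewrite lerDr.
Qed.

Lemma wX_up k : wX k <= 4 * jb k `^ (sg - 1).
Proof.
have b0 := br_gt0 k N00; have p0 := powR_ge0 (jb k) (sg - 1).
rewrite /wt ler_pdivrMr// /Gw mul1r.
have h1 : 1 <= jb k `^ sg by rewrite -(powRr0 (jb k)); apply: ler_powR => //; exact: jb_ge1.
have h2 : jb k <= 2 * br N0 k.
  have a1 : 1 <= br N0 k by rewrite /br le_max N01.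
  have a2 : ab R k <= br N0 k by rewrite /br le_max lexx orbT.
  have := jb_le R k; lra.
apply: (@le_trans _ _ (2 * jb k `^ sg)); first by lra.
rewrite jb_sg; apply: (@le_trans _ _ (2 * (jb k `^ (sg - 1) * (2 * br N0 k)))).
  by rewrite ler_pM2l//; apply: ler_wpM2l.
by rewrite le_eqVlt; apply/orP; left; apply/eqP; ring.
Qed.

Lemma sm0 : smooth_tx (fun _ _ : R => 0 : R).
Proof.
pose Q := fun _ : int => (0 : {poly R}, 0 : {poly R}).
have e := @Vsum_nil R pk Q.
split; first by rewrite -e; exact: sm_Vsum.
  by move=> t x.
move=> t; have := @fh_Vsum R pk Q [::] t 0; rewrite big_nil /fh => h.
by have := h; rewrite (_ : Vsum _ _ _ t = (fun _ => 0)) //; rewrite e.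
Qed.

Lemma smooth_lin (a : R) V V' : smooth_tx V -> smooth_tx V' -> smooth_tx (fun t x => a * V t x + V' t x).
Proof.
move=> [hs pV h0] [hs' pV' h0']; split.
- apply: smD => //; case: hs => [D [d0 dc dt dx]]; exists (fun m n t x => a * D m n t x); split.
  + by rewrite d0.
  + move=> m n q; exact: (@continuousM _ _ (fun=> a) (fun q : R * R => D m n q.1 q.2) q (@cst_continuous _ _ a q) (dc m n q)).
  + by move=> m n t x; exact: (is_deriveZ a (dt m n t x)).
  + by move=> m n t x; exact: (is_deriveZ a (dx m n t x)).
- by move=> t x; rewrite pV pV'.
- move=> t; have := @fh_lin R a (V t) (V' t) 0 (@sm_slice R V t hs) (@sm_slice R V' t hs').
  by rewrite /fh h0 h0' mulr0 addr0.
Qed.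

Lemma coefV_lin (a : R) V V' k t : smooth_tx V -> smooth_tx V' ->
  coefV (fun t x => a * V t x + V' t x) k t = (a%:C)%C * coefV V k t + coefV V' k t.
Proof.
move=> [hs _ _] [hs' _ _]; rewrite /coefV fh_lin; [|exact: sm_slice|exact: sm_slice].
by rewrite mulrDr mulrCA.
Qed.

(** Fields of finite gauge need not be limits of smooth ones, whereas the extension of the Duhamel
    operator is determined only on their closure. Hence the last clause, and the work of showing
    that Duhamel integrals and solutions satisfy it. *)
Definition Xp (v : int -> R -> C) := [/\ stopped T v, realz v, exists c, bdX v c &
  forall rho, 0 < rho -> exists2 V, smooth_tx V & bdX (fun k t => v k t - coefV V k t) rho].

Lemma scaleW (a : R) (x : W) : (a *: x : W) = (fun k t => (a%:C)%C * (x k t : C)).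
Proof.
apply/funext => k; apply/funext => t; rewrite -[LHS]/(a *: (x k t)).
by case: (x k t) => p q; apply: cplx_eq => /=; ring.
Qed.

Lemma Xp_lin (a : R) (x y : int -> R -> C) : Xp x -> Xp y -> Xp (fun k t => (a%:C)%C * x k t + y k t).
Proof.
move=> [s1 [r1 b1] [c1 h1] a1] [s2 [r2 b2] [c2 h2] a2]; split.
- by move=> k t; rewrite s1 s2.
- split=> [t|]; first by rewrite r1 r2 mulr0 addr0.
  rewrite -[in RHS]b1 -[in RHS]b2; apply/funext => k; apply/funext => t; rewrite /bar.
  move: (x (- k) t) (y (- k) t) => [p1 p2] [q1 q2].
  by apply: cplx_eq => /=; ring.
- by exists (nc (a%:C)%C * c1 + c2); exact: bdD (bdZ wX0 (a%:C)%C h1) h2.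
move=> rho rho0; have n1 : 0 < nc (a%:C)%C + 1 by have := nc_ge0 (a%:C)%C; lra.
have e1 : 0 < rho / 2 / (nc (a%:C)%C + 1) by rewrite !divr_gt0.
have e2 : 0 < rho / 2 by rewrite divr_gt0.
have [V hV k1] := a1 _ e1; have [V' hV' k2] := a2 _ e2.
exists (fun t x => a * V t x + V' t x); first exact: smooth_lin.
have := bdD wX0 (bdZ wX0 (a%:C)%C k1) k2 => /(bd_le wX0 (e := rho)) hh.
apply: (bd_ext _ (hh _)) => [k t|]; first by rewrite coefV_lin//; ring.
have : nc (a%:C)%C * (rho / 2 / (nc (a%:C)%C + 1)) <= rho / 2.
  rewrite mulrCA ler_piMr//; first exact: ltW.
  by rewrite ler_pdivrMr// mul1r lerDl.
by lra.
Qed.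

Lemma Xp0 : Xp (fun _ _ => 0).
Proof.
split=> //; last 2 first.
- by exists 0; exact: bd0.
- move=> rho rho0; exists (fun _ _ => 0); first exact: sm0.
  apply: (bd_ext (u := fun _ _ => 0)); last by apply: bd0 => //; exact: ltW.
  move=> k t; rewrite /coefV (_ : fh _ k = 0) ?mulr0 ?subr0//.
  rewrite fhFF /FF (_ : (fun x : R => 0 * ck k x) = sk 0); last by apply/funext => x; rewrite /sk mulr0z !mul0r sin0.
  rewrite (_ : (fun x : R => 0 * sk k x) = sk 0); last by apply/funext => x; rewrite /sk mulr0z !mul0r sin0.
  by rewrite int_sk conjc0 mulr0.
- by split=> //; apply/funext => k; apply/funext => t; rewrite /bar conjc0.
Qed.

Lemma Xp_lim (v : nat -> int -> R -> C) (u : int -> R -> C) : (forall n, Xp (v n)) ->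
  (forall d, 0 < d -> exists n0, forall n, (n0 <= n)%N -> bdX (fun k t => u k t - v n k t) d) -> Xp u.
Proof.
move=> hv hu.
have L k t : lims (fun n => v n k t) (u k t).
  move=> e e0; have [n0 hn] := hu _ (mulr_gt0 e0 (wX0 k)); exists n0 => n /hn h.
  by have := bd_pt wX0 k t h; rewrite mulfK ?gt_eqF// ncBC.
split.
- move=> k t; apply: lims_uniq (L k t) _.
  have := L k (clip 0 T t); rewrite (_ : (fun n => v n k (clip 0 T t)) = (fun n => v n k t))//.
  by apply/funext => n; have [h _ _ _] := hv n; rewrite -h.
- split=> [t|].
    apply: lims_uniq (L 0 t) _; rewrite (_ : (fun n => v n 0 t) = fun=> 0); first exact: lims_cst.
    by apply/funext => n; have [_ [h _] _ _] := hv n.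
  apply/funext => k; apply/funext => t; apply: lims_uniq _ (L k t).
  have := lims_conj (L (- k) t); rewrite (_ : (fun n => conjc (v n (- k) t)) = (fun n => v n k t))//.
  by apply/funext => n; have [_ [_ h] _ _] := hv n; rewrite -[in RHS]h.
- have [n0 /(_ n0 (leqnn _)) h] := hu 1 ltr01; have [_ _ [c hc] _] := hv n0.
  by exists (1 + c); apply: (bd_ext _ (bdD wX0 h hc)) => k t; rewrite subrK.
move=> rho rho0; have e2 : 0 < rho / 2 by rewrite divr_gt0.
have [n0 /(_ n0 (leqnn _)) h] := hu _ e2; have [_ _ _ /(_ _ e2)[V hV h2]] := hv n0.
exists V => //; have := bdD wX0 h h2; rewrite -splitr; apply: bd_ext => k t.
by rewrite addrA subrK.
Qed.

Lemma Xp_C1 (Z g : int -> R -> C) M (z : int -> R -> C) : (forall k, dC (Z k) (g k)) -> (forall k, cC (g k)) ->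
  (forall t, Z 0 t = 0) -> (forall k t, 0 <= t <= T -> Z (- k) t = conjc (Z k t)) ->
  (forall k t, z k t = if (`|k| <= M)%N then Z k (clip 0 T t) else 0) ->
  forall rho, 0 < rho -> exists2 V, smooth_tx V & bdX (fun k t => z k t - coefV V k t) rho.
Proof.
move=> dZ cg Z0 Zr ez rho rho0; have [V hV h] := @C1_closure R alpha beta N0 sg T N01 sg0 T0 Z g M rho dZ cg Z0 Zr rho0.
by exists V => //; apply: bd_ext h => k t; rewrite ez.
Qed.

(* These fields are C^1 in time with finitely many modes, so [Xp_C1] applies. *)
Lemma Xp_gal M M' (phi : int -> C) (f g : int -> R -> C) c c' rho : bdX f c -> bdX g c' -> realz f -> realz g ->
  phi 0 = 0 -> (forall k, conjc (phi (- k)) = phi k) -> 0 < rho ->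
  exists2 V, smooth_tx V & bdX (fun k t => (if (`|k| <= M')%N then phi k + Bgal alpha beta M 0 T f g k t else 0) - coefV V k t) rho.
Proof.
move=> hf hg [f0 fb] [g0 gb] p0 pb rho0.
have cf : cont f by exact: (bd_cont T0 hf).
have cg : cont g by exact: (bd_cont T0 hg).
pose b k := (`|k| <= M)%N.
have bN k : b (- k) = b k by rewrite /b abszN.
pose G k r := \sum_(i <- ZM M) \sum_(j <- ZM M)
    (if [&& i + j == k, i != 0 & j != 0] then (0 +i* k%:~R)%C * Ep alpha beta i j f g r else 0).
pose G' k r := \sum_(i <- ZM M) \sum_(j <- ZM M)
    (if [&& i + j == k, i != 0 & j != 0] then (0 +i* k%:~R)%C * (ce (phase alpha beta i j * r) * (f i r * g j r)) else 0).
have cE i j : cC (fun r => ce (phase alpha beta i j * r) * (f i r * g j r)).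
  by apply: cCM; [exact: cC_ce|apply: cCM; [exact: cf|exact: cg]].
have dG k : dC (G k) (G' k).
  apply: dC_sum => i; apply: dC_sum => j; case: [&& i + j == k, i != 0 & j != 0]; last exact: dC_cst.
  by apply: dCZ; have [_ d] := cprimP (cE i j).
have cG k : cC (G' k).
  apply: cC_sum => i; apply: cC_sum => j; case: [&& i + j == k, i != 0 & j != 0]; last exact: cC_cst.
  by apply: cCM; [exact: cC_cst|exact: cE].
have eB k t : BM alpha beta M 0 T f g k t = G k (clip 0 T t).
  rewrite /BM /G; apply: eq_bigr => i _; apply: eq_bigr => j _; case: ifP => // _.
  by rewrite /Bt; congr (_ * _); rewrite /Ep; have [-> _] := cprimP (cE i j); rewrite subr0.
pose Z k t := phi k + (if b k then G k t else 0).
pose Z' k t := 0 + (if b k then G' k t else 0).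
apply: (@Xp_C1 Z Z' M') => //.
- move=> k; apply: dCD; first exact: dC_cst.
  by case: (b k); [exact: dG|exact: dC_cst].
- move=> k; apply: cCD; first exact: cC_cst.
  by case: (b k); [exact: cG|exact: cC_cst].
- move=> t; suff h : G 0 t = 0 by rewrite /Z h p0 add0r; case: (b 0).
  have z0 : (0 +i* (0 : int)%:~R)%C = 0 :> C by rewrite mulr0z.
  by rewrite /G z0; apply: big1 => i _; apply: big1 => j _; rewrite mul0r; case: ifP.
- move=> k t ht; have eg j : G j t = BM alpha beta M 0 T f g j t by rewrite eB clip_id.
  have cjD (z w : C) : conjc (z + w) = conjc z + conjc w by exact: rmorphD.
  rewrite /Z bN -[in LHS](conjcK (phi (- k))) pb; case: (b k); last by rewrite !addr0.
  rewrite cjD !eg; congr (_ + _).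
  have := @BM_bar R alpha beta M 0 T f g (- k) t cf cg; rewrite fb gb /bar opprK => -> //.
- by move=> k t; rewrite /Z BgalE eB.
Qed.

(** The Galerkin operator approximates the limit operator in gauge, and [Xp_gal] approximates its
    values by smooth functions. *)
Lemma Xp_Binf f g : Xp f -> Xp g -> Xp (Binf alpha beta 0 T f g).
Proof.
move=> [s1 r1 [c1 h1] a1] [s2 r2 [c2 h2] a2].
have T1 : T - 0 <= T by rewrite subr0.
have [K0 Kb _] := X_bilop hok sg0 T0 TT T1.
split.
- by move=> k t; rewrite Binf_clip.
- split=> [t|]; first exact: Binf_0.
  have [_ b1] := r1; have [_ b2] := r2.
  apply/funext => k; apply/funext => t.
  have L := @X_lims R alpha beta N0 Ca sg T hok sg0 T0 0 T f g c1 c2 _ t TT T1 h1 h2.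
  apply: lims_uniq _ (L k); have := lims_conj (L (- k)).
  rewrite (_ : (fun n => conjc _) = fun n => BM alpha beta n 0 T f g k t)//; apply/funext => n.
  have cf : cont f by exact: (bd_cont T0 h1).
  have cg : cont g by exact: (bd_cont T0 h2).
  by have := @BM_bar R alpha beta n 0 T f g k t cf cg; rewrite b1 b2 /bar => ->.
- by eexists; exact: Kb h1 h2.
move=> rho rho0; have e2 : 0 < rho / 2 by rewrite divr_gt0.
have [M /(_ M (leqnn _)) hM] := X_cvg hok sg0 T0 h1 h2 e2.
have p0 : (fun=> 0 : C) (0 : int) = 0 by [].
have pb k : conjc ((fun=> 0 : C) (- k)) = (fun=> 0 : C) k by exact: conjc0.
have [V hV h] := @Xp_gal M M (fun=> 0) f g c1 c2 _ h1 h2 r1 r2 p0 pb e2.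
exists V => //; have := bdD wX0 hM h; rewrite -splitr; apply: bd_ext => k t.
by rewrite !BgalE; case: ifP => _; ring.
Qed.

(** By uniqueness the solution is the one glued from windows, which comes with its Galerkin
    approximations. Each of these is given by its own integral equation, to which [Xp_gal]
    applies. *)
Lemma Xp_sol phi u : data N0 sg phi -> sol alpha beta N0 sg T phi u -> Xp u.
Proof.
move=> hd hs; have [u' hs' [ha _]] := sol_exists hok sg0 T0 hd.
rewrite (sol_uniq hok sg0 T0 hs hs') {hs}; have [p1 r1 b1 _] := hs'; split=> // rho rho0.
have e2 : 0 < rho / 2 by rewrite divr_gt0.
have [m [m' [f [c [hf rf _ h]]]]] := ha _ e2; have [p0 pb _] := hd.
have [V hV h'] := @Xp_gal m m' phi f f c c _ hf hf rf rf p0 pb e2.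
exists V => //; have := bdD wX0 h h'; rewrite -splitr; apply: bd_ext => k t.
by rewrite addrA subrK.
Qed.

Let hg0 : Xp (0 : W). Proof. exact: Xp0. Qed.
Let hgL (a : R) (x y : W) : Xp x -> Xp y -> Xp (a *: x + y : W).
Proof.
move=> hx hy; have -> : (a *: x + y : W) = (fun k t => (a%:C)%C * (x k t : C) + y k t).
  by rewrite scaleW.
exact: Xp_lin.
Qed.
Let hgF (x : W) : Xp x -> exists c, bdX x c. Proof. by case. Qed.
Let hg_ge0 (x : W) c : bdX x c -> 0 <= c. Proof. by case. Qed.
Let hg_le (x : W) c d : c <= d -> bdX x c -> bdX x d. Proof. exact: bd_le. Qed.
Let hgZ (x : W) (a c : R) : bdX x c -> bdX (a *: x : W) (`|a| * c).
Proof. by move=> h; rewrite scaleW -nc_real; exact: bdZ. Qed.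
Let hgD (x y : W) c d : bdX x c -> bdX y d -> bdX (x + y : W) (c + d).
Proof. exact: bdD. Qed.
Let hg_closed (x : W) c : 0 <= c -> (forall d, 0 < d -> bdX x (c + d)) -> bdX x c.
Proof. exact: bd_closed. Qed.
Let hg_zero (x : W) : bdX x 0 -> x = 0.
Proof.
move=> h; apply/funext => k; apply/funext => t; apply: (bd_zero wX0) => d d0.
by apply: (bd_le wX0) h; exact: ltW.
Qed.
Let hg_complete (v : nat -> W) : (forall n, Xp (v n)) ->
    (forall d, 0 < d -> exists n0, forall n m, (n0 <= n)%N -> (n <= m)%N -> bdX (v m - v n : W) d) ->
    exists2 u : W, Xp u & forall d, 0 < d -> exists n0, forall n, (n0 <= n)%N -> bdX (u - v n : W) d.
Proof.
move=> hv hc; have [u hu] := bd_complete_eps wX0 OX0 hc.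
by exists u => //; exact: Xp_lim hv hu.
Qed.

Definition X_gauge : gauge_space W :=
  @GaugeSpace R W (fun v c => bdX v c) (fun v => Xp v) hg0 hgL hgF hg_ge0 hg_le hgZ hgD hg_closed hg_zero hg_complete.

End space.

(** * Fourier decay of test functions *)

Section testfun.
Variable R : realType.
Implicit Types (f : testfun R) (x M : R) (k : int).

Lemma tf_der f m x : is_derive x (1 : R) (derive1n m f) (derive1n m.+1 f x).
Proof. by rewrite derive1nS derive1E; apply: DeriveDef; [exact: tf_smooth|]. Qed.

Lemma tf_per f m : periodic (derive1n m f) (pi *+ 2).
Proof.
elim: m => [|m IH]; first exact: tf_periodic.
exact: (periodic_der (tf_der f m) IH).
Qed.

Lemma tf_cont f : continuous f.
Proof. exact: dR_continuous (tf_der f 0). Qed.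

Lemma tf_bound f : exists2 M, 0 <= M & forall x, `|derive1n 3 f x| <= M.
Proof.
have [H H0 hH] := @seg_bounded R (derive1n 3 f) (- pi) pi (dR_continuous (tf_der f 3)).
exists H => // x; have [y hy e] := period_red x.
by rewrite (e _ (@tf_per f 3)); exact: hH.
Qed.

Lemma tf_decay f M k : (forall x, `|derive1n 3 f x| <= M) -> ab R k ^+ 3 * nc (FF f k) <= 4 * pi * M.
Proof. by move=> h; exact: (@FF_decay R (fun m => derive1n m f) 3 k M (tf_der f) (tf_per f) h). Qed.

End testfun.

Section continuity.
Variable R : realType.
Notation C := R[i].

Lemma cC_eps (F : R -> C) t e : cC F -> 0 < e -> exists2 d, 0 < d & forall t', `|t' - t| < d -> nc (F t' - F t) <= e.
Proof.
move=> [c1 c2] e0; have e2 : 0 < e / 2 by rewrite divr_gt0.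
have h (f : R -> R) : continuous f -> exists2 d, 0 < d & forall t', `|t' - t| < d -> `|f t' - f t| <= e / 2.
  move=> cf; have /cvgrPdist_le /(_ _ e2) /nbhs_ballP [d /= d0 hd] := cf t.
  exists d => // t' ht; rewrite distrC; apply: (hd t').
  by rewrite /ball /= distrC.
have [d1 d10 h1] := h _ c1; have [d2 d20 h2] := h _ c2.
exists (Num.min d1 d2) => [|t']; first by rewrite lt_min d10 d20.
rewrite lt_min => /andP[/h1 a1 /h2 a2]; apply: (le_trans (nc_le _)).
by rewrite ReD ImD ReN ImN [leRHS]splitr; exact: lerD.
Qed.

Lemma fin_cont (F : int -> R -> C) (w : int -> R) (r : seq int) t e : (forall k, 0 < w k) -> (forall k, cC (F k)) -> 0 < e ->
  exists2 d, 0 < d & forall t', `|t' - t| < d -> \sum_(k <- r) w k * nc (F k t' - F k t) <= e.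
Proof.
move=> w0 cF; elim: r e => [|k r IH] e e0.
  by exists 1 => // t' _; rewrite big_nil ltW.
have e2 : 0 < e / 2 by rewrite divr_gt0.
have [d1 d10 h1] := IH _ e2; have [d2 d20 h2] := cC_eps t (cF k) (divr_gt0 e2 (w0 k)).
exists (Num.min d1 d2) => [|t']; first by rewrite lt_min d10 d20.
rewrite lt_min => /andP[/h1 a1 /h2 a2]; rewrite big_cons [leRHS]splitr; apply: lerD => //.
by rewrite mulrC -ler_pdivlMr.
Qed.

End continuity.

(** * From interaction coefficients to distributions *)

Section iota.
Variable R : realType.
Notation C := R[i].
Variables (alpha beta N0 Ca sg T : R).
Hypothesis hok : phase_ok alpha beta N0 Ca.
Hypothesis sg0 : 0 <= sg.
Hypothesis T0 : 0 < T.
Notation wX := (wt (Gw sg 1) N0).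
Notation bdX := (bd (wt (Gw sg 1) N0) (om N0 T)).
Notation pk := (pk alpha beta).
Notation coefV := (coefV alpha beta T).
Notation jb := (japanese_bracket R).
Notation U := (U_mult alpha beta).
Notation Xp := (Xp alpha beta N0 sg T).
Implicit Types (V : R -> R -> R) (t r : R) (k i j : int) (v : int -> R -> C) (c : R).

Let N01 : 1 <= N0. Proof. by case: hok. Qed.
Let N00 : 0 < N0. Proof. exact: lt_le_trans N01. Qed.
Let TT : 0 <= T. Proof. exact: ltW. Qed.
Let wX0 k : 0 < wX k. Proof. exact: wt_gt0 (submul_Gw sg0 ltr01) N00. Qed.
Let OX0 k : gpos (om N0 T k). Proof. exact: om_gpos. Qed.

Lemma UE t k : U t k = ce (- (t * pk k)). Proof. by []. Qed.
Lemma ncU t k : nc (U t k) = 1. Proof. exact: nc_ce. Qed.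
Lemma U_neq0 t k : U t k != 0.
Proof. by apply/eqP => h; have := ncU t k; rewrite h nc0 => /eqP; rewrite eq_sym oner_eq0. Qed.
Lemma U_conj t k : U t (- k) = conjc (U t k).
Proof. by rewrite !UE -ceN pkN mulrN opprK. Qed.

(** The pairing with a test function of the distribution with coefficients U(t) v(t). For real
    fields the symmetric partial sums are real, so [iot] loses nothing in taking the real part. *)
Definition Lf v t (f : R -> R) : C := limC (fun M => \sum_(k <- ZM M) U t k * v k t * FF f k).
Definition iot v t (f : testfun R) : R := complex.Re (Lf v t f).

(** Finite gauge lets the coefficients grow at most like |k|, and three derivatives of the test
    function give |k|^{-3}: the terms are of order 1 / k^2. *)
Lemma Lf_lims v c t (f : testfun R) M : bdX v c -> (forall t, v 0 t = 0) -> (forall x, `|derive1n 3 f x| <= M) ->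
  lims (fun M => \sum_(k <- ZM M) U t k * v k t * FF f k) (Lf v t f) /\ nc (Lf v t f) <= 8 * (c * N0 * (4 * pi * M)).
Proof.
move=> hv v0 hf; have c0 : 0 <= c by case: hv.
have M0 : 0 <= M by exact: le_trans (normr_ge0 _) (hf 0).
have p0 : 0 <= 4 * pi * M by rewrite mulr_ge0// mulr_ge0// pi_ge0.
have K0 : 0 <= c * N0 * (4 * pi * M) by rewrite mulr_ge0// mulr_ge0// ltW.
have hz k : k != 0 -> nc (U t k * v k t * FF f k) <= c * N0 * (4 * pi * M) / ab R k ^+ 2.
  move=> k0; have a0 := @ab_gt0 R k k0; have a1 : 1 <= ab R k by rewrite /ab ler1n absz_gt0.
  rewrite !ncM ncU mul1r ler_pdivlMr ?exprn_gt0//.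
  have b1 : nc (v k t) <= c * N0 * ab R k.
    apply: (le_trans (bd_pt wX0 k t hv)); rewrite -mulrA; apply: ler_wpM2l => //.
    rewrite invf_div ler_pdivrMr ?Gw_gt0//.
    have g1 : 1 <= Gw sg 1 k by rewrite /Gw lerDl mul1r powR_ge0.
    have hb : br N0 k <= N0 * ab R k.
      rewrite /br ge_max; apply/andP; split; first by rewrite ler_peMr// ltW.
      by rewrite ler_peMl// ltW.
    apply: (le_trans hb); rewrite ler_peMr// mulr_ge0// ltW//.
  apply: (@le_trans _ _ (c * N0 * ab R k * nc (FF f k) * ab R k ^+ 2)).
    by rewrite ler_pM2r ?exprn_gt0//; apply: ler_wpM2r => //; exact: nc_ge0.
  have -> : c * N0 * ab R k * nc (FF f k) * ab R k ^+ 2 = c * N0 * (ab R k ^+ 3 * nc (FF f k)) by ring.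
  by apply: ler_wpM2l; [rewrite mulr_ge0// ltW|exact: tf_decay].
have [L1 L2] := ser_lims K0 hz; split=> //.
have := L2 0%N; rewrite (_ : \sum_(k <- ZM 0) _ = 0) ?subr0 ?divr1//.
by rewrite big_seq big1// => k; rewrite mem_ZM leqn0 absz_eq0 => /eqP ->; rewrite v0 mulr0 mul0r.
Qed.

Lemma Lf_lin v c t (a : R) (f g h : testfun R) : bdX v c -> (forall t, v 0 t = 0) -> (forall x, h x = a * f x + g x) ->
  Lf v t h = (a%:C)%C * Lf v t f + Lf v t g.
Proof.
move=> hv v0 hh; have [M1 _ h1] := tf_bound f; have [M2 _ h2] := tf_bound g; have [M3 _ h3] := tf_bound h.
have [L1 _] := Lf_lims t hv v0 h1; have [L2 _] := Lf_lims t hv v0 h2; have [L3 _] := Lf_lims t hv v0 h3.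
apply: lims_uniq L3 _; have := limsD (limsZ (a%:C)%C L1) L2.
rewrite (_ : (fun n => _) = (fun M => \sum_(k <- ZM M) U t k * v k t * FF h k))//.
apply/funext => M; rewrite mulr_sumr -big_split; apply: eq_bigr => k _.
rewrite (_ : FF h k = (a%:C)%C * FF f k + FF g k); first by rewrite mulrDr mulrCA.
rewrite -FF_lin; [|exact: tf_cont|exact: tf_cont].
by congr (FF _ k); apply/funext => x; exact: hh.
Qed.

Lemma iot_dist v c t : bdX v c -> (forall t, v 0 t = 0) -> is_distribution (iot v t).
Proof.
move=> hv v0; split.
  move=> a f g h hh; rewrite /iot (Lf_lin t hv v0 hh).
  by move: (Lf v t f) (Lf v t g) => [p1 p2] [q1 q2] /=; ring.
exists 3%N, (8 * (c * N0 * (4 * pi))) => f M hM.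
have [_ h] := Lf_lims t hv v0 (fun x => hM 3%N x (leqnn 3)).
apply: (le_trans (Re_le _)); apply: (le_trans h).
by rewrite le_eqVlt; apply/orP; left; apply/eqP; ring.
Qed.

Lemma sum_pick M k (F : int -> C) : (`|k| <= M)%N ->
  \sum_(j <- ZM M) F j * (k == j)%:R = F k /\ \sum_(j <- ZM M) F j * (k == - j)%:R = F (- k).
Proof.
move=> kM; split.
  rewrite (bigD1_seq k) ?uniq_ZM ?mem_ZM//= eqxx mulr1 big1 ?addr0// => j jk.
  by rewrite eq_sym (negbTE jk) mulr0.
rewrite (bigD1_seq (- k)) ?uniq_ZM ?mem_ZM ?abszN//= opprK eqxx mulr1 big1 ?addr0// => j jk.
by rewrite -eqr_oppLR eq_sym (negbTE jk) mulr0.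
Qed.

Lemma iot_fourier v t k : realz v -> fourier (iot v t) k = U t k * v k t.
Proof.
move=> [v0 vb]; pose z j := U t j * v j t.
have zN j : z (- j) = conjc (z j).
  have e : v (- j) t = conjc (v j t) by rewrite -[in LHS]vb /bar opprK.
  by rewrite /z U_conj e (rmorphM conjc).
have pC (q : R) (b1 b2 : bool) : ((q * (b1%:R + b2%:R))%:C)%C = (q%:C)%C * (b1%:R + b2%:R) :> C.
  by case: b1; case: b2; apply: cplx_eq => /=; ring.
have pS (q : R) (b1 b2 : bool) : (0 +i* (q * (b1%:R - b2%:R)))%C = (0 +i* q)%C * (b1%:R - b2%:R) :> C.
  by case: b1; case: b2; apply: cplx_eq => /=; ring.
have Lc : Lf v t (ck k) = (pi%:C)%C * (z k + z (- k)).
  apply: limCP => e e0; exists `|k|%N => M kM.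
  rewrite (_ : \sum_(j <- ZM M) _ = (pi%:C)%C * (z k + z (- k))) ?subrr ?nc0 ?ltW//.
  have [s1 s2] := sum_pick z kM.
  rewrite -s1 -s2 -big_split mulr_sumr; apply: eq_bigr => j _ /=.
  by rewrite FF_ck /dd pC -mulrDr mulrCA.
have Ls : Lf v t (sk k) = (0 +i* pi)%C * (z k - z (- k)).
  apply: limCP => e e0; exists `|k|%N => M kM.
  rewrite (_ : \sum_(j <- ZM M) _ = (0 +i* pi)%C * (z k - z (- k))) ?subrr ?nc0 ?ltW//.
  have [s1 s2] := sum_pick z kM.
  rewrite -s1 -s2 -sumrB mulr_sumr; apply: eq_bigr => j _.
  by rewrite FF_sk /dd pS -mulrBr mulrCA.
rewrite /fourier /iot -/(ck k) -/(sk k) Lc Ls !zN -/(z k).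
have n0 : pi != 0 :> R by rewrite gt_eqF// pi_gt0.
rewrite -(mulr_natr pi 2); move: (z k) (@pi R : R) n0 => [a b] q n0.
by apply: cplx_eq => /=; field.
Qed.

Lemma iot_repr v c V t : bdX v c -> (forall t, v 0 t = 0) -> smooth_tx V -> 0 <= t <= T -> (forall k, v k t = coefV V k t) ->
  iot v t = distribution_of (V t).
Proof.
move=> hv v0 [hs pV V0] ht ev; apply/funext => f.
have [M _ hM] := tf_bound f; have [L _] := Lf_lims t hv v0 hM.
have [H H0 hH] := @smooth_decay R V T 2 hs pV.
have hS M' : \sum_(i <- ZM M') nc (fh (V t) i) <= 4 * H.
  apply: sum_inv2 => //; [by move=> i; exact: nc_ge0|by rewrite /fh V0 nc0|].
  by move=> i i0; rewrite ler_pdivlMr ?exprn_gt0 ?ab_gt0// mulrC; exact: hH.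
have eU k : U t k * v k t = fh (V t) k.
  by rewrite ev /coefV clip_id// UE mulrA -ceD addNr ce0 mul1r.
apply/eqP; rewrite -subr_eq0 -normr_le0; apply/ler_addgt0Pl => e e0; rewrite addr0.
have e2 : 0 < e / 2 by rewrite divr_gt0.
have [n1 h1] := L _ e2.
have [n2 h2] := pairing (@sm_slice R V t hs) hS (@tf_cont R f) (@tf_periodic R f) e2.
have {}h1 := h1 (maxn n1 n2) (leq_maxl _ _); have {}h2 := h2 (maxn n1 n2) (leq_maxr _ _).
have e1 : \sum_(k <- ZM (maxn n1 n2)) U t k * v k t * FF f k = \sum_(k <- ZM (maxn n1 n2)) fh (V t) k * FF f k.
  by apply: eq_bigr => k _; rewrite eU.
rewrite e1 in h1; have {}h1 := le_trans (Re_le _) h1; rewrite ReD ReN in h1.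
rewrite /iot /distribution_of.
move: (complex.Re (Lf v t f)) (complex.Re (\sum_(k <- _) _)) (Rintegral _ _ _) h1 h2 => x y w h1 h2.
rewrite (_ : x - w = - (y - x) + (y - w)); last by ring.
by apply: (le_trans (ler_normD _ _)); rewrite normrN [leRHS]splitr; exact: lerD.
Qed.

Lemma iot_lin (a : R) x y : Xp x -> Xp y ->
  iot (fun k t => (a%:C)%C * x k t + y k t) = (fun t f => a * iot x t f + iot y t f).
Proof.
move=> [_ [x0 _] [c1 h1] _] [_ [y0 _] [c2 h2] _]; apply/funext => t; apply/funext => f.
have [M _ hM] := tf_bound f.
have [L1 _] := Lf_lims t h1 x0 hM; have [L2 _] := Lf_lims t h2 y0 hM.
have e : Lf (fun k t => (a%:C)%C * x k t + y k t) t f = (a%:C)%C * Lf x t f + Lf y t f.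
  apply: limCP; have := limsD (limsZ (a%:C)%C L1) L2.
  rewrite (_ : (fun n => _) = (fun M => \sum_(k <- ZM M) U t k * ((a%:C)%C * x k t + y k t) * FF f k))//.
  apply/funext => M'; rewrite mulr_sumr -big_split; apply: eq_bigr => k _ /=; ring.
by rewrite /iot e ReD cReM /=; ring.
Qed.

Lemma iot_norm v c t : bdX v c -> realz v -> (Hdot_norm (sg - 1) (iot v t) <= (N0 * c)%:E)%E.
Proof.
move=> hv hr; have c0 : 0 <= c by case: hv.
have [_ h] := bd_at t wX0 hv.
apply: Hnorm_le; first by rewrite mulr_ge0// ltW.
apply: ell2_le (ell2Z N0 h); last by rewrite lexx andbT mulr_ge0// ltW.
move=> k; rewrite iot_fourier// ncM ncU mul1r mulr_ge0 ?powR_ge0 ?nc_ge0//= mulrA.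
by apply: ler_wpM2r; [exact: nc_ge0|exact: (wX_low sg hok)].
Qed.

(** A tail that is small at all times, and finitely many continuous modes. *)
Lemma iot_cont v c t e : bdX v c -> realz v -> 0 < e -> exists2 d, 0 < d & forall t', `|t' - t| < d ->
  (Hdot_norm (sg - 1) (iot v t' - iot v t)%R <= (N0 * e)%:E)%E.
Proof.
move=> hv hr e0.
have e4 : 0 < e / 4 by rewrite divr_gt0.
have e2 : 0 < e / 2 by rewrite divr_gt0.
have [M /(_ M (leqnn _)) hM] := bd_tail OX0 hv e4.
pose F k r := U r k * v k r.
have cF k : cC (F k).
  apply: cCM; last exact: (bd_cont T0 hv).
  have -> : (fun r => U r k) = (fun r => ce (- pk k * r)) by apply/funext => r; rewrite UE mulNr mulrC.
  exact: cC_ce.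
have [d d0 hd] := @fin_cont R F wX (ZM M) t _ wX0 cF e2.
exists d => // t' /hd h.
apply: Hnorm_le; first by rewrite mulr_ge0// ltW.
have [_ h1] := bd_at t wX0 hM; have [_ h2] := bd_at t' wX0 hM.
pose a k := if (`|k| <= M)%N then wX k * nc (F k t' - F k t) else 0.
have h3 : ell2 a (e / 2).
  apply: (@ell2_fin R a M).
  - by move=> k; rewrite /a; case: ifP => // _; rewrite mulr_ge0 ?nc_ge0// ltW.
  - by move=> k; rewrite /a ltnNge => /negbTE ->.
  - apply: le_trans h; rewrite big_seq [leRHS]big_seq; apply: ler_sum => k; rewrite mem_ZM => kM.
    by rewrite /a kM.
have e42 : 0 <= e / 4 + e / 4 by rewrite addr_ge0// ltW.
have h4 := ell2D (ltW e2) e42 h3 (ell2D (ltW e4) (ltW e4) h1 h2).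
have es : e / 2 + (e / 4 + e / 4) = e by field.
rewrite es in h4.
apply: ell2_le (ell2Z N0 h4); last by rewrite lexx andbT mulr_ge0// ltW.
move=> k; rewrite fourierB !iot_fourier// -/(F k t') -/(F k t) mulr_ge0 ?powR_ge0 ?nc_ge0//=.
apply: (@le_trans _ _ (N0 * (wX k * nc (F k t' - F k t)))).
  by rewrite mulrA; apply: ler_wpM2r; [exact: nc_ge0|exact: (wX_low sg hok)].
rewrite ler_pM2l// /a /proj; case: ifP => kM.
  by rewrite lerDl addr_ge0// mulr_ge0 ?nc_ge0// ltW.
rewrite add0r -mulrDr ler_pM2l// !subr0 [X in _ <= X]addrC; apply: (le_trans (ncB _ _)).
by rewrite /F !ncM !ncU !mul1r.
Qed.

Lemma iot_in_C v : Xp v -> in_C_Hdot T (sg - 1) (iot v).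
Proof.
move=> [_ hr [c hc] _]; have [v0 _] := hr; split=> [t ht|t ht].
  split; [exact: iot_dist hc v0|by rewrite iot_fourier// v0 mulr0|].
  by apply: le_lt_trans (iot_norm t hc hr) _; rewrite ltry.
move=> P /= hP; have /nbhs_ballP [e /= e0 he] : nbhs (0 : R) (fun r => P r%:E) by exact: hP.
have e1 : 0 < e / 2 / N0 by rewrite !divr_gt0.
have [d d0 hd] := iot_cont t hc hr e1.
apply/nbhs_ballP; exists d => //= t' bt' ht'.
have h : (Hdot_norm (sg - 1) (iot v t' - iot v t)%R <= (N0 * (e / 2 / N0))%:E)%E.
  by apply: hd; rewrite distrC.
have h0 : (0 <= Hdot_norm (sg - 1) (iot v t' - iot v t)%R)%E by exact: poweR_ge0.
move: (Hdot_norm _ _) h h0 => x h h0.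
have fx : x \is a fin_num by rewrite ge0_fin_numE//; apply: le_lt_trans h _; rewrite ltry.
rewrite -(fineK fx); apply: (he (fine x)); rewrite /ball /= sub0r normrN ger0_norm ?fine_ge0//.
rewrite -(fineK fx) lee_fin mulrC divfK ?gt_eqF// in h.
by apply: le_lt_trans h _; rewrite ltr_pdivrMr// ltr_pMr// ltr1n.
Qed.

Lemma iot_inj x y : stopped T x -> stopped T y -> realz x -> realz y ->
  (forall t, 0 <= t <= T -> iot x t = iot y t) -> x = y.
Proof.
move=> s1 s2 r1 r2 h; apply/funext => k; apply/funext => t; rewrite s1 s2.
have ct : 0 <= clip 0 T t <= T by exact: clip_in.
have := congr1 (fun p => fourier p k) (h _ ct); rewrite !iot_fourier// => e.
exact: (mulfI (U_neq0 _ _) e).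
Qed.

Lemma Binf_scale (a : C) f g c c' k t : bdX f c -> bdX g c' ->
  Binf alpha beta 0 T (fun k t => a * f k t) (fun k t => a * g k t) k t = a * a * Binf alpha beta 0 T f g k t.
Proof.
move=> hf hg; have T1 : T - 0 <= T by rewrite subr0.
have cf : cont f by exact: (bd_cont T0 hf).
have cg : cont g by exact: (bd_cont T0 hg).
have hf' := bdZ wX0 a hf; have hg' := bdZ wX0 a hg.
have cg' : cont (fun k t => a * g k t) by exact: (bd_cont T0 hg').
have L := X_lims hok sg0 T0 k t TT T1 hf hg; have L' := X_lims hok sg0 T0 k t TT T1 hf' hg'.
apply: lims_uniq L' _; have := limsZ (a * a) L.
rewrite (_ : (fun n => _) = (fun M => BM alpha beta M 0 T (fun k t => a * f k t) (fun k t => a * g k t) k t))//.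
apply/funext => M.
(* The linearity lemmas are in the form z f + f', hence a = (a - 1) + 1. *)
have e1 : (fun (k : int) (t : R) => a * f k t) = (fun k t => (a - 1) * f k t + f k t).
  by apply/funext => k'; apply/funext => t'; ring.
have e2 : (fun (k : int) (t : R) => a * g k t) = (fun k t => (a - 1) * g k t + g k t).
  by apply/funext => k'; apply/funext => t'; ring.
rewrite e1 BM_linl// e2 BM_linr//; ring.
Qed.

End iota.

(** * The Banach space, the extension of the Duhamel operator and the solution map *)

Section wellposed.
Variable R : realType.
Notation C := R[i].
Variables (alpha beta N0 Ca sg T : R).
Hypothesis hok : phase_ok alpha beta N0 Ca.
Hypothesis sg0 : 0 <= sg.
Hypothesis T0 : 0 < T.
Notation wX := (wt (Gw sg 1) N0).
Notation bdX := (bd (wt (Gw sg 1) N0) (om N0 T)).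
Notation pk := (pk alpha beta).
Notation coefV := (coefV alpha beta T).
Notation jb := (japanese_bracket R).
Notation U := (U_mult alpha beta).
Notation Xp := (Xp alpha beta N0 sg T).
Notation X := (gtype (X_gauge hok sg0 T0)).
Implicit Types (x y : X).

Let N01 : 1 <= N0. Proof. by case: hok. Qed.
Let N00 : 0 < N0. Proof. exact: lt_le_trans N01. Qed.
Let TT : 0 <= T. Proof. exact: ltW. Qed.
Let wX0 k : 0 < wX k. Proof. exact: wt_gt0 (submul_Gw sg0 ltr01) N00. Qed.
Let OX0 k : gpos (om N0 T k). Proof. exact: om_gpos. Qed.

Definition iotX (x : X) : R -> testfun R -> R := iot alpha beta (gval x : int -> R -> C).

Lemma gX x : Xp (gval x). Proof. exact: (@gvalE _ _ (X_gauge hok sg0 T0) x). Qed.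

Fact iotX_linear : linear iotX.
Proof.
move=> a x y; rewrite /iotX gvalD gvalZ scaleW.
exact: (iot_lin hok sg0 a (gX x) (gX y)).
Qed.
HB.instance Definition _ := GRing.isLinear.Build R X (R -> testfun R -> R) _ iotX iotX_linear.

Definition iotL : {linear X -> (R -> testfun R -> R)} := iotX.

Lemma bdX_norm x : bdX (gval x) `|x|. Proof. exact: (@gnormP _ _ (X_gauge hok sg0 T0) x). Qed.

Lemma norm_le x c : bdX (gval x) c -> `|x| <= c. Proof. exact: (@gnorm_le _ _ (X_gauge hok sg0 T0) x c). Qed.

Lemma iotX_embedded : embedded T (sg - 1) iotL.
Proof.
split.
- move=> x y h; apply: val_inj; have [s1 r1 _ _] := gX x; have [s2 r2 _ _] := gX y.
  apply: (iot_inj T0 s1 s2 r1 r2) => t ht.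
  by apply: h; rewrite in_itv.
- by move=> x; exact: (iot_in_C hok sg0 T0 (gX x)).
- by exists N0 => x t _; have [_ r _ _] := gX x; exact: (iot_norm hok sg0 t (bdX_norm x) r).
Qed.

Lemma Xp_coefV V : smooth_tx V -> Xp (coefV V).
Proof.
move=> hV; split; [exact: (coefV_stopped alpha beta T0)|exact: coefV_real|exact: (coefV_bd hok sg0 T0)|].
move=> rho rho0; exists V => //; apply: (bd_ext (u := fun _ _ => 0)); last by apply: bd0 => //; exact: ltW.
by move=> k t; rewrite subrr.
Qed.

Lemma represents_coefV V x : smooth_tx V -> gval x = coefV V -> represents T (iotL x) V.
Proof.
move=> hV e t; rewrite in_itv /= => ht; have [_ [r0 _] [c hc] _] := gX x.
by apply: (iot_repr hok sg0 hc r0 hV ht) => k; rewrite e.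
Qed.

(** The distributions at all times of [0, T] determine the stopped coefficients, so [coefV V] is the
    only element that represents [V]. *)
Lemma represents_inv V x : smooth_tx V -> represents T (iotL x) V -> gval x = coefV V.
Proof.
move=> hV h; have [y ey] := gtype_ex (S := X_gauge hok sg0 T0) (Xp_coefV hV).
have h' := represents_coefV hV ey.
by rewrite -ey; congr gval; have [i _ _] := iotX_embedded; apply: i => t ht; rewrite h// h'.
Qed.

Lemma bilinear_continuous (B : X * X -> X) : (forall p, gval (B p) = Binf alpha beta 0 T (gval p.1) (gval p.2)) ->
  continuous B.
Proof.
move=> hB [x y]; apply/cvgrPdist_lt => e e0.
have T1 : T - 0 <= T by rewrite subr0.
have [K0 Kb Kd] := X_bilop hok sg0 T0 TT T1.
set K := CB _ _ _ in K0 Kb Kd.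
pose m := K * (`|x| + `|y| + 1) + 1.
have m0 : 0 < m by rewrite /m ltr_wpDl// mulr_ge0// !addr_ge0.
pose d := Num.min 1 (e / m).
have d0 : 0 < d by rewrite lt_min ltr01 divr_gt0.
exists (ball x d, ball y d); first by split; exact: nbhsx_ballx.
move=> [x' y'] [] /=; rewrite -!ball_normE /= => hx hy.
have nx : `|x'| <= `|x| + 1.
  have -> : x' = x - (x - x') by rewrite opprB addrC subrK.
  apply: (le_trans (ler_normB _ _)); rewrite lerD2l ltW//; apply: lt_le_trans hx _.
  by rewrite ge_min lexx.
have h : bdX (gval (B (x, y) - B (x', y'))) (K * `|x - x'| * `|y| + K * `|x'| * `|y - y'|).
  rewrite gvalB !hB /=.
  have := bdD wX0 (Kb _ _ _ _ (bdX_norm (x - x')) (bdX_norm y)) (Kb _ _ _ _ (bdX_norm x') (bdX_norm (y - y'))).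
  apply: bd_ext => k t; rewrite !gvalB; symmetry.
  exact: (Kd _ _ _ _ _ _ _ _ (bdX_norm x) (bdX_norm y) (bdX_norm x') (bdX_norm y')).
apply: (le_lt_trans (norm_le h)).
have de : d <= e / m by rewrite ge_min lexx orbT.
apply: (@le_lt_trans _ _ (K * d * `|y| + K * (`|x| + 1) * d)).
  apply: lerD; first by apply: ler_wpM2r => //; apply: ler_wpM2l => //; exact: ltW.
  apply: ler_pM => //; [by rewrite mulr_ge0|by apply: ler_wpM2l|exact: ltW].
rewrite (_ : _ + _ = K * (`|x| + `|y| + 1) * d); last by ring.
apply: (@lt_le_trans _ _ (m * d)); first by rewrite ltr_pM2r// /m ltrDl.
by rewrite mulrC -ler_pdivlMr.
Qed.

Lemma iotX_duhamel (B : X * X -> X) : (forall p, gval (B p) = Binf alpha beta 0 T (gval p.1) (gval p.2)) ->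
  duhamel_extension alpha beta T iotL B.
Proof.
move=> hB; split.
- move=> V hV; have [x ex] := gtype_ex (S := X_gauge hok sg0 T0) (Xp_coefV hV).
  by exists x; exact: represents_coefV.
- move=> O [x Ox] oO.
  have /nbhs_ballP [e /= e0 he] : nbhs x O by exact: open_nbhs_nbhs.
  have e2 : 0 < e / 2 by rewrite divr_gt0.
  have [_ _ _ /(_ _ e2) [V hV h]] := gX x.
  have [y ey] := gtype_ex (S := X_gauge hok sg0 T0) (Xp_coefV hV).
  exists y; split; last by exists V => //; exact: represents_coefV.
  apply: he; rewrite -ball_normE /=; apply: (@le_lt_trans _ _ (e / 2)); last first.
    by rewrite ltr_pdivrMr// ltr_pMr// ltr1n.
  by apply: norm_le; rewrite gvalB ey.
- exact: bilinear_continuous.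
- move=> V V' x y hV hV' /(represents_inv hV) ex /(represents_inv hV') ey t k.
  rewrite in_itv /= => ht; rewrite (duhamel_coef hok sg0 T0 k hV hV' ht).
  have [_ r _ _] := gX (B (x, y)).
  by rewrite [LHS](iot_fourier alpha beta t k r) hB /= ex ey.
Qed.

Variable gamma : R.
Hypothesis gamma0 : gamma != 0.
Let a : C := ((- gamma)%:C)%C.
Let a0 : a != 0.
Proof. by apply/eqP => h; have := congr1 (@complex.Re R) h => /= /eqP; rewrite oppr_eq0 (negbTE gamma0). Qed.
Let na : nc a = `|gamma|. Proof. by rewrite nc_real normrN. Qed.

(** Multiplication by a = - gamma normalises u = p - gamma B(u, u) to v = phi + B(v, v), the form
    solved in [sol]. *)
Definition phi_of (u0 : testfun R -> R) k : C := a * fourier u0 k.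

Lemma weight_le (x y g n : R) : 0 <= g -> 0 <= n -> x <= 4 * y -> x * (g * n) <= 4 * g * (y * n).
Proof.
move=> g0 n0 h; rewrite (_ : 4 * g * (y * n) = 4 * y * (g * n)); last by ring.
by apply: ler_wpM2r => //; exact: mulr_ge0.
Qed.

Lemma phi_data u0 : Hdot (sg - 1) u0 -> data N0 sg (phi_of u0).
Proof.
move=> hu; have [du f0 _] := hu; split.
- by rewrite /phi_of f0 mulr0.
- have cjM (z w : C) : conjc (z * w) = conjc z * conjc w by exact: rmorphM.
  move=> k; rewrite /phi_of cjM distr_conj//; congr (_ * _).
  by apply: cplx_eq => /=; rewrite ?oppr0.
- have [c c0 hc] := Hdot_fin hu; exists (4 * `|gamma| * c); first by rewrite !mulr_ge0.
  apply: ell2_le (ell2Z (4 * `|gamma|) hc); last by rewrite lexx andbT !mulr_ge0.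
  move=> k; apply/andP; split; first by apply: mulr_ge0; [exact: ltW|exact: nc_ge0].
    by rewrite /phi_of ncM na; apply: weight_le; [exact: normr_ge0|exact: nc_ge0|exact: (wX_up hok sg0)].
Qed.

Lemma Xp_a x : Xp (fun k t => a * (gval x k t : C)).
Proof.
have := Xp_lin hok sg0 (- gamma) (gX x) (Xp0 alpha beta N0 sg T0).
by rewrite (_ : (fun k t => _) = (fun k t => a * (gval x k t : C)))//; apply/funext => k; apply/funext => t; rewrite addr0.
Qed.

Lemma solution_iff (B : X * X -> X) u0 x : (forall p, gval (B p) = Binf alpha beta 0 T (gval p.1) (gval p.2)) ->
  integral_solution alpha beta gamma T iotL B u0 x <->
  sol alpha beta N0 sg T (phi_of u0) (fun k t => a * (gval x k t : C)).
Proof.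
move=> hB; have [s1 r1 b1 _] := Xp_a x; have [_ r _ _] := gX x; have [_ r' _ _] := gX (B (x, x)).
have eq t k : (fourier (iotL x t) k = U t k * fourier u0 k - (gamma%:C)%C * fourier (iotL (B (x, x)) t) k) <->
    (a * (gval x k t : C) = phi_of u0 k + Binf alpha beta 0 T (fun k t => a * (gval x k t : C)) (fun k t => a * (gval x k t : C)) k t).
  rewrite [fourier (iotL x t) k](iot_fourier alpha beta t k r).
  rewrite [fourier (iotL (B (x, x)) t) k](iot_fourier alpha beta t k r') hB /=.
  rewrite (Binf_scale hok sg0 T0 a k t (bdX_norm x) (bdX_norm x)) /phi_of.
  have ga : (gamma%:C)%C = - a by apply: cplx_eq => /=; rewrite ?opprK ?oppr0.
  rewrite ga; move: (fourier u0 k) (Binf _ _ _ _ _ _ k t) (gval x k t : C) (U t k) (U_neq0 alpha beta t k) a a0 => p q z w w0 b b0; split=> h.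
    have e : w * z = w * (p + b * q) by rewrite h; ring.
    by rewrite (mulfI w0 e); ring.
  have e : b * z = b * (p + b * q) by rewrite h; ring.
  by rewrite (mulfI b0 e); ring.
split=> [h|[_ _ _ h] t k].
  by split=> // k t ht; apply/eq; apply: h; rewrite in_itv.
by rewrite in_itv /= => ht; apply/eq; exact: h.
Qed.

Lemma well_posed_T : exists (X : completeNormedModType R)
         (iota : {linear X -> (R -> testfun R -> R)}) (B : X * X -> X) (S : (testfun R -> R) -> X),
    [/\ embedded T (sg - 1) iota, duhamel_extension alpha beta T iota B,
        forall u0, Hdot (sg - 1) u0 ->
          integral_solution alpha beta gamma T iota B u0 (S u0) /\
          (forall u : X, integral_solution alpha beta gamma T iota B u0 u -> u = S u0)
      & forall u0, Hdot (sg - 1) u0 -> forall e : R, 0 < e ->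
          exists2 d : R, 0 < d & forall v0, Hdot (sg - 1) v0 ->
            (Hdot_norm (sg - 1) (v0 - u0)%R < d%:E)%E -> `|S v0 - S u0| < e].
Proof.
have hB0 (p : X * X) : exists z : X, gval z = Binf alpha beta 0 T (gval p.1) (gval p.2).
  exact: (gtype_ex (S := X_gauge hok sg0 T0) (Xp_Binf hok sg0 T0 (gX p.1) (gX p.2))).
have /choice [B hB] := hB0.
(* Outside the space of data the solution map takes the value 0. *)
have hS0 (u0 : testfun R -> R) : exists z : X, Hdot (sg - 1) u0 ->
    sol alpha beta N0 sg T (phi_of u0) (fun k t => a * (gval z k t : C)).
  have [hu|hu] := pselect (Hdot (sg - 1) u0); last by exists 0.
  have [u hs _] := sol_exists hok sg0 T0 (phi_data hu).
  have hp := Xp_lin hok sg0 (- gamma)^-1 (Xp_sol hok sg0 T0 (phi_data hu) hs) (Xp0 alpha beta N0 sg T0).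
  have [z ez] := gtype_ex (S := X_gauge hok sg0 T0) hp; exists z => _; rewrite ez.
  rewrite (_ : (fun k t => _) = u)//; apply/funext => k; apply/funext => t.
  rewrite addr0 mulrA (_ : a * _ = 1) ?mul1r//.
  by apply: cplx_eq => /=; field.
have /choice [S hS] := hS0.
have inj (x y : X) : (fun k t => a * (gval x k t : C)) = (fun k t => a * (gval y k t : C)) -> x = y.
  move=> e; apply: val_inj; apply/funext => k; apply/funext => t.
  have := congr1 (fun f => f k t) e; exact: mulfI a0 _ _.
exists X, iotL, B, S; split.
- exact: iotX_embedded.
- exact: iotX_duhamel.
- move=> u0 hu; split; first by apply/solution_iff => //; exact: hS.
  by move=> u /(solution_iff u0 u hB) h; apply: inj; exact: (sol_uniq hok sg0 T0 h (hS _ hu)).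
- move=> u0 hu e e0; have g0 : 0 < `|gamma| by rewrite normr_gt0.
  have rho0 : 0 < `|gamma| * (e / 2) by rewrite mulr_gt0// divr_gt0.
  have [u hs [_ /(_ _ rho0) [delta de0 hd]]] := sol_exists hok sg0 T0 (phi_data hu).
  (* The factor 4 |gamma| bounds the passage from the Sobolev norm of the data to the reference norm
     of the normalised data. *)
  exists (delta / (4 * `|gamma|)); first by rewrite divr_gt0// mulr_gt0.
  move=> v0 hv hn.
  have [_ fu _] := hu; have [_ fv _] := hv.
  have D0 : 0 <= delta / (4 * `|gamma|) by rewrite ltW// divr_gt0// mulr_gt0.
  have f0 : fourier (v0 - u0) 0 = 0 by rewrite fourierB fu fv subrr.
  have h1 := ell2Z (4 * `|gamma|) (Hnorm_ge D0 f0 (ltW hn)).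
  rewrite [4 * _ * (delta / _)]mulrC divfK in h1; last by rewrite mulf_neq0// gt_eqF.
  have h2 : ell2 (fun k => wX k * nc (phi_of v0 k - phi_of u0 k)) delta.
    apply: ell2_le h1; last by rewrite lexx andbT ltW.
    move=> k; apply/andP; split; first by apply: mulr_ge0; [exact: ltW|exact: nc_ge0].
    by rewrite /phi_of -mulrBr -fourierB ncM na; apply: weight_le; [exact: normr_ge0|exact: nc_ge0|exact: (wX_up hok sg0)].
  have [u' hs' hb] := hd _ (phi_data hv) h2.
  rewrite (sol_uniq hok sg0 T0 hs (hS _ hu)) (sol_uniq hok sg0 T0 hs' (hS _ hv)) in hb.
  apply: (@le_lt_trans _ _ (e / 2)); last by rewrite ltr_pdivrMr// ltr_pMr// ltr1n.
  apply: norm_le; rewrite gvalB.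
  have := bdZ wX0 a^-1 hb; rewrite (_ : nc a^-1 * (`|gamma| * (e / 2)) = e / 2); last first.
    by rewrite mulrA -na -ncM mulVf// (nc_real 1) normr1 mul1r.
  by apply: bd_ext => k t; rewrite -mulrBr mulKf.
Qed.

End wellposed.

Theorem theorem1p3 (R : realType) (alpha beta gamma s : R)
    (alpha_neq0 : alpha != 0) (gamma_neq0 : gamma != 0) (s_ge : -1 <= s) :
  globally_well_posed alpha beta gamma s.
Proof.
move=> T T0; have [N0 [Ca hok]] := phase_okP beta alpha_neq0.
(* The hypothesis s >= -1 enters as the nonnegativity of the extra regularity sg = s + 1. *)
have sg0 : 0 <= s + 1 by rewrite -lerBlDr sub0r.
by have := well_posed_T hok sg0 T0 gamma_neq0; rewrite addrK.
Qed.
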